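(* Let $\beta>2$ and let the obstacle process $X=\{X_t\}_{t\in[0,1]}$ satisfy one of the following: (a) $X\in S_G^\beta(0,1)$ and there is a constant $C_0$ with $X_t\le C_0$ for each $t\in[0,1]$; or (b) $X_t=X_0+\int_0^tb(s)\,ds+\int_0^tl(s)\,d\langle B\rangle_s+\int_0^t\sigma(s)\,dB_s$ with $b,l\in M_G^\beta(0,1)$ and $\sigma\in H_G^\beta(0,1)$. Let $(Y,Z,L)$ be the solution of the reflected $G$-BSDE with terminal value $X_1$, generator $0$ and obstacle process $X$. Then $Y_0=V_0$, where $$V_0=\sup_{\tau\in\mathcal T^\infty_{0,1}}\hat{\mathbb E}[X_\tau]$$ and $\mathcal T^\infty_{0,1}$ is the collection of all $G$-stopping times $\tau$ with $0\le\tau\le1$.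
   Context: Framework. Fix $0\le\underline\sigma\le\bar\sigma<\infty$ and $G(a)=\frac12(\bar\sigma^2a^+-\underline\sigma^2a^-)$. $\Omega=C_0([0,\infty);\mathbb R)$ is the space of continuous paths starting at $0$ (locally uniform topology, Borel $\sigma$-field $\mathcal B(\Omega)$), $B$ the canonical process, $\Omega_t=\{\omega_{\cdot\wedge t}:\omega\in\Omega\}$. $L_{ip}(\Omega_t)=\{\varphi(B_{t_1},\dots,B_{t_m}): m\ge1,\ t_i\in[0,t],\ \varphi \text{ bounded Lipschitz}\}$, $L_{ip}(\Omega)=\bigcup_tL_{ip}(\Omega_t)$. $\hat{\mathbb E}$ is the $G$-expectation, with conditional $G$-expectations $\hat{\mathbb E}_t$: for $X=\varphi(B_{t_1},B_{t_2}-B_{t_1},\dots,B_{t_m}-B_{t_{m-1}})$ one sets $\hat{\mathbb E}_{t_j}[X]=\varphi_j(B_{t_1},\dots,B_{t_j}-B_{t_{j-1}})$, where $\varphi_m=\varphi$ and $\varphi_{i-1}(x_1,\dots,x_{i-1})=u(t_i-t_{i-1},0)$ with $u$ the viscosity solution of $\partial_tu=G(\partial^2_{yy}u)$, $u(0,y)=\varphi_i(x_1,\dots,x_{i-1},y)$; $\hat{\mathbb E}=\hat{\mathbb E}_0$. $L_G^p(\Omega_t)$ is the completion of $L_{ip}(\Omega_t)$ under $\hat{\mathbb E}[|\cdot|^p]^{1/p}$, and $\hat{\mathbb E}_t$ is extended continuously to $L_G^1(\Omega)$. Under $\hat{\mathbb E}$, $B$ is a $G$-Brownian motion with quadratic variation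 $\langle B\rangle$; stochastic integrals are $G$-Itô integrals. $\mathcal P$ is the weakly compact set of all probability measures $P$ on $\Omega$ with $E^P[X]\le\hat{\mathbb E}[X]$ for all $X\in L_{ip}(\Omega)$; it represents $\hat{\mathbb E}$, and for Borel $X$ such that $E^P[X]$ exists for all $P\in\mathcal P$ one sets $\hat{\mathbb E}[X]=\sup_{P\in\mathcal P}E^P[X]$. $c(A)=\sup_{P\in\mathcal P}P(A)$; ''q.s.'' means outside a set of capacity $c$ zero. Relations between random variables are q.s. Process spaces. $M_G^0(0,T)$: processes $\eta_t=\sum_{j=0}^{N-1}\xi_jI_{[t_j,t_{j+1})}(t)$ with $0=t_0<\dots<t_N=T$ and $\xi_j\in L_{ip}(\Omega_{t_j})$; $H_G^p(0,T)$ and $M_G^p(0,T)$ are its completions under $\|\eta\|_{H_G^p}=\{\hat{\mathbb E}[(\int_0^T|\eta_s|^2ds)^{p/2}]\}^{1/p}$ and $\|\eta\|_{M_G^p}=(\hat{\mathbb E}[\int_0^T|\eta_s|^pds])^{1/p}$. $S_G^p(0,T)$ is the completion of $S_G^0(0,T)=\{h(t,B_{t_1\wedge t},\dots,B_{t_n\wedge t}):t_1,\dots,t_n\in[0,T],\ h\ \text{bounded Lipschitz on }\mathbb R^{n+1}\}$ under $\|\eta\|_{S_G^p}=\{\hat{\mathbb E}[\sup_{t\in[0,T]}|\eta_t|^p]\}^{1/p}$. Reflected $G$-BSDE. A triple $(Y,Z,L)$ is a solution of the reflected $G$-BSDE on $[0,1]$ with terminal value $X_1$, generator $0$ and obstacle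 $X$ if for some $1<\alpha\le\beta$: $Y\in S_G^\alpha(0,1)$, $Z\in H_G^\alpha(0,1)$, $L\in S_G^\alpha(0,1)$ is continuous nondecreasing with $L_0=0$; $Y_t\ge X_t$ for $0\le t\le1$; $Y_t=X_1-\int_t^1Z_s\,dB_s+(L_1-L_t)$; and $\{-\int_0^t(Y_s-X_s)\,dL_s\}_{t\in[0,1]}$ is a nonincreasing $G$-martingale. ($M$ is a $G$-martingale if $\hat{\mathbb E}_s[M_t]=M_s$ for $s\le t$.) Under the stated assumptions on $X$ it is known that a unique solution exists. $L_G^{1^*}(\Omega_t)$ is the set of $\mathcal B(\Omega_t)$-measurable $X$ with $\hat{\mathbb E}[|X|]<\infty$ for which there is $\{X_n\}\subset L_G^1(\Omega_t)$ with $X_n\downarrow X$ q.s. A random time $\tau:\Omega\to[0,\infty)$ is a $G$-stopping time if $I_{\{\tau\le t\}}\in L_G^{1^*}(\Omega_t)$ for each $t\ge0$. $X_\tau$ denotes $\omega\mapsto X_{\tau(\omega)}(\omega)$. *)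

(* Defs.v *)
From HB Require Import structures.
From mathcomp Require Import all_boot all_order all_algebra.
From mathcomp Require Import all_classical all_reals all_analysis.

Set Implicit Arguments.
Unset Strict Implicit.
Unset Printing Implicit Defensive.

Import Order.TTheory GRing.Theory Num.Theory.
Import numFieldNormedType.Exports.

Local Open Scope classical_set_scope.
Local Open Scope ring_scope.

(** * Path space *)

(* C_0([0,oo);R).  Paths are extended by 0 to negative times, which makes the
   representation unique. *)
Record path_space (R : realType) := Path {
  path_fun :> R -> R;
  path_continuous : continuous path_fun;
  path_le0 : forall t, t <= 0 -> path_fun t = 0 }.

Section PathSpace.
Context {R : realType}.

Lemma zero_path_continuous : continuous (fun _ : R => 0 : R).
Proof. by move=> x; exact: cvg_cst. Qed.

Definition zero_path : path_space R :=
  Path zero_path_continuous (fun _ _ => erefl).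

HB.instance Definition _ := gen_eqMixin (path_space R).
HB.instance Definition _ := gen_choiceMixin (path_space R).
HB.instance Definition _ := isPointed.Build (path_space R) zero_path.

(* Open sets of the topology of locally uniform convergence on [0,oo). *)
Definition path_open (U : set (path_space R)) : Prop :=
  forall w, U w -> exists T e : R, 0 < e /\
    forall w' : path_space R,
      (forall t, 0 <= t <= T -> `|w' t - w t| < e) -> U w'.

(* The Borel sigma-field of the path space. *)
HB.instance Definition _ :=
  Measurable.copy (path_space R) (g_sigma_algebraType path_open).

Lemma stop_continuous (t : R) (w : path_space R) :
  continuous (fun s => w (Num.min s t)).
Proof.
move=> s.
apply: (@continuous_comp _ _ _ (fun s => Num.min s t) w); last first.
  exact: path_continuous.
by apply: continuous_min; [exact: cvg_id | exact: cvg_cst].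
Qed.

Lemma stop_le0 (t : R) (w : path_space R) s : s <= 0 -> w (Num.min s t) = 0.
Proof. by move=> s0; apply: path_le0; rewrite ge_min s0. Qed.

Definition stop (t : R) (w : path_space R) : path_space R :=
  Path (@stop_continuous t w) (@stop_le0 t w).

(* The canonical process. *)
Definition B (t : R) (w : path_space R) : R := w t.

(* X is B(Omega_t)-measurable; B(Omega_t), seen as a sigma-field on Omega,
   consists of the preimages of Borel sets under stopping at t. *)
Definition measurable_upto (t : R) (X : path_space R -> R) : Prop :=
  forall C : set R, measurable C ->
    exists A : set (path_space R), measurable A /\ X @^-1` C = stop t @^-1` A.

(** * Cylinder random variables *)

(* A function of finite sequences is used as a function on R^m through its
   values on sequences of size m. *)
Definition bounded_lipschitz (m : nat) (phi : seq R -> R) : Prop :=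
  exists C : R,
    (forall x, size x = m -> `|phi x| <= C) /\
    (forall x y, size x = m -> size y = m ->
      `|phi x - phi y| <= C * \sum_(i < m) `|x`_i - y`_i|).

Definition Lip (t : R) (X : path_space R -> R) : Prop :=
  exists (ts : seq R) (phi : seq R -> R),
    [/\ (0 < size ts)%N, {in ts, forall s, 0 <= s <= t},
        bounded_lipschitz (size ts) phi &
        forall w, X w = phi [seq B s w | s <- ts]].

(* f t_1 - f 0, f t_2 - f t_1, ..., f t_m - f t_(m-1), for
   ts = [:: t_1; ...; t_m] *)
Definition increments (f : R -> R) (ts : seq R) : seq R :=
  pairmap (fun a b => f b - f a) 0 ts.

(* t_0 = 0, t_1, ..., t_m *)
Definition node (ts : seq R) (j : nat) : R := nth 0 (0 :: ts) j.

(** * Viscosity solutions of the G-heat equation *)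

Definition C12 (psi : R -> R -> R) : Prop :=
  forall t y : R, 0 < t ->
  [/\ derivable (psi^~ y) t 1,
      derivable (psi t) y 1,
      derivable (derive1 (psi t)) y 1 &
      [/\ {for (t, y), continuous (fun z : R * R => psi z.1 z.2)},
          {for (t, y), continuous (fun z : R * R => derive1 (psi^~ z.2) z.1)},
          {for (t, y), continuous (fun z : R * R => derive1 (psi z.1) z.2)} &
          {for (t, y), continuous (fun z : R * R => derive1 (derive1 (psi z.1)) z.2)}]].

End PathSpace.

Section GExpectation.
Context {R : realType} (sl su : R).
Local Notation Omega := (path_space R).

Definition G (a : R) : R :=
  (su ^+ 2 * Num.max a 0 - sl ^+ 2 * Num.max (- a) 0) / 2.

Definition viscosity_subsolution (u : R -> R -> R) : Prop :=
  forall (psi : R -> R -> R) (t y : R), C12 psi -> 0 < t ->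
    u t y = psi t y -> (forall s z, 0 < s -> u s z <= psi s z) ->
    derive1 (psi^~ y) t - G (derive1 (derive1 (psi t)) y) <= 0.

Definition viscosity_supersolution (u : R -> R -> R) : Prop :=
  forall (psi : R -> R -> R) (t y : R), C12 psi -> 0 < t ->
    u t y = psi t y -> (forall s z, 0 < s -> psi s z <= u s z) ->
    0 <= derive1 (psi^~ y) t - G (derive1 (derive1 (psi t)) y).

(* u is the viscosity solution of d_t u = G(d_yy u), u(0,.) = phi, for phi
   bounded and continuous.  Uniqueness requires a growth condition in y; the
   solution is bounded because phi is. *)
Definition viscosity_solution (phi : R -> R) (u : R -> R -> R) : Prop :=
  [/\ {within [set z : R * R | 0 <= z.1],
        continuous (fun z : R * R => u z.1 z.2)},
      exists C, forall t y, 0 <= t -> `|u t y| <= C,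
      forall y, u 0 y = phi y,
      viscosity_subsolution u &
      viscosity_supersolution u].

(** * G-expectation *)

(* Y is the conditional G-expectation at time t of the cylinder random variable
   X; t is one of the nodes t_0 = 0, t_1, ..., t_m of a representation of X. *)
Definition lip_condE (t : R) (X Y : Omega -> R) : Prop :=
  exists (ts : seq R) (phi : nat -> seq R -> R) (j : nat),
    [/\ (0 < size ts)%N /\ path.path <%R 0 ts,
        (j <= size ts)%N /\ node ts j = t,
        bounded_lipschitz (size ts) (phi (size ts)),
        forall i x, (i < size ts)%N -> size x = i ->
          exists u, viscosity_solution (fun y => phi i.+1 (rcons x y)) u /\
                    phi i x = u (node ts i.+1 - node ts i) 0 &
        forall w : Omega,
          X w = phi (size ts) (increments w ts) /\
          Y w = phi j (take j (increments w ts))].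

(* c is the G-expectation of the cylinder random variable X. *)
Definition lip_E (X : Omega -> R) (c : R) : Prop := lip_condE 0 X (cst c).

Definition calP : set (probability Omega R) :=
  [set P | forall X c, lip_E X c -> (\int[P]_w (X w)%:E <= c%:E)%E].

Definition Ehat (X : Omega -> \bar R) : \bar R :=
  ereal_sup [set (\int[P]_w X w)%E | P in calP].

Definition capacity (A : set Omega) : \bar R :=
  ereal_sup [set P A | P in calP].

Definition qs (Q : Omega -> Prop) : Prop :=
  exists N : set Omega,
    [/\ measurable N, capacity N = 0%E & forall w, ~ N w -> Q w].

Definition Lnorm_G (p : R) (X : Omega -> R) : \bar R :=
  (Ehat (fun w => (`|X w| `^ p)%:E) `^ p^-1)%E.

(* Elements of the completions are represented by Borel functions on Omega,
   determined up to q.s. equality. *)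
Definition LG (p t : R) (X : Omega -> R) : Prop :=
  measurable_fun setT X /\
  exists Xn : nat -> Omega -> R,
    (forall n, Lip t (Xn n)) /\
    (fun n => Lnorm_G p (fun w => Xn n w - X w)) @ \oo --> 0%E.

(* Y is the conditional G-expectation at time t of X in L_G^1(Omega); X
   determines Y up to q.s. equality. *)
Definition condE (t : R) (X Y : Omega -> R) : Prop :=
  [/\ measurable_fun setT X, measurable_fun setT Y &
      exists Xn Yn : nat -> Omega -> R,
      [/\ forall n, lip_condE t (Xn n) (Yn n),
          (fun n => Lnorm_G 1 (fun w => Xn n w - X w)) @ \oo --> 0%E &
          (fun n => Lnorm_G 1 (fun w => Yn n w - Y w)) @ \oo --> 0%E]].

Definition G_martingale (T : R) (M : R -> Omega -> R) : Prop :=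
  (forall t, 0 <= t <= T -> LG 1 t (M t)) /\
  (forall s t, 0 <= s -> s <= t -> t <= T -> condE s (M t) (M s)).

(** * Process spaces *)

Definition qs_continuous (T : R) (X : R -> Omega -> R) : Prop :=
  qs (fun w => {within `[0, T], continuous (X^~ w)}).

Definition SG0 (T : R) (eta : R -> Omega -> R) : Prop :=
  exists (ts : seq R) (h : seq R -> R),
    [/\ {in ts, forall s, 0 <= s <= T},
        bounded_lipschitz (size ts).+1 h &
        forall t w, eta t w = h (t :: [seq B (Num.min s t) w | s <- ts])].

Definition Snorm (p T : R) (eta : R -> Omega -> R) : \bar R :=
  (Ehat (fun w => ereal_sup [set (`|eta t w| `^ p)%:E | t in `[0%R, T]%classic])
     `^ p^-1)%E.

(* Elements of the completion are represented by versions with q.s. continuous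
   paths. *)
Definition SG (p T : R) (eta : R -> Omega -> R) : Prop :=
  [/\ forall t, 0 <= t <= T -> measurable_fun setT (eta t),
      qs_continuous T eta &
      exists en : nat -> R -> Omega -> R,
        (forall n, SG0 T (en n)) /\
        (fun n => Snorm p T (fun t w => en n t w - eta t w)) @ \oo --> 0%E].

(* M_G^0(0,T); the nodes are t_0 = 0 and sp_times = [:: t_1; ...; t_N]. *)
Record simple_process (T : R) := SimpleProcess {
  sp_times : seq R;
  sp_coef : nat -> Omega -> R;
  sp_nonempty : (0 < size sp_times)%N;
  sp_increasing : path.path <%R 0 sp_times;
  sp_last : last 0 sp_times = T;
  sp_lip : forall j, (j < size sp_times)%N ->
    Lip (node sp_times j) (sp_coef j) }.

Definition sp_val (T : R) (eta : simple_process T) (t : R) (w : Omega) : R :=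
  \sum_(j < size (sp_times eta))
     sp_coef eta j w *
     \1_(`[node (sp_times eta) j, node (sp_times eta) j.+1[%classic) t.

(* int_0^t eta dW for a simple process eta *)
Definition sp_integral (W : R -> Omega -> R) (T : R) (eta : simple_process T)
    (t : R) (w : Omega) : R :=
  \sum_(j < size (sp_times eta))
     sp_coef eta j w *
     (W (Num.min (node (sp_times eta) j.+1) t) w
      - W (Num.min (node (sp_times eta) j) t) w).

Definition Hnorm (p T : R) (eta : R -> Omega -> R) : \bar R :=
  (Ehat (fun w =>
     (\int[lebesgue_measure]_(s in `[0%R, T]) (`|eta s w| ^+ 2)%:E)
       `^ (p / 2)) `^ p^-1)%E.

Definition Mnorm (p T : R) (eta : R -> Omega -> R) : \bar R :=
  (Ehat (fun w =>
     \int[lebesgue_measure]_(s in `[0%R, T]) (`|eta s w| `^ p)%:E) `^ p^-1)%E.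

Definition jointly_measurable (T : R) (eta : R -> Omega -> R) : Prop :=
  measurable_fun (`[0, T] `*` setT) (fun z : R * Omega => eta z.1 z.2).

(* Elements of the completions of M_G^0(0,T) are represented by jointly
   measurable processes, so that the time integrals in the norms are random
   variables. *)
Definition simple_completion (nrm : (R -> Omega -> R) -> \bar R) (T : R)
    (eta : R -> Omega -> R) : Prop :=
  jointly_measurable T eta /\
  exists en : nat -> simple_process T,
    (fun n => nrm (fun s w => sp_val (en n) s w - eta s w)) @ \oo --> 0%E.

Definition HG (p T : R) := simple_completion (Hnorm p T) T.
Definition MG (p T : R) := simple_completion (Mnorm p T) T.

(** * Stochastic integrals *)

(* I is the q.s. continuous process I_t = int_0^t eta dW, where the integral is
   the continuous extension, from nrm to the norm of L_G^p, of the integral of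
   simple processes. *)
Definition is_integral (nrm : (R -> Omega -> R) -> \bar R) (p : R)
    (W : R -> Omega -> R) (T : R) (eta I : R -> Omega -> R) : Prop :=
  [/\ forall t, 0 <= t <= T -> measurable_fun setT (I t),
      qs_continuous T I &
      exists en : nat -> simple_process T,
        (fun n => nrm (fun s w => sp_val (en n) s w - eta s w)) @ \oo --> 0%E /\
        forall t, 0 <= t <= T ->
          (fun n => Lnorm_G p (fun w => sp_integral W (en n) t w - I t w))
            @ \oo --> 0%E].

(* I_t = int_0^t eta dB for eta in H_G^p(0,T) *)
Definition is_ito (p T : R) (eta I : R -> Omega -> R) : Prop :=
  is_integral (Hnorm p T) p B T eta I.

Definition is_partition (t : R) (ts : seq R) : Prop :=
  path.path <%R 0 ts /\ last 0 ts = t.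

Definition mesh (ts : seq R) : R :=
  \big[Num.max/0]_(d <- increments id ts) d.

(* QV is the quadratic variation process <B>. *)
Definition is_quadratic_variation (T : R) (QV : R -> Omega -> R) : Prop :=
  [/\ forall t, 0 <= t <= T -> measurable_fun setT (QV t),
      qs_continuous T QV &
      forall t, 0 <= t <= T ->
        forall ts : nat -> seq R, (forall n, is_partition t (ts n)) ->
          (fun n => mesh (ts n)) @ \oo --> (0 : R) ->
          (fun n => Lnorm_G 2 (fun w =>
             \sum_(d <- increments (w : Omega) (ts n)) d ^+ 2 - QV t w))
            @ \oo --> 0%E].

(* I_t = int_0^t eta d<B> for eta in M_G^1(0,T) *)
Definition is_qv_integral (T : R) (QV eta I : R -> Omega -> R) : Prop :=
  is_integral (Mnorm 1 T) 1 QV T eta I.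

(* v = int_0^t f dg for g continuous and nondecreasing on [0,t]; the
   Lebesgue-Stieltjes measure on ]0,t] does not depend on the extension F. *)
Definition is_stieltjes (f g : R -> R) (t v : R) : Prop :=
  exists F : cumulative R R,
    {in `[0, t], F =1 g} /\
    v%:E = (\int[lebesgue_stieltjes_measure F]_(s in `]0%R, t]) (f s)%:E)%E.

(** * Reflected G-BSDE and optimal stopping *)

Definition bounded_above_obstacle (beta : R) (X : R -> Omega -> R) : Prop :=
  SG beta 1 X /\
  exists C0 : R, qs (fun w => forall t, 0 <= t <= 1 -> X t w <= C0).

Definition ito_obstacle (beta : R) (X : R -> Omega -> R) : Prop :=
  exists (x0 : R) (b l sigma : R -> Omega -> R) (QV IQ IB : R -> Omega -> R),
    [/\ [/\ MG beta 1 b, MG beta 1 l & HG beta 1 sigma],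
        is_quadratic_variation 1 QV,
        is_qv_integral 1 QV l IQ,
        is_ito beta 1 sigma IB &
        qs (fun w => forall t, 0 <= t <= 1 ->
          X t w = x0 + (\int[lebesgue_measure]_(s in `[0, t]) b s w)
                  + IQ t w + IB t w)].

(* (Y, Z, L) solves the reflected G-BSDE on [0,1] with terminal value X_1,
   generator 0 and obstacle X.  J is the integral of Z, and
   K_t = - int_0^t (Y_s - X_s) dL_s. *)
Definition reflected_GBSDE_solution (beta : R) (X Y Z L : R -> Omega -> R) :
    Prop :=
  exists alpha : R, 1 < alpha <= beta /\
  [/\ SG alpha 1 Y,
      HG alpha 1 Z,
      SG alpha 1 L /\
        qs (fun w => L 0 w = 0 /\
          forall s t, 0 <= s -> s <= t -> t <= 1 -> L s w <= L t w),
      qs (fun w => forall t, 0 <= t <= 1 -> X t w <= Y t w) &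
      (exists J : R -> Omega -> R, is_ito alpha 1 Z J /\
        qs (fun w => forall t, 0 <= t <= 1 ->
          Y t w = X 1 w - (J 1 w - J t w) + (L 1 w - L t w))) /\
      (exists K : R -> Omega -> R,
        [/\ qs (fun w => forall t, 0 <= t <= 1 ->
              is_stieltjes (fun s => Y s w - X s w) (L^~ w) t (- K t w)),
            qs (fun w => forall s t, 0 <= s -> s <= t -> t <= 1 ->
              K t w <= K s w) &
            G_martingale 1 K])].

Definition LG1star (t : R) (X : Omega -> R) : Prop :=
  [/\ measurable_upto t X,
      (Ehat (fun w => `|X w|%:E) < +oo)%E &
      exists Xn : nat -> Omega -> R,
        (forall n, LG 1 t (Xn n)) /\
        qs (fun w => (forall n, Xn n.+1 w <= Xn n w) /\
                     (fun n => Xn n w) @ \oo --> X w)].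

Definition G_stopping_time (tau : Omega -> R) : Prop :=
  (forall w, 0 <= tau w) /\
  forall t, 0 <= t -> LG1star t (\1_[set w | tau w <= t]).

Definition stopping_times01 : set (Omega -> R) :=
  [set tau | G_stopping_time tau /\ forall w, 0 <= tau w <= 1].

Definition stopping_value (X : R -> Omega -> R) : \bar R :=
  ereal_sup [set Ehat (fun w => (X (tau w) w)%:E) | tau in stopping_times01].

End GExpectation.

(* Main.v *)
(* Idea.  Put D = Y - X and let J be the integral of Z, so that
   Y_t = Y_0 + J_t - J_0 - L_t, where Y_0 is a constant y q.s.

   Under every P in calP, J is a martingale and optional stopping holds along
   dyadic times, because indicators {tau <= s} lie in $L_G^{1*}$ and are thus
   limits of bounded cylinder variables.  Hence
   E_P[X_tau] <= E_P[Y_tau] <= y by dominated convergence.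

   Conversely K is a G-martingale with K_0 = 0, so some P in calP has
   E_P[K_1] >= -e^2.  Let tau_n be the first dyadic time of level n at which
   D <= e.  These times decrease to some tau before which D >= e, so
   e L_tau <= -K_1, E_P[L_tau] <= e, and
   E_P[X_(tau_n)] >= E_P[Y_(tau_n)] - e >= y - 3 e for n large.  That tau_n is a
   G-stopping time follows from an approximation of D_t by cylinder variables
   off sets of small capacity, which holds in both cases (a) and (b).

   The existence of P with E_P[X] equal to the G-expectation of a cylinder
   variable X rests on existence and comparison for the G-heat equation:
   existence by a binomial dynamic programming scheme, comparison by
   regularizing a supersolution (inf-convolution, one random walk, averaging)
   into a smooth one, which is enough because G is convex.  The nested heat
   semigroup extends by the Hahn-Banach theorem to a linear functional on
   bounded functions, and Kolmogorov's argument realizes it as the law of a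
   continuous process on the unit interval with Lebesgue measure. *)

(* [calP] is cut out by inequalities against [lip_E], and [lip_E] itself asks for viscosity
   solutions. Without existence and uniqueness for the equation nothing could be said about [calP],
   not even that its members have moments; this is why the equation is treated in full. A single
   polynomial barrier yields the bound $3 su^4 (t-s)^2$ for fourth moments of increments, and this
   bound feeds Kolmogorov's argument, the martingale property and quasi-continuity alike. The second
   obstacle is measurability. In (b) the process [X] is given only up to q.s. equality, so neither
   [X t] nor $X_\tau$ need be Borel. Integrals are therefore compared directly off null sets, random
   variables are approximated off sets of small capacity, and hitting times are formed from versions
   that depend on the stopped path alone, since a G-stopping time must be adapted at every path.
   Times are rounded to grids for the same reason: a process evaluated at a time with finitely many
   values is a finite sum of measurable terms. *)
Require Import Defs.
From HB Require Import structures.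
From mathcomp Require Import all_boot all_order all_algebra.
From mathcomp Require Import all_classical all_reals all_analysis.
From mathcomp Require Import measurable_realfun.
From mathcomp Require Import ring lra zify.

Set Implicit Arguments.
Unset Strict Implicit.
Unset Printing Implicit Defensive.

Import Order.TTheory GRing.Theory Num.Theory.
Import numFieldNormedType.Exports.

Local Open Scope classical_set_scope.
Local Open Scope ring_scope.

(* [lra] is slow on large contexts, hence the variants that first discard the
   part of the context it cannot use. *)
Ltac only_comparisons := repeat match goal with H : ?T |- _ => lazymatch T with
  | is_true (Order.le _ _) => fail
  | is_true (Order.lt _ _) => fail
  | is_true (_ && _) => fail
  | @eq (Real.sort _) _ _ => fail
  | _ => clear H end end.
Ltac qlra := first [only_comparisons; lra | lra].
Ltac qnra := first [only_comparisons; nra | nra].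

(** * Smooth functions and viscosity solutions *)

Section SmoothFunctions.
Context {R : realType}.
Implicit Types (u psi : R -> R -> R) (t y : R).

(** Continuity is asked on the whole plane, negative times included, to avoid one-sided limits; a
    solution on [t >= 0] is extended by its initial value in [viscosity_gsol]. *)
Definition cont2 u := continuous (fun z : R * R => u z.1 z.2).

(** The derivatives are explicit functions rather than [derive1] terms, so that sums and products
    are differentiated by rule; [smooth12_derivs] returns to [C12]. *)
Definition smooth_at psi (pt py pyy : R -> R -> R) t y :=
  [/\ is_derive t (1 : R) (psi^~ y) (pt t y),
      is_derive y (1 : R) (psi t) (py t y),
      is_derive y (1 : R) (py t) (pyy t y) &
      [/\ {for (t, y), continuous (fun z : R * R => psi z.1 z.2)},
          {for (t, y), continuous (fun z : R * R => pt z.1 z.2)},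
          {for (t, y), continuous (fun z : R * R => py z.1 z.2)} &
          {for (t, y), continuous (fun z : R * R => pyy z.1 z.2)}]].

Definition smooth12 psi (pt py pyy : R -> R -> R) :=
  forall t y, 0 < t -> smooth_at psi pt py pyy t y.

Lemma near_pos_fst t y : 0 < t -> \forall z \near nbhs ((t, y) : R * R), 0 < z.1.
Proof.
move=> t0; have : \forall s \near nbhs t, 0 < s by exact: lt_nbhsr.
by move=> /(@cvg_fst _ _ (nbhs t) (nbhs y) _ _).
Qed.

Lemma continuous_near_eq (f g : R * R -> R) z :
  (\forall x \near nbhs z, f x = g x) ->
  {for z, continuous f} -> {for z, continuous g}.
Proof.
move=> fg cf; have gz : f z = g z by exact: (nbhs_singleton fg).
rewrite /prop_for /continuous_at -gz; apply: cvg_trans cf.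
by apply: near_eq_cvg; apply: filterS fg => x ->.
Qed.

Lemma smooth12_derivs psi pt py pyy : smooth12 psi pt py pyy ->
  C12 psi /\ forall t y, 0 < t ->
    derive1 (psi^~ y) t = pt t y /\ derive1 (derive1 (psi t)) y = pyy t y.
Proof.
move=> S.
have et t y : 0 < t -> derive1 (psi^~ y) t = pt t y.
  by move=> /(S _ y)[D _ _ _]; rewrite derive1E derive_val.
have ey t : 0 < t -> derive1 (psi t) = py t.
  move=> t0; apply/funext => y; have [_ D _ _] := S _ y t0.
  by rewrite derive1E derive_val.
have eyy t y : 0 < t -> derive1 (derive1 (psi t)) y = pyy t y.
  by move=> t0; rewrite ey//; have [_ _ D _] := S _ y t0; rewrite derive1E derive_val.
split=> [t y t0|t y t0]; last by split; [exact: et|exact: eyy].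
have [D1 D2 D3 [c1 c2 c3 c4]] := S _ y t0.
split; [exact: ex_derive|exact: ex_derive|by rewrite ey//; exact: ex_derive|].
split=> //; [move: c2|move: c3|move: c4]; apply: continuous_near_eq;
  apply: filterS (near_pos_fst y t0) => z z0.
- by rewrite et.
- by rewrite ey.
- by rewrite eyy.
Qed.

Lemma is_derive_continuous (f : R -> R) x d :
  is_derive x (1 : R) f d -> {for x, continuous f}.
Proof.
move=> D; apply: differentiable_continuous.
by apply/derivable1_diffP; exact: ex_derive.
Qed.

Lemma C12_smooth12 psi : C12 psi ->
  smooth12 psi (fun t y => derive1 (psi^~ y) t) (fun t y => derive1 (psi t) y)
    (fun t y => derive1 (derive1 (psi t)) y).
Proof.
have D (f : R -> R) x : derivable f x 1 -> is_derive x (1 : R) f (derive1 f x).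
  by rewrite derive1E => /derivableP.
move=> S t y t0; have [D1 D2 D3 c] := S t y t0.
exact: And4 (D _ _ D1) (D _ _ D2) (D _ _ D3) c.
Qed.

Lemma is_derive_quad (f : R -> R) x d (C : R) :
  (forall h, `|f (x + h) - f x - d * h| <= C * h ^+ 2) ->
  is_derive x (1 : R) f d.
Proof.
move=> H; have C0 : 0 <= C.
  by have := le_trans (normr_ge0 _) (H 1); rewrite expr1n mulr1.
have L : (fun h => h^-1 *: ((f \o shift x) (h *: (1 : R)) - f x)) @ 0^' --> d.
  apply/cvgrPdist_le => e e0.
  have C1 : 0 < C + 1 by qlra.
  have eC : 0 < e / (C + 1) by exact: divr_gt0.
  near=> h; rewrite /= /GRing.scale /= mulr1.
  have h0 : h != 0 by near: h; exact: nbhs_dnbhs_neq.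
  rewrite -(ler_pM2r (x := `|h|)) ?normr_gt0// -normrM mulrBl mulrAC mulVf// mul1r.
  rewrite distrC addrC; have := H h; rewrite [h + x]addrC addrC.
  move=> /le_trans; apply.
  rewrite -(real_normK (num_real h)) expr2 mulrA ler_pM2r ?normr_gt0//.
  apply: (@le_trans _ _ ((C + 1) * `|h|)); first by rewrite ler_wpM2r// lerDl.
  rewrite mulrC -ler_pdivlMr//.
  by near: h; exact: dnbhs0_le.
apply: DeriveDef; first by apply/cvg_ex; exists d.
exact/cvg_lim.
Unshelve. all: by end_near.
Qed.

(** Squaring makes the positive part $C^1$. The time cutoff of [vsub_shift] is built from it, and
    test functions need only one time derivative. *)
Lemma is_derive_max2 x :
  is_derive x (1 : R) (fun z => Num.max 0 z ^+ 2) (2 * Num.max 0 x).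
Proof.
apply: (@is_derive_quad _ _ _ 1) => h; rewrite mul1r ler_norml.
by case: (lerP 0 x) => ?; case: (lerP 0 (x + h)) => ?; apply/andP; split; qnra.
Qed.

Lemma smooth_atD psi pt py pyy psi' pt' py' pyy' t y :
  smooth_at psi pt py pyy t y -> smooth_at psi' pt' py' pyy' t y ->
  smooth_at (fun t y => psi t y + psi' t y) (fun t y => pt t y + pt' t y)
    (fun t y => py t y + py' t y) (fun t y => pyy t y + pyy' t y) t y.
Proof.
move=> [D1 D2 D3 [c1 c2 c3 c4]] [D1' D2' D3' [c1' c2' c3' c4']].
split; [exact: is_deriveD|exact: is_deriveD|exact: is_deriveD|].
exact: And4 (cvgD c1 c1') (cvgD c2 c2') (cvgD c3 c3') (cvgD c4 c4').
Qed.

Lemma smooth12D psi pt py pyy psi' pt' py' pyy' :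
  smooth12 psi pt py pyy -> smooth12 psi' pt' py' pyy' ->
  smooth12 (fun t y => psi t y + psi' t y) (fun t y => pt t y + pt' t y)
    (fun t y => py t y + py' t y) (fun t y => pyy t y + pyy' t y).
Proof. by move=> S S' t y t0; exact: smooth_atD (S _ _ t0) (S' _ _ t0). Qed.

Lemma smooth_atM (f f' : R -> R) psi pt py pyy t y :
  is_derive t (1 : R) f (f' t) -> {for t, continuous f'} ->
  smooth_at psi pt py pyy t y ->
  smooth_at (fun t y => f t * psi t y) (fun t y => f t * pt t y + psi t y * f' t)
    (fun t y => f t * py t y) (fun t y => f t * pyy t y) t y.
Proof.
move=> Df cf' [D1 D2 D3 [c1 c2 c3 c4]].
have cf : {for t, continuous f} by exact: is_derive_continuous Df.
have cf1 : {for (t, y), continuous (fun z : R * R => f z.1)}.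
  by apply: (@cvg_comp _ _ _ fst f _ (nbhs t)); [exact: cvg_fst|exact: cf].
have cf1' : {for (t, y), continuous (fun z : R * R => f' z.1)}.
  by apply: (@cvg_comp _ _ _ fst f' _ (nbhs t)); [exact: cvg_fst|exact: cf'].
split.
- exact: is_deriveM.
- exact: (is_deriveZ (f t)).
- exact: (is_deriveZ (f t)).
- split; [|apply: cvgD| |]; exact: cvgM.
Qed.

Lemma smooth12M (f f' : R -> R) psi pt py pyy :
  (forall t, 0 < t -> is_derive t (1 : R) f (f' t)) ->
  (forall t, 0 < t -> {for t, continuous f'}) ->
  smooth12 psi pt py pyy ->
  smooth12 (fun t y => f t * psi t y) (fun t y => f t * pt t y + psi t y * f' t)
    (fun t y => f t * py t y) (fun t y => f t * pyy t y).
Proof. by move=> df cf' S t y t0; apply: smooth_atM; [exact: df|exact: cf'|exact: S]. Qed.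

Lemma smooth12_space (g g' g'' : R -> R) :
  (forall y, is_derive y (1 : R) g (g' y)) ->
  (forall y, is_derive y (1 : R) g' (g'' y)) ->
  continuous g'' ->
  smooth12 (fun t y => g y) (fun t y => 0) (fun t y => g' y) (fun t y => g'' y).
Proof.
move=> dg dg' cg'' t y t0.
have c (h h' : R -> R) : (forall y, is_derive y (1 : R) h (h' y)) ->
    {for (t, y), continuous (fun z : R * R => h z.2)}.
  move=> dh; apply: (@cvg_comp _ _ _ snd h _ (nbhs y)); first exact: cvg_snd.
  exact: is_derive_continuous (dh y).
split; [exact: is_derive_cst|exact: dg|exact: dg'|split].
- exact: c dg.
- exact: cvg_cst.
- exact: c dg'.
- by apply: (@cvg_comp _ _ _ snd g'' _ (nbhs y)); [exact: cvg_snd|exact: cg''].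
Qed.

Lemma smooth12_prod (f f' g g' g'' : R -> R) :
  (forall t, is_derive t (1 : R) f (f' t)) -> continuous f' ->
  (forall y, is_derive y (1 : R) g (g' y)) ->
  (forall y, is_derive y (1 : R) g' (g'' y)) -> continuous g'' ->
  smooth12 (fun t y => f t * g y) (fun t y => f' t * g y)
    (fun t y => f t * g' y) (fun t y => f t * g'' y).
Proof.
move=> df cf' dg dg' cg''.
have := smooth12M (fun t _ => df t) (fun t _ => cf' t) (smooth12_space dg dg' cg'').
congr smooth12; apply/funext => t; apply/funext => y.
by rewrite mulr0 add0r mulrC.
Qed.

Lemma smooth12Z (a : R) psi pt py pyy : smooth12 psi pt py pyy ->
  smooth12 (fun t y => a * psi t y) (fun t y => a * pt t y)
    (fun t y => a * py t y) (fun t y => a * pyy t y).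
Proof.
move=> S; have := @smooth12M (cst a) (cst 0) _ _ _ _ _ _ S.
move=> /(_ (fun t _ => is_derive_cst _ _ _) (fun t _ => cvg_cst _)).
by congr smooth12; apply/funext => t; apply/funext => y; rewrite /= mulr0 addr0.
Qed.

Lemma smooth12_cst (a : R) :
  smooth12 (fun _ _ => a) (fun _ _ => 0) (fun _ _ => 0) (fun _ _ => 0).
Proof.
move=> t y t0; split; [exact: is_derive_cst|exact: is_derive_cst|exact: is_derive_cst|].
by split; exact: cvg_cst.
Qed.

Lemma cont2D u v : cont2 u -> cont2 v -> cont2 (fun t y => u t y + v t y).
Proof. by move=> cu cv z; apply: cvgD; [exact: cu|exact: cv]. Qed.

Lemma cont2Z a u : cont2 u -> cont2 (fun t y => a * u t y).
Proof. by move=> cu z; apply: cvgMr; exact: cu. Qed.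

Lemma cont2N u : cont2 u -> cont2 (fun t y => - u t y).
Proof. by move=> cu z; apply: cvgN; exact: cu. Qed.

Lemma cont2_prod (f g : R -> R) : continuous f -> continuous g ->
  cont2 (fun t y => f t * g y).
Proof.
move=> cf cg z; apply: cvgM.
- by apply: (@cvg_comp _ _ _ fst f _ (nbhs z.1)); [exact: cvg_fst|exact: cf].
- by apply: (@cvg_comp _ _ _ snd g _ (nbhs z.2)); [exact: cvg_snd|exact: cg].
Qed.

Lemma cont2_cst a : cont2 (fun _ _ => a).
Proof. by move=> z; exact: cvg_cst. Qed.

End SmoothFunctions.

(** * Subsolutions of $\partial_t u = F(\partial_{yy} u)$ *)

Section Viscosity.
Context {R : realType}.
Implicit Types (u psi pt py pyy : R -> R -> R) (t y : R) (F : R -> R).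

Lemma is_derive_shiftX (n : nat) (c y : R) :
  is_derive y (1 : R) (fun z => (z - c) ^+ n) (n%:R * (y - c) ^+ n.-1).
Proof.
have D : is_derive y (1 : R) (fun z => z - c) 1.
  by apply: is_derive_eq; rewrite ?subr0 ?addr0.
by have := is_deriveX n D; rewrite exprfctE /GRing.scale /= mulr1.
Qed.

Lemma continuous_shiftX (n : nat) (a c : R) :
  continuous (fun z : R => a * (z - c) ^+ n).
Proof.
move=> z; apply: cvgMr; 
exact: is_derive_continuous (is_derive_shiftX n c z).
Qed.

Lemma smooth12_monomial (i j : nat) (a b : R) :
  smooth12 (fun t y => (t - a) ^+ i * (y - b) ^+ j)
    (fun t y => (i%:R * (t - a) ^+ i.-1) * (y - b) ^+ j)
    (fun t y => (t - a) ^+ i * (j%:R * (y - b) ^+ j.-1))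
    (fun t y => (t - a) ^+ i * (j%:R * (j.-1%:R * (y - b) ^+ j.-2))).
Proof.
apply: smooth12_prod.
- by move=> t; exact: is_derive_shiftX.
- exact: continuous_shiftX.
- by move=> y; exact: is_derive_shiftX.
- by move=> y; exact: (is_deriveZ (j%:R) (is_derive_shiftX _ _ _)).
- by move=> y; apply: cvgMr; exact: continuous_shiftX.
Qed.

Lemma cont2_monomial (i j : nat) (a b : R) :
  cont2 (fun t y : R => (t - a) ^+ i * (y - b) ^+ j).
Proof.
by apply: cont2_prod => z; exact: is_derive_continuous (is_derive_shiftX _ _ _).
Qed.

(** The operator is a parameter: [G] gives subsolutions, and [dualG] applied to [- u] gives
    supersolutions, so each estimate is proved once for both. *)
Definition vsub F u := forall psi t y, C12 psi -> 0 < t ->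
  u t y = psi t y -> (forall s z, 0 < s -> u s z <= psi s z) ->
  derive1 (psi^~ y) t <= F (derive1 (derive1 (psi t)) y).

(** Adding the constant [u t y - psi t y] makes [psi] touch [u], so it is enough that [u - psi] be
    maximal at the point. *)
Lemma vsub_smooth F u psi pt py pyy t y : vsub F u ->
  smooth12 psi pt py pyy -> 0 < t ->
  (forall s z, 0 < s -> u s z - psi s z <= u t y - psi t y) ->
  pt t y <= F (pyy t y).
Proof.
move=> vu S t0 mx; pose c := u t y - psi t y.
have S' := smooth12D S (smooth12_cst c).
have [C /(_ _ y t0)[e1 e2]] := smooth12_derivs S'.
have := vu _ t y C t0; rewrite e1 e2 !addr0; apply; first by rewrite /c; qlra.
by move=> s z s0; have := mx s z s0; rewrite /c; qlra.
Qed.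

(** At a positive maximum of [u - psi - d * pen] the subsolution test gives [pt + d * (2 * s + 2 * k
    + 1) <= F (pyy + 2 * d)], whereas the right side is at most [pt + 2 * k * d]. The penalty forces
    a maximum to exist, and its time slope exceeds what its second derivative can contribute through
    [F]. *)
Lemma vsub_le_smooth F u psi pt py pyy (k C C' : R) :
  0 <= k -> (forall a b : R, 0 <= b -> F (a + b) <= F a + k * b) ->
  vsub F u -> cont2 u -> (forall t y, 0 <= t -> u t y <= C) ->
  smooth12 psi pt py pyy -> cont2 psi -> (forall t y, 0 <= t -> C' <= psi t y) ->
  (forall t y, 0 < t -> F (pyy t y) <= pt t y) ->
  (forall y, u 0 y <= psi 0 y) -> forall t y, 0 <= t -> u t y <= psi t y.
Proof.
move=> k0 Fk vu cu uC S cpsi psiC sup u0 t1 y1 t1_ge0; rewrite leNgt; apply/negP => lt1.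
pose pen (s z : R) := (s - 0) ^+ 0 * (z - 0) ^+ 2 + ((s - 0) ^+ 2 * (z - 0) ^+ 0 +
  (2 * k + 1) * ((s - 0) ^+ 1 * (z - 0) ^+ 0)).
have penE s z : pen s z = z ^+ 2 + (s ^+ 2 + (2 * k + 1) * s).
  by rewrite /pen !subr0 !expr0 !expr1 !mulr1 mul1r.
have Spen := smooth12D (smooth12_monomial 0 2 0 0)
  (smooth12D (smooth12_monomial 2 0 0 0) (smooth12Z (2 * k + 1) (smooth12_monomial 1 0 0 0))).
have pen1 : 0 <= pen t1 y1.
  by rewrite penE; have := sqr_ge0 y1; have := sqr_ge0 t1; qnra.
pose d := (u t1 y1 - psi t1 y1) / (2 * (pen t1 y1 + 1)).
have d0 : 0 < d by apply: divr_gt0; qlra.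
have dpen : d * pen t1 y1 < u t1 y1 - psi t1 y1.
  rewrite /d -mulrA gtr_pMr ?subr_gt0// mulrC ltr_pdivrMr; qlra.
have Sd := smooth12D S (smooth12Z d Spen).
pose Th (z : R * R) := u z.1 z.2 - (psi z.1 z.2 + d * pen z.1 z.2).
have cTh : continuous Th.
  move=> z; apply: cvgB; first exact: cu.
  apply: cvgD; first exact: cpsi.
  apply: cvgMr; apply: cvgD; first exact: cont2_monomial.
  by apply: cvgD; [exact: cont2_monomial|apply: cvgMr; exact: cont2_monomial].
have Th1 : 0 < Th (t1, y1) by rewrite /Th /=; qlra.
(* Outside the box of size [S0] the penalty term exceeds [C - C'], so [Th] is negative there and its
   maximum over the box is a maximum over all nonnegative times. *)
pose S0 := 1 + t1 + `|y1| + `|C - C'| / d.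
have S0_ge0 : 0 <= `|C - C'| / d by rewrite divr_ge0// ltW.
have S0_1 : 1 <= S0 by rewrite /S0; have := normr_ge0 y1; qlra.
have dS : C - C' <= d * S0.
  apply: le_trans (ler_norm _) _; rewrite mulrC -ler_pdivrMr// /S0.
  by have := normr_ge0 y1; qlra.
have out (s z : R) : 0 <= s -> S0 < s \/ S0 < `|z| -> Th (s, z) < 0.
  move=> s0 H; rewrite /Th /= penE subr_lt0.
  have : S0 < z ^+ 2 + (s ^+ 2 + (2 * k + 1) * s).
    case: H => H.
    - by have := sqr_ge0 z; qnra.
    - by rewrite -(real_normK (num_real z)); have := normr_ge0 z; qnra.
  move=> H'; have {}H' : d * S0 < d * (z ^+ 2 + (s ^+ 2 + (2 * k + 1) * s)).
    by rewrite ltr_pM2l.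
  by have := uC s z s0; have := psiC s z s0; qlra.
have [[s z] szin mx] : exists2 c, c \in (`[0, S0] `*` `[- S0, S0])%classic &
    forall x, x \in (`[0, S0] `*` `[- S0, S0])%classic -> Th x <= Th c.
  apply: compact_EVT_max.
  - exists (0, 0); split; rewrite /= in_itv/= ?lexx/=; qlra.
  - by apply: compact_setX; exact: segment_compact.
  - by apply: continuous_subspaceT.
have {szin} [/= sin _] := set_mem szin.
have box x : x.1 < 0 \/ Th x < 0 \/ x \in (`[0, S0] `*` `[- S0, S0])%classic.
  case: x => s' z' /=; have [?|s'0] := ltP s' 0; [by left|right].
  have [?|H] := ltP (Th (s', z')) 0; [by left|right].
  rewrite inE; split; rewrite /= in_itv/=.
  - rewrite s'0 /= leNgt; apply/negP => H'.
    by have := out _ z' s'0 (or_introl H'); qlra.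
  - rewrite -ler_norml leNgt; apply/negP => H'.
    by have := out _ z' s'0 (or_intror H'); qlra.
have Thsz : 0 < Th (s, z).
  have [/=|[/=|b1]] := box (t1, y1); [qlra|qlra|].
  by apply: lt_le_trans Th1 _; exact: mx.
have s_gt0 : 0 < s.
  move: sin; rewrite in_itv/= => /andP[]; rewrite le_eqVlt => /predU1P[s0|//] _.
  move: Thsz; rewrite -s0 /Th /= penE.
  by have := u0 z; have := sqr_ge0 z; qnra.
have : pt s z + d * (2 * s + (2 * k + 1)) <= F (pyy s z + d * 2).
  have := @vsub_smooth _ _ _ _ _ _ s z vu Sd s_gt0; rewrite /= !subr0 !expr0 !expr1 !(mulr1, mul1r, mul0r, mulr0, addr0, add0r).
  apply => s' z' s'0; have [/=|[/=|b1]] := box (s', z'); first qlra.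
  - by move: Thsz; rewrite /Th /pen /= !subr0 !expr0 !expr1 !(mulr1, mul1r); qlra.
  - by have := mx _ b1; rewrite /Th /pen /= !subr0 !expr0 !expr1 !(mulr1, mul1r); qlra.
have := Fk (pyy s z) (d * 2) (mulr_ge0 (ltW d0) (ler0n _ _)).
by have := sup _ z s_gt0; qnra.
Qed.

Lemma smooth_at_eq psi pt py pyy psi' pt' py' pyy' t y (d : R) :
  0 < d -> (forall s z, `|t - s| < d ->
    [/\ psi s z = psi' s z, pt s z = pt' s z, py s z = py' s z & pyy s z = pyy' s z]) ->
  smooth_at psi pt py pyy t y -> smooth_at psi' pt' py' pyy' t y.
Proof.
move=> d0 E [D1 D2 D3 [c1 c2 c3 c4]].
have nt : \forall s \near nbhs t, `|t - s| < d by exact: cvgr_dist_lt.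
have nz : \forall z \near nbhs ((t, y) : R * R), `|t - z.1| < d.
  by move: nt => /(@cvg_fst _ _ (nbhs t) (nbhs y) _ _).
have tt : `|t - t| < d by rewrite subrr normr0.
have [e1 e2 e3 e4] := E t y tt.
have ey : psi t = psi' t by apply/funext => z; have [] := E t z tt.
have epy : py t = py' t by apply/funext => z; have [] := E t z tt.
split.
- rewrite -e2; apply: near_eq_is_derive D1.
  by apply: filterS nt => s /(E s y)[].
- by rewrite -ey -e3.
- by rewrite -epy -e4.
- split; [move: c1|move: c2|move: c3|move: c4]; apply: continuous_near_eq;
    by apply: filterS nz => z /(E z.1 z.2)[].
Qed.

Lemma smooth_at_shift psi pt py pyy (t0 t y : R) :
  smooth_at psi pt py pyy (t - t0) y ->
  smooth_at (fun s z => psi (s - t0) z) (fun s z => pt (s - t0) z)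
    (fun s z => py (s - t0) z) (fun s z => pyy (s - t0) z) t y.
Proof.
move=> [D1 D2 D3 [c1 c2 c3 c4]].
have c (f : R -> R -> R) : {for (t - t0, y), continuous (fun z : R * R => f z.1 z.2)} ->
    {for (t, y), continuous (fun z : R * R => f (z.1 - t0) z.2)}.
  move=> cf.
  apply: (@cvg_comp _ _ _ (fun z : R * R => (z.1 - t0, z.2)) _ _ _ _ _ cf).
  have h1 : (fun z : R * R => z.1 - t0) @ nbhs (t, y) --> t - t0.
    by apply: cvgB; [exact: cvg_fst|exact: cvg_cst].
  have h2 : (fun z : R * R => z.2) @ nbhs (t, y) --> y by exact: cvg_snd.
  exact: (cvg_pair h1 h2).
split.
- have D : is_derive t (1 : R) (fun s => s - t0) 1.
    by apply: is_derive_eq; rewrite ?subr0 ?addr0.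
  have := @is_derive1_comp _ (psi^~ y) (fun s => s - t0) t _ _ D1 D.
  by rewrite mulr1.
- exact: D2.
- exact: D3.
- exact: And4 (c _ c1) (c _ c2) (c _ c3) (c _ c4).
Qed.

(** A test function for the shifted solution is smooth only at times after [t0], but a test for [u]
    must be smooth and dominate at every positive time. Near the contact time [psi] is kept, and
    farther away the cutoff [chi] leads to the constant [C], which is above [u]; a convex
    combination of two majorants is again a majorant. *)
Lemma vsub_shift F u (t0 C : R) : 0 <= t0 -> vsub F u ->
  (forall t y, 0 <= t -> u t y <= C) -> vsub F (fun t y => u (t0 + t) y).
Proof.
move=> t0_ge0 vu uC psi s0 y0 /C12_smooth12 S s0_gt0 e le_psi.
pose d := s0 / 2.
have d0 : 0 < d by rewrite /d; qlra.
pose r (s : R) := 1 - d^-1 ^+ 2 * (s - (t0 + s0)) ^+ 2.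
pose chi (s : R) := Num.max 0 (r s) ^+ 2.
pose chi' (s : R) := 2 * Num.max 0 (r s) * - (d^-1 ^+ 2 * (2 * (s - (t0 + s0)))).
have Dr s : is_derive s (1 : R) r (- (d^-1 ^+ 2 * (2 * (s - (t0 + s0))))).
  have := is_deriveB (is_derive_cst (1 : R) s (1 : R))
    (is_deriveZ (d^-1 ^+ 2) (is_derive_shiftX 2 (t0 + s0) s)).
  by rewrite sub0r expr1.
have Dchi s : is_derive s (1 : R) chi (chi' s).
  exact: (@is_derive1_comp _ _ r s _ _ (is_derive_max2 (r s)) (Dr s)).
have cchi' s : {for s, continuous chi'}.
  apply: cvgM.
    apply: cvgMr; apply: (@continuous_max _ _ (fun=> 0) r s); first exact: cvg_cst.
    exact: is_derive_continuous (Dr s).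
  apply: cvgN; apply: cvgMr; apply: cvgMr.
  by apply: cvgB; [exact: cvg_id|exact: cvg_cst].
have far s : d <= `|s - (t0 + s0)| -> Num.max 0 (r s) = 0.
  move=> H; apply/max_idPl; rewrite /r subr_le0 -exprMn mulrC.
  rewrite -(real_normK (num_real _)) exprn_ege1// normrM normfV (gtr0_norm d0).
  by rewrite ler_pdivlMr// mul1r.
pose Th (s z : R) := chi s * (psi (s - t0) z + - C) + C.
have STh : exists pt py pyy, smooth12 Th pt py pyy /\
    pt (t0 + s0) y0 = derive1 (psi^~ y0) s0 /\
    pyy (t0 + s0) y0 = derive1 (derive1 (psi s0)) y0.
  pose pt (s z : R) := chi s * derive1 (psi^~ z) (s - t0) + (psi (s - t0) z + - C) * chi' s.
  pose py (s z : R) := chi s * derive1 (psi (s - t0)) z.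
  pose pyy (s z : R) := chi s * derive1 (derive1 (psi (s - t0))) z.
  have chi1 : chi (t0 + s0) = 1.
    by rewrite /chi /r subrr expr0n /= mulr0 subr0 maxEle ler01 expr1n.
  have chi'0 : chi' (t0 + s0) = 0 by rewrite /chi' subrr !mulr0 oppr0 mulr0.
  have ee : t0 + s0 - t0 = s0 by ring.
  exists pt, py, pyy; split; last first.
    by rewrite /pt /pyy chi1 chi'0 ee !mul1r mulr0 addr0.
  move=> s z s_gt0; have [sm|sm] := lerP s (t0 + s0 / 4).
    apply: (@smooth_at_eq (fun _ _ => C) (fun _ _ => 0) (fun _ _ => 0) (fun _ _ => 0)
      _ _ _ _ _ _ (s0 / 4)); [qlra| |exact: smooth12_cst].
    move=> s' z'; rewrite ltr_norml => /andP[h1 h2].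
    have f0 : Num.max 0 (r s') = 0.
      by apply: far; rewrite distrC ler_normr; apply/orP; left; rewrite /d; qlra.
    by split; rewrite /Th /pt /py /pyy /chi /chi' f0 ?expr0n /= ?(mulr0, mul0r, addr0, add0r).
  have S1 : smooth_at psi (fun t y => derive1 (psi^~ y) t) (fun t y => derive1 (psi t) y)
      (fun t y => derive1 (derive1 (psi t)) y) (s - t0) z by apply: S; qlra.
  have := smooth_at_shift S1.
  move=> /(smooth_atD (smooth12_cst (- C) z s_gt0)).
  move=> /(smooth_atM (Dchi s) (cchi' s)).
  move=> /(smooth_atD (smooth12_cst C z s_gt0)).
  apply: (@smooth_at_eq _ _ _ _ _ _ _ _ _ _ 1) => // s' z' _.
  by split; rewrite /Th /pt /py /pyy; ring.
have [pt [py [pyy [ST [<- <-]]]]] := STh.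
have s0' : 0 < t0 + s0 by qlra.
apply: (vsub_smooth vu ST s0') => s z s_gt0.
have -> : Th (t0 + s0) y0 = u (t0 + s0) y0.
  rewrite e /Th /chi /r subrr expr0n /= mulr0 subr0 maxEle ler01 expr1n.
  by rewrite (_ : t0 + s0 - t0 = s0); ring.
rewrite subrr subr_le0 /Th.
have [h|h] := lerP s t0.
  rewrite /chi far ?expr0n ?mul0r ?add0r; first by apply: uC; exact: ltW.
  by rewrite distrC ler_normr; apply/orP; left; rewrite /d; qlra.
have := le_psi (s - t0) z; rewrite (_ : t0 + (s - t0) = s); last ring.
rewrite subr_gt0 => /(_ h); have := uC s z (ltW s_gt0).
have : 0 <= chi s <= 1.
  rewrite /chi sqr_ge0/= expr_le1// ?le_max ?lexx// ge_max ler01 /r.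
  by rewrite gerBl mulr_ge0// sqr_ge0.
qnra.
Qed.

End Viscosity.

(** * Polynomial barriers *)

Section Barriers.
Context {R : realType}.
Implicit Types (u : R -> R -> R) (t y : R) (F : R -> R).

(* The barrier [z^4 + 6 k s z^2 + 3 k^2 s^2] is the fourth moment of a
   Brownian motion with variance [k] started at [z]. *)
Lemma vsub_barrier F u (k C g c p q M t0 y0 s : R) :
  0 <= k -> (forall a b : R, 0 <= b -> F (a + b) <= F a + k / 2 * b) ->
  vsub F u -> cont2 u -> (forall t y, 0 <= t -> u t y <= C) ->
  F q <= g -> `|g| <= k / 2 * `|q| -> 0 < M -> 0 <= t0 -> 0 <= s ->
  (forall z, u t0 z <=
     c + p * (z - y0) + q / 2 * (z - y0) ^+ 2 + M * (z - y0) ^+ 4) ->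
  u (t0 + s) y0 <= c + g * s + 3 * M * k ^+ 2 * s ^+ 2.
Proof.
move=> k0 Fk vu cu uC Fq gq M0 t0_ge0 s_ge0 u0.
pose mo (i j : nat) (s z : R) := (s - 0) ^+ i * (z - y0) ^+ j.
pose psi (s z : R) := c + (p * mo 0 1 s z + (q / 2 * mo 0 2 s z + (M * mo 0 4 s z +
  (g * mo 1 0 s z + (6 * M * k * mo 1 2 s z + 3 * M * k ^+ 2 * mo 2 0 s z))))).
have psiE s' z : psi s' z = c + p * (z - y0) + q / 2 * (z - y0) ^+ 2
    + M * (z - y0) ^+ 4 + g * s' + 6 * M * k * s' * (z - y0) ^+ 2 + 3 * M * k ^+ 2 * s' ^+ 2.
  by rewrite /psi /mo subr0 !expr0 !expr1; ring.
have S := smooth12D (smooth12_cst c) (smooth12D (smooth12Z p (smooth12_monomial 0 1 0 y0))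
  (smooth12D (smooth12Z (q / 2) (smooth12_monomial 0 2 0 y0))
  (smooth12D (smooth12Z M (smooth12_monomial 0 4 0 y0))
  (smooth12D (smooth12Z g (smooth12_monomial 1 0 0 y0))
  (smooth12D (smooth12Z (6 * M * k) (smooth12_monomial 1 2 0 y0))
  (smooth12Z (3 * M * k ^+ 2) (smooth12_monomial 2 0 0 y0))))))).
have cpsi : cont2 psi.
  by do !apply: cont2D; try apply: cont2Z; try exact: cont2_monomial; exact: cont2_cst.
(* The lower bound for [psi] comes from completing squares: half of $p^2$ pays for the linear term,
   the quartic term absorbs all quadratic ones, and the last fraction pays for [g * s]. *)
have := vsub_le_smooth (C := C) (C' := c - p ^+ 2 / 2 - (`|q| + 1) ^+ 2 / (16 * M) - q ^+ 2 / (48 * M)) (k := k / 2)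
  _ Fk (vsub_shift t0_ge0 vu uC) _ _ S cpsi _ _ _ y0 s_ge0.
have -> : c + g * s + 3 * M * k ^+ 2 * s ^+ 2 = psi s y0.
  by rewrite psiE subrr !expr0n /= !mulr0 !addr0.
apply.
- by qlra.
- move=> z.
  apply: (@cvg_comp _ _ _ (fun z : R * R => (t0 + z.1, z.2)) _ _ _ _ _ (cu (t0 + z.1, z.2))).
  have h1 : (fun z : R * R => t0 + z.1) @ nbhs z --> t0 + z.1.
    by apply: cvgD; [exact: cvg_cst|exact: cvg_fst].
  have h2 : (fun z : R * R => z.2) @ nbhs z --> z.2 by exact: cvg_snd.
  exact: (cvg_pair h1 h2).
- by move=> t y t_ge0; apply: uC; qlra.
- move=> t y t_ge0; rewrite -[X in _ <= X]/(psi t y) psiE.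
  set x := y - y0; have M16 : 0 < 16 * M by qlra.
  have e1 : - (p ^+ 2 / 2) - x ^+ 2 / 2 <= p * x by have := sqr_ge0 (p + x); qnra.
  have e2 : - ((`|q| + 1) ^+ 2 / (16 * M)) + (`|q| + 1) / 2 * x ^+ 2 <= M * x ^+ 4.
    rewrite -(ler_pM2l M16).
    have -> : 16 * M * (- ((`|q| + 1) ^+ 2 / (16 * M)) + (`|q| + 1) / 2 * x ^+ 2) =
       8 * M * (`|q| + 1) * x ^+ 2 - (`|q| + 1) ^+ 2 by field; qlra.
    have -> : x ^+ 4 = x ^+ 2 * x ^+ 2 by ring.
    by have := sqr_ge0 (4 * M * x ^+ 2 - (`|q| + 1)); qnra.
  have e3 : - (`|q| / 2) * x ^+ 2 <= q / 2 * x ^+ 2.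
    rewrite ler_wpM2r ?sqr_ge0//; have := ler_norm (- q); rewrite normrN; qlra.
  have e4 : - (q ^+ 2 / (48 * M)) <= g * t + 3 * M * k ^+ 2 * t ^+ 2.
    have M48 : 0 < 48 * M by qlra.
    rewrite -(ler_pM2l M48).
    have -> : 48 * M * - (q ^+ 2 / (48 * M)) = - `|q| ^+ 2.
      by rewrite real_normK ?num_real//; field; qlra.
    have h : - (k / 2 * `|q|) * t <= g * t.
      by rewrite ler_wpM2r//; have := ler_norm (- g); rewrite normrN; qlra.
    have := sqr_ge0 (12 * M * (k * t) - `|q|).
    move: h; have := normr_ge0 q; qnra.
  have e5 : 0 <= 6 * M * k * t * x ^+ 2.
    have kt : 0 <= k * t by exact: mulr_ge0.
    by have := mulr_ge0 (mulr_ge0 (ltW M0) kt) (sqr_ge0 x); qlra.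
  by move: e1 e2 e3 e4 e5; qlra.
- move=> t y t_gt0; rewrite !subr0 !expr0 !expr1 /=.
  set x := y - y0.
  have -> : 0 + (p * (1 * (1 * (0 * 1))) + (q / 2 * (1 * (2 * (1 * 1))) +
     (M * (1 * (4 * (3 * x ^+ 2))) + (g * (t * (0 * (0 * 1))) +
     (6 * M * k * (t * (2 * (1 * 1))) + 3 * M * k ^+ 2 * (t ^+ 2 * (0 * (0 * 1)))))))) =
     q + 12 * M * (x ^+ 2 + k * t) :> R by field.
  have h : 0 <= 12 * M * (x ^+ 2 + k * t).
    have kt : 0 <= x ^+ 2 + k * t by rewrite addr_ge0 ?sqr_ge0 ?mulr_ge0// ltW.
    by have := mulr_ge0 (ltW M0) kt; qlra.
  have := Fk q _ h; qlra.
- move=> y; rewrite -[X in _ <= X]/(psi 0 y) psiE addr0; have := u0 y.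
  by rewrite expr0n /= !(mulr0, mul0r, addr0).
Qed.

End Barriers.

(** * Primitives, and uniform convergence on compact sets *)

Section Primitives.
Context {R : realType}.
Implicit Types (f g : R -> R).
Local Notation mu := (@lebesgue_measure R).

(** Averages are taken below as difference quotients of primitives, so that their order, linearity
    and differentiability follow from the mean value theorem and the derivative rules. *)
Definition primitive (Phi f : R -> R) := forall x, is_derive x (1 : R) Phi (f x).

Lemma primitive_exists f : continuous f -> exists Phi, primitive Phi f.
Proof.
move=> cf.
have intf (a b : R) : mu.-integrable `[a, b] (EFin \o f).
  apply: continuous_compact_integrable; first exact: segment_compact.
  exact: continuous_subspaceT.
pose Phi x := if 0 <= x then \int[mu]_(t in `]0, x]) f t
  else - \int[mu]_(t in `]x, 0]) f t.
exists Phi => x.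
pose N := `|x| + 1.
pose F z := \int[mu]_(t in `[- N, z]) f t.
have N0 : 0 < N by rewrite /N; have := normr_ge0 x; qlra.
have /andP[xN1 xN2] : - N < x < N by rewrite -ltr_norml /N ltrDl.
have PhiE z : - N < z < N -> Phi z = F z - F 0.
  move=> /andP[z1 z2]; rewrite /Phi /F; have [z0|z0] := lerP 0 z.
  - by rewrite -(@Rintegral_itvB _ f (BLeft (- N)) (BRight z) 0)// ?bnd_simp//; qlra.
  - by rewrite -(@Rintegral_itvB _ f (BLeft (- N)) (BRight 0) z)// ?bnd_simp ?opprB//; qlra.
have [dF F'] : derivable F x 1 /\ derive1 F x = f x.
  by apply: (@continuous_FTC1_closed _ f (- N) x (N + 1)); [qlra|exact: intf|qlra|exact: cf].
have D : is_derive x (1 : R) (fun z => F z - F 0) (f x).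
  rewrite -F' derive1E -[X in is_derive _ _ _ X]subr0.
  apply: is_deriveB; first exact/derivableP.
apply: near_eq_is_derive D.
have nx : \forall z \near nbhs x, - N < z < N.
  have n1 : \forall z \near nbhs x, - N < z by exact: lt_nbhsr.
  have n2 : \forall z \near nbhs x, z < N by exact: lt_nbhsl.
  by apply: filterS2 n1 n2 => z -> ->.
by apply: filterS nx => z /PhiE ->.
Qed.

Lemma primitive_le Phi Psi f g (a b : R) : primitive Phi f -> primitive Psi g ->
  a <= b -> (forall x, a <= x <= b -> f x <= g x) ->
  Phi b - Phi a <= Psi b - Psi a.
Proof.
move=> pf pg ab fg.
have D x : is_derive x (1 : R) (fun x => Psi x - Phi x) (g x - f x).
  exact: is_deriveB.
have [|c] := @MVT_segment _ _ (fun x => g x - f x) a b ab (fun x _ => D x).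
  by apply: continuous_subspaceT => x; exact: is_derive_continuous (D x).
rewrite in_itv/= => /fg fgc e.
have : 0 <= (g c - f c) * (b - a) by rewrite mulr_ge0 ?subr_ge0.
by rewrite -e; qlra.
Qed.

Lemma primitive_cst c : primitive (fun x => c * x) (fun=> c).
Proof. by move=> x; have := is_deriveZ c (is_derive_id x (1 : R)); rewrite /GRing.scale /= mulr1. Qed.

Lemma primitiveZ c Phi f : primitive Phi f -> primitive (fun x => c * Phi x) (fun x => c * f x).
Proof. by move=> p x; exact: is_deriveZ. Qed.

Lemma primitiveD Phi Psi f g : primitive Phi f -> primitive Psi g ->
  primitive (fun x => Phi x + Psi x) (fun x => f x + g x).
Proof. by move=> p q x; exact: is_deriveD. Qed.

Lemma primitive_shift c Phi f : primitive Phi f ->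
  primitive (fun x => Phi (x + c)) (fun x => f (x + c)).
Proof.
move=> p x.
have D : is_derive x (1 : R) (fun z => z + c) 1 by apply: is_derive_eq; rewrite ?addr0.
by have := @is_derive1_comp _ Phi (fun s => s + c) x _ _ (p _) D; rewrite mulr1.
Qed.

Lemma lipschitz_continuous f (L : R) :
  (forall x y, `|f x - f y| <= L * `|x - y|) -> continuous f.
Proof.
move=> H x; apply/cvgrPdist_le => e e0.
have L0 : 0 <= L by have := le_trans (normr_ge0 _) (H 1 0); rewrite subr0 normr1 mulr1.
have L1 : 0 < L + 1 by qlra.
have eL : 0 < e / (L + 1) by exact: divr_gt0.
have nx : \forall y \near nbhs x, `|x - y| <= e / (L + 1) by exact: cvgr_dist_le.
apply: filterS nx => y; rewrite ler_pdivlMr// => xy.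
apply: le_trans (H x y) (le_trans _ xy).
by rewrite mulrC ler_wpM2l// lerDl.
Qed.

Lemma cont2_slice u (y : R) : cont2 u -> continuous (fun t : R => u t y).
Proof.
move=> cu t; apply: (@cvg_comp _ _ _ (fun t : R => (t, y)) _ _ _ _ _ (cu (t, y))).
have h1 : (fun s : R => s) @ nbhs t --> t by exact: cvg_id.
have h2 : (fun _ : R => y) @ nbhs t --> y by exact: cvg_cst.
exact: (cvg_pair h1 h2).
Qed.

Lemma cont2_tube u (t y r e : R) : cont2 u -> 0 < e ->
  \forall s \near nbhs t, forall z, y - r <= z <= y + r -> `|u t z - u s z| <= e.
Proof.
move=> cu e0.
have /compact_near_coveringP C : compact `[y - r, y + r] by exact: segment_compact.
have := C _ (nbhs t) (fun s z => `|u t z - u s z| <= e) _.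
have H : forall x, `[y - r, y + r]%classic x ->
    \forall x' \near x & i \near nbhs t, `|u t x' - u i x'| <= e.
  move=> x _.
  have : \forall z \near nbhs ((t, x) : R * R), `|u t x - u z.1 z.2| <= e / 2.
    by have /cvgrPdist_le := cu (t, x); apply; qlra.
  case=> -[A B] /= [At Bx] AB.
  exists (B, A) => //= -[x' i] [/= Bx' Ai].
  have h1 := AB (i, x') (conj Ai Bx').
  have h2 := AB (t, x') (conj (nbhs_singleton At) Bx').
  rewrite /= in h1 h2.
  have -> : u t x' - u i x' = - (u t x - u t x') + (u t x - u i x') by qlra.
  by apply: le_trans (ler_normD _ _) _; rewrite normrN; qlra.
move=> /(_ _ H); apply: filterS => s Hs z zin; apply: Hs.
by rewrite /= in_itv.
Qed.

(** A common Lipschitz constant spreads closeness at a point to a neighbourhood, and compactness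
    does the rest. The filter is arbitrary because the numerical scheme converges along an
    ultrafilter. *)
Lemma equilipschitz_cvg_unif (I : Type) (F : set_system I) (f : I -> R -> R) g (L r e : R) :
  Filter F -> (forall i x y, `|f i x - f i y| <= L * `|x - y|) ->
  (forall x y, `|g x - g y| <= L * `|x - y|) ->
  (forall x, forall d, 0 < d -> \forall i \near F, `|f i x - g x| <= d) -> 0 < e ->
  \forall i \near F, forall z, - r <= z <= r -> `|f i z - g z| <= e.
Proof.
move=> FF Lf Lg fg e0.
have L0 : 0 <= L by have := le_trans (normr_ge0 _) (Lg 1 0); rewrite subr0 normr1 mulr1.
have /compact_near_coveringP C : compact `[- r, r] by exact: segment_compact.
have := C _ F (fun i z => `|f i z - g z| <= e) FF.
have H : forall x, `[- r, r]%classic x -> \forall x' \near x & i \near F, `|f i x' - g x'| <= e.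
  move=> x _.
  have d0 : 0 < e / (4 * (L + 1)) by apply: divr_gt0; qlra.
  have nx : \forall s \near nbhs x, `|x - s| <= e / (4 * (L + 1)) by exact: cvgr_dist_le.
  have ni : \forall i \near F, `|f i x - g x| <= e / 2 by apply: fg; qlra.
  exists ([set x' | `|x - x'| <= e / (4 * (L + 1))], [set i | `|f i x - g x| <= e / 2]) => //.
  move=> [x' i] [/= h1 h2].
  have b (h : R -> R) : (forall x y, `|h x - h y| <= L * `|x - y|) -> `|h x - h x'| <= e / 4.
    move=> /(_ x x') /le_trans; apply.
    apply: (@le_trans _ _ ((L + 1) * (e / (4 * (L + 1))))); last first.
      by rewrite le_eqVlt; apply/orP; left; apply/eqP; field; qlra.
    by apply: ler_pM => //; qlra.
  have b1 := b _ (Lf i); have b2 := b _ Lg.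
  move: b1 b2 h2; rewrite !ler_norml; qlra.
move=> /(_ H); apply: filterS => s Hs z zin; apply: Hs.
by rewrite /= in_itv.
Qed.

End Primitives.

(** * Averages over intervals of length [d] *)

Section Averaging.
Context {R : realType}.
Implicit Types (f g h Phi Psi : R -> R) (u v : R -> R -> R) (d t y C L K a e : R).

Definition dq d f y := (f (y + d) - f y) / d.

Lemma primitive_dq d Phi f : primitive Phi f -> primitive (dq d Phi) (dq d f).
Proof.
move=> p; have := primitiveZ d^-1 (primitiveD (primitive_shift d p) (primitiveZ (-1) p)).
congr primitive; apply/funext => x; rewrite /dq; ring.
Qed.

Lemma primitive_continuous Phi f : primitive Phi f -> continuous Phi.
Proof. by move=> p x; exact: is_derive_continuous (p x). Qed.

Lemma dq_le d Phi Psi f g y z : 0 < d -> primitive Phi f -> primitive Psi g ->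
  (forall x, 0 <= x <= d -> f (y + x) <= g (z + x)) -> dq d Phi y <= dq d Psi z.
Proof.
move=> d0 pf pg fg; rewrite /dq ler_pM2r ?invr_gt0//.
have := primitive_le (primitive_shift y pf) (primitive_shift z pg) (ltW d0) _.
rewrite !add0r ![d + _]addrC; apply => x x0d; rewrite ![x + _]addrC; exact: fg.
Qed.

Lemma dq_ge_cst d Phi f y a : 0 < d -> primitive Phi f ->
  (forall x, 0 <= x <= d -> a <= f (y + x)) -> a <= dq d Phi y.
Proof.
move=> d0 pf H; have := dq_le (y := 0) (z := y) d0 (primitive_cst a) pf H.
by rewrite /dq -mulrBr addrAC subrr add0r mulfK ?gt_eqF.
Qed.

Lemma dq_le_cst d Phi f y a : 0 < d -> primitive Phi f ->
  (forall x, 0 <= x <= d -> f (y + x) <= a) -> dq d Phi y <= a.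
Proof.
move=> d0 pf H; have := dq_le (y := y) (z := 0) d0 pf (primitive_cst a) H.
by rewrite /dq -mulrBr addrAC subrr add0r mulfK ?gt_eqF.
Qed.

Lemma primitive_lip Phi f C : primitive Phi f -> (forall x, `|f x| <= C) ->
  forall x y, `|Phi x - Phi y| <= C * `|x - y|.
Proof.
move=> p fC; have W x y : x <= y -> `|Phi x - Phi y| <= C * `|x - y|.
  move=> xy.
  have h1 := primitive_le p (primitive_cst C) xy (fun z _ => le_trans (ler_norm _) (fC z)).
  have lo z : x <= z <= y -> - C <= f z by have := fC z; rewrite ler_norml => /andP[].
  have h2 := primitive_le (primitive_cst (- C)) p xy lo.
  rewrite distrC [`|x - y|]distrC (ger0_norm (x := y - x)) ?subr_ge0// ler_norml; qlra.
move=> x y; have [xy|/ltW xy] := leP x y; first exact: W.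
by have := W _ _ xy; rewrite distrC [`|y - x|]distrC.
Qed.

(** The mean of [f] over [[y, y + d]]; by [av_eq] any primitive gives the same value. The window is
    one-sided so that a time average started at [t >= 0] sees nonnegative times only. *)
Definition av d f : R -> R := dq d (xget f [set Phi | primitive Phi f]).

Lemma avP d f : continuous f -> exists2 Phi, primitive Phi f & av d f = dq d Phi.
Proof.
move=> cf; rewrite /av; case: xgetP => [Phi _ pf|]; first by exists Phi.
by have [Phi p] := primitive_exists cf => /(_ Phi).
Qed.

Lemma av_primitive d f : continuous f -> primitive (av d f) (dq d f).
Proof. by move=> /(avP d)[Phi p ->]; exact: primitive_dq. Qed.

Lemma av_eq d f Phi : 0 < d -> primitive Phi f -> continuous f -> av d f = dq d Phi.
Proof.
move=> d0 p cf; have [Psi q ->] := avP d cf; apply/funext => y.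
by apply/eqP; rewrite eq_le; apply/andP; split; exact: dq_le.
Qed.

Lemma av_le d f g y z : 0 < d -> continuous f -> continuous g ->
  (forall x, 0 <= x <= d -> f (y + x) <= g (z + x)) -> av d f y <= av d g z.
Proof.
by move=> d0 /(avP d)[Phi p ->] /(avP d)[Psi q ->]; exact: dq_le.
Qed.

Lemma avD d f g a y : 0 < d -> continuous f -> continuous g ->
  av d (fun x => f x + a * g x) y = av d f y + a * av d g y.
Proof.
move=> d0 cf cg; have [Phi p eP] := avP d cf; have [Psi q eQ] := avP d cg.
rewrite eP eQ.
rewrite (av_eq d0 (primitiveD p (primitiveZ a q))); first by rewrite /dq; ring.
by move=> x; apply: cvgD; [exact: cf|apply: cvgMr; exact: cg].
Qed.

Lemma av_bounds d f y a b : 0 < d -> continuous f ->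
  (forall x, 0 <= x <= d -> a <= f (y + x) <= b) -> a <= av d f y <= b.
Proof.
move=> d0 cf H; have [Phi p ->] := avP d cf.
by rewrite (dq_ge_cst d0 p) ?(dq_le_cst d0 p)// => x /H/andP[].
Qed.

Lemma av_near d f y a e : 0 < d -> continuous f ->
  (forall x, 0 <= x <= d -> `|f (y + x) - a| <= e) -> `|av d f y - a| <= e.
Proof.
move=> d0 cf H; rewrite ler_distl; apply: av_bounds => // x /H.
by rewrite ler_distl.
Qed.

Lemma cont2_slice2 u t : cont2 u -> continuous (u t).
Proof.
move=> cu y; apply: (@cvg_comp _ _ _ (fun z : R => (t, z)) _ _ _ _ _ (cu (t, y))).
have h1 : (fun s : R => s) @ nbhs y --> y by exact: cvg_id.
have h2 : (fun _ : R => t) @ nbhs y --> t by exact: cvg_cst.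
exact: (cvg_pair h2 h1).
Qed.

Lemma cont2_swap u : cont2 u -> cont2 (fun y t => u t y).
Proof.
move=> cu [y t]; apply: (@cvg_comp _ _ _ (fun z : R * R => (z.2, z.1)) _ _ _ _ _ (cu (t, y))).
have h1 : (fun z : R * R => z.1) @ nbhs (y, t) --> y by exact: cvg_fst.
have h2 : (fun z : R * R => z.2) @ nbhs (y, t) --> t by exact: cvg_snd.
exact: (cvg_pair h2 h1).
Qed.

Lemma cont2_shift u a b : cont2 u -> cont2 (fun t y => u (t + a) (y + b)).
Proof.
move=> cu [t y]; apply: (@cvg_comp _ _ _ (fun z : R * R => (z.1 + a, z.2 + b)) _ _ _ _ _ (cu (t + a, y + b))).
have h1 : (fun z : R * R => z.1 + a) @ nbhs (t, y) --> t + a.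
  by apply: cvgD; [exact: cvg_fst|exact: cvg_cst].
have h2 : (fun z : R * R => z.2 + b) @ nbhs (t, y) --> y + b.
  by apply: cvgD; [exact: cvg_snd|exact: cvg_cst].
exact: (cvg_pair h1 h2).
Qed.

Lemma cont2_lip_slice u L : (forall t y z, `|u t y - u t z| <= L * `|y - z|) ->
  (forall y, continuous (fun t => u t y)) -> cont2 u.
Proof.
move=> Lu cu [t y]; apply/cvgrPdist_le => e e0.
have L0 : 0 <= L by have := le_trans (normr_ge0 _) (Lu 0 1 0); rewrite subr0 normr1 mulr1.
have e1 : 0 < e / (2 * (L + 1)) by apply: divr_gt0; qlra.
have e2 : 0 < e / 2 by qlra.
have nt : \forall s \near nbhs t, `|u t y - u s y| <= e / 2.
  by have /cvgrPdist_le := cu y t; exact.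
have ny : \forall s \near nbhs y, `|y - s| <= e / (2 * (L + 1)) by exact: cvgr_dist_le.
exists ([set s | `|u t y - u s y| <= e / 2], [set s | `|y - s| <= e / (2 * (L + 1))]) => //.
move=> [t' y'] [/= h1 h2].
have h3 : `|u t' y - u t' y'| <= e / 2.
  apply: le_trans (Lu _ _ _) _.
  apply: (@le_trans _ _ ((L + 1) * (e / (2 * (L + 1))))); last first.
    by rewrite le_eqVlt; apply/orP; left; apply/eqP; field; qlra.
  by apply: ler_pM => //; qlra.
by move: h1 h3; rewrite !ler_norml; qlra.
Qed.

Lemma dq_lip d f C x y : 0 < d -> continuous f -> (forall z, `|f z| <= C) ->
  `|av d f x - av d f y| <= 2 * C / d * `|x - y|.
Proof.
move=> d0 cf fC; apply: (primitive_lip (av_primitive d cf)) => z.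
rewrite /dq normrM normfV (gtr0_norm d0) ler_pM2r ?invr_gt0//.
apply: le_trans (ler_normB _ _) _; have := fC (z + d); have := fC z; qlra.
Qed.

Lemma cont2_av d u C : 0 < d -> cont2 u -> (forall t y, `|u t y| <= C) ->
  cont2 (fun t => av d (u t)).
Proof.
move=> d0 cu uC.
apply: (@cont2_lip_slice _ (2 * C / d)).
  by move=> t y z; apply: dq_lip => //; exact: cont2_slice2.
move=> y t; apply/cvgrPdist_le => e e0.
apply: filterS (cont2_tube t (y + d) d cu e0) => s Hs.
have ct : continuous (u t) by exact: cont2_slice2.
have cs : continuous (u s) by exact: cont2_slice2.
have -> : av d (u t) y - av d (u s) y = av d (fun x => u t x + -1 * u s x) y.
  by rewrite avD//; ring.
rewrite ler_norml; apply: av_bounds => //.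
  by move=> x; apply: cvgD; [exact: ct|apply: cvgMr; exact: cs].
by move=> x xd; rewrite mulN1r -ler_norml; apply: Hs; qlra.
Qed.

Lemma cont2_dq d u : 0 < d -> cont2 u -> cont2 (fun t => dq d (u t)).
Proof.
move=> d0 cu z; have c : cont2 (fun t y => u (t + 0) (y + d)) by exact: cont2_shift.
apply: cvgM; last exact: cvg_cst.
apply: cvgB; last exact: cu.
by have := c z; under eq_fun do rewrite addr0.
Qed.

Lemma av_bounded d u C : 0 < d -> cont2 u -> (forall t y, `|u t y| <= C) ->
  forall t y, `|av d (u t) y| <= C.
Proof.
move=> d0 cu uC t y; rewrite -[av _ _ _]subr0; apply: av_near => //.
  exact: cont2_slice2.
by move=> x _; rewrite subr0.
Qed.

Definition taylor2 (K : R) f f1 f2 := forall y z,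
  `|f z - f y - f1 y * (z - y) - f2 y / 2 * (z - y) ^+ 2| <= K * `|z - y| ^+ 3.

Lemma primitive_quad f f1 L : primitive f f1 ->
  (forall x y, `|f1 x - f1 y| <= L * `|x - y|) ->
  forall y z, `|f z - f y - f1 y * (z - y)| <= L * `|z - y| ^+ 2.
Proof.
move=> p Lf y z.
have L0 : 0 <= L by have := le_trans (normr_ge0 _) (Lf 1 0); rewrite subr0 normr1 mulr1.
pose r : R := `|z - y|.
have pr := primitiveD p (primitive_cst (- f1 y)).
have B x : `|x - y| <= r -> `|f1 x + - f1 y| <= L * r.
  by move=> h; apply: le_trans (Lf _ _) _; rewrite ler_wpM2l.
have -> : f z - f y - f1 y * (z - y) = (f z + - f1 y * z) - (f y + - f1 y * y) by ring.
rewrite expr2 mulrA -/r; have [yz|/ltW zy] := lerP y z.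
- have hr : r = z - y by rewrite /r ger0_norm// subr_ge0.
  have H x : y <= x <= z -> `|f1 x + - f1 y| <= L * r.
    by move=> ?; apply: B; rewrite hr ger0_norm; qlra.
  have h1 := primitive_le pr (primitive_cst (L * r)) yz (fun x xi => le_trans (ler_norm _) (H x xi)).
  have lo x : y <= x <= z -> - (L * r) <= f1 x + - f1 y by move=> /H; rewrite ler_norml => /andP[].
  have h2 := primitive_le (primitive_cst (- (L * r))) pr yz lo.
  by rewrite ler_norml; move: h1 h2; rewrite -!mulrBr -hr; qlra.
- have hr : r = y - z by rewrite /r distrC ger0_norm// subr_ge0.
  have H x : z <= x <= y -> `|f1 x + - f1 y| <= L * r.
    by move=> ?; apply: B; rewrite hr distrC ger0_norm; qlra.
  have h1 := primitive_le pr (primitive_cst (L * r)) zy (fun x xi => le_trans (ler_norm _) (H x xi)).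
  have lo x : z <= x <= y -> - (L * r) <= f1 x + - f1 y by move=> /H; rewrite ler_norml => /andP[].
  have h2 := primitive_le (primitive_cst (- (L * r))) pr zy lo.
  by rewrite ler_norml; move: h1 h2; rewrite -!mulrBr -hr; qlra.
Qed.

Lemma primitive_taylor2 f f1 f2 L : primitive f f1 -> primitive f1 f2 ->
  (forall x y, `|f2 x - f2 y| <= L * `|x - y|) -> taylor2 L f f1 f2.
Proof.
move=> p1 p2 Lf y z.
have L0 : 0 <= L by have := le_trans (normr_ge0 _) (Lf 1 0); rewrite subr0 normr1 mulr1.
have Q := primitive_quad p2 Lf.
pose r : R := `|z - y|.
pose Psi x := f x + - f1 y * x + - (f2 y / 2) * (x - y) ^+ 2.
have pr : primitive Psi (fun x => f1 x - f1 y - f2 y * (x - y)).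
  move=> x; have := is_deriveD (primitiveD p1 (primitive_cst (- f1 y)) x)
    (is_deriveZ (- (f2 y / 2)) (is_derive_shiftX 2 y x)).
  by congr is_derive; rewrite /GRing.scale /= expr1; field.
have B x : `|x - y| <= r -> `|f1 x - f1 y - f2 y * (x - y)| <= L * r ^+ 2.
  by move=> h; apply: le_trans (Q _ _) _; rewrite ler_wpM2l// lerXn2r// nnegrE ?normr_ge0.
have -> : f z - f y - f1 y * (z - y) - f2 y / 2 * (z - y) ^+ 2 = Psi z - Psi y.
  by rewrite /Psi; ring.
rewrite exprSr mulrA -/r; have [yz|/ltW zy] := lerP y z.
- have hr : r = z - y by rewrite /r ger0_norm// subr_ge0.
  have H x : y <= x <= z -> `|f1 x - f1 y - f2 y * (x - y)| <= L * r ^+ 2.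
    by move=> ?; apply: B; rewrite hr ger0_norm; qlra.
  have h1 := primitive_le pr (primitive_cst (L * r ^+ 2)) yz (fun x xi => le_trans (ler_norm _) (H x xi)).
  have lo x : y <= x <= z -> - (L * r ^+ 2) <= f1 x - f1 y - f2 y * (x - y) by move=> /H; rewrite ler_norml => /andP[].
  have h2 := primitive_le (primitive_cst (- (L * r ^+ 2))) pr yz lo.
  by rewrite ler_norml; move: h1 h2; rewrite -!mulrBr -hr; qlra.
- have hr : r = y - z by rewrite /r distrC ger0_norm// subr_ge0.
  have H x : z <= x <= y -> `|f1 x - f1 y - f2 y * (x - y)| <= L * r ^+ 2.
    by move=> ?; apply: B; rewrite hr distrC ger0_norm; qlra.
  have h1 := primitive_le pr (primitive_cst (L * r ^+ 2)) zy (fun x xi => le_trans (ler_norm _) (H x xi)).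
  have lo x : z <= x <= y -> - (L * r ^+ 2) <= f1 x - f1 y - f2 y * (x - y) by move=> /H; rewrite ler_norml => /andP[].
  have h2 := primitive_le (primitive_cst (- (L * r ^+ 2))) pr zy lo.
  by rewrite ler_norml; move: h1 h2; rewrite -!mulrBr -hr; qlra.
Qed.

End Averaging.

(** * Comparison for the G-heat equation *)

Section GHeat.
Context {R : realType} (sl su : R).
Hypotheses (Hsl : 0 <= sl) (Hsu : sl <= su).
Implicit Types (f g : R -> R) (u w : R -> R -> R) (t y a c e r K L C : R) (b : bool).
Local Notation G := (G sl su).
Local Notation k := (su ^+ 2).

(** By [G_ge] and [G_eq], [G] is the larger of the two linear functions with slopes [sg b ^+ 2 / 2],
    so only the extreme volatilities ever have to be considered. *)
Definition sg (b : bool) := if b then su else sl.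

Lemma sg_ge0 b : 0 <= sg b.
Proof. by case: b => //=; apply: le_trans Hsl _. Qed.

Lemma sg_le b : sg b <= su.
Proof. by case: b => //=. Qed.

Lemma sg2_le b : sg b ^+ 2 <= k.
Proof. by rewrite lerXn2r ?nnegrE ?sg_ge0 ?sg_le ?(le_trans Hsl). Qed.

Lemma slsu2 : sl ^+ 2 <= k.
Proof. exact: (sg2_le false). Qed.

Lemma G_ge b a : sg b ^+ 2 / 2 * a <= G a.
Proof.
rewrite /Defs.G; have := slsu2; have := sqr_ge0 sl; case: b => /=;
  case: (lerP a 0) => ?; case: (lerP (- a) 0) => ?; qnra.
Qed.

Lemma G_eq a : exists b, G a = sg b ^+ 2 / 2 * a.
Proof.
rewrite /Defs.G; have [a0|a0] := lerP 0 a; [exists true|exists false] => /=.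
- by case: (lerP (- a) 0) => ?; qlra.
- by case: (lerP (- a) 0) => ?; qlra.
Qed.

Lemma G_lincomb (x y a b : R) : 0 <= x -> 0 <= y -> G (x * a + y * b) <= x * G a + y * G b.
Proof.
move=> x0 y0; have [s ->] := G_eq (x * a + y * b).
by have := G_ge s a; have := G_ge s b; qnra.
Qed.

Lemma G_addr a (b : R) : 0 <= b -> G (a + b) <= G a + k / 2 * b.
Proof.
move=> b0; have [s ->] := G_eq (a + b).
by have := G_ge s a; have := sg2_le s; qnra.
Qed.

Lemma G_norm a : `|G a| <= k / 2 * `|a|.
Proof.
have [s ->] := G_eq a; rewrite normrM ler_wpM2r// ger0_norm ?divr_ge0 ?sqr_ge0//.
by rewrite ler_pM2r// sg2_le.
Qed.

Definition dualG a := - G (- a).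

Lemma dualG_addr a (b : R) : 0 <= b -> dualG (a + b) <= dualG a + k / 2 * b.
Proof.
move=> b0; rewrite /dualG; have := G_addr (- (a + b)) b0.
by rewrite opprD addrNK; qlra.
Qed.

Lemma dualG_le b a : dualG a <= sg b ^+ 2 / 2 * a.
Proof. by rewrite /dualG; have := G_ge b (- a); qlra. Qed.

Lemma viscosity_sub_vsub u : viscosity_subsolution sl su u -> vsub G u.
Proof. by move=> H psi t y C t0 e m; rewrite -subr_le0; exact: H. Qed.

Lemma viscosity_super_vsub u : viscosity_supersolution sl su u ->
  vsub dualG (fun t y => - u t y).
Proof.
move=> H psi t y C t0 e m.
have S := smooth12Z (-1) (C12_smooth12 C).
have [C' E] := smooth12_derivs S.
have := H _ _ y C' t0; rewrite (E _ y t0).1 (E _ y t0).2 /dualG.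
rewrite -e mulrNN mul1r => /(_ erefl).
rewrite !mulN1r; set x := derive1 _ _; set z := derive1 _ _ => H'.
suff : 0 <= - x - G (- z) by qlra.
by apply: H' => s z' s0; have := m _ z' s0; rewrite mulN1r; qlra.
Qed.

Lemma vsub_G u : vsub G u -> viscosity_subsolution sl su u.
Proof. by move=> H psi t y C t0 e m; rewrite subr_le0; exact: H. Qed.

Lemma vsub_dualG u : vsub dualG (fun t y => - u t y) -> viscosity_supersolution sl su u.
Proof.
move=> H psi t y C t0 e m.
have S := smooth12Z (-1) (C12_smooth12 C).
have [C' E] := smooth12_derivs S.
have := H _ _ y C' t0; rewrite (E _ y t0).1 (E _ y t0).2 /dualG.
rewrite e mulN1r => /(_ erefl).
rewrite !mulN1r opprK; set x := derive1 _ _; set z := derive1 _ _ => H'.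
suff : - x <= - G z by qlra.
by apply: H' => s z' s0; have := m _ z' s0; rewrite mulN1r; qlra.
Qed.

(** One step of the symmetric random walk with increments [r] and [- r]. *)
Definition avg r f y := (f (y + r) + f (y - r)) / 2.

Lemma avg_le r f g : (forall z, f z <= g z) -> forall y, avg r f y <= avg r g y.
Proof.
by move=> fg y; rewrite /avg; have := fg (y + r); have := fg (y - r); qlra.
Qed.

Lemma iter_avg_le n r f g : (forall z, f z <= g z) ->
  forall y, iter n (avg r) f y <= iter n (avg r) g y.
Proof. by move=> fg; elim: n => //= n IH; exact: avg_le. Qed.

Lemma iter_avg_addc n r f c y :
  iter n (avg r) (fun z => f z + c) y = iter n (avg r) f y + c.
Proof. by elim: n y => //= n IH y; rewrite {1}/avg !IH /avg; field. Qed.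

(** With [x = z - y0], the walk after [n] steps has second moment $x^2 + n r^2$ and fourth moment
    $x^4 + 6 n r^2 x^2 + (3 n^2 - 2 n) r^4$ about [y0]; the part $-2n$ is dropped, which lowers the
    left side since [M >= 0]. *)
Lemma iter_avg_poly n r f y0 (c p q M : R) : 0 <= M ->
  (forall z, c + p * (z - y0) + q / 2 * (z - y0) ^+ 2 - M * (z - y0) ^+ 4 <= f z) ->
  forall z, c + p * (z - y0) + q / 2 * ((z - y0) ^+ 2 + n%:R * r ^+ 2)
    - M * ((z - y0) ^+ 4 + 6 * n%:R * r ^+ 2 * (z - y0) ^+ 2
           + 3 * n%:R ^+ 2 * r ^+ 4) <= iter n (avg r) f z.
Proof.
move=> M0 H; elim: n => [|n IH] z.
  by have := H z; rewrite /= expr0n /= !(mulr0, mul0r, addr0).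
rewrite iterS /avg; have := IH (z + r); have := IH (z - r).
have r4 : 0 <= r ^+ 4 by rewrite (_ : 4 = 2 * 2)%N// exprM sqr_ge0.
set P := iter n (avg r) f; rewrite (_ : n.+1%:R = n%:R + 1 :> R) ?natr1//; set N : R := n%:R.
have N0 : 0 <= N by rewrite ler0n.
have -> : z + r - y0 = (z - y0) + r by ring.
have -> : z - r - y0 = (z - y0) - r by ring.
move: (z - y0) (P (z + r)) (P (z - r)) => x p1 p2 h1 h2.
by have := mulr_ge0 M0 r4; qlra.
Qed.

End GHeat.

(** * Mollified supersolutions *)

Section SupersolutionApproximation.
Context {R : realType} (sl su : R).
Hypotheses (Hsl : 0 <= sl) (Hsu : sl <= su).
Implicit Types (f g h : R -> R) (u w : R -> R -> R) (t y a c e r d K L C : R) (b : bool).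
Local Notation G := (G sl su).
Local Notation dualG := (dualG sl su).
Local Notation sg := (sg sl su).
Local Notation k := (su ^+ 2).

Lemma su_ge0 : 0 <= su. Proof. exact: le_trans Hsu. Qed.

Lemma k_ge0 : 0 <= k. Proof. exact: sqr_ge0. Qed.

(** Young's inequality with a free scale [e]: it trades a cubic Taylor remainder for the quadratic
    and quartic terms that the barriers accept. *)
Lemma cube_le e (x : R) : 0 < e ->
  `|x| ^+ 3 <= e / 2 * x ^+ 2 + (2 * e)^-1 * x ^+ 4.
Proof.
move=> e0; have -> : x ^+ 4 = `|x| ^+ 2 * `|x| ^+ 2 by rewrite real_normK ?num_real//; ring.
rewrite -(real_normK (num_real x)); move: `|x| => z.
rewrite -(ler_pM2l (_ : 0 < 2 * e)); last qlra.
have -> : 2 * e * (e / 2 * z ^+ 2 + (2 * e)^-1 * (z ^+ 2 * z ^+ 2)) = e ^+ 2 * z ^+ 2 + z ^+ 2 * z ^+ 2.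
  by field; qlra.
have := mulr_ge0 (sqr_ge0 z) (sqr_ge0 (e - z)); qlra.
Qed.

Lemma taylor2_addc K f f1 f2 c : taylor2 K f f1 f2 -> taylor2 K (fun z => f z + c) f1 f2.
Proof.
by move=> H y z; have := H y z; rewrite (_ : f z + c - (f y + c) = f z - f y)//; ring.
Qed.

Lemma taylor2_avg K f f1 f2 r : taylor2 K f f1 f2 ->
  taylor2 K (avg r f) (avg r f1) (avg r f2).
Proof.
move=> H y z; have := H (y + r) (z + r); have := H (y - r) (z - r).
rewrite /avg (_ : z + r - (y + r) = z - y); last ring.
rewrite (_ : z - r - (y - r) = z - y); last ring.
rewrite !ler_norml; qlra.
Qed.

(** The terms in [k] are the loss of the barrier in [super_lower]; [su ^+ 3] is the Taylor remainder
    of one walk step of size at most [su * e]. *)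
Definition stepc := k / 2 + 3 / 2 * k ^+ 2 + su ^+ 3.

Lemma stepc_ge0 : 0 <= stepc.
Proof.
rewrite /stepc; have := k_ge0; have := sqr_ge0 k; have := exprn_ge0 3 su_ge0; qlra.
Qed.

Section OneSupersolution.
Variables (u : R -> R -> R) (C : R).
Hypotheses (vu : vsub dualG (fun t y => - u t y)) (cu : cont2 u)
  (uC : forall t y, `|u t y| <= C).

Let NuC t y : 0 <= t -> - u t y <= C.
Proof. by move=> _; apply: le_trans (ler_norm _) _; rewrite normrN. Qed.

(** With the cubic remainder split at scale [e], the second derivative worsens by [K * e] and the
    quartic coefficient is [K / (2 * e)]; over the time [e ^+ 2] both losses are of order
    [K * e ^+ 3], below the main term. *)
Lemma super_lower t0 f f1 f2 K b e y : 0 <= t0 -> 0 < e -> 0 < K ->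
  taylor2 K f f1 f2 -> (forall z, f z <= u t0 z) ->
  f y + sg b ^+ 2 / 2 * f2 y * e ^+ 2 - (k / 2 + 3 / 2 * k ^+ 2) * K * e ^+ 3 <= u (t0 + e ^+ 2) y.
Proof.
move=> t00 e0 K0 T fu.
have M0 : 0 < K * (2 * e)^-1 by rewrite mulr_gt0// invr_gt0; qlra.
have := @vsub_barrier _ dualG _ k C (sg b ^+ 2 / 2 * (- f2 y + K * e)) (- f y) (- f1 y)
  (- f2 y + K * e) (K * (2 * e)^-1) t0 y (e ^+ 2) k_ge0 (dualG_addr Hsl Hsu) vu (cont2N cu) NuC
  (dualG_le Hsl Hsu b _) _ M0 t00 (sqr_ge0 e).
have sgk := sg2_le Hsl Hsu b.
rewrite normrM ler_wpM2r//; last first.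
  by rewrite ger0_norm ?divr_ge0 ?sqr_ge0// ler_pM2r.
move=> /(_ erefl) H.
have {}H : - u (t0 + e ^+ 2) y <= - f y + sg b ^+ 2 / 2 * (- f2 y + K * e) * e ^+ 2 +
    3 * (K * (2 * e)^-1) * k ^+ 2 * (e ^+ 2) ^+ 2.
  apply: H => z; have := fu z; have := T y z.
  rewrite ler_norml => /andP[h1 _]; have := ler_wpM2l (ltW K0) (cube_le (z - y) e0).
  by move: h1; qlra.
have e1 : 3 * (K * (2 * e)^-1) * k ^+ 2 * (e ^+ 2) ^+ 2 = 3 / 2 * k ^+ 2 * K * e ^+ 3.
  by field; qlra.
have e3 : 0 <= K * e ^+ 3 by rewrite mulr_ge0 ?exprn_ge0// ltW.
have := ler_wpM2r e3 sgk; move: H; rewrite e1; qlra.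
Qed.

Lemma super_step t0 f f1 f2 K b e y : 0 <= t0 -> 0 < e -> 0 < K ->
  taylor2 K f f1 f2 -> (forall z, f z <= u t0 z) ->
  avg (sg b * e) f y - stepc * K * e ^+ 3 <= u (t0 + e ^+ 2) y.
Proof.
move=> t00 e0 K0 T fu; apply: le_trans (super_lower b y t00 e0 K0 T fu).
pose r := sg b * e.
have r0 : 0 <= r by rewrite mulr_ge0 ?sg_ge0// ltW.
have r3 : K * r ^+ 3 <= su ^+ 3 * K * e ^+ 3.
  rewrite /r exprMn mulrCA mulrA ler_wpM2r ?exprn_ge0 ?(ltW e0)//.
  by rewrite ler_wpM2r ?(ltW K0)// lerXn2r ?nnegrE ?sg_ge0 ?sg_le// su_ge0.
have := T y (y + r); have := T y (y - r).
rewrite !(addrAC y _ (- y)) subrr !add0r normrN (ger0_norm r0) sqrrN !ler_norml => /andP[_ h1] /andP[_ h2].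
have e2 : r ^+ 2 = sg b ^+ 2 * e ^+ 2 by rewrite exprMn.
rewrite /avg -/r /stepc; move: h1 h2 r3; rewrite e2; qlra.
Qed.

(** The constant [K] survives averaging and subtraction of constants, so the errors of the [n] steps
    simply add up. *)
Lemma super_iter n t0 f f1 f2 K b e y : 0 <= t0 -> 0 < e -> 0 < K ->
  taylor2 K f f1 f2 -> (forall z, f z <= u t0 z) ->
  iter n (avg (sg b * e)) f y - n%:R * (stepc * K * e ^+ 3) <= u (t0 + n%:R * e ^+ 2) y.
Proof.
move=> t00 e0 K0; elim: n t0 t00 f f1 f2 => [|n IH] t0 t00 f f1 f2 T fu.
  by rewrite !mul0r subr0 addr0.
have T' := taylor2_addc (- (stepc * K * e ^+ 3)) (taylor2_avg (sg b * e) T).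
have := IH (t0 + e ^+ 2) _ _ _ _ T' _.
rewrite addr_ge0 ?sqr_ge0// => /(_ erefl (fun z => super_step b z t00 e0 K0 T fu)).
rewrite iter_avg_addc -iterSr -natr1.
by rewrite (_ : t0 + (n%:R + 1) * e ^+ 2 = t0 + e ^+ 2 + n%:R * e ^+ 2); [qlra|ring].
Qed.

End OneSupersolution.

Lemma av_lip d f L x y : 0 < d -> (forall x y, `|f x - f y| <= L * `|x - y|) ->
  `|av d f x - av d f y| <= L * `|x - y|.
Proof.
move=> d0 Lf; have cf := lipschitz_continuous Lf.
have -> : av d f x - av d f y = av d f x - av d f x + (av d f x - av d f y) by ring.
have H c : av d (fun z => f z + c * 1) y = av d f y + c.
  have c1 : continuous (fun _ : R => 1 : R) by move=> ?; exact: cvg_cst.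
  rewrite avD//; congr (_ + _).
  rewrite (av_eq d0 (primitive_cst 1) c1) /dq -mulrBr addrAC subrr add0r mul1r.
  by rewrite divff ?mulr1// gt_eqF.
have cc c : continuous (fun z => f z + c * 1).
  by move=> z; apply: cvgD; [exact: cf|exact: cvg_cst].
rewrite subrr add0r ler_norml; apply/andP; split.
- rewrite lerBrDr addrC -H; apply: av_le => // z _.
  by have := Lf (x + z) (y + z); rewrite (_ : x + z - (y + z) = x - y); [rewrite ler_norml; qlra|ring].
- rewrite lerBlDr addrC -H; apply: av_le => // z _.
  by have := Lf (x + z) (y + z); rewrite (_ : x + z - (y + z) = x - y); [rewrite ler_norml; qlra|ring].
Qed.

Lemma av_dist d f L y : 0 < d -> (forall x y, `|f x - f y| <= L * `|x - y|) ->
  `|av d f y - f y| <= L * d.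
Proof.
move=> d0 Lf; have cf := lipschitz_continuous Lf.
have L0 : 0 <= L by have := le_trans (normr_ge0 _) (Lf 1 0); rewrite subr0 normr1 mulr1.
apply: av_near => // x x0d; apply: le_trans (Lf _ _) _.
by rewrite addrAC subrr add0r ler_wpM2l// ger0_norm; qlra.
Qed.

Lemma dq_lipschitz d f L x y : 0 < d -> (forall x y, `|f x - f y| <= L * `|x - y|) ->
  `|dq d f x - dq d f y| <= 2 * L / d * `|x - y|.
Proof.
move=> d0 Lf; rewrite /dq -mulrBl normrM normfV (gtr0_norm d0).
rewrite mulrAC ler_pM2r ?invr_gt0//.
have := Lf (x + d) (y + d); rewrite (_ : x + d - (y + d) = x - y); last ring.
by have := Lf x y; rewrite !ler_norml; qlra.
Qed.

(** The second derivative [dq d (dq d h)] of the double average is Lipschitz with constant $4L/d^2$.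
    The added 1 keeps the constant positive when [L = 0]. *)
Lemma mollify_taylor d h L : 0 < d -> (forall x y, `|h x - h y| <= L * `|x - y|) ->
  taylor2 (4 * L / d ^+ 2 + 1) (av d (av d h)) (dq d (av d h)) (dq d (dq d h)).
Proof.
move=> d0 Lh; have ch := lipschitz_continuous Lh.
apply: primitive_taylor2.
- apply: av_primitive; exact: primitive_continuous (av_primitive d ch).
- exact: primitive_dq (av_primitive d ch).
- move=> x y; apply: le_trans (dq_lipschitz x y d0 (fun x y => dq_lipschitz x y d0 Lh)) _.
  rewrite ler_wpM2r// -[X in X <= _]addr0 lerD// le_eqVlt; apply/orP; left; apply/eqP.
  by field; qlra.
Qed.

Lemma iter_avg_primitive n r f g : primitive f g ->
  primitive (iter n (avg r) f) (iter n (avg r) g).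
Proof.
move=> p; elim: n => //= n IH.
have := primitiveZ 2^-1 (primitiveD (primitive_shift r IH) (primitive_shift (- r) IH)).
by congr primitive; apply/funext => x; rewrite /avg mulrC.
Qed.

Lemma iter_avg_continuous n r f : continuous f -> continuous (iter n (avg r) f).
Proof.
move=> cf; elim: n => //= n IH x.
have cs c : (fun z => iter n (avg r) f (z + c)) @ nbhs x --> iter n (avg r) f (x + c).
  have D : is_derive x (1 : R) (fun z => z + c) 1 by apply: is_derive_eq; rewrite ?addr0.
  by apply: (@cvg_comp _ _ _ (fun z => z + c) _ _ (nbhs (x + c)));
    [exact: is_derive_continuous D|exact: IH].
by apply: cvgM; [apply: cvgD; exact: cs|exact: cvg_cst].
Qed.

Lemma av_iter_avg d n r f y : 0 < d -> continuous f ->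
  av d (iter n (avg r) f) y = iter n (avg r) (av d f) y.
Proof.
move=> d0 cf; have [Phi p ->] := avP d cf.
rewrite (av_eq d0 (iter_avg_primitive n r p) (iter_avg_continuous cf)).
elim: n y => //= n IH y; rewrite /avg -!IH /dq.
by rewrite !(addrAC y _ d); ring.
Qed.

(** Time is written as $e^2$ because the matching space scale is [e]; a loss of order $e^3$ then
    disappears in the difference quotient. *)
Lemma derive_ge (f : R -> R) t d a c : is_derive t (1 : R) f d ->
  (forall e, 0 < e -> a * e ^+ 2 - c * e ^+ 3 <= f (t + e ^+ 2) - f t) -> a <= d.
Proof.
move=> D H; rewrite leNgt; apply/negP => da.
have [/cvgrPdist_le cD vD] := D.
pose m := (a - d) / 4; have m0 : 0 < m by rewrite /m; qlra.
have := cD m m0.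
case=> dl /= dl0; rewrite -/(derive f t 1) vD => N.
pose e := Num.min (Num.min 1 (dl / 2)) (m / (`|c| + 1)).
have c1 : 0 < `|c| + 1 by have := normr_ge0 c; qlra.
have e0 : 0 < e by rewrite !lt_min ltr01 /= divr_gt0// divr_gt0.
have e1 : e <= 1 by rewrite /e !ge_min lexx.
have e2 : e <= dl / 2 by rewrite /e !ge_min lexx !orbT.
have e3 : e * (`|c| + 1) <= m by rewrite -ler_pdivlMr// /e !ge_min lexx !orbT.
have ee : 0 < e ^+ 2 by exact: exprn_gt0.
have ee1 : e ^+ 2 < dl by rewrite expr2; have := ler_wpM2l (ltW e0) e1; qlra.
have := N (e ^+ 2); rewrite /ball_ /= sub0r normrN (gtr0_norm ee) => /(_ ee1 (lt0r_neq0 ee)).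
rewrite /GRing.scale /= mulr1 [e ^+ 2 + t]addrC ler_norml => /andP[+ _].
rewrite lerBrDl -lerBrDr opprK ler_pdivrMl// => H1.
have := H e e0; have : c * e ^+ 3 <= m * e ^+ 2.
  rewrite exprSr mulrA mulrAC ler_wpM2r ?(ltW ee)//.
  apply: le_trans e3; rewrite mulrC ler_wpM2l ?(ltW e0)//.
  by have := ler_norm c; qlra.
have : 0 < (a - d) * e ^+ 2 by rewrite mulr_gt0// subr_gt0.
by move: H1; rewrite /m; qlra.
Qed.

(* A supersolution dominates one walk step of any smooth minorant up to an
   error of order [e^3]; mollifying [u t0] and summing over [n] steps of
   length [e^2/n] makes the total error [O(1/sqrt n)]. *)
Lemma super_walk u L C t0 e b (eps : R) :
  vsub dualG (fun t y => - u t y) -> cont2 u -> (forall t y, `|u t y| <= C) ->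
  (forall t x y, `|u t x - u t y| <= L * `|x - y|) ->
  0 <= t0 -> 0 < e -> 0 < eps ->
  exists n, forall y, iter n.+1 (avg (sg b * (e / Num.sqrt n.+1%:R))) (u t0) y - eps
    <= u (t0 + e ^+ 2) y.
Proof.
move=> vu cu uC Lu t00 e0 eps0.
have L0 : 0 <= L by have := le_trans (normr_ge0 _) (Lu 0 1 0); rewrite subr0 normr1 mulr1.
pose d := eps / (8 * (L + 1)).
have d0 : 0 < d by rewrite /d divr_gt0//; qlra.
have Ld : 4 * L * d <= eps / 2.
  have : (L + 1) * d = eps / 8 by rewrite /d; field; qlra.
  by qnra.
pose K := 4 * L / d ^+ 2 + 1.
have K0 : 0 < K by rewrite /K ltr_wpDl// divr_ge0 ?sqr_ge0// mulr_ge0.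
pose f z := av d (av d (u t0)) z + - (2 * L * d).
have T : taylor2 K f (dq d (av d (u t0))) (dq d (dq d (u t0))).
  by apply: taylor2_addc; exact: mollify_taylor.
have near z : `|av d (av d (u t0)) z - u t0 z| <= 2 * L * d.
  have h1 := av_dist z d0 (Lu t0); have h2 := av_dist z d0 (fun x y => av_lip x y d0 (Lu t0)).
  by move: h1 h2; rewrite !ler_norml; qlra.
pose A := stepc * K * e ^+ 3.
have A0 : 0 <= A by rewrite !mulr_ge0 ?stepc_ge0 ?exprn_ge0 ?ltW.
(* [A] is the error of a single step at scale [e]; with [n.+1] steps at scale $e/\sqrt{n+1}$ the
   total is $A/\sqrt{n+1}$, and this [n] makes it at most [eps / 2]. *)
pose n := Num.truncn ((2 * A / eps) ^+ 2).
have n1 : (2 * A / eps) ^+ 2 < n.+1%:R by rewrite truncnS_gt.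
exists n => y; set N : R := n.+1%:R in n1 *.
pose s := Num.sqrt N.
have N0 : 0 < N by rewrite ltr0n.
have s0 : 0 < s by rewrite sqrtr_gt0.
have sN : s ^+ 2 = N by rewrite sqr_sqrtr// ltW.
have es0 : 0 < e / s by exact: divr_gt0.
have := super_iter vu cu uC n.+1 b y t00 es0 K0 T _.
have eN : n.+1%:R * (e / s) ^+ 2 = e ^+ 2 by rewrite -/N -sN; field; qlra.
rewrite eN -/N.
have fu z : f z <= u t0 z by have := near z; rewrite ler_norml /f; qlra.
move=> /(_ fu) H.
have lo : iter n.+1 (avg (sg b * (e / s))) (u t0) y - 4 * L * d <=
    iter n.+1 (avg (sg b * (e / s))) f y.
  rewrite -iter_avg_addc; apply: iter_avg_le => z.
  by have := near z; rewrite ler_norml /f; qlra.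
have err : N * (stepc * K * (e / s) ^+ 3) <= eps / 2.
  have -> : N * (stepc * K * (e / s) ^+ 3) = A / s.
    by rewrite -sN /A; field; qlra.
  rewrite ler_pdivrMr//.
  have : 2 * A / eps <= s.
    apply: ltW; rewrite -(ltr_pXn2r (_ : 0 < 2)%N) ?nnegrE ?(ltW s0) ?sN//.
    by rewrite divr_ge0 ?(ltW eps0)// mulr_ge0.
  by rewrite ler_pdivrMr//; qnra.
by move: H lo err; rewrite -/s; qlra.
Qed.

(** Averages are monotone and commute with the walk, so [super_walk] passes to the twice averaged
    function. That function has a cubic Taylor remainder, and the walk has total variance
    [sg b ^+ 2 * e ^+ 2] whatever the number of steps; hence [eps] can be sent to 0 and only a loss
    of order $e^3$ remains. *)
Lemma mollified_step u L C d t0 e b y :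
  vsub dualG (fun t y => - u t y) -> cont2 u -> (forall t y, `|u t y| <= C) ->
  (forall t x y, `|u t x - u t y| <= L * `|x - y|) ->
  0 <= t0 -> 0 < e -> 0 < d ->
  av d (av d (u t0)) y + sg b ^+ 2 / 2 * dq d (dq d (u t0)) y * e ^+ 2
    - stepc * (4 * L / d ^+ 2 + 1) * e ^+ 3 <= av d (av d (u (t0 + e ^+ 2))) y.
Proof.
move=> vu cu uC Lu t00 e0 d0; apply/ler_addgt0Pr => eps eps0.
have L0 : 0 <= L by have := le_trans (normr_ge0 _) (Lu 0 1 0); rewrite subr0 normr1 mulr1.
have [n Hn] := super_walk b vu cu uC Lu t00 e0 eps0.
set r := sg b * _ in Hn.
have c0 : continuous (u t0) by exact: cont2_slice2.
have c1 : continuous (u (t0 + e ^+ 2)) by exact: cont2_slice2.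
have cav f : continuous f -> continuous (av d f).
  by move=> cf; exact: primitive_continuous (av_primitive d cf).
have cc f : continuous f -> continuous (fun z => f z + eps * (cst 1 z)).
  by move=> cf z; apply: cvgD; [exact: cf|apply: cvgMr; exact: cvg_cst].
have c1c : continuous (cst (1 : R) : R -> R) by move=> ?; exact: cvg_cst.
have av1 z : av d (cst (1 : R)) z = 1.
  rewrite (av_eq d0 (primitive_cst 1) c1c) /dq -mulrBr addrAC subrr add0r mul1r.
  by rewrite divff// gt_eqF.
have step f g : continuous f -> continuous g -> (forall z, f z <= g z + eps * 1) ->
    forall z, av d f z <= av d g z + eps * 1.
  move=> cf cg fg z; rewrite -[X in _ + eps * X](av1 z) -avD//.
  by apply: av_le => //; exact: cc.
have H1 z : iter n.+1 (avg r) (u t0) z <= u (t0 + e ^+ 2) z + eps * 1.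
  by have := Hn z; qlra.
have H2 := step _ _ (iter_avg_continuous c0) c1 H1.
have H3 := step _ _ (cav _ (iter_avg_continuous c0)) (cav _ c1) H2 y.
have E : av d (av d (iter n.+1 (avg r) (u t0))) y = iter n.+1 (avg r) (av d (av d (u t0))) y.
  rewrite -av_iter_avg//; last exact: cav.
  by congr (av d _ y); apply/funext => z; rewrite av_iter_avg.
rewrite E mulr1 in H3.
pose K := 4 * L / d ^+ 2 + 1.
have K0 : 0 < K by rewrite /K ltr_wpDl// divr_ge0 ?sqr_ge0// mulr_ge0.
have T : taylor2 K _ _ _ := mollify_taylor d0 (Lu t0).
set g := av d (av d (u t0)) in T H3 *; set g2 := dq d (dq d (u t0)) in T *.
have M0 : 0 <= K * (2 * e)^-1 by rewrite mulr_ge0 ?(ltW K0)// invr_ge0; qlra.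
have := @iter_avg_poly _ n.+1 r g y (g y) (dq d (av d (u t0)) y) (g2 y - K * e) _ M0 _ y.
have lo z : g y + dq d (av d (u t0)) y * (z - y) + (g2 y - K * e) / 2 * (z - y) ^+ 2 -
    K * (2 * e)^-1 * (z - y) ^+ 4 <= g z.
  have := T y z; rewrite ler_norml => /andP[h1 _].
  have := ler_wpM2l (ltW K0) (cube_le (z - y) e0); move: h1; qlra.
move=> /(_ lo); rewrite subrr !expr0n /= !mulr0 !addr0 !add0r.
have N0 : 0 < n.+1%:R :> R by rewrite ltr0n.
have r2 : n.+1%:R * r ^+ 2 = sg b ^+ 2 * e ^+ 2.
  by rewrite /r !exprMn exprVn sqr_sqrtr ?(ltW N0)//; field; rewrite gt_eqF.
have -> : 3 * n.+1%:R ^+ 2 * r ^+ 4 = 3 * (sg b ^+ 2 * e ^+ 2) ^+ 2 by rewrite -r2; ring.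
rewrite r2; set s2 := sg b ^+ 2.
have -> : K * (2 * e)^-1 * (3 * (s2 * e ^+ 2) ^+ 2) = 3 / 2 * s2 ^+ 2 * (K * e ^+ 3).
  by field; qlra.
have sk : s2 <= k by exact: sg2_le.
have s20 : 0 <= s2 by exact: sqr_ge0.
have s4 : s2 ^+ 2 <= k ^+ 2 by rewrite lerXn2r ?nnegrE// k_ge0.
have Ke : 0 <= K * e ^+ 3 by rewrite mulr_ge0 ?exprn_ge0 ?ltW.
have := ler_wpM2r Ke sk; have := ler_wpM2r Ke s4.
have : 0 <= su ^+ 3 * (K * e ^+ 3) by rewrite mulr_ge0// exprn_ge0// su_ge0.
by move: H3; rewrite iterS /stepc -/K; qlra.
Qed.

(** From $L|x| \le L\kappa/2 + Lx^2/(2\kappa)$ and a barrier. The point is that the modulus at time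
    0 does not depend on [y]: mere continuity of [u] would not control the initial values of its
    averages uniformly. *)
Lemma super_initial u L C kap t y :
  vsub dualG (fun t y => - u t y) -> cont2 u -> (forall t y, `|u t y| <= C) ->
  (forall x y, `|u 0 x - u 0 y| <= L * `|x - y|) -> 0 < kap -> 0 <= t ->
  u 0 y - (L * kap / 2 + k * L / (2 * kap) * t + 3 * k ^+ 2 * t ^+ 2) <= u t y.
Proof.
move=> vu cu uC Lu kap0 t0.
have L0 : 0 <= L by have := le_trans (normr_ge0 _) (Lu 1 0); rewrite subr0 normr1 mulr1.
have Lk : 0 <= L / kap by rewrite divr_ge0// ltW.
have NuC s z : 0 <= s -> - u s z <= C.
  by move=> _; apply: le_trans (ler_norm _) _; rewrite normrN.
have := @vsub_barrier _ dualG _ k C (k / 2 * (L / kap)) (- u 0 y + L * kap / 2) 0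
  (L / kap) 1 0 y t k_ge0 (dualG_addr Hsl Hsu) vu (cont2N cu) NuC
  (dualG_le Hsl Hsu true _) _ ltr01 (lexx _) t0.
rewrite normrM ger0_norm ?divr_ge0 ?k_ge0// => /(_ (lexx _)) H.
have : - u (0 + t) y <= - u 0 y + L * kap / 2 + k / 2 * (L / kap) * t + 3 * 1 * k ^+ 2 * t ^+ 2.
  apply: H => z; rewrite mul0r addr0 mul1r.
  have z4 : 0 <= (z - y) ^+ 4 by rewrite (_ : 4 = 2 * 2)%N// exprM sqr_ge0.
  have := Lu y z; rewrite distrC ler_norml => /andP[h1 _].
  suff : L * `|z - y| <= L * kap / 2 + L / kap / 2 * (z - y) ^+ 2.
    by rewrite distrC in h1; move: h1; qlra.
  rewrite -(real_normK (num_real (z - y))); set x := `|_|.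
  have -> : L * kap / 2 + L / kap / 2 * x ^+ 2 = L * x + L / kap / 2 * (kap - x) ^+ 2.
    by field; qlra.
  by rewrite lerDl mulr_ge0 ?sqr_ge0// divr_ge0.
rewrite add0r (_ : k / 2 * (L / kap) = k * L / (2 * kap)); last by field; qlra.
by qlra.
Qed.

Lemma av_time_primitive d (v v1 : R -> R -> R) L : 0 < d -> cont2 v -> cont2 v1 ->
  (forall t, primitive (v t) (v1 t)) ->
  (forall t x y, `|v1 t x - v1 t y| <= L * `|x - y|) -> forall t,
  primitive (fun y => av d (v^~ y) t) (fun y => av d (v1^~ y) t).
Proof.
move=> d0 cv cv1 p Lv t y; apply: (@is_derive_quad _ _ _ _ L) => h.
have c z : continuous (v^~ z) by exact: cont2_slice.
have c1 z : continuous (v1^~ z) by exact: cont2_slice.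
have cD f g a : continuous f -> continuous g -> continuous (fun r => f r + a * g r).
  by move=> cf cg z; apply: cvgD; [exact: cf|apply: cvgMr; exact: cg].
have -> : av d (v^~ (y + h)) t - av d (v^~ y) t - av d (v1^~ y) t * h =
    av d (fun r => v r (y + h) + -1 * v r y + - h * v1 r y) t.
  by rewrite avD ?avD//; [ring|exact: cD].
rewrite -[X in `|X|]subr0; apply: av_near => //; first by apply: (cD); [exact: cD|exact: c1].
move=> x _; rewrite subr0; have := primitive_quad (p (t + x)) (Lv (t + x)) y (y + h).
have e1 : y + h - y = h :> R by ring.
rewrite !e1 real_normK ?num_real//; congr (_ <= _); congr `|_|; ring.
Qed.

End SupersolutionApproximation.

(** * Comparison by smooth supersolutions *)

Section Comparison.
Context {R : realType} (sl su : R).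
Hypotheses (Hsl : 0 <= sl) (Hsu : sl <= su).
Implicit Types (f g h : R -> R) (u w : R -> R -> R) (t y a c e r d K L C : R) (b : bool).
Local Notation G := (G sl su).
Local Notation dualG := (dualG sl su).
Local Notation sg := (sg sl su).
Local Notation k := (su ^+ 2).

(** The approximation is averaged twice in space and once in time. Since [G] is a maximum of two
    linear functions, the differential inequality is checked for one volatility at a time, where it
    is linear and survives averaging. The upper bound is wanted at the single point [(t1, y1)], so
    continuity there suffices. *)
Lemma super_approx u L C (eps t1 y1 : R) :
  vsub dualG (fun t y => - u t y) -> cont2 u -> (forall t y, `|u t y| <= C) ->
  (forall t x y, `|u t x - u t y| <= L * `|x - y|) -> 0 < eps ->
  exists psi pt py pyy, [/\ smooth12 psi pt py pyy, cont2 psi,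
    (forall t y, - C <= psi t y) /\ (forall t y, 0 < t -> G (pyy t y) <= pt t y),
    (forall y, u 0 y - eps <= psi 0 y) & psi t1 y1 <= u t1 y1 + eps].
Proof.
move=> vu cu uC Lu eps0.
have L0 : 0 <= L by have := le_trans (normr_ge0 _) (Lu 0 1 0); rewrite subr0 normr1 mulr1.
have k0 : 0 <= k by exact: sqr_ge0.
have [d d0 [near1 near0]] : exists2 d, 0 < d &
    (forall r z, 0 <= r <= d -> 0 <= z <= 2 * d -> `|u (t1 + r) (y1 + z) - u t1 y1| <= eps) /\
    (forall r z y, 0 <= r <= d -> 0 <= z <= 2 * d -> u 0 y - eps <= u r (y + z)).
  pose kap := eps / (4 * (L + 1)).
  have kap0 : 0 < kap by rewrite /kap divr_gt0//; qlra.
  (* [A] collects the coefficients of [d] in [super_initial] and in the Lipschitz bound over a space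
     window of length [2 * d]. *)
  pose A := k * L / (2 * kap) + 3 * k ^+ 2 + 2 * L + 1.
  have A0 : 0 < A.
    rewrite /A; have := sqr_ge0 k; have : 0 <= k * L / (2 * kap); last qlra.
    exact: (divr_ge0 (mulr_ge0 k0 L0) (mulr_ge0 (ler0n R 2) (ltW kap0))).
  have := cu (t1, y1); rewrite /continuous_at => /cvgrPdist_le/(_ eps eps0).
  case=> -[U V] /= [[d1 /= d10 H1] [d2 /= d20 H2]] UV.
  pose d := Num.min (Num.min (d1 / 2) (d2 / 4)) (Num.min 1 (eps / (2 * A))).
  have d0 : 0 < d by rewrite !lt_min ltr01 !divr_gt0//; qlra.
  have dd1 : d <= d1 / 2 by rewrite /d !ge_min lexx.
  have dd2 : d <= d2 / 4 by rewrite /d !ge_min lexx !orbT.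
  have dd3 : d <= 1 by rewrite /d !ge_min lexx !orbT.
  have dd4 : A * d <= eps / 2.
    have : d <= eps / (2 * A) by rewrite /d !ge_min lexx !orbT.
    by rewrite ler_pdivlMr; qlra.
  exists d => //; split=> [r z r0d z0d|r z y r0d z0d].
    rewrite distrC; apply: (UV (t1 + r, y1 + z)); split; rewrite /=.
    - by apply: H1; rewrite /= opprD addNKr normrN ger0_norm; qlra.
    - by apply: H2; rewrite /= opprD addNKr normrN ger0_norm; qlra.
  have r0 : 0 <= r by qlra.
  have h1 := super_initial Hsl Hsu y vu cu uC (Lu 0) kap0 r0.
  have h2 : `|u r (y + z) - u r y| <= L * (2 * d).
    apply: le_trans (Lu _ _ _) _; rewrite addrAC subrr add0r ler_wpM2l// ger0_norm; qlra.
  have e1 : L * kap / 2 <= eps / 8.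
    have : (L + 1) * kap = eps / 4 by rewrite /kap; field; qlra.
    by qnra.
  have e2 : k * L / (2 * kap) * r <= k * L / (2 * kap) * d.
    rewrite ler_wpM2l//; last qlra.
    exact: (divr_ge0 (mulr_ge0 k0 L0) (mulr_ge0 (ler0n R 2) (ltW kap0))).
  have e3 : 3 * k ^+ 2 * r ^+ 2 <= 3 * k ^+ 2 * d.
    apply: ler_wpM2l; first exact: (mulr_ge0 (ler0n R 3) (sqr_ge0 k)).
    by rewrite expr2; have := ler_wpM2l r0 (_ : r <= 1); qlra.
  move: h1 h2 dd4; rewrite ler_norml /A; qlra.
pose g1 t := dq d (av d (u t)); pose g2 t := dq d (dq d (u t)).
pose g t := av d (av d (u t)).
have cav : cont2 (fun t => av d (u t)) by exact: (cont2_av d0 cu uC).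
have avC : forall t y, `|av d (u t) y| <= C by exact: av_bounded.
have cut t : continuous (u t) by exact: (@cont2_slice2 _ u t cu).
have cavt t : continuous (av d (u t)) by exact: (@cont2_slice2 _ (fun t => av d (u t)) t cav).
have cg : cont2 g by exact: (cont2_av d0 cav avC).
have gC t y : `|g t y| <= C by exact: (av_bounded d0 cav avC).
have cg1 : cont2 g1 by exact: (cont2_dq d0 cav).
have cg2 : cont2 g2 by exact: (cont2_dq d0 (cont2_dq d0 cu)).
have dqC f C' : (forall y, `|f y| <= C') -> forall y, `|dq d f y| <= 2 * C' / d.
  move=> fC y; rewrite /dq normrM normfV (gtr0_norm d0) ler_pM2r ?invr_gt0//.
  by apply: le_trans (ler_normB _ _) _; have := fC (y + d); have := fC y; qlra.
have g1C t y : `|g1 t y| <= 2 * C / d by exact: dqC.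
have g2C t y : `|g2 t y| <= 2 * (2 * C / d) / d by apply: (dqC) => ?; exact: dqC.
have pg t : primitive (g t) (g1 t).
  by apply: av_primitive; exact: cavt.
have pg1 t : primitive (g1 t) (g2 t).
  by apply: primitive_dq; apply: av_primitive; exact: cut.
have Lg1 t x y := primitive_lip (pg1 t) (g2C t) x y.
have Lg2 t x y := dq_lipschitz x y d0 (fun x y => dq_lipschitz x y d0 (Lu t)).
have ctime (v : R -> R -> R) C' : cont2 v -> (forall t y, `|v t y| <= C') ->
    cont2 (fun t y => av d (v^~ y) t).
  move=> cv vC; apply: (@cont2_swap _ (fun y t => av d (v^~ y) t)).
  by apply: (@cont2_av _ d (fun y t => v t y) C' d0) => //; exact: cont2_swap.
exists (fun t y => av d (g^~ y) t), (fun t y => dq d (g^~ y) t),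
  (fun t y => av d (g1^~ y) t), (fun t y => av d (g2^~ y) t).
have cs (v : R -> R -> R) y : cont2 v -> continuous (v^~ y) by exact: cont2_slice.
have cdq : cont2 (fun t y => dq d (g^~ y) t).
  apply: (@cont2_swap _ (fun y t => dq d (g^~ y) t)).
  by apply: (cont2_dq d0 (cont2_swap cg)).
split.
- move=> t y t0; split.
  + exact: (av_primitive d (cs _ y cg)).
  + exact: (av_time_primitive d0 cg cg1 pg Lg1).
  + exact: (av_time_primitive d0 cg1 cg2 pg1 Lg2).
  + exact: And4 (ctime _ _ cg gC _) (cdq _) (ctime _ _ cg1 g1C _) (ctime _ _ cg2 g2C _).
- exact: ctime gC.
- split=> t y.
    have := @av_bounds _ d (g^~ y) t (- C) C d0 (cs _ y cg) _ => /(_ _)/andP[]//.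
    by move=> x _; rewrite -ler_norml.
  move=> t0; have [b ->] := G_eq sl su (av d (g2^~ y) t).
  apply: (@derive_ge _ (fun t => av d (g^~ y) t) t _ _ (stepc su * (4 * L / d ^+ 2 + 1))).
    exact: (av_primitive d (cs _ y cg)).
  move=> e e0.
  have c1c : continuous (cst (1 : R) : R -> R) by move=> ?; exact: cvg_cst.
  have av1 z : av d (cst (1 : R)) z = 1.
    rewrite (av_eq d0 (primitive_cst 1) c1c) /dq -mulrBr addrAC subrr add0r mul1r.
    by rewrite divff// gt_eqF.
  set c3 := stepc su * _ * _.
  have cD f h a : continuous f -> continuous h -> continuous (fun r => f r + a * h r).
    by move=> cf ch z; apply: cvgD; [exact: cf|apply: cvgMr; exact: ch].
  have : av d (fun r => g r y + sg b ^+ 2 / 2 * e ^+ 2 * g2 r y + - c3 * cst 1 r) t <=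
      av d (g^~ y) (t + e ^+ 2).
    apply: av_le => //.
    - by apply: (cD) => //; apply: (cD); exact: cs.
    - exact: cs.
    - move=> x x0d; have := @mollified_step _ sl su Hsl Hsu u L C d (t + x) e b y vu cu uC Lu _ e0 d0.
      rewrite (_ : t + x + e ^+ 2 = t + e ^+ 2 + x); last ring.
      rewrite addr_ge0 ?(ltW t0)//=; last qlra.
      by move=> /(_ erefl); rewrite -/(g _ _) -/(g2 _ _) -/(g _ _) -/c3 /=; qlra.
  rewrite (avD _ _ d0); [|by apply: (cD); exact: cs|by []].
  by rewrite (avD _ _ d0) ?av1; [qlra|exact: cs|exact: cs].
- move=> y; have := @av_bounds _ d (g^~ y) 0 (u 0 y - eps) C d0 (cs _ y cg) _.
  move=> /(_ _)/andP[]// x x0d; apply/andP; split; last by apply: le_trans (ler_norm _) (gC _ _).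
  have := @av_bounds _ d (av d (u (0 + x))) y (u 0 y - eps) C d0 (cavt _) _.
  move=> /(_ _)/andP[]// z z0d; apply/andP; split; last by apply: le_trans (ler_norm _) (avC _ _).
  have := @av_bounds _ d (u (0 + x)) (y + z) (u 0 y - eps) C d0 (cut _) _.
  move=> /(_ _)/andP[]// z' z'0d; apply/andP; split; last by apply: le_trans (ler_norm _) (uC _ _).
  by rewrite add0r -addrA; apply: near0; qlra.
- have := @av_near _ d (g^~ y1) t1 (u t1 y1) eps d0 (cs _ y1 cg) _.
  have H x : 0 <= x <= d -> `|g (t1 + x) y1 - u t1 y1| <= eps.
    move=> x0d; apply: (av_near d0 (cavt _)) => z z0d.
    apply: (av_near d0 (cut _)).
    by move=> z' z'0d; rewrite -addrA; apply: near1; qlra.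
  by move=> /(_ H); rewrite ler_norml; qlra.
Qed.

Definition bounded_sol (u : R -> R -> R) C := cont2 u /\ forall t y, `|u t y| <= C.

(* The inf-convolution in space of a supersolution is a Lipschitz
   supersolution with the same initial value when the latter is Lipschitz. *)
Lemma inf_convolution u C L : vsub dualG (fun t y => - u t y) -> bounded_sol u C ->
  0 < L -> (forall x y, `|u 0 x - u 0 y| <= L * `|x - y|) ->
  exists v, [/\ vsub dualG (fun t y => - v t y), bounded_sol v C,
    forall t x y, `|v t x - v t y| <= L * `|x - y|,
    forall t y, v t y <= u t y & forall y, v 0 y = u 0 y].
Proof.
move=> vu [cu uC] L0 Lu.
have C0 : 0 <= C by exact: le_trans (normr_ge0 _) (uC 0 0).
(* Beyond distance [r] the cone alone costs more than [2 * C], which bounds the oscillation of [u],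
   so minimizers exist and stay in a bounded window. *)
pose r := 2 * C / L + 1.
have r0 : 0 < r by rewrite /r ltr_wpDl// divr_ge0 ?mulr_ge0// ltW.
have Lr : 2 * C < L * r by rewrite /r mulrDr mulrCA divff ?gt_eqF// !mulr1 ltrDl.
have ex t y : exists z, (y - r <= z <= y + r) /\ forall x, u t z + L * `|y - z| <= u t x + L * `|y - x|.
  have c : continuous (fun z => u t z + L * `|y - z|).
    move=> z; apply: cvgD; first exact: cont2_slice2.
    apply: cvgMr; apply: cvg_norm; apply: cvgB; [exact: cvg_cst|exact: cvg_id].
  have [|z zin mz] := @EVT_min _ _ (y - r) (y + r) _ (continuous_subspaceT c); first qlra.
  exists z; split; first by move: zin; rewrite in_itv.
  move=> x; have [xin|xout] := boolP (x \in `[y - r, y + r]%R); first exact: mz.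
  have : u t z + L * `|y - z| <= u t y + L * `|y - y| by apply: mz; rewrite in_itv/=; qlra.
  move=> /le_trans; apply; rewrite subrr normr0 mulr0 addr0.
  have : r < `|y - x|.
    by move: xout; rewrite in_itv/= -ler_distl -ltNge distrC.
  rewrite -(ltr_pM2l L0) => h3.
  have := uC t y; have := uC t x; rewrite !ler_norml; qlra.
pose Z t y := xget 0 [set z | (y - r <= z <= y + r) /\ forall x, u t z + L * `|y - z| <= u t x + L * `|y - x|].
have ZP t y : (y - r <= Z t y <= y + r) /\ forall x, u t (Z t y) + L * `|y - Z t y| <= u t x + L * `|y - x|.
  by rewrite /Z; case: xgetP => [z _ //|]; have [z zP] := ex t y => /(_ z).
pose v t y := u t (Z t y) + L * `|y - Z t y|.
have vle t y x : v t y <= u t x + L * `|y - x| by have [] := ZP t y.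
have vu' t y : v t y <= u t y by have := vle t y y; rewrite subrr normr0 mulr0 addr0.
have Lv t x y : `|v t x - v t y| <= L * `|x - y|.
  have H a c : v t a - v t c <= L * `|a - c|.
    have h1 := vle t a (Z t c); rewrite {2}/v.
    have := ler_wpM2l (ltW L0) (ler_distD c a (Z t c)); qlra.
  rewrite ler_norml; have := H x y; have := H y x; rewrite (distrC y x); qlra.
have vC t y : `|v t y| <= C.
  rewrite ler_norml; apply/andP; split.
  - rewrite /v; have := uC t (Z t y); rewrite ler_norml => /andP[h _].
    by have := mulr_ge0 (ltW L0) (normr_ge0 (y - Z t y)); qlra.
  - by apply: le_trans (vu' t y) _; have := uC t y; rewrite ler_norml => /andP[].
exists v; split=> //.
- move=> psi t0 y0 S t00 e m.
  (* If [psi] touches [- v] at [y0], then up to a constant its translate by [z0 - y0] touches [- u]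
     at the minimizer [z0], with the same derivatives. *)
  pose z0 := Z t0 y0.
  have S1 : smooth12 (fun t y => psi t (y - (z0 - y0))) (fun t y => derive1 (psi^~ (y - (z0 - y0))) t)
      (fun t y => derive1 (psi t) (y - (z0 - y0))) (fun t y => derive1 (derive1 (psi t)) (y - (z0 - y0))).
    move=> t y t_gt0; have [D1 D2 D3 [c1 c2 c3 c4]] := C12_smooth12 S (y - (z0 - y0)) t_gt0.
    have sh (f : R -> R) df : is_derive (y - (z0 - y0)) (1 : R) f df -> is_derive y (1 : R) (fun x => f (x - (z0 - y0))) df.
      move=> D; have D' : is_derive y (1 : R) (fun x => x - (z0 - y0)) 1 by apply: is_derive_eq; rewrite ?addr0 ?subr0.
      by have := @is_derive1_comp _ f (fun x => x - (z0 - y0)) y _ _ D D'; rewrite mulr1.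
    have c (f : R -> R -> R) : {for (t, y - (z0 - y0)), continuous (fun z : R * R => f z.1 z.2)} ->
        {for (t, y), continuous (fun z : R * R => f z.1 (z.2 - (z0 - y0)))}.
      move=> cf; apply: (@cvg_comp _ _ _ (fun z : R * R => (z.1, z.2 - (z0 - y0))) _ _ _ _ _ cf).
      have h1 : (fun z : R * R => z.1) @ nbhs (t, y) --> t by exact: cvg_fst.
      have h2 : (fun z : R * R => z.2 - (z0 - y0)) @ nbhs (t, y) --> y - (z0 - y0).
        by apply: cvgB; [exact: cvg_snd|exact: cvg_cst].
      exact: (cvg_pair h1 h2).
    split; [exact: D1|exact: sh D2|exact: sh D3|].
    exact: And4 (c _ c1) (c (fun t y => derive1 (psi^~ y) t) c2) (c (fun t y => derive1 (psi t) y) c3)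
      (c (fun t y => derive1 (derive1 (psi t)) y) c4).
  have := @vsub_smooth _ _ _ _ _ _ _ t0 z0 vu S1 t00.
  rewrite (_ : z0 - (z0 - y0) = y0); last ring.
  apply=> s z s0; rewrite -e.
  have := m s (z - (z0 - y0)) s0; have := vle s (z - (z0 - y0)) z.
  rewrite /v -/z0 (_ : z - (z0 - y0) - z = y0 - z0); last ring.
  qlra.
- split=> //; apply: (cont2_lip_slice Lv) => y t; apply/cvgrPdist_le => e e0.
  apply: filterS (cont2_tube t y r cu e0) => s Hs.
  have [zt _] := ZP t y; have [zs _] := ZP s y.
  have := vle s y (Z t y); have := vle t y (Z s y); rewrite -/(v _ _) => h1 h2.
  have := Hs _ zt; have := Hs _ zs; rewrite !ler_norml {2 4}/v => h3 h4.
  by move: h1 h2; rewrite {1 3}/v; move: h3 h4; rewrite /v; qlra.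
- move=> y; apply/eqP; rewrite eq_le vu' /=.
  have := Lu y (Z 0 y); rewrite /v ler_norml; qlra.
Qed.

(** Two supersolutions are combined because [G] is sublinear: a nonnegative combination of smooth
    supersolutions is again one ([G_lincomb]). One statement thus yields monotonicity, uniqueness,
    subadditivity and positive homogeneity of the G-expectation. *)
Lemma comparison w u1 u2 (a1 a2 C L : R) : 0 <= a1 -> 0 <= a2 ->
  vsub G w -> bounded_sol w C ->
  vsub dualG (fun t y => - u1 t y) -> bounded_sol u1 C ->
  vsub dualG (fun t y => - u2 t y) -> bounded_sol u2 C ->
  (forall x y, `|u1 0 x - u1 0 y| <= L * `|x - y|) ->
  (forall x y, `|u2 0 x - u2 0 y| <= L * `|x - y|) ->
  (forall y, w 0 y <= a1 * u1 0 y + a2 * u2 0 y) ->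
  forall t y, 0 <= t -> w t y <= a1 * u1 t y + a2 * u2 t y.
Proof.
move=> a10 a20 vw [cw wC] vu1 bu1 vu2 bu2 Lu1 Lu2 w0 t y t0.
have L0 : 0 <= L by have := le_trans (normr_ge0 _) (Lu1 1 0); rewrite subr0 normr1 mulr1.
have L1 : 0 < L + 1 by qlra.
have Lw f : (forall x y, `|f x - f y| <= L * `|x - y|) -> forall x y, `|f x - f y| <= (L + 1) * `|x - y|.
  by move=> H x z; apply: le_trans (H x z) _; rewrite ler_wpM2r// lerDl.
have [v1 [vv1 [cv1 v1C] Lv1 vu1' v10]] := inf_convolution vu1 bu1 L1 (Lw _ Lu1).
have [v2 [vv2 [cv2 v2C] Lv2 vu2' v20]] := inf_convolution vu2 bu2 L1 (Lw _ Lu2).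
suff : w t y <= a1 * v1 t y + a2 * v2 t y.
  by move=> /le_trans; apply; rewrite lerD// ler_wpM2l.
apply/ler_addgt0Pr => eps eps0.
pose e := eps / (2 * (a1 + a2 + 1)).
have e0 : 0 < e by rewrite /e divr_gt0//; qlra.
have ee : 2 * ((a1 + a2) * e) <= eps.
  have : 2 * ((a1 + a2 + 1) * e) = eps by rewrite /e; field; qlra.
  by qlra.
have [p1 [pt1 [py1 [pyy1 [S1 c1 [b1 s1] i1 n1]]]]] := super_approx t y vv1 cv1 v1C Lv1 e0.
have [p2 [pt2 [py2 [pyy2 [S2 c2 [b2 s2] i2 n2]]]]] := super_approx t y vv2 cv2 v2C Lv2 e0.
have S := smooth12D (smooth12_cst ((a1 + a2) * e)) (smooth12D (smooth12Z a1 S1) (smooth12Z a2 S2)).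
have c : cont2 (fun t y => (a1 + a2) * e + (a1 * p1 t y + a2 * p2 t y)).
  by apply: cont2D; [exact: cont2_cst|apply: cont2D; exact: cont2Z].
have k2 : 0 <= k / 2 by rewrite divr_ge0 ?sqr_ge0.
have wC' s z : 0 <= s -> w s z <= C by move=> _; exact: le_trans (ler_norm _) (wC s z).
have := vsub_le_smooth (C' := (a1 + a2) * e - (a1 + a2) * C) k2 (G_addr Hsl Hsu) vw cw wC' S c _ _ _ y t0.
rewrite /= => H; have {}H : w t y <= (a1 + a2) * e + (a1 * p1 t y + a2 * p2 t y).
  apply: H.
  - move=> s z s0; have := ler_wpM2l a10 (b1 s z); have := ler_wpM2l a20 (b2 s z); qlra.
  - move=> s z s0; rewrite !add0r; apply: le_trans (G_lincomb _ _ _ _ _ _) _ => //.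
    by rewrite lerD// ler_wpM2l// ?s1 ?s2.
  - move=> z; apply: le_trans (w0 z) _; rewrite -v10 -v20.
    by have := ler_wpM2l a10 (i1 z); have := ler_wpM2l a20 (i2 z); qlra.
by have := ler_wpM2l a10 n1; have := ler_wpM2l a20 n2; qlra.
Qed.

End Comparison.

(** * Existence for the G-heat equation *)

Section Existence.
Context {R : realType}.
Implicit Types (f g h : R -> R) (u w : R -> R -> R) (t y a c e r d K L C : R).

Lemma taylor_upper f f1 f2 q y d : primitive f f1 -> primitive f1 f2 ->
  (forall x, `|x - y| < d -> f2 x <= q) ->
  forall z, `|z - y| < d -> f z <= f y + f1 y * (z - y) + q / 2 * (z - y) ^+ 2.
Proof.
move=> p1 p2 H z zd.
have pq : primitive (fun x => f1 y * x + q / 2 * (x - y) ^+ 2) (fun x => f1 y + q * (x - y)).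
  move=> x; have := is_deriveD (primitive_cst (f1 y) x) (is_deriveZ (q / 2) (is_derive_shiftX 2 y x)).
  by congr is_derive; rewrite /GRing.scale /= expr1; field.
have [yz|/ltW zy] := leP y z.
- have H1 x : y <= x <= z -> f1 x <= f1 y + q * (x - y).
    move=> /andP[yx xz]; have := primitive_le p2 (primitive_cst q) yx.
    have H' x' : y <= x' <= x -> f2 x' <= q.
      by move=> ?; apply: H; move: zd; rewrite !ger0_norm; qlra.
    by move=> /(_ H'); qlra.
  have := primitive_le p1 pq yz H1; rewrite subrr expr0n mulr0 /=; qlra.
- have H1 x : z <= x <= y -> f1 y + q * (x - y) <= f1 x.
    move=> /andP[zx xy]; have := primitive_le p2 (primitive_cst q) xy.
    have H' x' : x <= x' <= y -> f2 x' <= q.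
      by move=> ?; apply: H; move: zd; rewrite !ler0_norm; qlra.
    by move=> /(_ H'); qlra.
  have := primitive_le pq p1 zy H1; rewrite subrr expr0n mulr0 /=; qlra.
Qed.

(** An expansion at past times is enough, because the scheme compares its value at [t0] with its
    values at an earlier time. *)
Lemma smooth_past_upper psi pt py pyy t0 y0 e : smooth12 psi pt py pyy -> 0 < t0 -> 0 < e ->
  exists2 d, 0 < d < t0 & forall s z, t0 - d < s <= t0 -> `|z - y0| < d ->
    psi s z <= psi t0 y0 - (pt t0 y0 - e) * (t0 - s) + py t0 y0 * (z - y0)
      + (pyy t0 y0 + e) / 2 * (z - y0) ^+ 2.
Proof.
move=> S t00 e0; have [_ _ _ [_ ct _ cyy]] := S t0 y0 t00.
have nt : \forall z \near nbhs ((t0, y0) : R * R), `|pt t0 y0 - pt z.1 z.2| <= e.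
  by move/cvgrPdist_le : ct; exact.
have nyy : \forall z \near nbhs ((t0, y0) : R * R), `|pyy t0 y0 - pyy z.1 z.2| <= e.
  by move/cvgrPdist_le : cyy; exact.
case: (filterI nt nyy) => -[U V] /= [[d1 /= d10 H1] [d2 /= d20 H2]] UV.
pose d := Num.min (Num.min d1 d2) (t0 / 2).
have d0 : 0 < d by rewrite !lt_min d10 d20 divr_gt0.
have dd1 : d <= d1 by rewrite /d !ge_min lexx.
have dd2 : d <= d2 by rewrite /d !ge_min lexx !orbT.
have dd3 : d <= t0 / 2 by rewrite /d !ge_min lexx !orbT.
have near s z : `|t0 - s| < d -> `|y0 - z| < d ->
    `|pt t0 y0 - pt s z| <= e /\ `|pyy t0 y0 - pyy s z| <= e.
  move=> h1 h2; apply: (UV (s, z)); split; [apply: H1|apply: H2] => /=; qlra.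
exists d; first qlra.
move=> s z /andP[s1 s2] zd.
have h1 : psi s z <= psi t0 z - (pt t0 y0 - e) * (t0 - s).
  have D x : x \in `]s, t0[%R -> is_derive x (1 : R) (psi^~ z) (pt x z).
    rewrite in_itv/= => /andP[sx _].
    have x0 : 0 < x by qlra.
    by have [Dx _ _ _] := S x z x0; exact: Dx.
  have [|c] := @MVT_segment _ (psi^~ z) (pt^~ z) s t0 s2 D.
    apply: derivable_within_continuous => x; rewrite in_itv/= => /andP[sx _].
    have x0 : 0 < x by qlra.
    by have [Dx _ _ _] := S x z x0; exact: ex_derive.
  rewrite in_itv/= => /andP[sc ct0] E.
  have [] := near c z _ _; [rewrite ger0_norm; qlra|by rewrite distrC|].
  rewrite ler_norml => h _.
  have : (pt t0 y0 - e) * (t0 - s) <= pt c z * (t0 - s) by rewrite ler_wpM2r; qlra.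
  by rewrite -E; qlra.
have P1 : primitive (psi t0) (py t0) by move=> x; have [] := S t0 x t00.
have P2 : primitive (py t0) (pyy t0) by move=> x; have [] := S t0 x t00.
have := taylor_upper P1 P2 (q := pyy t0 y0 + e) (y := y0) (d := d) _ zd.
have H' x : `|x - y0| < d -> pyy t0 x <= pyy t0 y0 + e.
  move=> xd; have [] := near t0 x _ _; [by rewrite subrr normr0|by rewrite distrC|].
  by move=> _; rewrite ler_norml; qlra.
by move=> /(_ H'); qlra.
Qed.

(** The budget over a time [eta]: the strict inequality gains [m * eta], the quartic term costs half
    of it, and three errors [rho] (two from the limit, one from time rounding) cost an eighth
    each. *)
Lemma scheme_gap (M k F a m eta rho h tau P W : R) :
  0 <= M -> 0 < m -> 0 < eta -> eta <= 1 -> eta * (6 * M * k ^+ 2 + 1) <= m ->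
  rho = m * eta / 8 -> F + m <= a -> 0 <= h -> h <= eta -> h <= 1 ->
  h * (`|F| + 9 * M * k ^+ 2 + 1) <= rho -> `|tau - eta| <= h ->
  W <= rho + (P - a * eta) + F * tau + 3 * M * k ^+ 2 * tau ^+ 2 ->
  - rho <= W - P -> False.
Proof.
move=> M0 m0 eta0 eta1 eta2 -> gap h0 h1 h2 h3 tauh H Hn2.
have /andP[t1 t2] : eta - h <= tau <= eta + h by rewrite -ler_distl.
have F1 : F * tau <= F * eta + `|F| * h.
  have : F * (tau - eta) <= `|F| * h.
    by apply: le_trans (ler_norm _) _; rewrite normrM ler_wpM2l.
  by clear; rewrite mulrBr; qlra.
have tau2 : tau ^+ 2 <= eta ^+ 2 + 3 * h.
  have t0 : 0 <= tau by move: t1 h1; clear; qlra.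
  have : tau ^+ 2 <= (eta + h) ^+ 2 by rewrite [leLHS]expr2 expr2; apply: ler_pM.
  by move=> /le_trans; apply; move: h0 h2 eta1 eta0; clear; qnra.
have Mk2 : 0 <= 3 * M * k ^+ 2.
  by apply: mulr_ge0 (sqr_ge0 k); exact: mulr_ge0.
have T2 := ler_wpM2l Mk2 tau2.
have gap' : F * eta + m * eta <= a * eta by rewrite -mulrDl ler_wpM2r// ltW.
have eta3 : 3 * M * k ^+ 2 * eta ^+ 2 <= m * eta / 2.
  by move: (ler_wpM2r (ltW eta0) eta2) (sqr_ge0 eta); clear; qnra.
have := mulr_gt0 m0 eta0.
by move: H F1 T2 h0 h3 Hn2 gap' eta3; clear; qlra.
Qed.

(** Monotonicity and consistency of the scheme are condensed into the last hypothesis: a quartic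
    majorant of [wn n s] propagates to time [t], with the elapsed time rounded by at most [hn n]. *)
Lemma scheme_vsub (F : R -> R) (k C L : R) (U : set_system nat) (hn : nat -> R)
    (wn : nat -> R -> R -> R) w : 0 <= k -> ProperFilter U ->
  (forall a b : R, 0 <= b -> F (a + b) <= F a + k / 2 * b) ->
  (forall e, 0 < e -> \forall n \near U, 0 <= hn n <= e) ->
  (forall n t y, `|wn n t y| <= C) ->
  (forall n t x y, `|wn n t x - wn n t y| <= L * `|x - y|) ->
  (forall t x y, `|w t x - w t y| <= L * `|x - y|) ->
  (forall t y e, 0 < e -> \forall n \near U, `|wn n t y - w t y| <= e) ->
  (forall n s t y (c p q M : R), 0 <= M -> 0 <= s -> s <= t ->
     (forall z, wn n s z <= c + p * (z - y) + q / 2 * (z - y) ^+ 2 + M * (z - y) ^+ 4) ->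
     exists2 tau, `|tau - (t - s)| <= hn n &
       wn n t y <= c + F q * tau + 3 * M * k ^+ 2 * tau ^+ 2) ->
  vsub F w.
Proof.
move=> k0 PU Fk hn0 wC Lwn Lw cw step psi t0 y0 SC t00 e0 m.
have S := C12_smooth12 SC; move: S.
set pt := fun t y => derive1 (psi^~ y) t; set py := fun t y => derive1 (psi t) y.
set pyy := fun t y => derive1 (derive1 (psi t)) y => S.
rewrite -/(pt t0 y0) -/(pyy t0 y0) leNgt; apply/negP => lt.
set a : R := pt t0 y0 in lt; set q : R := pyy t0 y0 in lt.
pose mm : R := (a - F q) / 2; have mm0 : 0 < mm by rewrite /mm; qlra.
pose e : R := mm / (1 + k / 2).
have k1 : 0 < 1 + k / 2 by have := divr_ge0 k0 (ler0n R 2); qlra.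
have ep : 0 < e by exact: divr_gt0.
have ke : e * (1 + k / 2) = mm by rewrite /e divfK// gt_eqF.
have [d /andP[d0 dt0] past] := smooth_past_upper y0 S t00 ep.
have C0 : 0 <= C by exact: le_trans (normr_ge0 _) (wC 0%N 0 0).
set a' : R := a - e; set q' : R := q + e; set p : R := py t0 y0; set P : R := psi t0 y0.
have gap : F q' + mm <= a'.
  have := Fk q e (ltW ep); rewrite -/q' /a' => h.
  have m2 : mm * 2 = a - F q by rewrite /mm; field.
  by move: h ke m2; rewrite mulrDr; qlra.
(* [M] is so large that at distance at least [d] from [y0] the quartic term pays for the bound [C]
   and for all lower-order terms; the local majorant becomes a global one. *)
pose M := (C + `|P| + `|a'| * d) / d ^+ 4 + `|p| / d ^+ 3 + `|q'| / (2 * d ^+ 2) + 1.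
have M0 : 0 <= M.
  rewrite /M !addr_ge0// ?divr_ge0 ?exprn_ge0 ?mulr_ge0 ?addr_ge0 ?sqr_ge0 ?(ltW d0)//.
  by rewrite mulr_ge0// ltW.
have M1 : 1 <= M.
  rewrite /M lerDr !addr_ge0// ?divr_ge0 ?exprn_ge0 ?mulr_ge0 ?addr_ge0 ?sqr_ge0 ?(ltW d0)//.
  by rewrite mulr_ge0// ltW.
have far s z : t0 - d < s <= t0 -> d <= `|z - y0| ->
    C <= P - a' * (t0 - s) + p * (z - y0) + q' / 2 * (z - y0) ^+ 2 + M * (z - y0) ^+ 4.
  move=> /andP[s1 s2]; set x := z - y0 => dx.
  have x2 : x ^+ 2 = `|x| ^+ 2 by rewrite real_normK ?num_real.
  have x4 : x ^+ 4 = `|x| ^+ 4 by rewrite -normrX ger0_norm// (_ : 4 = 2 * 2)%N// exprM sqr_ge0.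
  have px : - (`|p| * `|x|) <= p * x by rewrite -normrM; have := ler_norm (- (p * x)); rewrite normrN; qlra.
  have qx : - (`|q'| / 2 * `|x| ^+ 2) <= q' / 2 * x ^+ 2.
    rewrite x2 -mulNr ler_wpM2r ?sqr_ge0//.
    by have := ler_norm (- q'); rewrite normrN; qlra.
  have ax : a' * (t0 - s) <= `|a'| * d.
    apply: le_trans (ler_norm _) _; rewrite normrM ler_wpM2l// ger0_norm; qlra.
  have Pl : - `|P| <= P by have := ler_norm (- P); rewrite normrN; qlra.
  move: px qx; rewrite x4; set X : R := `|x| in dx * => px qx.
  have X0 : 0 <= X by exact: normr_ge0.
  have dX i : (i <= 4)%N -> X ^+ (4 - i) <= X ^+ 4 / d ^+ i.
    move=> i4; rewrite ler_pdivlMr ?exprn_gt0//.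
    rewrite -[X in _ <= _ ^+ X](subnK i4) exprD ler_wpM2l ?exprn_ge0//.
    by rewrite lerXn2r ?nnegrE ?(ltW d0).
  have h4 : C + `|P| + `|a'| * d <= (C + `|P| + `|a'| * d) / d ^+ 4 * X ^+ 4.
    have := dX 4%N (leqnn _); rewrite subnn expr0 => h.
    rewrite -[X in X <= _]mulr1 mulrAC -mulrA ler_wpM2l//.
    by rewrite !addr_ge0 ?mulr_ge0// ltW.
  have h3 : `|p| * X <= `|p| / d ^+ 3 * X ^+ 4.
    have := dX 3%N isT; rewrite expr1 => h.
    by rewrite mulrAC -mulrA ler_wpM2l.
  have h2 : `|q'| / 2 * X ^+ 2 <= `|q'| / (2 * d ^+ 2) * X ^+ 4.
    have := dX 2%N isT => h.
    have -> : `|q'| / (2 * d ^+ 2) * X ^+ 4 = `|q'| / 2 * (X ^+ 4 / d ^+ 2).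
      by field; rewrite gt_eqF.
    by rewrite ler_wpM2l// divr_ge0.
  have X4 : 0 <= X ^+ 4 by rewrite exprn_ge0.
  rewrite /M !(mulrDl _ _ (X ^+ 4)) mul1r.
  move: h4 h3 h2 X4 ax px qx Pl; set A4 := _ / d ^+ 4 * _; set A3 := _ / d ^+ 3 * _.
  set A2 := _ / (2 * _) * _; move: A4 A3 A2 (a' * _) (p * x) (`|a'| * d) (`|p| * X) => *; qlra.
pose eta := Num.min (Num.min (d / 2) 1) (mm / (6 * M * k ^+ 2 + 1)).
have Mk : 0 < 6 * M * k ^+ 2 + 1.
  by have := mulr_ge0 M0 (sqr_ge0 k); qlra.
have eta0 : 0 < eta by rewrite !lt_min ltr01 /= divr_gt0// divr_gt0.
have eta1 : eta <= d / 2 by rewrite /eta !ge_min lexx.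
have eta4 : eta <= 1 by rewrite /eta !ge_min lexx !orbT.
have eta2 : eta * (6 * M * k ^+ 2 + 1) <= mm by rewrite -ler_pdivlMr// /eta ge_min lexx orbT.
clearbody eta.
pose s := t0 - eta.
have sd : t0 - d < s <= t0 by rewrite /s; qlra.
have wpsi z : `|z - y0| < d -> w s z <= P - a' * (t0 - s) + p * (z - y0) + q' / 2 * (z - y0) ^+ 2.
  by move=> zd; apply: le_trans (past s z sd zd); apply: m; rewrite /s; qlra.
pose rho := mm * eta / 8.
have rho0 : 0 < rho by rewrite divr_gt0// mulr_gt0.
have FU : Filter U by exact: filter_filter.
have unif := @equilipschitz_cvg_unif _ _ _ (fun n z => wn n s z) (w s) L (`|y0| + d) rho FU
  (fun n x y => Lwn n s x y) (Lw s) (fun x d => cw s x d) rho0.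
have B : 0 < `|F q'| + 9 * M * k ^+ 2 + 1.
  by have := normr_ge0 (F q'); have := mulr_ge0 M0 (sqr_ge0 k); qlra.
have e1 : 0 < Num.min (Num.min eta 1) (rho / (`|F q'| + 9 * M * k ^+ 2 + 1)).
  rewrite lt_min; apply/andP; split; last by rewrite divr_gt0.
  by rewrite lt_min eta0 ltr01.
have [n [Hn1 Hn2 Hn3]] : exists n, [/\ 0 <= hn n <= Num.min (Num.min eta 1) (rho / (`|F q'| + 9 * M * k ^+ 2 + 1)),
    `|wn n t0 y0 - w t0 y0| <= rho &
    forall z, - (`|y0| + d) <= z <= `|y0| + d -> `|wn n s z - w s z| <= rho].
  have [n [[h1 h2] h3]] := filter_ex (filterI (filterI (hn0 _ e1) (cw t0 y0 rho rho0)) unif).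
  by exists n.
have wnpoly z : wn n s z <= (rho + (P - a' * eta)) + p * (z - y0) + q' / 2 * (z - y0) ^+ 2 + M * (z - y0) ^+ 4.
  have [zd|zd] := ltP `|z - y0| d.
  - have := wpsi z zd; have := Hn3 z.
    have -> : - (`|y0| + d) <= z <= `|y0| + d.
      by move: (ler_normD (z - y0) y0) zd; clear; rewrite -ler_norml subrK; qlra.
    move=> /(_ isT); rewrite ler_norml => h1 h2.
    have : 0 <= M * (z - y0) ^+ 4 by rewrite mulr_ge0// (_ : 4 = 2 * 2)%N// exprM sqr_ge0.
    by move: h1 h2; clear; rewrite /s (_ : t0 - (t0 - eta) = eta); [qlra|ring].
  - move: (far s z sd zd) (wC n s z) rho0; clear; rewrite ler_norml.
    by rewrite /s (_ : t0 - (t0 - eta) = eta); [qlra|ring].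
have st : s <= t0 by move: (ltW eta0); clear; rewrite /s; qlra.
have s0 : 0 <= s by move: sd dt0; clear; move=> /andP[]; qlra.
have [tau] := step n s t0 y0 _ _ _ _ M0 s0 st wnpoly.
rewrite /s (_ : t0 - (t0 - eta) = eta); last ring.
move=> tauh H.
move: Hn1; rewrite !le_min => /andP[hn_ge0 /andP[/andP[hn1 hn2] hn3]].
move: hn3; rewrite ler_pdivlMr// => hn3.
move: Hn2; rewrite e0 -/P ler_norml => /andP[Hn2 _].
exact: (@scheme_gap M k (F q') a' mm eta rho (hn n) tau P (wn n t0 y0)).
Qed.

(** Along an ultrafilter every bounded sequence converges, so limits exist at all points [(t, y)] at
    once, without extraction of subsequences. *)
Lemma ultra_lim (U : set_system nat) (x : nat -> R) C : UltraFilter U ->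
  (forall n, `|x n| <= C) -> exists l, forall e, 0 < e -> \forall n \near U, `|x n - l| <= e.
Proof.
move=> UU xC.
have cpt : compact `[- C, C] by exact: segment_compact.
have FU : Filter U by exact: filter_filter.
have xU : (x @ U) `[- C, C]%classic.
  by rewrite /fmap /= /preimage /=; apply: filterS (@filterT _ U _) => n _; rewrite /= in_itv/= -ler_norml.
have [l [_ cl]] := cpt (x @ U) _ xU.
exists l => e e0.
have [//|NV] := in_ultra_setVsetC [set n | `|x n - l| <= e] UU.
have [|z [/= [n nV <-]]] := cl (x @` (~` [set n | `|x n - l| <= e])) (ball l e) _ (nbhsx_ballx _ _ e0).
  by rewrite /fmap /=; apply: filterS NV => n ?; exists n.
by rewrite /ball /= => ?; exfalso; apply: nV; rewrite /= distrC ltW.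
Qed.

(** * The dynamic programming scheme *)

Section Scheme.
Variables (sl su : R).
Hypotheses (Hsl : 0 <= sl) (Hsu : sl <= su).
Local Notation sg := (sg sl su).
Local Notation G := (Defs.G sl su).
Local Notation dualG := (dualG sl su).
Local Notation k := (su ^+ 2).

(** The Bellman operator of one step: a controller chooses between the two extreme volatilities. *)
Definition dpstep (r : R) f y := Num.max (avg (sl * r) f y) (avg (su * r) f y).

Lemma dpstep_ge b r f y : avg (sg b * r) f y <= dpstep r f y.
Proof. by rewrite /dpstep le_max; case: b => /=; rewrite lexx ?orbT. Qed.

Lemma dpstep_le r f y (x : R) : (forall b, avg (sg b * r) f y <= x) -> dpstep r f y <= x.
Proof. by move=> H; rewrite /dpstep ge_max (H false) (H true). Qed.

Lemma iter_dpstep_mono n r f g : (forall z, f z <= g z) ->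
  forall y, iter n (dpstep r) f y <= iter n (dpstep r) g y.
Proof.
move=> fg; elim: n => //= n IH y; apply: dpstep_le => b.
apply: le_trans (dpstep_ge b _ _ _); exact: avg_le.
Qed.

Lemma iter_dpstep_addc n r f c y :
  iter n (dpstep r) (fun z => f z + c) y = iter n (dpstep r) f y + c.
Proof.
elim: n y => //= n IH y.
by rewrite /dpstep /avg !IH -!(addrACA _ _ c c) addr_maxl; congr Num.max; field.
Qed.

Lemma iter_dpstep_ge b n r f y : iter n (avg (sg b * r)) f y <= iter n (dpstep r) f y.
Proof.
elim: n y => //= n IH y; apply: le_trans (dpstep_ge b _ _ _).
exact: avg_le.
Qed.

Lemma iter_dpstep_shift n r f c y :
  iter n (dpstep r) (fun z => f (z + c)) y = iter n (dpstep r) f (y + c).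
Proof.
by elim: n y => //= n IH y; rewrite /dpstep /avg !IH !(addrAC y c).
Qed.

Lemma iter_dpstep_bound n r f C y : (forall z, `|f z| <= C) -> `|iter n (dpstep r) f y| <= C.
Proof.
move=> fC; elim: n y => //= n IH y.
rewrite ler_norml; apply/andP; split.
- apply: le_trans (dpstep_ge true _ _ _); rewrite /avg.
  have := IH (y + sg true * r); have := IH (y - sg true * r); rewrite !ler_norml; qlra.
- apply: dpstep_le => b; rewrite /avg.
  have := IH (y + sg b * r); have := IH (y - sg b * r); rewrite !ler_norml; qlra.
Qed.

Lemma iter_dpstep_lip n r f L : (forall x y, `|f x - f y| <= L * `|x - y|) ->
  forall x y, `|iter n (dpstep r) f x - iter n (dpstep r) f y| <= L * `|x - y|.
Proof.
move=> Lf.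
have H x y : iter n (dpstep r) f x <= iter n (dpstep r) f y + L * `|x - y|.
  have -> : x = y + (x - y) by ring.
  rewrite -iter_dpstep_shift -iter_dpstep_addc; apply: iter_dpstep_mono => z.
  have := Lf (z + (x - y)) z; rewrite ler_norml (_ : z + (x - y) - z = x - y); last ring.
  by rewrite (_ : y + (x - y) - y = x - y); [qlra|ring].
move=> x y; rewrite ler_norml; have := H x y; have := H y x; rewrite (distrC y x); qlra.
Qed.

Lemma iter_dpstep_poly n r f y0 (c p q M g : R) : 0 <= M ->
  (forall b, sg b ^+ 2 / 2 * q <= g) ->
  (forall z, f z <= c + p * (z - y0) + q / 2 * (z - y0) ^+ 2 + M * (z - y0) ^+ 4) ->
  forall z, iter n (dpstep r) f z <=
    c + p * (z - y0) + q / 2 * (z - y0) ^+ 2 + g * (n%:R * r ^+ 2)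
    + M * ((z - y0) ^+ 4 + 6 * k * (n%:R * r ^+ 2) * (z - y0) ^+ 2
           + 3 * k ^+ 2 * (n%:R * r ^+ 2) ^+ 2).
Proof.
move=> M0 gq H; elim: n => [|n IH] z.
  by have := H z; rewrite /= mul0r expr0n /= !(mulr0, mul0r, addr0).
rewrite iterS; apply: dpstep_le => b; rewrite /avg.
have := IH (z + sg b * r); have := IH (z - sg b * r).
have -> : n.+1%:R * r ^+ 2 = n%:R * r ^+ 2 + r ^+ 2 by rewrite -natr1 mulrDl mul1r.
set P := iter n (dpstep r) f; set N : R := n%:R * r ^+ 2.
have N0 : 0 <= N by rewrite mulr_ge0 ?ler0n ?sqr_ge0.
have -> : z + sg b * r - y0 = (z - y0) + sg b * r by ring.
have -> : z - sg b * r - y0 = (z - y0) - sg b * r by ring.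
set x := z - y0; move: (P (z + sg b * r)) (P (z - sg b * r)) => p1 p2 h1 h2.
have r2 : 0 <= r ^+ 2 by exact: sqr_ge0.
pose s := sg b ^+ 2; have s0 : 0 <= s by exact: sqr_ge0.
have sk : s <= k by exact: sg2_le.
have k0 : 0 <= k by exact: sqr_ge0.
have gr := ler_wpM2r r2 (gq b).
have e1 : M * (s * r ^+ 2) * x ^+ 2 <= M * (k * r ^+ 2) * x ^+ 2.
  apply: ler_wpM2r; first exact: sqr_ge0.
  by apply: ler_wpM2l => //; exact: ler_wpM2r.
have e2 : M * (k * N) * (s * r ^+ 2) <= M * (k * N) * (k * r ^+ 2).
  apply: ler_wpM2l; first exact: mulr_ge0 M0 (mulr_ge0 k0 N0).
  exact: ler_wpM2r.
have e3 : M * (s * r ^+ 2) ^+ 2 <= M * (k * r ^+ 2) ^+ 2.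
  have h : s * r ^+ 2 <= k * r ^+ 2 by exact: ler_wpM2r.
  have h0 : 0 <= s * r ^+ 2 by exact: mulr_ge0.
  by apply: ler_wpM2l => //; rewrite expr2 [leRHS]expr2; apply: ler_pM.
have e4 : 0 <= M * (k * r ^+ 2) ^+ 2 by rewrite mulr_ge0 ?sqr_ge0.
rewrite -/s in gr; move: h1 h2 gr e1 e2 e3 e4; rewrite /s; qlra.
Qed.


(** Taking [kap] near the square root of the elapsed time would give a modulus of order one half in
    time, uniformly in the step size; [kap] is left free instead. *)
Lemma iter_dpstep_move n r f L (kap : R) y : 0 < kap ->
  (forall x y, `|f x - f y| <= L * `|x - y|) ->
  `|iter n (dpstep r) f y - f y| <= L * (kap / 2 + k * (n%:R * r ^+ 2) / (2 * kap)).
Proof.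
move=> kap0 Lf.
have L0 : 0 <= L by have := le_trans (normr_ge0 _) (Lf 1 0); rewrite subr0 normr1 mulr1.
have Lk : 0 <= L / kap by rewrite divr_ge0// ltW.
have B z : `|f z - f y| <= L * kap / 2 + L / kap / 2 * (z - y) ^+ 2.
  apply: le_trans (Lf _ _) _; rewrite -(real_normK (num_real (z - y))); set x := `|_|.
  have -> : L * kap / 2 + L / kap / 2 * x ^+ 2 = L * x + L / kap / 2 * (kap - x) ^+ 2.
    by field; qlra.
  by rewrite lerDl mulr_ge0 ?sqr_ge0// divr_ge0.
have e : L * (kap / 2 + k * (n%:R * r ^+ 2) / (2 * kap)) =
    L * kap / 2 + k / 2 * (L / kap) * (n%:R * r ^+ 2) by field; qlra.
rewrite ler_norml e; apply/andP; split.
- apply: le_trans (_ : iter n (avg (sg true * r)) f y - f y <= _); last first.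
    by rewrite lerD2r iter_dpstep_ge.
  have := @iter_avg_poly _ n (sg true * r) f y (f y - L * kap / 2) 0 (- (L / kap)) 0 (lexx _) _ y.
  have H z : f y - L * kap / 2 + 0 * (z - y) + - (L / kap) / 2 * (z - y) ^+ 2 - 0 * (z - y) ^+ 4 <= f z.
    by have := B z; rewrite ler_norml !mul0r; qlra.
  move=> /(_ H); rewrite subrr expr0n /= !mul0r add0r exprMn /=.
  rewrite [n%:R * (_ * _)]mulrCA; qlra.
- have := @iter_dpstep_poly n r f y (f y + L * kap / 2) 0 (L / kap) 0 (k / 2 * (L / kap)) (lexx _) _ _ y.
  have H z : f z <= f y + L * kap / 2 + 0 * (z - y) + L / kap / 2 * (z - y) ^+ 2 + 0 * (z - y) ^+ 4.
    by have := B z; rewrite ler_norml !mul0r; qlra.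
  have H' b : sg b ^+ 2 / 2 * (L / kap) <= k / 2 * (L / kap).
    by rewrite ler_wpM2r// ler_pM2r// sg2_le.
  move=> /(_ H' H); rewrite subrr expr0n /= !mul0r !mulr0; qlra.
Qed.

Section Limit.
Variables (phi : R -> R) (C L : R).
Hypotheses (phiC : forall y, `|phi y| <= C) (Lphi : forall x y, `|phi x - phi y| <= L * `|x - y|).

Let hn (n : nat) : R := n.+1%:R^-1.
Let rn n : R := Num.sqrt (hn n).
Let kn n t : nat := Num.truncn (t / hn n).
Let vn n t y := iter (kn n t) (dpstep (rn n)) phi y.

Let hn_gt0 n : 0 < hn n. Proof. by rewrite invr_gt0 ltr0n. Qed.

Let rn2 n : rn n ^+ 2 = hn n. Proof. by rewrite sqr_sqrtr// ltW. Qed.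

(** The number of steps between [t] and [t + s] is [s / hn n] up to one step. [truncn] sends
    negative numbers to 0, so [vn] is constant at negative times and its limit lives on the whole
    plane. *)
Let kn_add n (t s : R) : 0 <= s -> exists2 j : nat, kn n (t + s) = (j + kn n t)%N &
  (0 <= t -> `|j%:R * hn n - s| <= hn n) /\ j%:R * hn n <= s + hn n.
Proof.
move=> s0; set h := hn n; have h0 : 0 < h by exact: hn_gt0.
pose B := kn n (t + s); pose A := kn n t.
have AB : (A <= B)%N.
  rewrite /A /B /kn -/h; have [t0|t0] := leP 0 t.
  - rewrite truncn_ge_nat ?divr_ge0 ?addr_ge0 ?(ltW h0)//.
    have /andP[] := truncn_itv (divr_ge0 t0 (ltW h0)) => h1 _.
    by apply: le_trans h1 _; rewrite ler_pM2r ?invr_gt0// lerDl.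
  - by rewrite (_ : Num.truncn (t / h) = 0%N)//; apply/truncn0Pn; rewrite -ltNge ltr_pdivrMr// mul1r; lra.
have E : B%:R = (B - A)%:R + A%:R :> R by rewrite natrB// subrK.
exists (B - A)%N; first by rewrite -/B -/A subnK.
have [ts|ts] := leP 0 (t + s).
- have /andP[b1 b2] := truncn_itv (divr_ge0 ts (ltW h0)).
  rewrite -/(kn n (t + s)) -/B ler_pdivlMr// in b1.
  rewrite -/(kn n (t + s)) -/B ltr_pdivrMr// -natr1 in b2.
  have A0 : 0 <= A%:R * h by rewrite mulr_ge0 ?ler0n// ltW.
  split=> [t0|].
  + have /andP[a1 a2] := truncn_itv (divr_ge0 t0 (ltW h0)).
    rewrite -/(kn n t) -/A ler_pdivlMr// in a1.
    rewrite -/(kn n t) -/A ltr_pdivrMr// -natr1 in a2.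
    by rewrite ler_norml; move: b1 b2 a1 a2; rewrite E -/h; lra.
  + have [t0|t0] := leP 0 t.
      have /andP[a1 a2] := truncn_itv (divr_ge0 t0 (ltW h0)).
      rewrite -/(kn n t) -/A ltr_pdivrMr// -natr1 in a2.
      by move: b1 a2; rewrite E; lra.
    by move: b1; rewrite E; lra.
- have B0 : B = 0%N.
    by apply/truncn0Pn; rewrite -ltNge ltr_pdivrMr// mul1r; apply: lt_trans ts h0.
  by rewrite B0 sub0n mul0r; split; lra.
Qed.

Let vnC n t y : `|vn n t y| <= C. Proof. exact: iter_dpstep_bound. Qed.

Let vnL n t x y : `|vn n t x - vn n t y| <= L * `|x - y|.
Proof. exact: iter_dpstep_lip. Qed.

Let vnD n (t s y kap : R) : 0 < kap -> 0 <= s ->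
  `|vn n (t + s) y - vn n t y| <= L * (kap / 2 + k * (s + hn n) / (2 * kap)).
Proof.
move=> kap0 s0; have [j e [_ jh]] := kn_add n t s0.
rewrite /vn e iterD; apply: le_trans (iter_dpstep_move j (rn n) y kap0 (vnL n t)) _.
have L0 : 0 <= L by have := le_trans (normr_ge0 _) (Lphi 1 0); rewrite subr0 normr1 mulr1.
rewrite ler_wpM2l// lerD2l ler_pM2r ?invr_gt0; last lra.
by rewrite ler_wpM2l ?sqr_ge0// rn2.
Qed.

(* The Barles-Souganidis argument, with an ultrafilter limit of the
   dynamic programming scheme in place of half-relaxed limits. *)
Lemma viscosity_solution_exists : exists v : R -> R -> R,
  [/\ viscosity_solution sl su phi v, forall t y, `|v t y| <= C &
      forall t x y, `|v t x - v t y| <= L * `|x - y|].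
Proof.
have [U [UU oU]] := ultraFilterLemma (@eventually_filter : ProperFilter \oo).
have PU : ProperFilter U by exact: ultra_proper.
have FU : Filter U by exact: filter_filter.
have [v vP] : exists v : R -> R -> R, forall t y e, 0 < e -> \forall n \near U, `|vn n t y - v t y| <= e.
  have H t : exists v : R -> R, forall y e, 0 < e -> \forall n \near U, `|vn n t y - v y| <= e.
    have := fun y => ultra_lim (x := fun n => vn n t y) UU (fun n => vnC n t y).
    by case/choice => f Hf; exists f.
  by case/choice : H => f Hf; exists f.
have hnU e : 0 < e -> \forall n \near U, 0 <= hn n <= e.
  move=> e0; apply: oU; exists (Num.truncn e^-1) => // n /= ne.
  rewrite (ltW (hn_gt0 n)) /= /hn invf_ple ?posrE ?ltr0n//.
  apply: le_trans (ltW (truncnS_gt e^-1)) _.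
  by rewrite ler_nat ltnS.
have vC t y : `|v t y| <= C.
  apply/ler_addgt0Pr => e e0; have [n Hn] := filter_ex (vP t y e e0).
  by have := vnC n t y; move: Hn; rewrite !ler_norml; lra.
have vL t x y : `|v t x - v t y| <= L * `|x - y|.
  apply/ler_addgt0Pr => e e0; have e2 : 0 < e / 2 by lra.
  have [n [H1 H2]] := filter_ex (filterI (vP t x _ e2) (vP t y _ e2)).
  by have := vnL n t x y; move: H1 H2; rewrite !ler_norml; lra.
have L0 : 0 <= L by have := le_trans (normr_ge0 _) (Lphi 1 0); rewrite subr0 normr1 mulr1.
have vD (t s y kap : R) : 0 < kap -> 0 <= s ->
    `|v (t + s) y - v t y| <= L * (kap / 2 + k * s / (2 * kap)).
  move=> kap0 s0; apply/ler_addgt0Pr => e e0; have e2 : 0 < e / 4 by lra.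
  have A0 : 0 <= L * k / kap := divr_ge0 (mulr_ge0 L0 (sqr_ge0 su)) (ltW kap0).
  have e3 : 0 < e / (L * k / kap + 1) by apply: divr_gt0 => //; lra.
  have [n [[H1 H2] H3]] := filter_ex (filterI (filterI (vP (t + s) y _ e2) (vP t y _ e2)) (hnU _ e3)).
  have := vnD n t y kap0 s0; move: H1 H2; rewrite !ler_norml => H1 H2 H4.
  have : L * (kap / 2 + k * (s + hn n) / (2 * kap)) <= L * (kap / 2 + k * s / (2 * kap)) + e / 2.
    have -> : L * (kap / 2 + k * (s + hn n) / (2 * kap)) =
        L * (kap / 2 + k * s / (2 * kap)) + L * k / kap * hn n / 2 by field; lra.
    rewrite lerD2l ler_pM2r//.
    apply: (@le_trans _ _ ((L * k / kap + 1) * (e / (L * k / kap + 1)))); last first.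
      by rewrite mulrC divfK// gt_eqF//; lra.
    by case/andP: H3 => h1 h2; apply: ler_pM => //; lra.
  lra.
have cv : cont2 v.
  apply: (cont2_lip_slice vL) => y t; apply/cvgrPdist_le => e e0.
  pose kap := e / (L + 1); have L1 : 0 < L + 1 by lra.
  have kap0 : 0 < kap by exact: divr_gt0.
  pose d := kap ^+ 2 / (k + 1).
  have k1 : 0 < k + 1 by have := sqr_ge0 su; lra.
  have d0 : 0 < d by rewrite divr_gt0 ?exprn_gt0.
  have nt : \forall s \near nbhs t, `|t - s| <= d by exact: cvgr_dist_le.
  have B s : 0 <= s <= d -> L * (kap / 2 + k * s / (2 * kap)) <= e.
    move=> /andP[s0 sd].
    have : k * s / (2 * kap) <= kap / 2.
      rewrite ler_pdivrMr; last lra.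
      have : (k + 1) * s <= kap ^+ 2 by rewrite mulrC -ler_pdivlMr.
      by have := sqr_ge0 su; nra.
    move=> h; apply: (@le_trans _ _ (L * kap)); first by rewrite ler_wpM2l//; lra.
    by rewrite /kap mulrCA ger_pMr// ler_pdivrMr//; lra.
  apply: filterS nt => s ts; have [st|/ltW ts'] := leP s t.
  - have E : t = s + (t - s) by ring.
    rewrite [in v t y]E; apply: le_trans (vD _ _ _ _ kap0 _) _; first lra.
    by apply: B; rewrite ger0_norm in ts; lra.
  - have E : s = t + (s - t) by ring.
    rewrite [in v s y]E distrC; apply: le_trans (vD _ _ _ _ kap0 _) _; first lra.
    by apply: B; rewrite distrC ger0_norm in ts; lra.
have k0 : 0 <= k by exact: sqr_ge0.
exists v; split => //; split.
- by apply: continuous_subspaceT.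
- by exists C => t y _.
- move=> y; apply/eqP; rewrite -subr_eq0 -normr_le0; apply/ler_addgt0Pr => e e0.
  have [n] := filter_ex (vP 0 y e e0).
  by rewrite /vn /kn mul0r truncn0 add0r /= distrC.
- apply: vsub_G; apply: (@scheme_vsub G k C L U hn vn) => //.
  + exact: G_addr.
  + move=> n s t y c p q M M0 s0 st Hs.
    have ts0 : 0 <= t - s by rewrite subr_ge0.
    have [j e [/(_ s0) jh _]] := kn_add n s ts0.
    rewrite subrKC in e.
    exists (j%:R * hn n) => //.
    have := @iter_dpstep_poly j (rn n) (vn n s) y c p q M (G q) M0 (fun b => G_ge Hsl Hsu b q) Hs y.
    by rewrite -iterD -e rn2 subrr !expr0n /= !mulr0 !addr0 add0r -/(vn n t y); lra.
- apply: vsub_dualG; apply: (@scheme_vsub dualG k C L U hn (fun n t y => - vn n t y)) => //.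
  + exact: dualG_addr.
  + by move=> n t y; rewrite normrN.
  + by move=> n t x y; rewrite -opprD normrN; exact: vnL.
  + by move=> t x y; rewrite -opprD normrN; exact: vL.
  + move=> t y e e0; apply: filterS (vP t y e e0) => n.
    by rewrite -opprD normrN.
  + move=> n s t y c p q M M0 s0 st Hs.
    have ts0 : 0 <= t - s by rewrite subr_ge0.
    have [j e [/(_ s0) jh _]] := kn_add n s ts0.
    rewrite subrKC in e.
    exists (j%:R * hn n) => //.
    (* One volatility attaining [G (- q)] is kept throughout; the scheme dominates that walk. *)
    have [b Gb] := G_eq sl su (- q).
    have := @iter_avg_poly _ j (sg b * rn n) (vn n s) y (- c) (- p) (- q) M M0 _ y.
    have H z : - c + - p * (z - y) + - q / 2 * (z - y) ^+ 2 - M * (z - y) ^+ 4 <= vn n s z.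
      by have := Hs z; lra.
    move=> /(_ H); rewrite subrr !expr0n /= !mulr0 !addr0 !add0r => lo.
    have := iter_dpstep_ge b j (rn n) (vn n s) y.
    have -> : iter j (dpstep (rn n)) (vn n s) y = vn n t y by rewrite /vn e iterD.
    move=> up.
    have J0 : 0 <= j%:R * hn n by rewrite mulr_ge0 ?ler0n// ltW.
    have e1 : j%:R * (sg b * rn n) ^+ 2 = sg b ^+ 2 * (j%:R * hn n) by rewrite -rn2; ring.
    have e2 : 3 * j%:R ^+ 2 * (sg b * rn n) ^+ 4 = 3 * (sg b ^+ 2 * (j%:R * hn n)) ^+ 2.
      by rewrite -e1; ring.
    rewrite e1 e2 in lo.
    have s4 : M * (sg b ^+ 2 * (j%:R * hn n)) ^+ 2 <= M * (k * (j%:R * hn n)) ^+ 2.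
      have h : sg b ^+ 2 * (j%:R * hn n) <= k * (j%:R * hn n) by apply: ler_wpM2r => //; exact: sg2_le.
      have h0 : 0 <= sg b ^+ 2 * (j%:R * hn n) := mulr_ge0 (sqr_ge0 _) J0.
      by apply: ler_wpM2l => //; rewrite expr2 [leRHS]expr2; apply: ler_pM.
    by rewrite /dualG Gb; move: lo up s4; lra.
Qed.

End Limit.

End Scheme.

End Existence.

(** * The G-heat semigroup and nested conditional expectations *)

Section Heat.
Context {R : realType} (sl su : R).
Hypotheses (Hsl : 0 <= sl) (Hsu : sl <= su).
Implicit Types (f g phi : R -> R) (u v w : R -> R -> R).
Local Notation G := (G sl su).
Local Notation dualG := (dualG sl su).

Definition blip (C L : R) phi := (forall y, `|phi y| <= C) /\
  (forall x y, `|phi x - phi y| <= L * `|x - y|).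

Lemma blip_cst (c : R) : blip `|c| 0 (fun=> c).
Proof. by split => // x y; rewrite subrr normr0 mul0r. Qed.

Lemma blip_ge0 C L phi : blip C L phi -> 0 <= C /\ 0 <= L.
Proof.
move=> [h1 h2]; split; first exact: le_trans (normr_ge0 _) (h1 0).
by have := le_trans (normr_ge0 _) (h2 1 0); rewrite subr0 normr1 mulr1.
Qed.

Lemma blip_shift C L phi c : blip C L phi -> blip C L (fun y => phi (y + c)).
Proof.
move=> [h1 h2]; split => // x y; apply: le_trans (h2 _ _) _.
by rewrite (_ : x + c - (y + c) = x - y)//; ring.
Qed.

(** The form of a viscosity solution used by [comparison]: continuous on the whole plane, with an
    explicit bound [C]. *)
Definition gsol phi C v := [/\ vsub G v, vsub dualG (fun t y => - v t y),
  bounded_sol v C & forall y, v 0 y = phi y].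

Lemma vsub_eq (F : R -> R) u v : (forall t y, 0 < t -> u t y = v t y) -> vsub F u -> vsub F v.
Proof.
move=> e H psi t y C t0 e1 m; apply: H => //; first by rewrite e.
by move=> s z s0; rewrite e//; exact: m.
Qed.

Lemma gsol_viscosity phi C v : gsol phi C v -> viscosity_solution sl su phi v.
Proof.
move=> [h1 h2 [cv vC] h4]; split => //.
- exact: continuous_subspaceT.
- by exists C => t y _.
- exact: vsub_G.
- exact: vsub_dualG.
Qed.

Lemma viscosity_gsol phi u C : viscosity_solution sl su phi u ->
  (forall t y, 0 <= t -> `|u t y| <= C) -> gsol phi C (fun t y => u (Num.max t 0) y).
Proof.
move=> [cu _ h0 h1 h2] hC; split.
- apply: vsub_eq (viscosity_sub_vsub h1) => t y t0.
  by rewrite max_l// ltW.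
- apply: vsub_eq (viscosity_super_vsub h2) => t y t0.
  by rewrite max_l// ltW.
- split; last by move=> t y; apply: hC; rewrite le_max lexx orbT.
  pose F : R * R -> R := fun z => u z.1 z.2.
  pose q : R * R -> R * R := fun z => (Num.max z.1 0, z.2).
  have cq : continuous q.
    move=> z; have h : {for z, continuous (fun z : R * R => Num.max z.1 0)}.
      apply: (@continuous_max _ _ (fun z : R * R => z.1) (fun=> 0)); first exact: cvg_fst.
      exact: cvg_cst.
    have h' : {for z, continuous (fun z : R * R => z.2)} by exact: cvg_snd.
    exact: cvg_pair h h'.
  have A : continuous (F \o q).
    move=> z; have qz : 0 <= (q z).1 by rewrite le_max lexx orbT.
    have := (@subspace_continuousP _ _ _ F).1 cu (q z) qz => H.
    apply: cvg_trans H => U /= HU; have := cq z _ HU; rewrite /fmap /= => HH.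
    change (\forall x \near z, U (F (q x))).
    have {}HH : \forall x \near z, 0 <= (q x).1 -> U (F (q x)) := HH.
    by apply: filterS HH => x; apply; rewrite /= le_max lexx orbT.
  exact: A.
- by move=> y; rewrite maxxx h0.
Qed.

Lemma gsol_bound phi C C' v : C <= C' -> gsol phi C v -> gsol phi C' v.
Proof.
by move=> CC [h1 h2 [h3 h3'] h4]; split => //; split => // t y; exact: le_trans (h3' t y) CC.
Qed.

Lemma gsol_cmp phi phi1 phi2 C0 C1 C2 v v1 v2 K1 K2 L1 L2 (a1 a2 : R) : 0 <= a1 -> 0 <= a2 ->
  gsol phi C0 v -> gsol phi1 C1 v1 -> gsol phi2 C2 v2 ->
  blip K1 L1 phi1 -> blip K2 L2 phi2 ->
  (forall y, phi y <= a1 * phi1 y + a2 * phi2 y) ->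
  forall t y, 0 <= t -> v t y <= a1 * v1 t y + a2 * v2 t y.
Proof.
move=> a10 a20 s s1 s2 b1 b2 H.
pose C := Num.max C0 (Num.max C1 C2).
have CC : [/\ C0 <= C, C1 <= C & C2 <= C] by rewrite /C; split; rewrite !le_max lexx ?orbT.
have [/gsol_bound e0 /gsol_bound e1' /gsol_bound e2'] := CC.
have [h1 _ hb h0] := e0 _ _ s; have [_ k1 kb k0] := e1' _ _ s1; have [_ l1 lb l0] := e2' _ _ s2.
have L10 := (blip_ge0 b1).2; have L20 := (blip_ge0 b2).2.
have e1 x y : `|v1 0 x - v1 0 y| <= (L1 + L2) * `|x - y|.
  by rewrite !k0; apply: le_trans (b1.2 x y) _; apply: ler_wpM2r => //; lra.
have e2 x y : `|v2 0 x - v2 0 y| <= (L1 + L2) * `|x - y|.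
  by rewrite !l0; apply: le_trans (b2.2 x y) _; apply: ler_wpM2r => //; lra.
apply: (comparison Hsl Hsu a10 a20 h1 hb k1 kb l1 lb e1 e2).
by move=> y; rewrite h0 k0 l0.
Qed.

Lemma gsol_unique phi C1 C2 v1 v2 K L : gsol phi C1 v1 -> gsol phi C2 v2 -> blip K L phi ->
  forall t y, 0 <= t -> v1 t y = v2 t y.
Proof.
move=> s1 s2 b t y t0; apply/eqP; rewrite eq_le; apply/andP; split.
- have := gsol_cmp ler01 (lexx 0) s1 s2 s2 b b _ y t0; rewrite mul1r mul0r addr0.
  by apply=> z; rewrite mul1r mul0r addr0.
- have := gsol_cmp ler01 (lexx 0) s2 s1 s1 b b _ y t0; rewrite mul1r mul0r addr0.
  by apply=> z; rewrite mul1r mul0r addr0.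
Qed.

Lemma gsol_exists phi C L : blip C L phi -> exists v,
  gsol phi C v /\ forall t x y, `|v t x - v t y| <= L * `|x - y|.
Proof.
move=> [h1 h2]; have [v [vs vC vL]] := viscosity_solution_exists Hsl Hsu h1 h2.
exists (fun t y => v (Num.max t 0) y); split => //.
by apply: viscosity_gsol vs _ => t y _.
Qed.

Definition heat phi : R -> R -> R :=
  xget (fun _ _ => 0) [set v | exists C, gsol phi C v].

Lemma heat_gsol phi C L : blip C L phi -> exists C', gsol phi C' (heat phi).
Proof.
move=> /gsol_exists[v [vs _]].
have H : [set v | exists C, gsol phi C v] v by exists C.
exact: (xgetPex (fun _ _ => 0) (ex_intro _ v H)).
Qed.

Lemma heat_viscosity phi C L : blip C L phi -> viscosity_solution sl su phi (heat phi).
Proof. by move=> /heat_gsol[C' /gsol_viscosity]. Qed.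

Lemma heat_cmp phi phi1 phi2 C0 L0 C1 C2 L1 L2 (a1 a2 : R) : 0 <= a1 -> 0 <= a2 ->
  blip C0 L0 phi -> blip C1 L1 phi1 -> blip C2 L2 phi2 ->
  (forall y, phi y <= a1 * phi1 y + a2 * phi2 y) ->
  forall t y, 0 <= t -> heat phi t y <= a1 * heat phi1 t y + a2 * heat phi2 t y.
Proof.
move=> a10 a20 b b1 b2; have [? s] := heat_gsol b.
have [? s1] := heat_gsol b1; have [? s2] := heat_gsol b2.
exact: gsol_cmp a10 a20 s s1 s2 b1 b2.
Qed.

Lemma heat_unique phi C L u : blip C L phi -> viscosity_solution sl su phi u ->
  forall t y, 0 <= t -> u t y = heat phi t y.
Proof.
move=> b us t y t0; have [_ [C' uC] _ _ _] := us.
have [? s] := heat_gsol b.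
have := gsol_unique (viscosity_gsol us uC) s b y t0.
by rewrite max_l.
Qed.

Lemma heat_blip phi C L t : blip C L phi -> 0 <= t -> blip C L (heat phi t).
Proof.
move=> b t0; have [v [vs vL]] := gsol_exists b.
have [? s] := heat_gsol b.
have e y : heat phi t y = v t y by exact: (gsol_unique s vs b y t0).
split => [y|x y]; rewrite !e => //.
by have [_ _ [_ ->] _] := vs.
Qed.

Lemma heat_cst (c : R) t y : 0 <= t -> heat (fun=> c) t y = c.
Proof.
move=> t0; have [C [h1 h2 [h3 h3'] h4]] := heat_gsol (blip_cst c).
set u := heat _ in h1 h2 h3 h3' h4 *.
have k0 : 0 <= su ^+ 2 / 2 by rewrite divr_ge0// sqr_ge0.
have G0 : G 0 = 0 by rewrite /Defs.G oppr0 maxxx !mulr0 subrr mul0r.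
have S a := smooth12_cst (R := R) a.
have K a : cont2 (fun _ _ : R => a) by exact: cont2_cst.
have uC t' y' := h3' t' y'.
apply/eqP; rewrite eq_le; apply/andP; split.
- apply: (@vsub_le_smooth _ _ u _ _ _ _ _ C c k0 (fun a b => @G_addr _ _ _ Hsl Hsu a b) h1 h3 _ (S c) (K c)) => //.
  + by move=> t' y' _; apply: le_trans (ler_norm _) (uC t' y').
  + by move=> t' y' _; rewrite G0.
  + by move=> y'; rewrite h4.
- rewrite -lerN2.
  apply: (@vsub_le_smooth _ _ (fun t y => - u t y) _ _ _ _ _ C (- c) k0 (fun a b => @dualG_addr _ _ _ Hsl Hsu a b) h2 (cont2N h3) _ (S (- c)) (K (- c))) => //.
  + by move=> t' y' _; apply: le_trans (ler_norm _) _; rewrite normrN.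
  + by move=> t' y' _; rewrite /dualG oppr0 G0 oppr0.
  + by move=> y'; rewrite h4.
Qed.

Lemma smooth_at_shift_space psi pt py pyy (c t y : R) :
  smooth_at psi pt py pyy t (y - c) ->
  smooth_at (fun s z => psi s (z - c)) (fun s z => pt s (z - c))
    (fun s z => py s (z - c)) (fun s z => pyy s (z - c)) t y.
Proof.
move=> [D1 D2 D3 [c1 c2 c3 c4]].
have cc (f : R -> R -> R) : {for (t, y - c), continuous (fun z : R * R => f z.1 z.2)} ->
    {for (t, y), continuous (fun z : R * R => f z.1 (z.2 - c))}.
  move=> cf.
  apply: (@cvg_comp _ _ _ (fun z : R * R => (z.1, z.2 - c)) _ _ _ _ _ cf).
  have h1 : (fun z : R * R => z.2 - c) @ nbhs (t, y) --> y - c.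
    by apply: cvgB; [exact: cvg_snd|exact: cvg_cst].
  have h2 : (fun z : R * R => z.1) @ nbhs (t, y) --> t by exact: cvg_fst.
  exact: (cvg_pair h2 h1).
have D : is_derive y (1 : R) (fun s => s - c) 1.
  by apply: is_derive_eq; rewrite ?subr0 ?addr0.
split.
- exact: D1.
- have := @is_derive1_comp _ (psi t) (fun s => s - c) y _ _ D2 D.
  by rewrite mulr1.
- have := @is_derive1_comp _ (py t) (fun s => s - c) y _ _ D3 D.
  by rewrite mulr1.
- exact: And4 (cc _ c1) (cc _ c2) (cc _ c3) (cc _ c4).
Qed.

Lemma vsub_shift_space (F : R -> R) u (c : R) : vsub F u -> vsub F (fun t y => u t (y + c)).
Proof.
move=> vu psi t y /C12_smooth12 S t0 e m.
have S' : smooth12 (fun s z => psi s (z - c)) (fun s z => derive1 (psi^~ (z - c)) s)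
    (fun s z => derive1 (psi s) (z - c)) (fun s z => derive1 (derive1 (psi s)) (z - c)).
  by move=> s z s0; apply: (smooth_at_shift_space (S s (z - c) s0)).
have := vsub_smooth (y := y + c) vu S' t0; rewrite addrK; apply=> s z s0.
by rewrite e subrr subr_le0; have := m s (z - c) s0; rewrite subrK.
Qed.

Lemma heat_shift phi C L c t y : blip C L phi -> 0 <= t ->
  heat (fun z => phi (z + c)) t y = heat phi t (y + c).
Proof.
move=> b t0; have [C' [h1 h2 [cv vC] h4]] := heat_gsol b.
have s' : gsol (fun z => phi (z + c)) C' (fun t y => heat phi t (y + c)).
  split => //.
  - exact: vsub_shift_space h1.
  - exact: (@vsub_shift_space dualG (fun t y => - heat phi t y)).
  - split=> [|s z]; last exact: vC.
    rewrite (_ : (fun t y => _) = fun t y => heat phi (t + 0) (y + c)); first exact: cont2_shift.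
    apply/funext => s; apply/funext => z.
    by rewrite addr0.
have [? s2] := heat_gsol (blip_shift c b).
by rewrite (gsol_unique s2 s' (blip_shift c b) y t0).
Qed.

(** The solution restarted at time [e] solves the equation with initial value [heat phi e]
    ([vsub_shift]), and such a solution is unique. *)
Lemma heat_add phi C L d e y : blip C L phi -> 0 <= d -> 0 <= e ->
  heat (heat phi e) d y = heat phi (d + e) y.
Proof.
move=> b d0 e0.
have [C' s] := heat_gsol b; have [h1 h2 [cv vC] h4] := s.
have s' : gsol (heat phi e) C' (fun t y => heat phi (e + t) y).
  split => //.
  - by apply: (vsub_shift (C := C') e0 h1) => t z _; apply: le_trans (ler_norm _) (vC t z).
  - by apply: (vsub_shift (C := C') e0 h2) => t z _; apply: le_trans (ler_norm _) _; rewrite normrN; exact: vC.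
  - split=> [|t z]; last exact: vC.
    pose q : R * R -> R * R := fun z => (e + z.1, z.2).
    have cq : continuous q.
      move=> z; have h : {for z, continuous (fun z : R * R => e + z.1)}.
        apply: cvgD; [exact: cvg_cst|exact: cvg_fst].
      have h' : {for z, continuous (fun z : R * R => z.2)} by exact: cvg_snd.
      exact: cvg_pair h h'.
    move=> z; exact: (@continuous_comp _ _ _ q _ z (cq z) (cv (q z))).
  - by move=> z; rewrite addr0.
have [? s2] := heat_gsol (heat_blip b e0).
by rewrite (gsol_unique s2 s' (heat_blip b e0) y d0) addrC.
Qed.

End Heat.

(** * Iterated heat evolution of cylinder functionals *)

Section Nested.
Context {R : realType} (sl su : R).
Hypotheses (Hsl : 0 <= sl) (Hsu : sl <= su).
Implicit Types (g : R -> R) (ts us : seq R) (X : (R -> R) -> R).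
Local Notation heat := (heat sl su).
Local Notation Omega := (path_space R).

Definition step g (r y : R) : R -> R := fun t => g t + (if r <= t then y else 0).

(** The state is the whole past [g], frozen from time [b] on, instead of a list of increments;
    further times can then be inserted without reindexing. The heat solution is read at 0 because
    [y] stands for an increment. *)
Fixpoint nest (b : R) g ts X : R :=
  if ts is r :: ts' then heat (fun y => nest r (step g r y) ts' X) (r - b) 0 else X g.

(** Functionals live on all functions, not on continuous paths, since [step] creates jumps. One
    constant serves as bound and as Lipschitz constant, and [nest] preserves it ([nest_skel]). *)
Definition skel us (C : R) X := (forall g, `|X g| <= C) /\
  (forall g g', `|X g - X g'| <= C * \sum_(t <- us) `|g t - g' t|).

Lemma skel_ge0 us C X : skel us C X -> 0 <= C.
Proof. by case=> h _; exact: le_trans (normr_ge0 _) (h (fun=> 0)). Qed.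

Lemma skel_eq us C X g g' : skel us C X -> {in us, g =1 g'} -> X g = X g'.
Proof.
move=> [_ h] e; apply/eqP; rewrite -subr_eq0 -normr_le0.
apply: le_trans (h g g') _; rewrite big1_seq ?mulr0// => t /andP[_ tu].
by rewrite e// subrr normr0.
Qed.

Lemma skel_step us C X g r : skel us C X -> blip C (C * (size us)%:R) (fun y => X (step g r y)).
Proof.
move=> H; have C0 := skel_ge0 H; have [h1 h2] := H; split => [y|x y]; first exact: h1.
apply: le_trans (h2 _ _) _; rewrite -mulrA; apply: ler_wpM2l => //.
have -> : (size us)%:R * `|x - y| = \sum_(t <- us) `|x - y|.
  by rewrite big_const_seq count_predT iter_addr addr0 mulr_natl.
apply: ler_sum => t _; rewrite /step opprD addrACA subrr add0r.
by case: ifP => _ //; rewrite subrr normr0.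
Qed.

Lemma heat_close phi psi C L d (t y : R) : blip C L phi -> blip C L psi ->
  (forall x, `|phi x - psi x| <= d) -> 0 <= t -> `|heat phi t y - heat psi t y| <= d.
Proof.
move=> b1 b2 H t0.
have d0 : 0 <= d by exact: le_trans (normr_ge0 _) (H 0).
have K := blip_cst (1 : R).
have A f h : blip C L f -> blip C L h -> (forall x, f x - h x <= d) -> heat f t y - heat h t y <= d.
  move=> bf bh fh; have := heat_cmp Hsl Hsu ler01 d0 bf bh K _ y t0.
  rewrite (heat_cst Hsl Hsu)// mul1r mulr1 lerBlDl; apply => x.
  by rewrite mul1r -lerBlDl.
rewrite ler_norml; apply/andP; split.
- by rewrite lerNl opprB; apply: A => // x; have := H x; rewrite ler_norml; lra.
- by apply: A => // x; have := H x; rewrite ler_norml; lra.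
Qed.

Lemma nest_skel us C X ts b : skel us C X -> path.path <%R b ts -> skel us C (fun g => nest b g ts X).
Proof.
move=> H; elim: ts b => //= r ts IH b /andP[br rts].
have {}IH := IH r rts; have rb : 0 <= r - b by lra.
have B g : blip C (C * (size us)%:R) (fun y => nest r (step g r y) ts X).
  exact: (@skel_step us C (fun g => nest r g ts X) g r IH).
split => [g|g g'].
- exact: (heat_blip Hsl Hsu (B g) rb).1.
- apply: heat_close (B g) (B g') _ rb => x.
  apply: le_trans (IH.2 _ _) _; rewrite ler_wpM2l ?(skel_ge0 H)//.
  by apply: ler_sum => t _; rewrite /step opprD addrACA subrr addr0.
Qed.

Lemma nest_blip us C X ts b g r : skel us C X -> path.path <%R b ts ->
  blip C (C * (size us)%:R) (fun y => nest b (step g r y) ts X).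
Proof. by move=> H p; apply: (@skel_step us C (fun g => nest b g ts X)); exact: nest_skel. Qed.

Lemma nest_cst (c : R) ts b g : path.path <%R b ts -> nest b g ts (fun=> c) = c.
Proof.
elim: ts b g => //= r ts IH b g /andP[br rts].
rewrite (_ : (fun y => _) = fun=> c); last by apply/funext => y; exact: IH.
by apply: heat_cst => //; lra.
Qed.

Lemma nest_cat ts1 ts2 X b g :
  nest b g (ts1 ++ ts2) X = nest b g ts1 (fun g => nest (last b ts1) g ts2 X).
Proof.
elim: ts1 b g => //= r ts IH b g.
by congr (heat _ _ _); apply/funext => y; exact: IH.
Qed.

(** These are the states reached by [nest]. Comparison is asked on them only, and their vanishing at
    [t <= 0] is what allows [path_through] to interpolate them by paths. *)
Definition flat b g := (forall t, t <= 0 -> g t = 0) /\ (forall t, b <= t -> g t = g b).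

Lemma flat_step b r g y : flat b g -> b <= r -> 0 < r -> flat r (step g r y).
Proof.
move=> [h1 h2] br r0; split => t; rewrite /step => tr.
- by rewrite h1// leNgt (le_lt_trans tr r0) addr0.
- by rewrite tr lexx h2 ?(h2 r)//; exact: le_trans tr.
Qed.

Lemma nest_cmp us us1 us2 C C1 C2 X X1 X2 (a1 a2 : R) ts b g : 0 <= a1 -> 0 <= a2 ->
  skel us C X -> skel us1 C1 X1 -> skel us2 C2 X2 ->
  0 <= b -> path.path <%R b ts -> flat b g ->
  (forall g, flat (last b ts) g -> X g <= a1 * X1 g + a2 * X2 g) ->
  nest b g ts X <= a1 * nest b g ts X1 + a2 * nest b g ts X2.
Proof.
move=> a10 a20 s s1 s2; elim: ts b g => [|r ts IH] b g b0 /=; first by move=> _ fg; exact.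
move=> /andP[br rts] fg H; have r0 : 0 < r by exact: le_lt_trans br.
have rb : 0 <= r - b by lra.
apply: (heat_cmp Hsl Hsu a10 a20 (nest_blip g r s rts) (nest_blip g r s1 rts)
  (nest_blip g r s2 rts) _ _ rb) => y.
by apply: IH => //; [exact: ltW|exact: flat_step fg (ltW br) r0].
Qed.

Lemma nest_le us C X (c : R) ts b g : skel us C X ->
  0 <= b -> path.path <%R b ts -> flat b g ->
  (forall g, flat (last b ts) g -> X g <= c) -> nest b g ts X <= c.
Proof.
move=> s b0 p fg H; have sc : skel [::] `|c| (fun=> c).
  by split => // *; rewrite subrr normr0 big_nil mulr0.
have := @nest_cmp us [::] [::] C `|c| `|c| X (fun=> c) (fun=> c) 1 0 ts b g ler01 (lexx _) s sc sc b0 p fg.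
by rewrite !nest_cst// mul0r mul1r addr0; apply => g' /H.
Qed.

(** A time on which the functional does not depend can be inserted freely: before another node it
    splits a heat step by the semigroup law, after the last one it evolves a constant. *)
Lemma nest_subseq us C X ts ts' b g : skel us C X -> path.path <%R b ts' ->
  subseq ts ts' -> (forall t, t \in us -> t <= b \/ t \in ts) ->
  nest b g ts X = nest b g ts' X.
Proof.
move=> s; elim: ts' ts b g => [|r' ts' IH] ts b g.
  by move=> _; rewrite subseq0 => /eqP ->.
rewrite [path.path _ _ _]/= => /andP[br' rts']; case: ts => [_ us_b|r ts].
  have E y : nest r' (step g r' y) ts' X = X g.
    rewrite -(IH [::]) /=; last 1 first.
    - by move=> t /us_b[|//] tb; left; lra.
    - apply: skel_eq s _ => t /us_b[|//] tb; rewrite /step ifF ?addr0//.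
      by apply/negbTE; rewrite -ltNge (le_lt_trans tb).
    - exact: rts'.
    - exact: sub0seq.
  rewrite /= (_ : (fun y => _) = fun=> X g); last by apply/funext => y; exact: E.
  by rewrite (heat_cst Hsl Hsu)//; lra.
rewrite [subseq _ _]/=; case: eqP => [-> ss us_b|_ ss us_b].
  rewrite /=; congr (heat _ _ _); apply/funext => y; apply: IH => //.
  by move=> t /us_b[tb|]; [left; lra|rewrite inE => /predU1P[->|->]; [left|right]].
have r'r : r' < r.
  have := rts'; rewrite (path_sortedE lt_trans) => /andP[/allP h _].
  by apply: h; apply: (mem_subseq ss); rewrite mem_head.
have rts : path.path <%R r ts.
  by have := subseq_path lt_trans ss rts' => /= /andP[].
rewrite [RHS]/=.
have E y : nest r' (step g r' y) ts' X = heat (fun z => nest r (step g r z) ts X) (r - r') y.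
  rewrite -(IH (r :: ts)) //=; last by move=> t /us_b[tb|]; [left; lra|right].
  rewrite -[in RHS](add0r y) -(heat_shift Hsl Hsu (C := C) (L := C * (size us)%:R)); [|exact: nest_blip|lra].
  congr (heat _ _ _); apply/funext => z.
  apply: (skel_eq (nest_skel s rts)) => t /us_b tu; rewrite /step -addrA; congr (_ + _).
  have [r't|r't] := leP r' t; last first.
    by rewrite add0r leNgt (lt_trans r't r'r).
  have rt : r <= t.
    case: tu => [tb|]; first by move: (lt_le_trans br' r't); rewrite ltNge tb.
    rewrite inE => /predU1P[->//|tts].
    by have := rts; rewrite (path_sortedE lt_trans) => /andP[/allP/(_ _ tts)/ltW].
  by rewrite rt addrC.
rewrite (_ : (fun y => nest r' _ _ _) = heat (fun z => nest r (step g r z) ts X) (r - r')); last first.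
  by apply/funext => y; exact: E.
rewrite (heat_add Hsl Hsu (C := C) (L := C * (size us)%:R)); [|exact: nest_blip|lra|lra].
by rewrite /=; congr (heat _ _ _); ring.
Qed.

(** Tent functions correct the values one time after another. Inequalities between random variables
    are known on continuous paths only, while [nest] evaluates functionals at step functions;
    finitely many values cannot tell them apart. *)
Lemma path_through us g : (forall t, t <= 0 -> g t = 0) ->
  exists w : Omega, {in us, w =1 g}.
Proof.
move=> g0; elim: us => [|r us [w wg]]; first by exists (zero_path (R := R)).
have [rus|rus] := boolP (r \in us).
  by exists w => t; rewrite inE => /predU1P[->|]; exact: wg.
have [r0|r0] := leP r 0.
  exists w => t; rewrite inE => /predU1P[->|]; last exact: wg.
  by rewrite path_le0// g0.
have [d [d0 dr dus]] : exists d : R, [/\ 0 < d, d <= r & forall t, t \in us -> d <= `|t - r|].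
  elim: us rus {wg} => [_|s us IH]; first by exists r; split.
  rewrite inE negb_or => /andP[rs /IH[d [d0 dr dus]]].
  have sr : 0 < `|s - r| by rewrite normr_gt0 subr_eq0 eq_sym.
  exists (Num.min d `|s - r|); split; first by rewrite lt_min d0.
  - by rewrite ge_min dr.
  - move=> t; rewrite inE ge_min => /predU1P[->|/dus ->//]; by rewrite lexx orbT.
pose hat t := (g r - w r) * Num.max 0 (1 - d^-1 * `|t - r|).
have hat0 t : d <= `|t - r| -> hat t = 0.
  move=> dt; rewrite /hat max_l ?mulr0// subr_le0 mulrC ler_pdivlMr// mul1r//.
have chat : continuous hat.
  move=> t.
  have h1 : {for t, continuous (fun t => 1 - d^-1 * `|t - r|)}.
    apply: cvgB; first exact: cvg_cst.
    apply: cvgMr; apply: cvg_norm; apply: cvgB; [exact: cvg_id|exact: cvg_cst].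
  have h2 : {for t, continuous (fun _ : R => 0 : R)} by exact: cvg_cst.
  by have := @cvgMl_tmp _ _ _ _ (fun t => Num.max 0 (1 - d^-1 * `|t - r|)) (g r - w r) _ (continuous_max h2 h1); apply.
have cw : continuous (fun t => w t + hat t).
  by move=> t; apply: cvgD; [exact: path_continuous|exact: chat].
have w0 t : t <= 0 -> w t + hat t = 0.
  move=> t0; rewrite path_le0// add0r hat0// ler0_norm; lra.
exists (Path cw w0) => t /=; rewrite inE => /predU1P[->|tus].
  by rewrite /hat subrr normr0 mulr0 subr0 max_r// mulr1; ring.
by rewrite hat0 ?addr0; [exact: wg|exact: dus].
Qed.

End Nested.

(** * The G-expectation of cylinder variables *)

Section LipExpectation.
Context {R : realType} (sl su : R).
Hypotheses (Hsl : 0 <= sl) (Hsu : sl <= su).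
Implicit Types (g : R -> R) (ts us : seq R).
Local Notation Omega := (path_space R).
Local Notation nest := (nest sl su).
Local Notation heat := (heat sl su).

(** A form of [lip_E] that does not refer to increments; [lip_E_nested] and [nested_lip_E] show that
    the two agree. Representations over different times are compared on a common refinement. *)
Definition nested (X : Omega -> R) c := exists us C Xh ts,
  [/\ skel us C Xh, forall t, t \in us -> t <= 0 \/ t \in ts, path.path <%R 0 ts,
      forall w : Omega, X w = Xh w & c = nest 0 (fun=> 0) ts Xh].

Lemma path_sort_undup us : {in us, forall t, 0 < t} ->
  path.path <%R 0 (sort <=%R (undup us)).
Proof.
move=> h; rewrite (path_sortedE lt_trans); apply/andP; split.
  by apply/allP => t; rewrite mem_sort mem_undup => /h.
by rewrite lt_sorted_uniq_le sort_uniq undup_uniq sort_le_sorted.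
Qed.

Lemma subseq_sorted ts ts' : sorted <%R ts -> sorted <%R ts' ->
  {subset ts <= ts'} -> subseq ts ts'.
Proof.
move=> s s' h; suff -> : ts = [seq t <- ts' | t \in ts] by exact: filter_subseq.
apply: lt_sorted_eq => //; first exact: lt_sorted_filter.
move=> t; rewrite mem_filter; case: (boolP (t \in ts)) => //= /h ->//.
Qed.

Lemma path_gt0 ts : path.path <%R (0 : R) ts -> {in ts, forall t, 0 < t}.
Proof. by rewrite (path_sortedE lt_trans) => /andP[/allP]. Qed.

Lemma nested_cmp X X1 X2 c c1 c2 (a1 a2 : R) : 0 <= a1 -> 0 <= a2 ->
  nested X c -> nested X1 c1 -> nested X2 c2 ->
  (forall w, X w <= a1 * X1 w + a2 * X2 w) -> c <= a1 * c1 + a2 * c2.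
Proof.
move=> a10 a20 [us [C [Xh [ts [s u p e ->]]]]] [us1 [C1 [Xh1 [ts1 [s1 u1 p1 e1 ->]]]]]
  [us2 [C2 [Xh2 [ts2 [s2 u2 p2 e2 ->]]]]] H.
pose T := sort <=%R (undup (ts ++ ts1 ++ ts2)).
have memT t : (t \in T) = [|| t \in ts, t \in ts1 | t \in ts2].
  by rewrite mem_sort mem_undup !mem_cat.
have pT : path.path <%R 0 T.
  apply: path_sort_undup => t; rewrite !mem_cat => /orP[|/orP[]]; exact: path_gt0.
have sT ts' : path.path <%R 0 ts' -> {subset ts' <= T} -> subseq ts' T.
  by move=> /path_sorted s' h; apply: subseq_sorted => //; exact: path_sorted pT.
rewrite (@nest_subseq _ _ _ Hsl Hsu us C Xh ts T) => //; last first.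
  by apply: sT p _ => t; rewrite memT => ->.
rewrite (@nest_subseq _ _ _ Hsl Hsu us1 C1 Xh1 ts1 T) => //; last first.
  by apply: sT p1 _ => t; rewrite memT => ->; rewrite orbT.
rewrite (@nest_subseq _ _ _ Hsl Hsu us2 C2 Xh2 ts2 T) => //; last first.
  by apply: sT p2 _ => t; rewrite memT => ->; rewrite !orbT.
apply: (nest_cmp Hsl Hsu a10 a20 s s1 s2) => // g [g0 _].
have [w wg] := path_through (us ++ us1 ++ us2) g0.
have := H w; rewrite e e1 e2.
rewrite (skel_eq s (g' := g)); last by move=> t tu; apply: wg; rewrite !mem_cat tu.
rewrite (skel_eq s1 (g' := g)); last by move=> t tu; apply: wg; rewrite !mem_cat tu orbT.
by rewrite (skel_eq s2 (g' := g)); last by move=> t tu; apply: wg; rewrite !mem_cat tu !orbT.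
Qed.

Lemma increments_nth g ts j : (j < size ts)%N ->
  (increments g ts)`_j = g (node ts j.+1) - g (node ts j).
Proof. by move=> js; rewrite /increments (nth_pairmap 0)//. Qed.

Lemma node_lt ts i j : path.path <%R 0 ts -> (i < j)%N -> (j <= size ts)%N ->
  node ts i < node ts j.
Proof.
move=> p ij js; rewrite /node (lt_sorted_ltn_nth 0 (s := 0 :: ts))//.
by rewrite inE /= ltnS (leq_trans (ltnW ij)).
Qed.

Lemma node_le ts i j : path.path <%R 0 ts -> (i <= j)%N -> (j <= size ts)%N ->
  node ts i <= node ts j.
Proof.
by move=> p; rewrite leq_eqVlt => /predU1P[->//|ij js]; exact/ltW/node_lt.
Qed.

(** The factor 2 appears because each time belongs to at most two increments. *)
Lemma skel_increments ts (F : seq R -> R) : bounded_lipschitz (size ts) F ->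
  exists C, skel (0 :: ts) C (fun g => F (increments g ts)).
Proof.
move=> [C [h1 h2]]; have sz g : size (increments g ts) = size ts by rewrite size_pairmap.
have C0 : 0 <= C by exact: le_trans (normr_ge0 _) (h1 _ (sz (fun=> 0))).
exists (C * 2); split => [g|g g'].
  by apply: le_trans (h1 _ (sz g)) _; lra.
apply: le_trans (h2 _ _ (sz g) (sz g')) _; rewrite -mulrA; apply: ler_wpM2l => //.
pose h t := `|g t - g' t|.
have -> : \sum_(t <- 0 :: ts) `|g t - g' t| = \sum_(i < (size ts).+1) h (node ts i).
  by rewrite (big_nth 0) big_mkord.
apply: (@le_trans _ _ (\sum_(i < size ts) (h (node ts i.+1) + h (node ts i)))).
  apply: ler_sum => i _; rewrite !increments_nth// /h.
  by rewrite (_ : _ - _ - _ = (g (node ts i.+1) - g' (node ts i.+1)) - (g (node ts i) - g' (node ts i))); [exact: ler_normB|ring].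
rewrite big_split /= mulr_natl mulr2n; apply: lerD.
- by rewrite big_ord_recl /= lerDr normr_ge0.
- by rewrite big_ord_recr /= lerDl normr_ge0.
Qed.

Lemma lip_E_nested X c : lip_E sl su X c -> nested X c.
Proof.
move=> [ts [phi [j [[ts0 p] [js nj] bl rec Xw]]]].
have j0 : j = 0%N.
  apply/eqP; rewrite -leqn0 leqNgt; apply/negP => j0.
  by have := node_lt p j0 js; rewrite nj ltxx.
subst j; have [C s] := skel_increments bl.
exists (0 :: ts), C, (fun g => phi (size ts) (increments g ts)), ts; split => //.
- by move=> t; rewrite inE => /predU1P[->|->]; [left|right].
- by move=> w; have [] := Xw w.
have [_] := Xw (zero_path (R := R)); rewrite take0 /cst => ->.
set Xh := (fun g => _).
(* Backward induction along the nodes: [k] counts the remaining times, and [g] is any state frozen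
   after the [i]-th node. *)
have claim k i g : (i + k = size ts)%N -> (forall t, node ts i <= t -> g t = g (node ts i)) ->
    phi i (take i (increments g ts)) = nest (node ts i) g (drop i ts) Xh.
  elim: k i g => [|k IH] i g.
    rewrite addn0 => -> _; rewrite drop_size /= take_oversize// size_pairmap//.
  move=> ik fg; have im : (i < size ts)%N by rewrite -ik addnS ltnS leq_addr.
  have sx : size (take i (increments g ts)) = i by rewrite size_takel// size_pairmap ltnW.
  have [u [us ->]] := rec i _ im sx.
  have nn : node ts i < node ts i.+1 by exact: node_lt.
  have pd : path.path <%R (node ts i.+1) (drop i.+1 ts).
    by have := drop_sorted i.+1 (s := 0 :: ts) p; rewrite /= (drop_nth 0 im).
  have E : (fun y => phi i.+1 (rcons (take i (increments g ts)) y)) =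
      fun y => nest (node ts i.+1) (step g (node ts i.+1) y) (drop i.+1 ts) Xh.
    apply/funext => y; rewrite -IH ?addSnnS//; last first.
      by move=> t nt; rewrite /step nt lexx fg ?(fg (node ts i.+1))//; [exact: ltW|exact: ltW (lt_le_trans nn nt)].
    congr (phi _ _); apply: (@eq_from_nth _ 0).
      by rewrite size_rcons sx size_takel// size_pairmap.
    rewrite size_rcons sx => l; rewrite ltnS => li.
    have lm : (l < size ts)%N by exact: leq_ltn_trans im.
    rewrite nth_take ?ltnS// nth_rcons sx; have [li'|il] := ltnP l i.
      rewrite nth_take// !increments_nth// /step !ifF ?addr0//; apply/negbTE; rewrite -ltNge.
        by apply: node_lt => //; rewrite ltnS ltnW.
      exact: node_lt.
    have -> : l = i by apply/eqP; rewrite eqn_leq li.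
    rewrite eqxx increments_nth// /step lexx ifF; last by apply/negbTE; rewrite -ltNge.
    by rewrite fg ?(ltW nn)//; ring.
  rewrite (drop_nth 0 im) /=.
  rewrite E in us; have b := nest_blip Hsl Hsu g (node ts i.+1) s pd.
  by rewrite (heat_unique Hsl Hsu b us)// subr_ge0 ltW.
by have := claim (size ts) 0%N (fun=> 0) (add0n _) (fun _ _ => erefl); rewrite take0 drop0.
Qed.

Definition walk ts (x : seq R) : R -> R :=
  fun t => \sum_(0 <= j < size x) (if node ts j.+1 <= t then x`_j else 0).

Lemma walk_rcons ts x y : walk ts (rcons x y) = step (walk ts x) (node ts (size x).+1) y.
Proof.
apply/funext => t; rewrite /walk /step size_rcons big_nat_recr//=.
rewrite nth_rcons ltnn eqxx; congr (_ + _); apply: eq_big_nat => j /andP[_ jx].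
by rewrite nth_rcons jx.
Qed.

Lemma walk_increments ts (w : Omega) t : path.path <%R 0 ts -> t <= 0 \/ t \in ts ->
  walk ts (increments w ts) t = w t.
Proof.
move=> p; rewrite /walk size_pairmap => -[t0|].
  rewrite path_le0// big_nat big1// => j /andP[_ jm].
  rewrite ifF//; apply/negbTE; rewrite -ltNge; apply: le_lt_trans t0 _.
  exact: (node_lt p (ltn0Sn j) jm).
move=> /(nthP 0)[k km <-]; rewrite -[nth 0 ts k]/(node ts k.+1).
rewrite (@big_cat_nat _ _ _ k.+1)//= (_ : \sum_(k.+1 <= j < _) _ = 0) ?addr0; last first.
  rewrite big_nat big1// => j /andP[kj jm]; rewrite ifF//; apply/negbTE; rewrite -ltNge.
  by apply: node_lt.
rewrite (eq_big_nat _ _ (F2 := fun j => w (node ts j.+1) - w (node ts j))); last first.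
  move=> j /andP[_ jk]; rewrite increments_nth; last exact: leq_ltn_trans km.
  by rewrite node_le.
by rewrite telescope_sumr// (path_le0 w (lexx 0)) subr0.
Qed.

Lemma nested_lip_E X c : nested X c -> lip_E sl su X c.
Proof.
move=> [us [C [Xh [ts0 [s u0 p0 Xw c_nest]]]]].
(* [lip_E] asks for at least one time, so an empty list of nodes is replaced by the single time 1,
   which leaves the value unchanged. *)
have [ts [ts_gt0 p u {}c_nest]] : exists ts, [/\ (0 < size ts)%N, path.path <%R 0 ts,
    forall t, t \in us -> t <= 0 \/ t \in ts & c = nest 0 (fun=> 0) ts Xh].
  case: ts0 u0 p0 c_nest => [|r ts] u0 p0 c_nest; last by exists (r :: ts).
  exists [:: 1]; split => //; rewrite /= ?ltr01//.
    by move=> t /u0[]//; left.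
  by rewrite c_nest (@nest_subseq _ _ _ Hsl Hsu us C Xh [::] [:: 1])//= ltr01.
exists ts, (fun i x => nest (node ts i) (walk ts x) (drop i ts) Xh), 0%N; split => //.
- have C0 := skel_ge0 s; exists (C + C * (size us)%:R).
  have M0 : 0 <= C * (size us)%:R by rewrite mulr_ge0.
  rewrite drop_size /=; split => [x _|x y sx sy].
    by apply: le_trans (s.1 _) _; lra.
  apply: le_trans (s.2 _ _) _.
  set S := \sum_(i < _) _; have S0 : 0 <= S by exact: sumr_ge0.
  apply: (@le_trans _ _ (C * (size us)%:R * S)); last first.
    by rewrite ler_wpM2r// lerDr.
  rewrite -mulrA ler_wpM2l//.
  have -> : (size us)%:R * S = \sum_(t <- us) S.
    by rewrite big_const_seq count_predT iter_addr addr0 mulr_natl.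
  apply: ler_sum => t _; rewrite /walk sx sy -sumrB /S -(big_mkord xpredT (fun i => `|x`_i - y`_i|)).
  apply: le_trans (ler_norm_sum _ _ _) _; apply: ler_sum => j _.
  by case: ifP => // _; rewrite subrr normr0.
- move=> i x im sx; pose f y := nest (node ts i.+1) (walk ts (rcons x y)) (drop i.+1 ts) Xh.
  have E : f = fun y => nest (node ts i.+1) (step (walk ts x) (node ts i.+1) y) (drop i.+1 ts) Xh.
    by apply/funext => y; rewrite /f walk_rcons sx.
  have pd : path.path <%R (node ts i.+1) (drop i.+1 ts).
    by have := drop_sorted i.+1 (s := 0 :: ts) p; rewrite /= (drop_nth 0 im).
  have b := nest_blip Hsl Hsu (walk ts x) (node ts i.+1) s pd.
  exists (heat f); split; last by rewrite E [in LHS](drop_nth 0 im).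
  by rewrite -E in b; exact: (heat_viscosity Hsl Hsu b).
- move=> w; rewrite drop_size drop0 take0 /=; split.
    by rewrite Xw; apply: (skel_eq s) => t /u tu; rewrite walk_increments.
  by rewrite /cst c_nest; congr (nest _ _ _ _); apply/funext => t; rewrite /walk big_nil.
Qed.

Definition nodes us := sort <=%R (undup [seq t <- us | 0 < t]).

Lemma path_nodes us : path.path <%R 0 (nodes us).
Proof. by apply: path_sort_undup => t; rewrite mem_filter => /andP[]. Qed.

Lemma mem_nodes us t : t \in us -> t <= 0 \/ t \in nodes us.
Proof.
move=> tu; have [t0|t0] := leP t 0; [by left|right].
by rewrite mem_sort mem_undup mem_filter t0.
Qed.

Lemma skel_nested us C Xh (X : Omega -> R) : skel us C Xh -> (forall w : Omega, X w = Xh w) ->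
  nested X (nest 0 (fun=> 0) (nodes us) Xh).
Proof.
move=> s e; exists us, C, Xh, (nodes us); split => //; [exact: mem_nodes|exact: path_nodes].
Qed.

Lemma Lip_skel t X : Lip t X -> exists us C Xh,
  [/\ skel us C Xh, {in us, forall s, 0 <= s <= t} & forall w : Omega, X w = Xh w].
Proof.
move=> [ts [F [_ ts0 [C [h1 h2]] e]]].
exists ts, C, (fun g => F [seq g s | s <- ts]); split => //.
split => [g|g g']; first by apply: h1; rewrite size_map.
apply: le_trans (h2 _ _ _ _) _; rewrite ?size_map//.
rewrite (big_nth 0) big_mkord (eq_bigr (fun i : 'I_(size ts) => `|g ts`_i - g' ts`_i|))// => i _.
by rewrite !(nth_map 0).
Qed.

End LipExpectation.

(** * Linear functionals dominated by the G-expectation *)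

Section HahnBanach.
Context {R : realType} {V : lmodType R} (S : V -> Prop).
Hypotheses (S0 : S 0) (SD : forall x y, S x -> S y -> S (x + y))
  (SZ : forall (a : R) x, S x -> S (a *: x)).
Implicit Types (p q : V -> R) (x y : V).

(** The subspace is a predicate [S] because the theorem is applied to the bounded functions inside
    the space of all functions on [Omega]. *)
Definition sublinear p := (forall x y, S x -> S y -> p (x + y) <= p x + p y) /\
  (forall (a : R) x, 0 <= a -> S x -> p (a *: x) = a * p x).

Let SN x : S x -> S (- x). Proof. by rewrite -scaleN1r; exact: SZ. Qed.

Lemma sublinear0 p : sublinear p -> p 0 = 0.
Proof. by move=> [_ h]; rewrite -(scale0r 0) h// mul0r. Qed.

Lemma sublinear_opp p x : sublinear p -> S x -> - p (- x) <= p x.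
Proof.
move=> sp Sx; have := sp.1 _ _ Sx (SN Sx); rewrite subrr (sublinear0 sp); lra.
Qed.

Lemma sublinearI p : (forall x y, S x -> S y -> p (x + y) <= p x + p y) -> p 0 = 0 ->
  (forall (a : R) x, 0 < a -> S x -> p (a *: x) <= a * p x) -> sublinear p.
Proof.
move=> h1 h0 h2; split => // a x; rewrite le_eqVlt => /predU1P[<- _|a0 Sx].
  by rewrite scale0r mul0r.
apply/eqP; rewrite eq_le h2//=; have ai : 0 < a^-1 by rewrite invr_gt0.
have := h2 _ _ ai (SZ a Sx); rewrite scalerA mulVf ?gt_eqF// scale1r.
by rewrite ler_pdivlMl.
Qed.

(* The largest sublinear functional below [q] that is at most [- q y] at [- y]. *)
Definition tilt q y x := inf [set q (x + t *: y) - t * q y | t in [set t : R | 0 <= t]].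

Lemma tilt_lb q y x : sublinear q -> S x -> S y ->
  lbound [set q (x + t *: y) - t * q y | t in [set t : R | 0 <= t]] (- q (- x)).
Proof.
move=> sq Sx Sy _ [t /= t0 <-]; rewrite -(sq.2 t y t0 Sy).
have := sq.1 _ _ (SD Sx (SZ t Sy)) (SN Sx); rewrite addrAC subrr add0r; lra.
Qed.

Lemma tilt_le q y x t : sublinear q -> S x -> S y -> 0 <= t ->
  tilt q y x <= q (x + t *: y) - t * q y.
Proof.
move=> sq Sx Sy t0; apply: ge_inf; last by exists t.
by exists (- q (- x)); exact: tilt_lb.
Qed.

Lemma tilt_ge q y x c : (forall t, 0 <= t -> c <= q (x + t *: y) - t * q y) ->
  c <= tilt q y x.
Proof.
move=> h; apply: lb_le_inf; first by exists (q (x + 0 *: y) - 0 * q y); exists 0 => //=.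
by move=> _ [t /= t0 <-]; exact: h.
Qed.

Lemma tilt_adherent q y x e : sublinear q -> S x -> S y -> 0 < e ->
  exists2 t, 0 <= t & q (x + t *: y) - t * q y < tilt q y x + e.
Proof.
move=> sq Sx Sy e0; have [|_ [t /= t0 <-] h] := @inf_adherent _ [set q (x + t *: y) - t * q y | t in [set t : R | 0 <= t]] _ e0.
  split; first by exists (q (x + 0 *: y) - 0 * q y); exists 0 => //=.
  by exists (- q (- x)); exact: tilt_lb.
by exists t.
Qed.

Lemma tilt_sublinear q y : sublinear q -> S y -> sublinear (tilt q y).
Proof.
move=> sq Sy; apply: sublinearI.
- move=> x1 x2 S1 S2; apply/ler_addgt0Pr => e e0; have e2 : 0 < e / 2 by lra.
  have [t1 t10 h1] := tilt_adherent sq S1 Sy e2.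
  have [t2 t20 h2] := tilt_adherent sq S2 Sy e2.
  have := tilt_le sq (SD S1 S2) Sy (addr_ge0 t10 t20).
  have := sq.1 _ _ (SD S1 (SZ t1 Sy)) (SD S2 (SZ t2 Sy)).
  by rewrite scalerDl mulrDl addrACA; lra.
- apply/eqP; rewrite eq_le; apply/andP; split.
    by have := tilt_le sq S0 Sy (lexx 0); rewrite scale0r addr0 mul0r (sublinear0 sq) subr0.
  apply: tilt_ge => t t0; rewrite add0r sq.2// subrr//.
- move=> a x a0 Sx; rewrite mulrC -ler_pdivrMr//; apply: tilt_ge => t t0.
  have := tilt_le sq (SZ a Sx) Sy (mulr_ge0 (ltW a0) t0).
  rewrite -scalerA -scalerDr sq.2 ?(ltW a0)//; last exact: SD (SZ _ _).
  by rewrite ler_pdivrMr//; lra.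
Qed.

Lemma tilt_le_id q y x : sublinear q -> S x -> S y -> tilt q y x <= q x.
Proof.
by move=> sq Sx Sy; have := tilt_le sq Sx Sy (lexx 0); rewrite scale0r addr0 mul0r subr0.
Qed.

Lemma tilt_opp q y : sublinear q -> S y -> tilt q y (- y) <= - q y.
Proof.
move=> sq Sy; have := tilt_le sq (SN Sy) Sy ler01.
by rewrite scale1r addNr (sublinear0 sq) mul1r sub0r.
Qed.

(** Zorn's lemma for the reversed pointwise order; the infimum of a chain is bounded below through
    [- p (- x)] and is again sublinear. *)
Lemma minimal_sublinear p : sublinear p -> exists q, [/\ sublinear q,
  forall x, S x -> q x <= p x &
  forall q', sublinear q' -> (forall x, S x -> q' x <= q x) -> forall x, S x -> q x <= q' x].
Proof.
move=> sp.
pose T := {q : V -> R | sublinear q /\ forall x, S x -> q x <= p x}.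
have pp : sublinear p /\ forall x, S x -> p x <= p x by split.
pose t0 : T := exist _ p pp.
pose le (a b : T) : bool := `[< forall x, S x -> sval b x <= sval a x >].
have [||A tot|[q [sq qp]] mq] := @ZL_preorder T t0 le.
- by move=> a; apply/asboolP.
- move=> r s t /asboolP rs /asboolP st; apply/asboolP => x Sx.
  exact: le_trans (st x Sx) (rs x Sx).
- have [A0|/set0P[a0 Aa0]] := eqVneq A set0; first by exists t0 => s; rewrite A0.
  pose E x := [set sval a x | a in A].
  have Elb x : S x -> lbound (E x) (- p (- x)).
    move=> Sx _ [[a [sa ap]] Aa <-] /=.
    by apply: le_trans (sublinear_opp sa Sx); rewrite lerN2; apply: (ap); exact: SN.
  have Ele x a : S x -> A a -> inf (E x) <= sval a x.
    by move=> Sx Aa; apply: ge_inf; [exists (- p (- x)); exact: Elb|exists a].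
  have Ead x e : S x -> 0 < e -> exists2 a, A a & sval a x < inf (E x) + e.
    move=> Sx e0; have [|_ [a Aa <-] h] := @inf_adherent _ (E x) _ e0; last by exists a.
    by split; [exists (sval a0 x); exists a0|exists (- p (- x)); exact: Elb].
  have sI : sublinear (fun x => inf (E x)).
    apply: sublinearI.
    + move=> x y Sx Sy; apply/ler_addgt0Pr => e e0; have e2 : 0 < e / 2 by lra.
      have [a Aa ha] := Ead x _ Sx e2; have [b Ab hb] := Ead y _ Sy e2.
      have [/asboolP|/asboolP] := tot a b Aa Ab => ab.
      * have := Ele _ _ (SD Sx Sy) Ab; have := (svalP b).1.1 _ _ Sx Sy.
        by have := ab x Sx; lra.
      * have := Ele _ _ (SD Sx Sy) Aa; have := (svalP a).1.1 _ _ Sx Sy.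
        by have := ab y Sy; lra.
    + rewrite (_ : E 0 = [set 0]) ?inf1//; apply/seteqP; split => [_ [[a [sa ap]] Aa <-]|_ ->] /=.
        by rewrite (sublinear0 sa).
      by exists a0 => //; rewrite (sublinear0 (svalP a0).1).
    + move=> a x a_gt0 Sx; rewrite mulrC -ler_pdivrMr//.
      apply: lb_le_inf; first by exists (sval a0 x); exists a0.
      move=> _ [b Ab <-]; rewrite ler_pdivrMr// mulrC -(svalP b).1.2 ?(ltW a_gt0)//.
      exact: Ele (SZ _ Sx) Ab.
  have Ip x : S x -> inf (E x) <= p x.
    by move=> Sx; apply: le_trans (Ele x a0 Sx Aa0) _; exact: (svalP a0).2.
  exists (exist (fun q => sublinear q /\ forall x, S x -> q x <= p x) (fun x => inf (E x)) (conj sI Ip)) => s As; apply/asboolP => x Sx /=.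
  exact: Ele.
- exists q; split => // q' sq' q'q x Sx.
  have q'p y : S y -> q' y <= p y by move=> Sy; exact: le_trans (q'q y Sy) (qp y Sy).
  have /asboolP := mq (exist (fun q => sublinear q /\ forall x, S x -> q x <= p x) q' (conj sq' q'p)) (introT (asboolP _) q'q).
  exact.
Qed.

(** On [S] a minimal sublinear [q] coincides with each of its tilts, so [q (- y) = - q y] and [q] is
    linear. Starting below [tilt p x0] forces the value at [x0]. *)
Lemma hahn_banach_sublinear p x0 : sublinear p -> S x0 -> exists f : V -> R,
  [/\ forall x y, S x -> S y -> f (x + y) = f x + f y,
      forall (a : R) x, S x -> f (a *: x) = a * f x,
      forall x, S x -> f x <= p x & f x0 = p x0].
Proof.
move=> sp Sx0; have sp0 := tilt_sublinear sp Sx0.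
have [q [sq qp mq]] := minimal_sublinear sp0.
have qN y : S y -> q (- y) = - q y.
  move=> Sy; apply/eqP; rewrite eq_le; apply/andP; split.
    have st := tilt_sublinear sq Sy.
    have := mq _ st (fun x Sx => tilt_le_id sq Sx Sy) _ (SN Sy).
    by move=> h; apply: le_trans h (tilt_opp sq Sy).
  by have := sublinear_opp sq (SN Sy); rewrite opprK; lra.
exists q; split.
- move=> x y Sx Sy; apply/eqP; rewrite eq_le sq.1//=.
  have := sq.1 _ _ (SN Sx) (SN Sy); rewrite -opprD !qN//; first lra.
  exact: SD.
- move=> a x Sx; have [a0|a0] := leP 0 a; first exact: sq.2.
  have := sq.2 (- a) x; rewrite scaleNr qN; last exact: SZ.
  by move=> h; have := h (_ : 0 <= - a) Sx; rewrite mulNr => /(_ ltac:(lra)) /oppr_inj.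
- by move=> x Sx; apply: le_trans (qp x Sx) (tilt_le_id sp Sx Sx0).
- apply/eqP; rewrite eq_le; apply/andP; split.
    by apply: le_trans (qp _ Sx0) (tilt_le_id sp Sx0 Sx0).
  have := qp _ (SN Sx0); have := tilt_opp sp Sx0; rewrite qN//; lra.
Qed.

End HahnBanach.

(** * Extension to bounded random variables *)

Section Dominated.
Context {R : realType} (sl su : R).
Hypotheses (Hsl : 0 <= sl) (Hsu : sl <= su).
Local Notation Omega := (path_space R).
Local Notation nested := (nested sl su).
Implicit Types (X : Omega -> R).

Definition bounded_rv X := exists M, forall w, `|X w| <= M.

Lemma skel_cst (c : R) : skel [::] `|c| (fun _ : R -> R => c).
Proof. by split => // g g'; rewrite subrr normr0 big_nil mulr0. Qed.

Lemma nested_cst (c : R) : nested (fun=> c) c.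
Proof.
exists [::], `|c|, (fun=> c), [::]; split => //; exact: skel_cst.
Qed.

Lemma nested_le X1 X2 c1 c2 : nested X1 c1 -> nested X2 c2 -> (forall w, X1 w <= X2 w) -> c1 <= c2.
Proof.
move=> h1 h2 le12.
have := @nested_cmp _ _ _ Hsl Hsu _ _ _ _ _ _ _ _ ler01 (lexx 0) h1 h2 (nested_cst 0).
by rewrite mul1r mul0r addr0; apply => w; rewrite mul1r addr0.
Qed.

Lemma nested_unique X c1 c2 : nested X c1 -> nested X c2 -> c1 = c2.
Proof.
by move=> h1 h2; apply/eqP; rewrite eq_le (nested_le h1 h2)// (nested_le h2 h1).
Qed.

Lemma skelW us us' C C' (X : (R -> R) -> R) : C <= C' -> skel us C X -> skel (us ++ us') C' X.
Proof.
move=> CC s; have C0 := skel_ge0 s; have [h1 h2] := s.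
split => [g|g g']; first exact: le_trans (h1 g) CC.
apply: le_trans (h2 g g') _; rewrite big_cat /=; apply: ler_pM => //.
  exact: sumr_ge0.
by rewrite lerDl; exact: sumr_ge0.
Qed.

Lemma skelC us us' C (X : (R -> R) -> R) : skel (us ++ us') C X -> skel (us' ++ us) C X.
Proof.
move=> [h1 h2]; split => // g g'; apply: le_trans (h2 g g') _.
by rewrite !big_cat /= addrC.
Qed.

Lemma skelD us us' C C' (X X' : (R -> R) -> R) : skel us C X -> skel us' C' X' ->
  skel (us ++ us') (C + C') (fun g => X g + X' g).
Proof.
move=> s s'; have C0 := skel_ge0 s; have C'0 := skel_ge0 s'.
have [h1 h2] := skelW us' (lexx C) s; have [h1' h2'] := skelC (skelW us (lexx C') s').
split => [g|g g'].
  by apply: le_trans (ler_normD _ _) _; exact: lerD.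
rewrite opprD addrACA mulrDl; apply: le_trans (ler_normD _ _) _; exact: lerD.
Qed.

Lemma skelZ us C (X : (R -> R) -> R) (a : R) : skel us C X -> skel us (`|a| * C) (fun g => a * X g).
Proof.
move=> [h1 h2]; split => [g|g g']; first by rewrite normrM ler_wpM2l.
by rewrite -mulrBr normrM -mulrA ler_wpM2l.
Qed.

Lemma nestedD X1 X2 c1 c2 : nested X1 c1 -> nested X2 c2 ->
  exists2 c, nested (fun w => X1 w + X2 w) c & c <= c1 + c2.
Proof.
move=> n1 n2; have [us1 [C1 [Xh1 [_ [s1 _ _ e1 _]]]]] := n1.
have [us2 [C2 [Xh2 [_ [s2 _ _ e2 _]]]]] := n2.
have [c n] : exists c, nested (fun w => X1 w + X2 w) c.
  by eexists; apply: skel_nested (skelD s1 s2) _ => w; rewrite e1 e2.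
exists c => //; have := @nested_cmp _ _ _ Hsl Hsu _ _ _ _ _ _ _ _ ler01 ler01 n n1 n2.
by rewrite !mul1r; apply => w; rewrite !mul1r.
Qed.

Lemma nestedZ X c (a : R) : 0 <= a -> nested X c ->
  exists2 c', nested (fun w => a * X w) c' & c' <= a * c.
Proof.
move=> a0 n; have [us [C [Xh [_ [s _ _ e _]]]]] := n.
have [c' n'] : exists c, nested (fun w => a * X w) c.
  by eexists; apply: skel_nested (skelZ a s) _ => w; rewrite e.
exists c' => //; have := @nested_cmp _ _ _ Hsl Hsu _ _ _ _ _ _ _ _ a0 (lexx 0) n' n (nested_cst 0).
by rewrite mul0r addr0; apply => w; rewrite addr0.
Qed.

(** Going beyond cylinder variables is what allows dominated functionals to be evaluated at
    indicators of path events. *)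
Definition upper_value X := inf [set c | exists2 X', nested X' c & forall w, X w <= X' w].

Lemma upper_value_lb X M : (forall w, `|X w| <= M) ->
  lbound [set c | exists2 X', nested X' c & forall w, X w <= X' w] (- M).
Proof.
move=> h c [X' n le]; apply: nested_le (nested_cst _) n _ => w.
by apply: le_trans (le w); have := h w; rewrite ler_norml => /andP[].
Qed.

Lemma upper_value_le X X' c : bounded_rv X -> nested X' c -> (forall w, X w <= X' w) ->
  upper_value X <= c.
Proof.
move=> [M h] n le; apply: ge_inf; last by exists X'.
by exists (- M); exact: upper_value_lb.
Qed.

Lemma upper_value_adherent X e : bounded_rv X -> 0 < e ->
  exists X' c, [/\ nested X' c, forall w, X w <= X' w & c < upper_value X + e].
Proof.
move=> [M h] e0; have [|c [X' n le] lt] := @inf_adherent _ [set c | exists2 X', nested X' c & forall w, X w <= X' w] _ e0.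
  split; last by exists (- M); exact: upper_value_lb.
  by exists M, (fun=> M); [exact: nested_cst|move=> w; exact: le_trans (ler_norm _) (h w)].
by exists X', c.
Qed.

Lemma upper_value_nested X c : nested X c -> upper_value X = c.
Proof.
move=> n; have [us [C [Xh [_ [s _ _ e _]]]]] := n.
have bX : bounded_rv X by exists C => w; rewrite e; exact: s.1.
apply/eqP; rewrite eq_le (upper_value_le bX n)//=.
apply: lb_le_inf; first by exists c, X.
by move=> c' [X' n' le]; exact: nested_le n n' le.
Qed.

Lemma bounded_rvD X X' : bounded_rv X -> bounded_rv X' -> bounded_rv (X + X').
Proof.
move=> [M h] [M' h']; exists (M + M') => w.
by apply: le_trans (ler_normD _ _) _; exact: lerD.
Qed.

Lemma bounded_rvZ (a : R) X : bounded_rv X -> bounded_rv (a *: X).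
Proof. by move=> [M h]; exists (`|a| * M) => w; rewrite normrM ler_wpM2l. Qed.

Lemma bounded_rv_cst (a : R) : bounded_rv (fun=> a).
Proof. by exists `|a|. Qed.

Lemma upper_value_sublinear : sublinear bounded_rv upper_value.
Proof.
apply: sublinearI.
- exact: bounded_rvZ.
- move=> X X' bX bX'; apply/ler_addgt0Pr => e e0; have e2 : 0 < e / 2 by lra.
  have [Y [c [n le lt]]] := upper_value_adherent bX e2.
  have [Y' [c' [n' le' lt']]] := upper_value_adherent bX' e2.
  have [c'' n'' cc] := nestedD n n'.
  have := upper_value_le (bounded_rvD bX bX') n'' (fun w => lerD (le w) (le' w)); lra.
- by rewrite (upper_value_nested (nested_cst 0)).
- move=> a X a0 bX; apply/ler_addgt0Pr => e e0; have ea : 0 < e / a by exact: divr_gt0.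
  have [Y [c [n le lt]]] := upper_value_adherent bX ea.
  have [c' n' cc] := nestedZ (ltW a0) n.
  have := upper_value_le (bounded_rvZ a bX) n' (fun w => ler_wpM2l (ltW a0) (le w)).
  move: lt; rewrite -ltrBlDr -(ltr_pM2l a0) mulrBr mulrCA divff ?gt_eqF// mulr1; lra.
Qed.

(* A linear functional dominated by the G-expectation; it will be realized as
   the expectation under a probability measure of [calP]. *)
Definition dominated (f : (Omega -> R) -> R) :=
  [/\ forall X X', bounded_rv X -> bounded_rv X' -> f (fun w => X w + X' w) = f X + f X',
      forall (a : R) X, bounded_rv X -> f (fun w => a * X w) = a * f X,
      forall X X', bounded_rv X -> bounded_rv X' -> (forall w, X w <= X' w) -> f X <= f X' &
      forall X c, nested X c -> f X <= c].

Lemma dominated_exists X0 c0 : nested X0 c0 -> exists2 f, dominated f & f X0 = c0.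
Proof.
move=> n0; have bn X c : nested X c -> bounded_rv X.
  by move=> [us [C [Xh [_ [s _ _ e _]]]]]; exists C => w; rewrite e; exact: s.1.
have [f [fD fZ fp f0]] := hahn_banach_sublinear (bounded_rv_cst 0) bounded_rvD bounded_rvZ
  upper_value_sublinear (bn _ _ n0).
exists f; last by rewrite f0 (upper_value_nested n0).
split => //.
- move=> X X' bX bX' le; have bN := bounded_rvZ (-1) bX'.
  have := fp _ (bounded_rvD bX bN); rewrite fD// fZ// => h.
  have := upper_value_le (bounded_rvD bX bN) (nested_cst 0).
  have H w : (X + -1 *: X') w <= 0 by rewrite /= scaleN1r subr_le0.
  by move=> /(_ H); lra.
- by move=> X c n; apply: le_trans (fp _ (bn _ _ n)) _; rewrite (upper_value_nested n).
Qed.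

Lemma dominated_cst f (c : R) : dominated f -> f (fun=> c) = c.
Proof.
move=> [_ fZ _ fn]; have b1 := bounded_rv_cst 1.
apply/eqP; rewrite eq_le (fn _ _ (nested_cst c))/=.
have := fn _ _ (nested_cst (- c)).
have -> : (fun _ : Omega => - c) = fun w => -1 * (fun=> c) w by apply/funext => w; rewrite mulN1r.
by rewrite fZ; [lra|exact: bounded_rv_cst].
Qed.

Lemma dominated_sum f (I : Type) (r : seq I) (P : pred I) (F : I -> Omega -> R) : dominated f ->
  (forall i, bounded_rv (F i)) ->
  f (fun w => \sum_(i <- r | P i) F i w) = \sum_(i <- r | P i) f (F i) /\
  bounded_rv (fun w => \sum_(i <- r | P i) F i w).
Proof.
move=> df bF; elim: r => [|i r [IH b]].
  rewrite big_nil -[RHS](dominated_cst 0 df); split.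
    by congr f; apply/funext => w; rewrite big_nil.
  by exists 0 => w; rewrite big_nil normr0.
have [fD _ _ _] := df.
rewrite big_cons; case: ifP => Pi; last first.
  by split; [rewrite -IH; congr f; apply/funext => w|move: b; congr bounded_rv; apply/funext => w]; rewrite big_cons Pi.
split.
  by rewrite -IH -fD//; congr f; apply/funext => w; rewrite big_cons Pi.
have := bounded_rvD (bF i) b; congr bounded_rv; apply/funext => w.
by rewrite big_cons Pi.
Qed.

(** Conditioning on the path up to [s]: the outer evolutions preserve a bound valid for every past,
    so only the last heat step has to be estimated. *)
Lemma nested_last us C Xh (X : Omega -> R) (s t c c' : R) : 0 <= s -> s < t ->
  skel us C Xh -> (forall r, r \in us -> r <= s \/ r = t) ->
  (forall w : Omega, X w = Xh w) -> nested X c' ->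
  (forall g, flat s g -> heat sl su (fun y => Xh (step g t y)) (t - s) 0 <= c) -> c' <= c.
Proof.
move=> s0 st sk ust e n H.
pose ts := nodes (s :: [seq r <- us | r <= s]).
have pts := path_nodes (s :: [seq r <- us | r <= s]).
have tss r : r \in ts -> r <= s.
  rewrite mem_sort mem_undup mem_filter inE => /andP[_ /predU1P[->//|]].
  by rewrite mem_filter => /andP[].
have lasts : last 0 ts = s.
  have [s0'|s0'] := leP s 0.
    have z : s = 0 by apply/eqP; rewrite eq_le s0'.
    case E : ts => [//|a l]; have := mem_last a l; rewrite -[in X in X -> _]E => h.
    apply/eqP; rewrite eq_le tss//= z -z.
    by have := path_gt0 pts; rewrite -/ts => /(_ _ h); rewrite z => /ltW.
  have sts : s \in ts.
    by have [|//] := mem_nodes (mem_head s [seq r <- us | r <= s]); rewrite leNgt s0'.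
  have tsn : last 0 ts \in ts by case: (ts) sts => [//|a l] _ /=; exact: mem_last.
  apply/eqP; rewrite eq_le tss//=.
  have /(nthP 0)[k km ks] := sts.
  rewrite -[X in X <= _]ks (last_nth 0) -[X in X <= _]/(node ts k.+1) -[X in _ <= X]/(node ts (size ts)).
  exact: node_le.
have p' : path.path <%R 0 (rcons ts t) by rewrite rcons_path pts /= lasts.
have n' : nested X (nest sl su 0 (fun=> 0) (rcons ts t) Xh).
  exists us, C, Xh, (rcons ts t); split => // r rus.
  have [rs|->] := ust r rus; last by right; rewrite mem_rcons mem_head.
  have [||rts] := @mem_nodes _ (s :: [seq r <- us | r <= s]) r; [by rewrite inE mem_filter rs rus orbT|by move=> ?; left|].
  by right; rewrite mem_rcons inE rts orbT.
rewrite (nested_unique n n') -cats1 nest_cat /= lasts.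
have sk' : skel us C (fun g => nest sl su s g [:: t] Xh).
  by apply: nest_skel => //=; rewrite st.
apply: (nest_le Hsl Hsu sk' (lexx 0) pts) => // g; rewrite lasts => fg.
exact: H.
Qed.

End Dominated.

(** * Realization by probability measures on path space *)

Section UniformMeasure.
Context {R : realType}.

Definition unif01 : set (measurableTypeR R) -> \bar R := mrestr (@lebesgue_measure R) (measurable_itv `[0, 1[).

HB.instance Definition _ := Measure.on unif01.

Lemma unif01_setT : unif01 setT = 1%E.
Proof. by rewrite /unif01 /mrestr setTI lebesgue_measure_itv /= lte01 oppr0 adde0. Qed.

HB.instance Definition _ := Measure_isProbability.Build _ _ _ unif01 unif01_setT.

Lemma unif01_itv (a b : R) : 0 <= a -> a <= b -> b <= 1 -> unif01 `[a, b[%classic = (b - a)%:E.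
Proof.
move=> a0 ab b1; rewrite /unif01 /mrestr setIidl; last first.
  by move=> x /=; rewrite !in_itv/= => /andP[h1 h2]; rewrite (le_trans a0 h1) (lt_le_trans h2 b1).
rewrite lebesgue_measure_itv/= lte_fin; case: ltP => // ba.
by have -> : a = b; [apply/eqP; rewrite eq_le ab|rewrite subrr].
Qed.

End UniformMeasure.

(** * Coding a sequence of events by points of the unit interval *)

Section BinaryDigits.
Context {R : realType} (sl su : R).
Local Notation Omega := (path_space R).
Variables (f : (Omega -> R) -> R) (e : nat -> Omega -> bool).
Hypothesis (df : dominated sl su f).

(** The newest digit stands first, so that refining a word is a [cons]. *)
Fixpoint word (d : nat -> bool) n := if n is m.+1 then d m :: word d m else [::].

Lemma size_word d n : size (word d n) = n.
Proof. by elim: n => //= n ->. Qed.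

Let cyl s (w : Omega) : R := (word (e^~ w) (size s) == s)%:R.
Let nu s := f (cyl s).

Let bcyl s : bounded_rv (cyl s).
Proof. by exists 1 => w; rewrite /cyl ger0_norm ?ler0n// lern1 leq_b1. Qed.

Let nu_ge0 s : 0 <= nu s.
Proof.
have [_ _ fm _] := df; rewrite -(dominated_cst 0 df); by apply: fm => //; exact: bounded_rv_cst.
Qed.

Let nu_nil : nu [::] = 1.
Proof. by rewrite -[RHS](dominated_cst 1 df); congr f; apply/funext. Qed.

Let nu_cons s : nu s = nu (false :: s) + nu (true :: s).
Proof.
have [fD _ _ _] := df; rewrite /nu -fD//; congr f; apply/funext => w.
rewrite /cyl /= !eqseq_cons.
by case: (e (size s) w); rewrite /= ?add0r ?addr0.
Qed.

(** For words [s] of a fixed length the intervals [[left_end s, left_end s + nu s[] partition [[0,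
    1[], and a further digit splits each of them in two; [rword] finds the interval containing
    [x]. *)
Fixpoint left_end s : R :=
  if s is b :: s' then left_end s' + (if b then nu (false :: s') else 0) else 0.

Let left_itv s : 0 <= left_end s /\ left_end s + nu s <= 1.
Proof.
elim: s => [|b s [h1 h2]] /=; first by rewrite nu_nil add0r.
have := nu_cons s; have := nu_ge0 (true :: s); have := nu_ge0 (false :: s).
by case: b; lra.
Qed.

Fixpoint rword (x : R) n := if n is m.+1 then
  let s := rword x m in (left_end s + nu (false :: s) <= x) :: s else [::].

Definition digit n x := head false (rword x n.+1).

Lemma rword_word x n : rword x n = word (digit^~ x) n.
Proof. by elim: n => //= n IH; rewrite -IH. Qed.

Let size_rword x n : size (rword x n) = n.
Proof. by rewrite rword_word size_word. Qed.

Let rword_itv x s : 0 <= x < 1 ->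
  (rword x (size s) == s) = (left_end s <= x < left_end s + nu s).
Proof.
move=> x01; elim: s => [|b s IH] /=; first by rewrite nu_nil eqxx add0r.
rewrite eqseq_cons; have [E|NE] := eqVneq (rword x (size s)) s.
- rewrite E; move: IH; rewrite E eqxx => /esym/andP[h1 h2].
  have := nu_cons s; case: b => hn; rewrite andbT.
    rewrite eqb_id -addrA -hn h2 andbT//.
  by rewrite addr0 h1 /= eqbF_neg -ltNge.
- rewrite andbF; apply/esym/negbTE; move: IH; rewrite (negbTE NE) => /esym/negbT.
  apply: contra => /andP[h1 h2]; move: h1 h2.
  have := nu_cons s; have := nu_ge0 (true :: s); have := nu_ge0 (false :: s).
  by case: b => k1 k2 k3 h1 h2; apply/andP; split; lra.
Qed.

Let measurable_rword n s : measurable ([set x | rword x n = s] : set (measurableTypeR R)).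
Proof.
elim: n s => [|n IH] s.
  by case: (eqVneq [::] s) => [<-|/eqP E]; [rewrite (_ : [set _ | _] = setT)//; apply/seteqP|
    rewrite (_ : [set _ | _] = set0)//; apply/seteqP; split => // x].
case: s => [|b s]; first by rewrite (_ : [set _ | _] = set0)//; apply/seteqP; split.
pose c := left_end s + nu (false :: s).
have -> : [set x | rword x n.+1 = b :: s] =
    [set x | rword x n = s] `&` (if b then `[c, +oo[%classic else `]-oo, c[%classic).
  apply/seteqP; split => x /=.
    move=> [hb hs]; split => //; rewrite hs -/c in hb.
    by case: b hb => hb; rewrite /= in_itv/= ?andbT// ltNge hb.
  move=> [hs]; rewrite hs -/c => hb; congr (_ :: _).
  by case: b hb; rewrite /= in_itv/= ?andbT// => h; apply/negbTE; rewrite -ltNge.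
by apply: measurableI; [exact: IH|case: b; exact: measurable_itv].
Qed.

Lemma measurable_digits n (g : seq bool -> R) :
  measurable_fun setT (fun x : measurableTypeR R => g (word (digit^~ x) n)).
Proof.
rewrite (_ : (fun x => _) = fun x => \sum_(s : n.-tuple bool) g s * \1_[set x | rword x n = s] x); last first.
  apply/funext => x; rewrite -rword_word.
  have sz : size (rword x n) == n by rewrite size_rword.
  rewrite (bigD1 (Tuple sz))//= indicE mem_set// mulr1 big1 ?addr0// => s sx.
  rewrite indicE memNset ?mulr0//= => E; move/eqP : sx; apply; exact: val_inj.
apply: measurable_sum => s; apply: measurable_funM; first exact: measurable_cst.
by apply: measurable_indic; exact: measurable_rword.
Qed.

(** [f] is only finitely additive, but finitely many digits involve finitely many intervals;
    countable additivity is supplied by Lebesgue measure. *)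
Lemma integral_digits n (g : seq bool -> R) :
  (\int[unif01]_x (g (word (digit^~ x) n))%:E)%E = (f (fun w => g (word (e^~ w) n)))%:E.
Proof.
have mr := measurable_rword n.
under eq_integral => x _.
  rewrite -rword_word.
  rewrite (_ : (g _)%:E = (\sum_(s : n.-tuple bool) (g s * \1_[set x | rword x n = s] x)%:E)%E); last first.
    have sz : size (rword x n) == n by rewrite size_rword.
    rewrite (bigD1 (Tuple sz))//= indicE mem_set// mulr1 big1 ?adde0// => s sx.
    rewrite indicE memNset ?mulr0//= => E; move/eqP : sx; apply; exact: val_inj.
  over.
have ii (s : n.-tuple bool) : unif01.-integrable setT (fun x => (g s * \1_[set x | rword x n = s] x)%:E).
  apply: (@integrableZl _ _ _ unif01 setT measurableT (g s) (fun x => (\1_[set x | rword x n = s] x)%:E)).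
  by apply: integrable_indic.
rewrite integral_sum//.
have -> : (fun w => g (word (e^~ w) n)) = fun w => \sum_(s : n.-tuple bool) g s * cyl s w.
  apply/funext => w; have sz : size (word (e^~ w) n) == n by rewrite size_word.
  rewrite (bigD1 (Tuple sz))//= /cyl /= size_word eqxx mulr1 big1 ?addr0// => s sx.
  rewrite size_tuple (_ : _ == _ = false) ?mulr0//.
  by apply: contraNF sx => /eqP E; apply/eqP/val_inj; rewrite /= E.
have [fD fZ _ _] := df.
rewrite (dominated_sum _ _ df _).1; last by move=> s; exact: bounded_rvZ.
rewrite -sumEFin; apply: eq_bigr => s _; rewrite fZ//.
under eq_integral do rewrite EFinM.
rewrite integralZl//; last exact: integrable_indic.
rewrite integral_indic// setIT EFinM; congr (_ * _)%E.
have [l0 l1] := left_itv s; have n0 := nu_ge0 s.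
rewrite -[RHS]/((nu s)%:E) -[in RHS](addrK (left_end s) (nu s)) (addrC (nu s)).
rewrite -unif01_itv//; last by rewrite lerDl.
rewrite /unif01 /mrestr; congr lebesgue_measure; apply/seteqP; split => x /=.
  move=> [h x01]; split => //; rewrite in_itv/= in x01; rewrite in_itv/= -rword_itv// size_tuple h//.
move=> [h x01]; split => //; rewrite in_itv/= in x01; rewrite in_itv/= -rword_itv// size_tuple in h.
exact/eqP.
Qed.

End BinaryDigits.

Section MaxMin.
Context {R : realType}.

Lemma max_lip (c x y : R) : `|Num.max c x - Num.max c y| <= `|x - y|.
Proof.
have := ler_norm (x - y); have := ler_norm (y - x); rewrite (distrC y x).
by case: (leP c x) => ?; case: (leP c y) => ?; rewrite ler_norml; qlra.
Qed.

Lemma min_lip (c x y : R) : `|Num.min c x - Num.min c y| <= `|x - y|.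
Proof.
have := ler_norm (x - y); have := ler_norm (y - x); rewrite (distrC y x).
by case: (leP c x) => ?; case: (leP c y) => ?; rewrite ler_norml; qlra.
Qed.

End MaxMin.

(** * Borel sets of the path space *)

Section PathMeasurability.
Context {R : realType}.
Local Notation Omega := (path_space R).

Lemma path_open_measurable (U : set Omega) : path_open U -> measurable U.
Proof. by move=> h; exact: sub_sigma_algebra. Qed.

Lemma measurable_B (t : R) : measurable_fun setT (@B R t).
Proof.
move=> mD; apply: (measurability _ (RGenOInfty.measurableE R)) => //.
move=> /= _ [_ [a ->] <-]; rewrite setTI; apply: path_open_measurable => w /=.
rewrite in_itv/= andbT => aw; exists `|t|, (B t w - a); split; first by rewrite subr_gt0.
move=> w' h; rewrite /= in_itv/= andbT.
have [t0|t0] := leP 0 t.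
  have := h t; rewrite t0 ler_norm => /(_ isT); rewrite ltr_distlC /B; qlra.
by move: aw; rewrite /B !path_le0// ltW.
Qed.

Lemma continuous_unif (w : R -> R) (n e : R) : continuous w -> 0 < e ->
  exists2 d, 0 < d & forall z s, 0 <= z <= n -> `|s| <= d -> `|w z - w (z + s)| <= e.
Proof.
move=> cw e0.
have cu : cont2 (fun s z => w (z + s)).
  move=> z; apply: (@cvg_comp _ _ _ (fun z : R * R => z.2 + z.1) w _ _ _ _ (cw _)).
  by apply: cvgD; [exact: cvg_snd|exact: cvg_fst].
have [d /= d0 H] := cont2_tube 0 0 n cu e0.
exists (d / 2); first by rewrite divr_gt0.
move=> z s zn sd; have := H s _ z _; rewrite addr0; apply.
  by rewrite /= sub0r normrN; qlra.
by qlra.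
Qed.

(* The basic neighbourhoods: uniform closeness on [0, n] to a rational step
   function of mesh 1 / (m + 1), tested at rational times only. *)
Definition rat_step (m : nat) (a : seq rat) (t : R) : R :=
  ratr (nth 0%Q a (Num.truncn (t * m.+1%:R))).

Definition tube (n m r : nat) (a : seq rat) : set Omega :=
  [set w : Omega | forall q : rat, 0 <= (ratr q : R) <= n%:R ->
    `|w (ratr q : R) - rat_step m a (ratr q : R)| <= r.+1%:R^-1].

Lemma path_open_tube (U : set Omega) w : path_open U -> U w ->
  exists n m r a, tube n m r a w /\ tube n m r a `<=` U.
Proof.
move=> oU /oU[T [e [e0 H]]].
pose n := (Num.truncn `|T|).+2.
have nT : T + 1 < n%:R.
  have := truncnS_gt `|T|; have := ler_norm T; rewrite /n -[_.+2%:R]natr1; qlra.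
pose r := Num.truncn (2 / e).
have r0 : (0 : R) < r.+1%:R by rewrite ltr0n.
have re : 2 * r.+1%:R^-1 < e.
  by have := truncnS_gt (2 / e); rewrite -/r ltr_pdivrMr// ltr_pdivrMr// mulrC.
pose h : R := r.+1%:R^-1; have h0 : 0 < h by rewrite invr_gt0.
have [d d0 wd] := @continuous_unif w n%:R _ (@path_continuous _ w) (divr_gt0 h0 (ltr0n _ 2)).
pose m := Num.truncn d^-1; have m0 : (0 : R) < m.+1%:R by rewrite ltr0n.
have md : m.+1%:R^-1 <= d by rewrite invf_ple ?posrE//; exact: ltW (truncnS_gt _).
have [a_ aP] : exists a_ : nat -> rat, forall j, `|w (j%:R / m.+1%:R) - ratr (a_ j)| <= h / 2.
  suff /choice[a_ aP] : forall j : nat, exists q : rat, `|w (j%:R / m.+1%:R) - ratr q| <= h / 2 by exists a_.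
  move=> j; have lt : w (j%:R / m.+1%:R) < w (j%:R / m.+1%:R) + h / 2 by qlra.
  have [q] := rat_in_itvoo lt; rewrite in_itv/= => /andP[q1 q2].
  by exists q; rewrite ler_norml; qlra.
exists n, m, r, (mkseq a_ (n * m.+1).+1).
have tw : tube n m r (mkseq a_ (n * m.+1).+1) w.
  move=> q /andP[q0 qn]; rewrite /rat_step; set j := Num.truncn _.
  have qm0 : 0 <= ratr q * m.+1%:R :> R by rewrite mulr_ge0.
  have /andP[j1 j2] := truncn_itv qm0; rewrite -/j in j1 j2.
  have jn : (j < (n * m.+1).+1)%N.
    rewrite ltnS -(ler_nat R) natrM; apply: le_trans j1 _; exact: ler_wpM2r (ltW m0) _ _ qn.
  rewrite nth_mkseq//; have := aP j; have := wd (ratr q) (j%:R / m.+1%:R - ratr q).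
  rewrite q0 qn subrKC => /(_ isT) wq aj.
  have qj : `|j%:R / m.+1%:R - ratr q| <= d :> R.
    apply: le_trans md; rewrite -[j.+1%:R]natr1 in j2.
    have k1 : j%:R / m.+1%:R <= ratr q :> R by rewrite ler_pdivrMr.
    have k2 : ratr q <= j%:R / m.+1%:R + m.+1%:R^-1 :> R.
      by rewrite -[X in _ + X]mul1r -mulrDl ler_pdivlMr// ltW.
    have := ltW m0; rewrite -invr_ge0 ler_norml; move: k1 k2; set y := _ / _; set x := _^-1; qlra.
  have {}wq := wq qj.
  have -> : w (ratr q) - ratr (a_ j) = (w (ratr q) - w (j%:R / m.+1%:R)) + (w (j%:R / m.+1%:R) - ratr (a_ j)) by ring.
  by apply: le_trans (ler_normD _ _) _; rewrite -/h; qlra.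
split => // w' tw'; apply: H => t_; move: (t_ : R) => t /andP[t0 tT].
apply: le_lt_trans re; rewrite -/h; apply/ler_addgt0Pr => y_; move: (y_ : R) => y y0.
have y2 : 0 < y / 2 by qlra.
have n1 : \forall s \near nbhs t, `|w t - w s| <= y / 2 by move/cvgrPdist_le : (@path_continuous _ w t); apply.
have n2 : \forall s \near nbhs t, `|w' t - w' s| <= y / 2 by move/cvgrPdist_le : (@path_continuous _ w' t); apply.
have [c /= c0 cH] := filterI n1 n2.
have lt : t < t + Num.min c 1 by rewrite ltrDl lt_min c0 ltr01.
have [q] := rat_in_itvoo lt; rewrite in_itv/= => /andP[q1 q2].
have c1 : Num.min c 1 <= c /\ Num.min c 1 <= 1 by rewrite !ge_min !lexx orbT.
have [] := cH (ratr q); first by rewrite /= distrC gtr0_norm; qlra.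
move=> k1 k2; have q0n : 0 <= (ratr q : R) <= n%:R by apply/andP; split; qlra.
have := tw q q0n; have := tw' q q0n; rewrite -/h; set z := rat_step _ _ _ => k3 k4.
move: k1 k2 k3 k4; rewrite !ler_norml; qlra.
Qed.

(** An open set is a countable union of tubes, and a tube is tested at countably many times; hence
    coordinates decide measurability. *)
Lemma measurable_path d (T : measurableType d) (Phi : T -> Omega) :
  (forall t, 0 <= t -> measurable_fun setT (fun x => Phi x t)) -> measurable_fun setT Phi.
Proof.
move=> mPhi; apply: (measurability (@path_open R)) => // _ [U oU <-]; rewrite setTI.
pose A k : set Omega := if unpickle k is Some (n, m, r, a) then
  (if `[< tube n m r a `<=` U >] then tube n m r a else set0) else set0.
have -> : Phi @^-1` U = \bigcup_k (Phi @^-1` A k).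
  apply/seteqP; split => x /=.
    move=> /(path_open_tube oU)[n [m [r [a [tw tU]]]]].
    exists (pickle (n, m, r, a)); first exact: I.
    change (A (pickle (n, m, r, a)) (Phi x)); rewrite /A pickleK.
    by case: asboolP.
  move=> [k _] /=; rewrite /A; case: unpickle => // -[[[n m] r] a].
  by case: asboolP => // tU /tU.
apply: bigcupT_measurable => k; rewrite /A.
case: unpickle => [[[[n m] r] a]|]; last by rewrite preimage_set0.
case: asboolP => _; last by rewrite preimage_set0.
rewrite (_ : _ @^-1` _ = \bigcap_(q in [set q : rat | 0 <= (ratr q : R) <= n%:R])
  ((fun x => Phi x (ratr q)) @^-1` [set y | `|y - rat_step m a (ratr q)| <= r.+1%:R^-1])); last first.
  by apply/seteqP; split => x /= h q; exact: h.
rewrite -[X in measurable X]setCK setC_bigcap; apply: measurableC.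
rewrite bigcup_mkcond; apply: bigcupT_measurable_rat => q; case: ifPn => // /[!inE] /andP[q0 _].
apply: measurableC.
rewrite -[X in measurable X]setTI; apply: mPhi => //.
rewrite (_ : [set y | _] = `[rat_step m a (ratr q) - r.+1%:R^-1,
  rat_step m a (ratr q) + r.+1%:R^-1]%classic); first exact: measurable_itv.
by apply/seteqP; split => y /=; rewrite in_itv/= ler_distl.
Qed.

End PathMeasurability.

(** * Fourth moments of increments *)

Section Chebyshev.
Context {R : realType} (sl su : R).
Hypotheses (Hsl : 0 <= sl) (Hsu : sl <= su).
Local Notation Omega := (path_space R).
Local Notation G := (Defs.G sl su).

Lemma heat_barrier phi (C L c p q M d : R) : blip C L phi -> 0 < M -> 0 <= d ->
  (forall z, phi z <= c + p * z + q / 2 * z ^+ 2 + M * z ^+ 4) ->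
  heat sl su phi d 0 <= c + G q * d + 3 * M * (su ^+ 2) ^+ 2 * d ^+ 2.
Proof.
move=> b M0 d0 H; have [C' [h1 _ [h3 h3'] h4]] := heat_gsol Hsl Hsu b.
have := @vsub_barrier _ G _ (su ^+ 2) C' (G q) c p q M 0 0 d (sqr_ge0 su)
  (fun a b => @G_addr _ _ _ Hsl Hsu a b) h1 h3.
rewrite add0r; apply => //.
- by move=> t y _; apply: le_trans (ler_norm _) (h3' t y).
- exact: G_norm.
- by move=> z; rewrite h4 subr0.
Qed.

(** A fourth power made bounded and Lipschitz, so that it gives cylinder variables;
    [N ^+ 4 * clip4 (y / N)] equals $\min(N,|y|)^4$ for [N > 0]. *)
Definition clip4 (y : R) : R := Num.min 1 `|y| ^+ 4.

Lemma clip4_ge0 y : 0 <= clip4 y.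
Proof. by rewrite exprn_ge0// le_min ler01 normr_ge0. Qed.

Lemma clip4_le1 y : clip4 y <= 1.
Proof. by rewrite exprn_ile1// ?le_min ?ler01 ?normr_ge0// ge_min lexx. Qed.

Lemma clip4_le y : clip4 y <= y ^+ 4.
Proof.
rewrite -(@ger0_norm _ (y ^+ 4)) ?normrX; last by rewrite (_ : 4 = 2 * 2)%N// exprM sqr_ge0.
by rewrite lerXn2r ?nnegrE ?le_min ?ler01 ?normr_ge0// ge_min lexx orbT.
Qed.

Lemma clip4_1 y : 1 <= `|y| -> clip4 y = 1.
Proof. by move=> y1; rewrite /clip4 min_l// expr1n. Qed.

Lemma clip4_lip x y : `|clip4 x - clip4 y| <= 4 * `|x - y|.
Proof.
have H a b : 0 <= a <= 1 -> 0 <= b <= 1 -> `|a ^+ 4 - b ^+ 4| <= 4 * `|a - b| :> R.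
  move=> /andP[a0 a1] /andP[b0 b1].
  have -> : a ^+ 4 - b ^+ 4 = (a - b) * ((a + b) * (a ^+ 2 + b ^+ 2)) by ring.
  have s0 : 0 <= a + b <= 2 by apply/andP; split; lra.
  have t0 : 0 <= a ^+ 2 + b ^+ 2 <= 2 by apply/andP; split; nra.
  rewrite normrM mulrC ler_wpM2r// ger0_norm; first by move: s0 t0 => /andP[? ?] /andP[? ?]; nra.
  by move: s0 t0 => /andP[? ?] /andP[? ?]; exact: mulr_ge0.
have I (z : R) : (0 <= Num.min 1 `|z|) && (Num.min 1 `|z| <= 1).
  by apply/andP; split; [rewrite le_min ler01 normr_ge0|rewrite ge_min lexx].
apply: le_trans (H _ _ (I x) (I y)) _; rewrite ler_pM2l//.
have h := ler_dist_dist x y; apply: le_trans h.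
by case: (leP 1 `|x|) => ?; case: (leP 1 `|y|) => ?; rewrite ?subrr ?normr0 ?normr_ge0// ler_norml; have := ler_norm (`|x| - `|y|); have := ler_norm (- (`|x| - `|y|)); rewrite normrN; lra.
Qed.

(** The barrier with zero linear and quadratic parts and $M = c^{-4}$; as [G 0 = 0], only the
    fourth-moment term is left. The exponent 2 of [t - s] exceeds 1, as Kolmogorov's argument
    requires. *)
Lemma dominated_chebyshev f (s t c : R) : dominated sl su f -> 0 <= s -> 0 <= t -> 0 < c ->
  f (fun w : Omega => (c <= `|w t - w s|)%R%:R) <= 3 * (su ^+ 2) ^+ 2 * (t - s) ^+ 2 / c ^+ 4.
Proof.
move=> df; wlog st : s t / s <= t => [H|] s0 t0 c0.
  have [st|/ltW ts] := leP s t; first exact: H.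
  have := H _ _ ts t0 s0 c0; rewrite -(sqrrN (s - t)) opprB; congr (_ <= _).
  by congr f; apply/funext => w; rewrite distrC.
have [<-|nst] := eqVneq s t.
  rewrite subrr expr0n /= mulr0 mul0r -(dominated_cst 0 df); have [_ _ fm _] := df.
  apply: fm => [||w]; [by exists 1 => w; rewrite ger0_norm ?lern1 ?leq_b1|exact: bounded_rv_cst|].
  by have -> : (c <= `|w s - w s|) = false by rewrite subrr normr0 leNgt c0.
have {nst}st : s < t by rewrite lt_neqAle nst.
pose Xh (g : R -> R) := clip4 ((g t - g s) / c).
have c4 : 0 < 4 / c by rewrite divr_gt0.
have L x y : `|clip4 (x / c) - clip4 (y / c)| <= 4 / c * `|x - y|.
  apply: le_trans (clip4_lip _ _) _; rewrite -mulrBl normrM (@ger0_norm _ c^-1) ?invr_ge0 ?(ltW c0)//.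
  by rewrite mulrA mulrAC.
have sk : skel [:: t; s] (1 + 4 / c) Xh.
  split=> [g|g g']; first by rewrite ger0_norm ?clip4_ge0//; have := clip4_le1 ((g t - g s) / c); rewrite /Xh; lra.
  rewrite !big_cons big_nil addr0; apply: le_trans (L _ _) _.
  have -> : g t - g s - (g' t - g' s) = (g t - g' t) - (g s - g' s) by ring.
  apply: ler_pM; rewrite ?normr_ge0 ?(ltW c4)//; first lra.
  exact: ler_normB.
have n := skel_nested sl su sk (fun w : Omega => erefl (Xh w)).
have [_ _ fm fn] := df.
apply: (@le_trans _ _ (f (fun w : Omega => Xh w))).
  apply: fm => [||w]; first by exists 1 => w; rewrite ger0_norm ?lern1 ?leq_b1.
    by exists (1 + 4 / c) => w; exact: sk.1.
  have [h|h] := leP c `|w t - w s|; last exact: clip4_ge0.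
  rewrite /Xh clip4_1// normrM (@ger0_norm _ c^-1) ?invr_ge0 ?(ltW c0)//.
  by rewrite ler_pdivlMr// mul1r.
apply: le_trans (fn _ _ n) _.
apply: (nested_last Hsl Hsu s0 st sk _ _ n) => [r||g [_ fg]].
- by rewrite !inE => /orP[/eqP->|/eqP->]; [right|left].
- by [].
- have -> : (fun y => Xh (step g t y)) = fun y => clip4 (y / c).
    apply/funext => y; rewrite /Xh /step lexx leNgt st /= addr0 (fg t (ltW st)).
    by congr (clip4 (_ / _)); ring.
  have b : blip 1 (4 / c) (fun y => clip4 (y / c)).
    by split => // y; rewrite ger0_norm ?clip4_le1 ?clip4_ge0.
  have M0 : 0 < (c ^+ 4)^-1 by rewrite invr_gt0 exprn_gt0.
  have d0 : 0 <= t - s by lra.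
  have := @heat_barrier _ _ _ 0 0 0 _ _ b M0 d0.
  rewrite !mul0r !add0r /Defs.G oppr0 maxxx !mulr0 subrr !mul0r add0r => h.
  apply: le_trans (h _) _; last by rewrite le_eqVlt; apply/orP; left; apply/eqP; field; lra.
  by move=> z; rewrite !mul0r !add0r; apply: le_trans (clip4_le _) _; rewrite exprMn mulrC exprVn.
Qed.

Lemma skel_measurable us (C : R) Xh (X : Omega -> R) : skel us C Xh ->
  (forall w : Omega, X w = Xh w) -> measurable_fun setT X.
Proof.
move=> sk e mD; apply: (measurability _ (RGenOInfty.measurableE R)) => //.
move=> /= _ [_ [a ->] <-]; rewrite setTI; apply: path_open_measurable => w /=.
rewrite in_itv/= andbT => aw; have C0 := skel_ge0 sk.
pose M := C * (size us)%:R + 1; have M0 : 0 < M by rewrite ltr_wpDl// mulr_ge0.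
exists (\sum_(t <- us) `|t|), ((X w - a) / M); split; first by rewrite divr_gt0// subr_gt0.
move=> w' h; rewrite /= in_itv/= andbT.
have h' t : t \in us -> `|w t - w' t| <= (X w - a) / M.
  move=> tu; have [t0|t0] := leP 0 t; last first.
    rewrite !path_le0 ?ltW// subrr normr0; apply: divr_gt0 => //.
    by rewrite subr_gt0.
  rewrite distrC ltW//; apply: h; rewrite t0 /= -[leLHS](ger0_norm t0).
  by rewrite (perm_big _ (perm_to_rem tu))/= big_cons lerDl sumr_ge0.
have := sk.2 w w'; rewrite -!e => h1.
have h2 : C * \sum_(t <- us) `|w t - w' t| <= C * (size us)%:R * ((X w - a) / M).
  rewrite -mulrA ler_wpM2l//.
  rewrite (_ : _ * _ = \sum_(t <- us) ((X w - a) / M)); last first.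
    by rewrite big_const_seq count_predT iter_addr addr0 mulr_natl.
  by rewrite !big_seq; apply: ler_sum => t /h'.
have h3 : C * (size us)%:R * ((X w - a) / M) < X w - a.
  rewrite mulrCA -ltr_pdivlMl ?subr_gt0// mulVf ?gt_eqF ?subr_gt0//.
  by rewrite ltr_pdivrMr// mul1r /M; lra.
move: h1; rewrite ler_norml; lra.
Qed.

End Chebyshev.

(** * Continuous paths as limits of step functions *)

Section PathLimit.
Context {R : realType}.
Local Notation Omega := (path_space R).

Lemma expr_small (q e : R) : 0 <= q -> q < 1 -> 0 < e ->
  exists N, forall k, (N <= k)%N -> q ^+ k <= e.
Proof.
move=> q0 q1 e0; have := @cvg_expr _ q; rewrite ger0_norm// => /(_ q1)/cvgrPdist_le/(_ e e0)[N _ H].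
by exists N => k Nk; have := H k Nk; rewrite /= sub0r normrN ger0_norm// exprn_ge0.
Qed.

(** Two demands meet here. The rate is below 1, so moves between levels are summable, with the
    factor $10 = 1/(1 - rate)$; its fourth power is above 1/2, so $2^k$ grid points times a
    Chebyshev bound of order $(4\,rate^4)^{-k}$ are summable too. *)
Definition rate : R := 9 / 10.

Lemma rate_gt0 : 0 < rate. Proof. by rewrite /rate; lra. Qed.

Lemma rateX_gt0 k : 0 < rate ^+ k. Proof. by rewrite exprn_gt0// rate_gt0. Qed.

Lemma rate_small (e : R) : 0 < e -> exists N, forall k, (N <= k)%N -> rate ^+ k <= e.
Proof. by move=> e0; apply: expr_small => //; rewrite /rate; lra. Qed.

Lemma rate_cvg (u : nat -> R) K : (forall k, (K <= k)%N -> `|u k.+1 - u k| <= rate ^+ k) ->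
  exists2 l, u @ \oo --> l & forall k, (K <= k)%N -> `|l - u k| <= 10 * rate ^+ k.
Proof.
move=> H.
have B k m : (K <= k)%N -> `|u (k + m)%N - u k| <= 10 * (rate ^+ k - rate ^+ (k + m)).
  move=> Kk; elim: m => [|m IH]; first by rewrite addn0 !subrr normr0 mulr0.
  rewrite addnS; have -> : u (k + m).+1 - u k = (u (k + m).+1 - u (k + m)%N) + (u (k + m)%N - u k) by ring.
  apply: le_trans (ler_normD _ _) _; have := H _ (leq_trans Kk (leq_addr m k)).
  by rewrite exprS /rate; lra.
have B' k m : (K <= k)%N -> (k <= m)%N -> `|u m - u k| <= 10 * rate ^+ k.
  move=> Kk km; rewrite -(subnKC km); apply: le_trans (B k (m - k)%N Kk) _.
  by have := rateX_gt0 (k + (m - k)); lra.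
have /cauchy_cvgP cu : cauchy (u @ \oo).
  apply: cauchy_exP => e e0.
  have [N HN] := rate_small (divr_gt0 e0 (ltr0n _ 20)).
  exists (u (maxn K N)), (maxn K N) => // m /= km.
  rewrite /ball /= distrC; apply: le_lt_trans (B' _ _ (leq_maxl K N) km) _.
  by have := HN _ (leq_maxr K N); lra.
exists (lim (u @ \oo)) => // k Kk.
apply/ler_addgt0Pr => e e0; have /cvgrPdist_le/(_ e e0)[N _ HN] := cu.
have := HN (maxn N k) (leq_maxl _ _); have := B' k (maxn N k) Kk (leq_maxr _ _).
by rewrite !ler_norml; lra.
Qed.

(** Small moves between levels give uniform convergence on [[0, n]], and the small oscillation of
    level [k] at scale $2^{-k}$ makes the limit continuous. The value at 0 is subtracted so that the
    limit starts at 0. *)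
Lemma path_of_levels (W : nat -> R -> R) :
  (forall n : nat, exists K, forall k, (K <= k)%N ->
    (forall t, 0 <= t <= n%:R -> `|W k.+1 t - W k t| <= rate ^+ k) /\
    (forall s t, 0 <= s <= n%:R -> 0 <= t <= n%:R -> `|t - s| <= (2 ^+ k)^-1 ->
       `|W k t - W k s| <= rate ^+ k)) ->
  exists w : Omega, forall t, 0 <= t -> (fun k => W k t - W k 0) @ \oo --> w t.
Proof.
move=> H.
have [l lP] : exists l : R -> R, forall t, 0 <= t -> (fun k => W k t) @ \oo --> l t.
  suff H' : forall t : R, exists l : R, 0 <= t -> (fun k => W k t) @ \oo --> l.
    by case/choice : H' => l lP; exists l.
  move=> t; have [t0|t0] := leP 0 t; last by exists 0.
  have [K HK] := H (Num.truncn t).+1.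
  have [|l lu _] := @rate_cvg (fun k => W k t) K; last by exists l.
  by move=> k /HK[h _]; apply: h; rewrite t0 ltW// truncnS_gt.
have near_l (n : nat) : exists K, forall k, (K <= k)%N ->
    (forall t, 0 <= t <= n%:R -> `|l t - W k t| <= 10 * rate ^+ k).
  have [K HK] := H n; exists K => k Kk t tn.
  have [|l' lu ll] := @rate_cvg (fun k => W k t) K; first by move=> j /HK[h _]; exact: h.
  have t0 : 0 <= t by case/andP: tn.
  by rewrite (cvg_unique _ (lP t t0) lu)//; exact: ll.
pose w (t : R) : R := l (Num.max t 0) - l 0.
have cw : continuous w.
  move=> t_; move: (t_ : R) => t; apply/cvgrPdist_le => e_; move: (e_ : R) => e e0.
  pose n := (Num.truncn `|t|).+2.
  have nt : `|t| + 1 <= n%:R by have := truncnS_gt `|t|; rewrite /n -[_.+2%:R]natr1; lra.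
  have [K1 h1] := H n; have [K2 h2] := near_l n.
  have [K3 h3] := rate_small (divr_gt0 e0 (ltr0n _ 21)).
  pose k := maxn K1 (maxn K2 K3).
  have [_ {}h1] := h1 k (leq_maxl _ _).
  have {}h2 := h2 k (leq_trans (leq_maxl _ _) (leq_maxr _ _)).
  have {}h3 := h3 k (leq_trans (leq_maxr _ _) (leq_maxr _ _)).
  have d0 : 0 < Num.min 1 (2 ^+ k)^-1 :> R by rewrite lt_min ltr01 invr_gt0 exprn_gt0.
  have nb : \forall s \near nbhs t, `|t - s| <= Num.min 1 (2 ^+ k)^-1 by exact: cvgr_dist_le.
  apply: filterS nb => s; rewrite le_min => /andP[ts1 ts2].
  have nn (r : R) : `|r| <= n%:R -> 0 <= Num.max r 0 <= n%:R.
    move=> rn; rewrite le_max lexx orbT ge_max ler0n (le_trans (ler_norm r) rn)//.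
  have tn : 0 <= Num.max t 0 <= n%:R by apply: nn; move: nt; lra.
  have sn : 0 <= Num.max s 0 <= n%:R.
    by apply: nn; have := ler_normD (s - t) t; rewrite subrK distrC; lra.
  have ms : `|Num.max s 0 - Num.max t 0| <= (2 ^+ k)^-1.
    by rewrite !(maxC _ 0) distrC; exact: le_trans (max_lip _ _ _) ts2.
  have := h1 _ _ tn sn ms; have := h2 _ tn; have := h2 _ sn; rewrite /w !ler_norml; lra.
have w0 t : t <= 0 -> w t = 0 by move=> t0; rewrite /w max_r// subrr.
exists (Path cw w0) => t t0 /=; rewrite /w max_l//.
by apply: cvgB; exact: lP.
Qed.

End PathLimit.

(** * Kolmogorov's argument for a dominated functional *)

Section Realization.
Context {R : realType} (sl su : R).
Hypotheses (Hsl : 0 <= sl) (Hsu : sl <= su).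
Local Notation Omega := (path_space R).
Local Notation rate := (@rate R).
Local Notation K4 := (3 * (su ^+ 2) ^+ 2).
Implicit Types (d : nat -> bool) (w : Omega).

Definition dyad k j : R := j%:R / 2 ^+ k.

(* The binary digits of the path: [level k j] recovers the value of the path at
   [dyad k j] up to 2^-k, provided this value is at most 2^k. *)
Definition path_event (i : nat) w : bool :=
  if unpickle i is Some (k, j, r) then
    (- 2 ^+ k + r%:R / 2 ^+ k < w (dyad k j))%R else false.

Definition level (k j : nat) d : R :=
  - 2 ^+ k + (\sum_(r < 2 * 4 ^ k) d (pickle (k, j, nat_of_ord r)))%N%:R / 2 ^+ k.

Lemma count_lt N (z : R) : (z <= N%:R -> 0 <= z ->
    z <= (\sum_(r < N) (r%:R < z)%R)%N%:R <= z + 1) /\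
  (N%:R <= z -> (\sum_(r < N) (r%:R < z)%R)%N = N).
Proof.
elim: N => [|N [IH1 IH2]].
  rewrite big_ord0; split => // z0 z0'; apply/andP; split; lra.
rewrite big_ord_recr /=; split; last first.
  rewrite -natr1 => Nz; rewrite IH2; last by lra.
  by rewrite (_ : (N%:R < z)%R = true) ?addn1//; lra.
rewrite -natr1 => zN z0; have [Nz|zN'] := ltP N%:R z.
  by rewrite IH2 ?(ltW Nz)//= natrD zN /= lerD2r ltW.
by rewrite addn0; exact: IH1.
Qed.

Let pow2_gt0 k : 0 < 2 ^+ k :> R. Proof. by rewrite exprn_gt0. Qed.

Lemma level_near k j w : `|w (dyad k j)| <= 2 ^+ k ->
  `|level k j (path_event^~ w) - w (dyad k j)| <= (2 ^+ k)^-1.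
Proof.
set y := w _ => yk; set a : R := 2 ^+ k; have a0 : 0 < a by exact: pow2_gt0.
rewrite -/a in yk; pose z : R := (y + a) * a.
have zN : z <= (2 * 4 ^ k)%N%:R.
  rewrite natrM natrX (_ : 4%:R = 2 ^+ 2 :> R); last by rewrite -natrX.
  rewrite -exprM mulnC exprM -/a /z expr2 mulrA; apply: ler_wpM2r; first exact: ltW.
  by move: yk; rewrite ler_norml; lra.
have z0 : 0 <= z by apply: mulr_ge0; [move: yk; rewrite ler_norml; lra|exact: ltW].
have [/(_ zN z0)/andP[h1 h2] _] := count_lt (2 * 4 ^ k) z.
have E : (\sum_(r < 2 * 4 ^ k) path_event (pickle (k, j, nat_of_ord r)) w)%N =
    (\sum_(r < 2 * 4 ^ k) (r%:R < z)%R)%N.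
  apply: eq_bigr => r _; rewrite /path_event pickleK -/y -/a /z.
  by rewrite addrC -ltrBrDr opprK ltr_pdivrMr.
rewrite /level E -/a; move: h1 h2; set S : R := _%:R => h1 h2.
have -> : - a + S / a - y = (S - z) / a by rewrite /z; field; lra.
rewrite normrM (@ger0_norm _ a^-1) ?invr_ge0 ?(ltW a0)// -[leRHS]mul1r ler_pM2r ?invr_gt0//.
by rewrite ler_norml; lra.
Qed.

Section Fixed.
Variables (f : (Omega -> R) -> R).
Hypothesis (df : dominated sl su f).
Let D (x : R) : nat -> bool := digit f path_event ^~ x.

Definition level_dep (F : (nat -> bool) -> R) := exists l : seq (nat * nat),
  forall d d', (forall p, p \in l -> level p.1 p.2 d = level p.1 p.2 d') -> F d = F d'.

Lemma level_dep_word F : level_dep F -> exists n, forall d d', (forall i, (i < n)%N -> d i = d' i) -> F d = F d'.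
Proof.
move=> [l H].
suff [n hn] : exists n, forall d d', (forall i, (i < n)%N -> d i = d' i) ->
    forall p, p \in l -> level p.1 p.2 d = level p.1 p.2 d'.
  by exists n => d d' /hn; exact: H.
elim: l {H} => [|[k j] l [n hn]]; first by exists 0%N.
exists (n + \sum_(r < 2 * 4 ^ k) (pickle (k, j, nat_of_ord r)).+1)%N => d d' e p.
rewrite inE => /predU1P[->|]; last first.
  by apply: hn => i ni; apply: e; rewrite ltn_addr.
rewrite /level /=; congr (_ + _%:R / _); apply: eq_bigr => r _; congr nat_of_bool.
by apply: e; rewrite (bigD1 r)//= addnCA leq_addr.
Qed.

Lemma nth_word d n i : (i < n)%N -> nth false (word d n) (n - i.+1) = d i.
Proof.
elim: n => // n IH; rewrite ltnS leq_eqVlt => /predU1P[->|lt]; first by rewrite subnn.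
by rewrite subSn//= IH.
Qed.

Lemma level_transfer F : level_dep F ->
  measurable_fun setT (fun x : measurableTypeR R => F (D x)) /\
  (\int[unif01]_x (F (D x))%:E)%E = (f (fun w => F (path_event^~ w)))%:E.
Proof.
move=> /level_dep_word[n Fn].
pose g s := F (fun i => nth false s (n - i.+1)).
have e d : F d = g (word d n) by apply: Fn => i ni; rewrite nth_word.
split.
- rewrite (_ : (fun x => _) = fun x => g (word (D x) n)); last by apply/funext => x; exact: e.
  exact: measurable_digits.
- under eq_integral do rewrite e.
  rewrite (integral_digits path_event df); congr (f _)%:E.
  by apply/funext => w; rewrite e.
Qed.

Definition jump k' j' k j d : bool := (rate ^+ k < `|level k' j' d - level k j d|)%R.

(** The indices [j.*2] and [j.*2.+1] are the children of [j] on the next grid and [j.+1] is its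
    right neighbour: these are the comparisons used in [good_levels]. The interval [[0, n]] has
    [n * 2 ^ k] cells. *)
Definition bad n k d : bool := [exists j : 'I_(n * 2 ^ k).+1,
  [|| jump k.+1 j.*2 k j d, jump k.+1 j.*2.+1 k j d | jump k j.+1 k j d]].

Let rho : R := (4 * rate ^+ 4)^-1.

Lemma bounded_bool (P : Omega -> bool) : bounded_rv (fun w => (P w)%:R : R).
Proof. by exists 1 => w; rewrite ger0_norm ?lern1 ?leq_b1. Qed.

Lemma rho_gt0 : 0 < rho.
Proof. by rewrite invr_gt0 mulr_gt0// rateX_gt0. Qed.

Lemma half_rate k : (3 <= k)%N -> 4 * (2 ^+ k)^-1 <= rate ^+ k :> R.
Proof.
move=> /subnK <-; elim: (k - 3)%N => [|m IH]; first by rewrite /rate; lra.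
by rewrite addSn !exprS invfM /rate; move: IH (rateX_gt0 (R := R) (m + 3)); rewrite /rate; lra.
Qed.

Lemma pow16_rho k : ((2 ^+ k) ^+ 4)^-1 <= rho ^+ k :> R.
Proof.
rewrite -exprM mulnC exprM -exprVn; apply: lerXn2r; rewrite ?nnegrE.
- by rewrite invr_ge0 exprn_ge0.
- exact: ltW rho_gt0.
- by rewrite /rho /rate; lra.
Qed.

Lemma rate_rho k : ((2 ^+ k)^-1) ^+ 2 / (rate ^+ k / 2) ^+ 4 = 16 * rho ^+ k.
Proof.
have -> : rho ^+ k = ((2 ^+ k) ^+ 2 * (rate ^+ k) ^+ 4)^-1.
  rewrite /rho exprVn exprMn (exprAC rate); congr ((_ * _)^-1).
  by rewrite exprAC; congr (_ ^+ _); rewrite -natrX.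
set a := rate ^+ k; set b : R := 2 ^+ k.
have a0 : 0 < a by exact: rateX_gt0.
have b0 : 0 < b by exact: pow2_gt0.
by field; rewrite !gt_eqF.
Qed.

(** A jump occurs only if the path leaves the range where levels are accurate, or if its increment
    is at least half of $rate^k$; the two reading errors, at most $2^{-k}$ each, fit into the other
    half from [k = 3] on. All three events obey the Chebyshev bound. *)
Lemma jump_estimate k' j' k j (T : R) : (3 <= k)%N -> (k <= k')%N ->
  `|dyad k' j' - dyad k j| <= (2 ^+ k)^-1 -> dyad k' j' <= T -> dyad k j <= T ->
  f (fun w => (jump k' j' k j (path_event^~ w))%:R) <= K4 * (2 * T ^+ 2 + 16) * rho ^+ k.
Proof.
move=> k3 kk'; set s := dyad k j; set t := dyad k' j' => ts tT sT.
have s0 : 0 <= s by rewrite divr_ge0// exprn_ge0.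
have t0 : 0 <= t by rewrite divr_ge0// exprn_ge0.
have [fD fZ fm _] := df.
pose A w := (2 ^+ k' <= `|w t - w 0|)%R; pose B w := (2 ^+ k <= `|w s - w 0|)%R.
pose C w := (rate ^+ k / 2 <= `|w t - w s|)%R.
have rk : 0 < rate ^+ k / 2 by rewrite divr_gt0// rateX_gt0.
have hA := dominated_chebyshev Hsl Hsu df (lexx 0) t0 (pow2_gt0 k').
have hB := dominated_chebyshev Hsl Hsu df (lexx 0) s0 (pow2_gt0 k).
have hC := dominated_chebyshev Hsl Hsu df s0 t0 rk.
have le w : (jump k' j' k j (path_event^~ w))%:R <= (A w)%:R + (B w)%:R + (C w)%:R :> R.
  have b0 (b : bool) : 0 <= b%:R :> R by exact: ler0n.
  have [J|] := boolP (jump k' j' k j _); last by move=> _; rewrite !addr_ge0.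
  have : [|| A w, B w | C w].
    apply/negPn/negP; rewrite !negb_or -!ltNge !(path_le0 w (lexx 0)) !subr0 => /and3P[a b c].
    have na := level_near (ltW a : `|w (dyad k' j')| <= 2 ^+ k').
    have nb := level_near (ltW b : `|w (dyad k j)| <= 2 ^+ k).
    have h2 : (2 ^+ k')^-1 <= (2 ^+ k)^-1 :> R.
      by rewrite lef_pV2 ?posrE// ler_eXn2l// ltr1n.
    have h4 := half_rate k3.
    move: J; rewrite /jump ltNge => /negP; apply.
    rewrite -/t -/s in na nb; set u := level k' j' _ in na *; set v := level k j _ in nb *.
    have -> : u - v = (u - w t) + (w t - w s) - (v - w s) by ring.
    apply: le_trans (ler_normB _ _) _; have := ler_normD (u - w t) (w t - w s).
    by move: c na nb h2 h4; clear; lra.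
  by case/or3P => ->; rewrite ?lerDl ?lerDr ?addr_ge0// -?addrA ?lerDl ?addr_ge0// addrCA lerDl addr_ge0.
have bA := bounded_bool A; have bB := bounded_bool B; have bC := bounded_bool C.
apply: le_trans (fm _ _ (bounded_bool _) (bounded_rvD (bounded_rvD bA bB) bC) le) _.
rewrite fD//; last exact: (bounded_rvD bA bB).
rewrite fD//.
have K40 : 0 <= K4 by rewrite mulr_ge0// sqr_ge0.
have r16 := pow16_rho k; have p0 : 0 <= rho ^+ k by rewrite exprn_ge0// ltW// rho_gt0.
have sq (r : R) : 0 <= r -> r <= T -> r ^+ 2 <= T ^+ 2 by move=> r0 rT; rewrite !expr2; exact: ler_pM.
have eA : f (fun w => (A w)%:R) <= K4 * T ^+ 2 * rho ^+ k.
  apply: le_trans hA _; rewrite subr0.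
  have h1 : K4 * t ^+ 2 <= K4 * T ^+ 2 by apply: ler_wpM2l => //; exact: sq.
  have h2 : ((2 ^+ k') ^+ 4)^-1 <= rho ^+ k.
    apply: le_trans r16; rewrite lef_pV2 ?posrE ?exprn_gt0//.
    by rewrite lerXn2r ?nnegrE ?exprn_ge0// ler_eXn2l// ltr1n.
  apply: ler_pM h1 h2; first exact: mulr_ge0 K40 (sqr_ge0 t).
  by rewrite invr_ge0 !exprn_ge0.
have eB : f (fun w => (B w)%:R) <= K4 * T ^+ 2 * rho ^+ k.
  apply: le_trans hB _; rewrite subr0.
  have h1 : K4 * s ^+ 2 <= K4 * T ^+ 2 by apply: ler_wpM2l => //; exact: sq.
  apply: ler_pM h1 r16; first exact: mulr_ge0 K40 (sqr_ge0 s).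
  by rewrite invr_ge0 !exprn_ge0.
have eC : f (fun w => (C w)%:R) <= K4 * (16 * rho ^+ k).
  apply: le_trans hC _; rewrite -rate_rho [leRHS]mulrA; apply: ler_wpM2r.
    by rewrite invr_ge0 exprn_ge0// ltW.
  apply: ler_wpM2l => //; rewrite -[leLHS]ger0_norm ?sqr_ge0// normrX.
  by rewrite !expr2; apply: ler_pM.
move: eA eB eC; lra.
Qed.

Lemma dyad_double k j : dyad k.+1 j.*2 = dyad k j.
Proof. by rewrite /dyad -muln2 natrM exprSr -mulf_div divff ?mulr1. Qed.

Lemma dyadS k j : dyad k j.+1 = dyad k j + (2 ^+ k)^-1.
Proof. by rewrite /dyad -natr1 mulrDl mul1r. Qed.

(** The union over about [n * 2 ^ k] grid points turns the ratio [rho] into [2 * rho], which is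
    still below 1. *)
Lemma bad_estimate n : exists2 M, 0 <= M & forall k, (3 <= k)%N ->
  f (fun w => (bad n k (path_event^~ w))%:R) <= M * (2 * rho) ^+ k.
Proof.
pose T : R := n%:R + 2; pose E := K4 * (2 * T ^+ 2 + 16).
have E0 : 0 <= E.
  apply: mulr_ge0; first by rewrite mulr_ge0// sqr_ge0.
  by apply: addr_ge0 => //; rewrite mulr_ge0// sqr_ge0.
exists (3 * (n%:R + 1) * E) => [|k k3]; first by apply: mulr_ge0 => //; apply: mulr_ge0 => //; exact: addr_ge0.
have ik0 : 0 < (2 ^+ k)^-1 :> R by rewrite invr_gt0.
have ikl : (2 ^+ k)^-1 <= 1 :> R by rewrite invf_le1// exprn_ege1// ler1n.
have ik1 : (2 ^+ k.+1)^-1 = (2 ^+ k)^-1 / 2 :> R by rewrite exprS invfM mulrC.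
pose F (j : 'I_(n * 2 ^ k).+1) w : R :=
  (jump k.+1 j.*2 k j (path_event^~ w))%:R + (jump k.+1 j.*2.+1 k j (path_event^~ w))%:R
  + (jump k j.+1 k j (path_event^~ w))%:R.
have bF j : bounded_rv (F j) by exact: (bounded_rvD (bounded_rvD (bounded_bool _) (bounded_bool _)) (bounded_bool _)).
have fF j : f (F j) <= 3 * (E * rho ^+ k).
  have [fD _ _ _] := df; rewrite /F fD; [|exact: (bounded_rvD (bounded_bool _) (bounded_bool _))|exact: bounded_bool].
  rewrite fD; [|exact: bounded_bool|exact: bounded_bool].
  have jn : dyad k j <= n%:R.
    rewrite /dyad ler_pdivrMr//; have := ltn_ord j; rewrite ltnS -(ler_nat R) natrM natrX//.
  have h1 : dyad k.+1 j.*2.+1 = dyad k j + (2 ^+ k)^-1 / 2 by rewrite dyadS dyad_double ik1.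
  have := @jump_estimate k.+1 j.*2 k j T k3 (leqnSn k).
  rewrite dyad_double subrr normr0 => e1.
  have := @jump_estimate k.+1 j.*2.+1 k j T k3 (leqnSn k).
  rewrite h1 addrAC subrr add0r => e2.
  have := @jump_estimate k j.+1 k j T k3 (leqnn k).
  rewrite dyadS addrAC subrr add0r => e3.
  rewrite (ger0_norm (ltW ik0)) in e3; rewrite (ger0_norm (divr_ge0 (ltW ik0) (ler0n _ 2))) in e2.
  have jT : dyad k j <= T by rewrite /T; lra.
  have {}e1 := e1 (ltW ik0) jT jT.
  have {}e2 := e2 ltac:(lra) ltac:(rewrite /T; lra) jT.
  have {}e3 := e3 (lexx _) ltac:(rewrite /T; lra) jT.
  by move: e1 e2 e3; rewrite -/E; lra.
have [fs bs] := dominated_sum (index_enum 'I_(n * 2 ^ k).+1) xpredT df bF.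
have [_ _ fm _] := df.
apply: le_trans (fm _ _ (bounded_bool _) bs _) _ => [w|].
  have F0 j : 0 <= F j w by rewrite /F !addr_ge0.
  have [/existsP[j hj]|_] := boolP (bad n k _); last by exact: sumr_ge0.
  rewrite (bigD1 j)//=; apply: (@le_trans _ _ (F j w)); last by rewrite lerDl; exact: sumr_ge0.
  rewrite /F; move: hj; set a := jump _ _ _ _ _; set b := jump _ _ _ _ _; set c := jump _ _ _ _ _.
  by case: a; case: b; case: c => //= _; lra.
rewrite fs; apply: le_trans (ler_sum _ (fun j _ => fF j)) _.
rewrite sumr_const card_ord -[leLHS]mulr_natr exprMn.
have N : (n * 2 ^ k).+1%:R <= (n%:R + 1) * 2 ^+ k :> R.
  by rewrite -natr1 natrM natrX mulrDl mul1r lerD2l exprn_ege1// ler1n.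
have r0 : 0 <= rho ^+ k by rewrite exprn_ge0// ltW// rho_gt0.
have p0 : 0 <= 3 * (E * rho ^+ k) by apply: mulr_ge0 => //; exact: mulr_ge0.
by apply: le_trans (ler_wpM2l p0 N) _; rewrite le_eqVlt; apply/orP; left; apply/eqP; ring.
Qed.

Lemma bad_dep n k : level_dep (fun d => (bad n k d)%:R).
Proof.
exists [seq (i, j) | i <- [:: k; k.+1], j <- iota 0 (2 * (n * 2 ^ k)).+3] => d d' e.
congr (nat_of_bool _)%:R; rewrite /bad; apply: eq_existsb => j.
have jn := ltn_ord j.
have m i m' : i \in [:: k; k.+1] -> (m' < (2 * (n * 2 ^ k)).+3)%N -> level i m' d = level i m' d'.
  move=> ik mn; apply: (e (i, m')); apply/allpairsP; exists (i, m'); split => //.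
  by rewrite mem_iota.
rewrite /jump !m ?inE ?eqxx ?orbT//; move: jn; rewrite -?muln2; lia.
Qed.

Definition bad_set n k : set (measurableTypeR R) := [set x | bad n k (D x)].

Lemma measurable_bad n k : measurable (bad_set n k).
Proof.
have [mF _] := level_transfer (bad_dep n k).
have := mF measurableT _ (measurable_set1 1); rewrite setTI.
congr measurable; apply/seteqP; split => x /=; rewrite /bad_set /=.
  by case: bad => // /esym/eqP; rewrite oner_eq0.
by move=> ->.
Qed.

Lemma bad_set_measure n k : unif01 (bad_set n k) = (f (fun w => (bad n k (path_event^~ w))%:R))%:E.
Proof.
have [_ <-] := level_transfer (bad_dep n k).
rewrite -(setIT (bad_set n k)) -(integral_indic unif01 measurableT (measurable_bad n k)).
apply: eq_integral => x _; rewrite indicE; congr (nat_of_bool _)%:R%:E.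
by apply/idP/idP; rewrite inE.
Qed.

(** Borel-Cantelli; the shift by 3 reflects the range of [half_rate]. *)
Lemma lim_sup_bad n : unif01 (lim_sup_set (fun k => bad_set n (k + 3))) = 0%E.
Proof.
apply: lim_sup_set_cvg0 => [k|]; first exact: measurable_bad.
have [M M0 HM] := bad_estimate n.
pose q := 2 * rho; have q0 : 0 <= q by rewrite mulr_ge0// ltW// rho_gt0.
have q1 : q < 1 by rewrite /q /rho /rate; lra.
have B k : (unif01 (bad_set n (k + 3)) <= (M * q ^+ k)%:E)%E.
  rewrite bad_set_measure lee_fin; apply: le_trans (HM _ (leq_addl _ _)) _.
  by rewrite ler_wpM2l// ler_wiXn2l// ?(ltW q1)// leq_addr.
apply: (@le_lt_trans _ _ (M / (1 - q))%:E); last exact: ltry.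
apply: lime_le; first by apply: is_cvg_nneseries => k _ _; exact: measure_ge0.
apply: nearW => N; apply: (@le_trans _ _ (\sum_(0 <= k < N) (M * q ^+ k)%:E)%E).
  by apply: lee_sum => k _; exact: B.
rewrite sumEFin lee_fin -mulr_sumr ler_wpM2l//.
have -> : \sum_(0 <= k < N) q ^+ k = (1 - q ^+ N) / (1 - q).
  by rewrite big_mkord; apply: (canRL (mulfK _)); [lra|have := subrX1 q N; lra].
rewrite -[leRHS]mul1r ler_pM2r ?invr_gt0; last lra.
by have := exprn_ge0 N q0; lra.
Qed.

Definition good x := forall n, exists K, forall k, (K <= k)%N -> ~ bad n k (D x).

Definition good_set : set (measurableTypeR R) := [set x | good x].

Lemma good_setE : good_set = \bigcap_n ~` lim_sup_set (fun k => bad_set n (k + 3)).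
Proof.
apply/seteqP; split => x /= H n.
  move=> _ L; have [K HK] := H n; have [k /= Kk b] := L K I.
  by apply: (HK (k + 3)%N) b; rewrite (leq_trans Kk)// leq_addr.
have := H n I; apply: contra_notP => N.
move=> K _; apply: contrapT => N'; apply: N; exists (K + 3)%N => k Kk b; apply: N'.
exists (k - 3)%N; first by rewrite /= -(leq_add2r 3) subnK// (leq_trans _ Kk)// leq_addl.
by rewrite /bad_set /= subnK// (leq_trans _ Kk)// leq_addl.
Qed.

Lemma measurable_lim_sup_bad n : measurable (lim_sup_set (fun k => bad_set n (k + 3))).
Proof.
apply: bigcap_measurableType => k _; apply: bigcup_measurable => j _.
exact: measurable_bad.
Qed.

Lemma measurable_good : measurable good_set.
Proof.
by rewrite good_setE; apply: bigcapT_measurable => n; apply: measurableC; exact: measurable_lim_sup_bad.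
Qed.

Lemma good_null : unif01 (~` good_set) = 0%E.
Proof.
rewrite good_setE setC_bigcap; apply/negligibleP.
  by apply: bigcupT_measurable => n; rewrite setCK; exact: measurable_lim_sup_bad.
apply: negligible_bigcup => n; rewrite setCK; apply/negligibleP; first exact: measurable_lim_sup_bad.
exact: lim_sup_bad.
Qed.

End Fixed.
End Realization.

(** * The law realizing a dominated functional *)

Section Realized.
Context {R : realType} (sl su : R).
Hypotheses (Hsl : 0 <= sl) (Hsu : sl <= su).
Local Notation Omega := (path_space R).
Local Notation rate := (@rate R).
Local Notation K4 := (3 * (su ^+ 2) ^+ 2).
Variables (f : (Omega -> R) -> R).
Hypothesis (df : dominated sl su f).
Local Notation D x := (digit f (path_event (R := R)) ^~ x).

Let gr k (t : R) : nat := Num.truncn (t * 2 ^+ k).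

Let pow2_gt0 k : 0 < 2 ^+ k :> R. Proof. by rewrite exprn_gt0. Qed.

Let gr_itv k t : 0 <= t -> (gr k t)%:R <= t * 2 ^+ k < (gr k t)%:R + 1.
Proof.
move=> t0; have := truncn_itv (mulr_ge0 t0 (ltW (pow2_gt0 k))).
by rewrite natr1.
Qed.

Let gr_le n k t : 0 <= t <= n%:R -> (gr k t < (n * 2 ^ k).+1)%N.
Proof.
move=> /andP[t0 tn]; rewrite ltnS -(ler_nat R) natrM natrX.
have /andP[h _] := gr_itv k t0; apply: le_trans h _.
by apply: ler_wpM2r => //; exact: ltW.
Qed.

(** The grid index of a time passes to one of its two children, and by [gr_near] close times have
    equal or adjacent indices; these are the pairs tested in [bad]. *)
Let gr_double k t : 0 <= t -> gr k.+1 t = (gr k t).*2 \/ gr k.+1 t = (gr k t).*2.+1.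
Proof.
move=> t0; have /andP[a b] := gr_itv k t0; have /andP[a' b'] := gr_itv k.+1 t0.
have h1 : ((gr k t).*2 < (gr k.+1 t).+1)%N.
  rewrite -(ltr_nat R) -muln2 natrM -natr1; rewrite exprSr in a' b'; lra.
have h2 : (gr k.+1 t < (gr k t).*2.+2)%N.
  rewrite -(ltr_nat R) -[X in _ < X]natr1 -natr1 -muln2 natrM; rewrite exprSr in a' b'; lra.
lia.
Qed.

Let gr_near k s t : 0 <= s -> 0 <= t -> `|t - s| <= (2 ^+ k)^-1 ->
  [\/ gr k t = gr k s, gr k t = (gr k s).+1 | gr k s = (gr k t).+1].
Proof.
move=> s0 t0 ts; have /andP[a b] := gr_itv k t0; have /andP[a' b'] := gr_itv k s0.
have : `|t * 2 ^+ k - s * 2 ^+ k| <= 1.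
  rewrite -mulrBl normrM (@ger0_norm _ (2 ^+ k)) ?(ltW (pow2_gt0 k))//.
  by rewrite -ler_pdivlMr// mul1r.
rewrite ler_norml => /andP[c d].
have h1 : (gr k t < (gr k s).+2)%N.
  by rewrite -(ltr_nat R) -[X in _ < X]natr1 -natr1; lra.
have h2 : (gr k s < (gr k t).+2)%N.
  by rewrite -(ltr_nat R) -[X in _ < X]natr1 -natr1; lra.
move: h1 h2; move: (gr k t) (gr k s) => p q; clear => h1 h2.
have [E|E|E] := ltngtP p q; [apply: Or33; lia|apply: Or32; lia|exact: Or31].
Qed.

Lemma good_levels x : good f x -> forall n : nat, exists K, forall k, (K <= k)%N ->
  (forall t, 0 <= t <= n%:R ->
     `|level k.+1 (gr k.+1 t) (D x) - level k (gr k t) (D x) | <= rate ^+ k) /\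
  (forall s t, 0 <= s <= n%:R -> 0 <= t <= n%:R -> `|t - s| <= (2 ^+ k)^-1 ->
     `|level k (gr k t) (D x) - level k (gr k s) (D x)| <= rate ^+ k).
Proof.
move=> gx n; have [K HK] := gx n; exists K => k /HK/negP.
rewrite negb_exists => /forallP nb.
have B j : (j < (n * 2 ^ k).+1)%N -> [/\ `|level k.+1 j.*2 (D x) - level k j (D x)| <= rate ^+ k,
    `|level k.+1 j.*2.+1 (D x) - level k j (D x)| <= rate ^+ k &
    `|level k j.+1 (D x) - level k j (D x)| <= rate ^+ k].
  move=> jn; have := nb (Ordinal jn); rewrite !negb_or /jump /= -!leNgt.
  by move=> /and3P[].
split=> [t tn|s t sn tn ts].
  have [h1 h2 _] := B _ (gr_le k tn); have t0 : 0 <= t by case/andP: tn.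
  by have [->|->] := gr_double k t0.
have [_ _ h1] := B _ (gr_le k tn); have [_ _ h2] := B _ (gr_le k sn).
have t0 : 0 <= t by case/andP: tn.
have s0 : 0 <= s by case/andP: sn.
have [E|E|E] := gr_near s0 t0 ts.
- by rewrite E subrr normr0 ltW// rateX_gt0.
- by rewrite E.
- by rewrite E distrC.
Qed.

Let gk k d (t : R) : R := if 0 <= t then level k (gr k t) d - level k (gr k 0) d else 0.

(** Off the good set the path is set to 0. Measurability is checked on coordinates, each a limit of
    functions of finitely many digits. *)
Lemma realization_map : exists Phi : measurableTypeR R -> Omega, measurable_fun setT Phi /\
  forall x, good f x -> forall t, (fun k => gk k (D x) t) @ \oo --> Phi x t.
Proof.
have [Phi PhiP] : exists Phi : measurableTypeR R -> Omega, forall x,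
    (good f x -> forall t, 0 <= t -> (fun k => gk k (D x) t) @ \oo --> Phi x t) /\
    (~ good f x -> Phi x = zero_path (R := R)).
  have H (x : R) : exists w : Omega,
      (good f x -> forall t, 0 <= t -> (fun k => gk k (D x) t) @ \oo --> w t) /\
      (~ good f x -> w = zero_path (R := R)).
    have [gx|gx] := pselect (good f x); last by exists (zero_path (R := R)).
    have [w hw] := @path_of_levels _ (fun k t => level k (gr k t) (D x)) (good_levels gx).
    exists w; split => // _ t t0.
    rewrite (_ : (fun k => gk k (D x) t) = fun k => level k (gr k t) (D x) - level k (gr k 0) (D x)).
      exact: hw.
    by apply/funext => k; rewrite /gk t0.
  by case/choice : H => Phi; exists Phi.
exists Phi; split; last first.
  move=> x gx t; have [t0|t0] := leP 0 t; first by have [h _] := PhiP x; exact: h.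
  rewrite path_le0 ?ltW// /gk leNgt t0 /=; exact: cvg_cst.
apply: measurable_path => t t0.
apply: (@measurable_fun_cvg _ _ _ _ (fun k x => \1_(good_set f) x * gk k (D x) t)).
  move=> k; apply: measurable_funM.
    by apply: measurable_indic; exact: (measurable_good Hsl Hsu df).
  rewrite /gk t0; apply: measurable_funB.
  - apply: (level_transfer df _).1; exists [:: (k, gr k t)] => d d' e.
    by have := e (k, gr k t); rewrite mem_head; apply.
  - apply: (level_transfer df _).1; exists [:: (k, gr k 0)] => d d' e.
    by have := e (k, gr k 0); rewrite mem_head; apply.
move=> x _; have [h1 h2] := PhiP x; have [gx|gx] := pselect (good f x).
- rewrite (_ : (fun k => _) = fun k => gk k (D x) t); first exact: h1.
  by apply/funext => k; rewrite indicE mem_set// mul1r.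
- rewrite (h2 gx) /=; apply: cvg_near_cst; apply: nearW => k.
  by rewrite indicE memNset// mul0r.
Qed.

Lemma dominated_dist (X Y S : Omega -> R) : bounded_rv X -> bounded_rv Y -> bounded_rv S ->
  (forall w, `|Y w - X w| <= S w) -> `|f Y - f X| <= f S.
Proof.
have [fD _ fm _] := df => bX bY bS H.
have h1 : f Y <= f (fun w => X w + S w).
  by apply: fm => // [|w]; [exact: bounded_rvD|have := H w; rewrite ler_norml; lra].
have h2 : f X <= f (fun w => Y w + S w).
  by apply: fm => // [|w]; [exact: bounded_rvD|have := H w; rewrite ler_norml; lra].
by move: h1 h2; rewrite !fD// ler_norml; lra.
Qed.

(** [f] admits no dominated convergence, so the approximation is quantitative: where the path stays
    in range and moves little, [gk] is within three times $rate^k$ of it, and the exceptional events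
    are small by Chebyshev. *)
Lemma level_approximation us C Xh (X : Omega -> R) : skel us C Xh ->
  (forall w : Omega, X w = Xh w) ->
  exists M, forall k, (3 <= k)%N ->
    `|f (fun w => Xh (gk k (path_event (R := R) ^~ w))) - f X| <= M * rate ^+ k.
Proof.
move=> sk e; have C0 := skel_ge0 sk.
pose us' := [seq t <- us | 0 <= t].
pose S0 := 3 * C * (size us)%:R.
exists (S0 + \sum_(t <- us') 2 * C * (K4 * (t ^+ 2 + 16))) => k k3.
pose A t (w : Omega) := (2 ^+ k <= `|w (dyad k (gr k t)) - w 0|)%R.
pose B t (w : Omega) := (rate ^+ k / 2 <= `|w t - w (dyad k (gr k t))|)%R.
pose F t w : R := 2 * C * ((A t w)%:R + (B t w)%:R).
have bF t : bounded_rv (F t).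
  exact: (bounded_rvZ (2 * C) (bounded_rvD (bounded_bool (A t)) (bounded_bool (B t)))).
have [fs bs] := dominated_sum us' xpredT df bF.
have F0 t w : 0 <= F t w by rewrite /F mulr_ge0 ?mulr_ge0 ?addr_ge0.
have r0 : 0 < rate ^+ k by exact: rateX_gt0.
have h4 := half_rate (R := R) k3; have i0 : 0 < (2 ^+ k)^-1 :> R by rewrite invr_gt0.
have D0 t : 0 <= t -> 0 <= dyad (R := R) k (gr k t) <= t /\ t - dyad k (gr k t) <= (2 ^+ k)^-1.
  move=> t0; have /andP[g1 g2] := gr_itv k t0; rewrite /dyad; split.
    by rewrite divr_ge0 ?(ltW (pow2_gt0 k))//= ler_pdivrMr.
  by rewrite lerBlDr -[X in X + _]mul1r -mulrDl ler_pdivlMr// addrC ltW.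
have S00 : 0 <= S0 * rate ^+ k by rewrite !mulr_ge0// ltW.
have diff w : `|Xh (gk k (path_event (R := R) ^~ w)) - X w| <= S0 * rate ^+ k + \sum_(t <- us') F t w.
  have [/hasP[t tu AB]|nAB] := boolP (has (fun t => A t w || B t w) us').
    apply: (@le_trans _ _ (2 * C)).
      rewrite e; have := sk.1 (gk k (path_event (R := R) ^~ w)); have := sk.1 w.
      by move=> ? ?; apply: le_trans (ler_normB _ _) _; lra.
    apply: ler_wpDl => //; rewrite (perm_big _ (perm_to_rem tu)) /= big_cons.
    apply: (@le_trans _ _ (F t w)); last by rewrite lerDl; exact: sumr_ge0.
    by rewrite -[leLHS]mulr1 /F; apply: ler_wpM2l; [exact: mulr_ge0|case/orP: AB => ->; rewrite ?lerDl ?lerDr].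
  rewrite e; apply: le_trans (sk.2 _ _) _.
  apply: ler_wpDr; first exact: sumr_ge0.
  rewrite /S0 -mulrA -(mulrA 3) mulrCA ler_wpM2l//.
  rewrite (_ : 3 * _ = \sum_(t <- us) 3 * rate ^+ k); last first.
    by rewrite big_const_seq count_predT iter_addr addr0 -mulr_natl; ring.
  rewrite !big_seq; apply: ler_sum => t tu; rewrite /gk; have [t0|t0] := leP 0 t; last first.
    rewrite (path_le0 w (ltW t0)) subrr normr0; lra.
  have tu' : t \in us' by rewrite mem_filter t0.
  move/hasPn : nAB => /(_ t tu'); rewrite negb_or -!ltNge => /andP[]; rewrite /A /B.
  rewrite (path_le0 w (lexx 0)) subr0 => a b.
  have na := level_near (ltW a).
  have g0 : gr k 0 = 0%N by rewrite /gr mul0r truncn0.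
  have nb : `|level k 0 (path_event (R := R) ^~ w)| <= (2 ^+ k)^-1 :> R.
    have d0 : dyad (R := R) k 0 = 0 by rewrite /dyad mul0r.
    have w0 : `|w (dyad k 0)| <= 2 ^+ k.
      by rewrite d0 (path_le0 w (lexx 0)) normr0; exact: ltW.
    by have := level_near w0; rewrite d0 (path_le0 w (lexx 0)) subr0.
  rewrite g0; set u := level k (gr k t) _ in na *; set v := level k 0 _ in nb *.
  have -> : u - v - w t = (u - w (dyad k (gr k t))) - v - (w t - w (dyad k (gr k t))) by ring.
  apply: le_trans (ler_normB _ _) _; have := ler_normB (u - w (dyad k (gr k t))) v.
  by move: b na nb h4 r0; lra.
have bX : bounded_rv X by exists C => w; rewrite e; exact: sk.1.
have bY : bounded_rv (fun w : Omega => Xh (gk k (path_event (R := R) ^~ w))) by exists C => w; exact: sk.1.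
have bS : bounded_rv (fun w : Omega => S0 * rate ^+ k + \sum_(t <- us') F t w).
  exact: (bounded_rvD (bounded_rv_cst (S0 * rate ^+ k)) bs).
apply: le_trans (dominated_dist bX bY bS diff) _.
have [fD fZ _ _] := df.
rewrite fD//; last exact: bounded_rv_cst.
rewrite (dominated_cst _ df) fs mulrDl lerD2l mulr_suml big_seq [leRHS]big_seq.
apply: ler_sum => t; rewrite mem_filter => /andP[t0 _].
rewrite /F fZ; last exact: (bounded_rvD (bounded_bool (A t)) (bounded_bool (B t))).
rewrite -[leRHS]mulrA ler_wpM2l ?mulr_ge0// fD; [|exact: bounded_bool|exact: bounded_bool].
have [/andP[d0 dt] td] := D0 t t0; set s := dyad k (gr k t) in d0 dt td.
have K40 : 0 <= K4 by rewrite mulr_ge0// sqr_ge0.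
have rk2 : 0 < rate ^+ k / 2 by rewrite divr_gt0.
have hA := dominated_chebyshev Hsl Hsu df (lexx 0) d0 (pow2_gt0 k).
have hB := dominated_chebyshev Hsl Hsu df d0 t0 rk2.
have rr : ((4 * rate ^+ 4)^-1) ^+ k <= rate ^+ k.
  have q0 : 0 <= (4 * rate ^+ 4)^-1 by rewrite invr_ge0 mulr_ge0// ltW// rateX_gt0.
  by apply: lerXn2r; rewrite ?nnegrE ?(ltW (rate_gt0 R))//; rewrite /rate; lra.
have eA : f (fun w => (A t w)%:R) <= K4 * t ^+ 2 * rate ^+ k.
  apply: le_trans hA _; rewrite subr0 -/s.
  have h1 : K4 * s ^+ 2 <= K4 * t ^+ 2.
    by apply: ler_wpM2l => //; rewrite !expr2; apply: ler_pM.
  have h2 : ((2 ^+ k) ^+ 4)^-1 <= rate ^+ k by apply: le_trans rr; exact: pow16_rho.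
  apply: ler_pM h1 h2; first exact: mulr_ge0 K40 (sqr_ge0 s).
  by rewrite invr_ge0 !exprn_ge0.
have eB : f (fun w => (B t w)%:R) <= K4 * (16 * rate ^+ k).
  apply: le_trans hB _.
  apply: (@le_trans _ _ (K4 * (16 * (4 * rate ^+ 4)^-1 ^+ k))); last first.
    by apply: ler_wpM2l => //; rewrite ler_pM2l.
  rewrite -rate_rho [leRHS]mulrA; apply: ler_wpM2r; first by rewrite invr_ge0 exprn_ge0// ltW.
  by apply: ler_wpM2l => //; rewrite -/s !expr2; apply: ler_pM => //; lra.
by move: eA eB; lra.
Qed.

Lemma gk_dep us C Xh k : skel us C Xh -> level_dep (fun d => Xh (gk k d)).
Proof.
move=> sk; exists ((k, gr k 0) :: [seq (k, gr k t) | t <- us]) => d d' H.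
apply: (skel_eq sk) => t tu; rewrite /gk; case: ifP => // _.
have h1 := H (k, gr k t); have h0 := H (k, gr k 0).
rewrite h1 ?h0 ?mem_head//.
by rewrite inE; apply/orP; right; apply/mapP; exists t.
Qed.

(** The same functionals of finitely many digits have two limits: dominated convergence on the unit
    interval gives the integral of [X], and [level_approximation] gives [f X]. [level_transfer]
    equates them term by term. *)
Theorem dominated_realized : exists P : probability Omega R, forall us C Xh (X : Omega -> R),
  skel us C Xh -> (forall w : Omega, X w = Xh w) -> (\int[P]_w (X w)%:E)%E = (f X)%:E.
Proof.
have [Phi [mPhi PhiP]] := realization_map.
pose Phi' : {mfun measurableTypeR R >-> Omega} := HB.pack Phi (isMeasurableFun.Build _ _ _ _ Phi mPhi).
exists (distribution (@unif01 R) Phi') => us C Xh X sk e.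
have mX := skel_measurable sk e.
have C0 := skel_ge0 sk.
have XC w : `|X w| <= C by rewrite e; exact: sk.1.
have mXE : measurable_fun setT (fun w => (X w)%:E) by exact/measurable_EFinP.
have mXP : measurable_fun setT (fun x => (X (Phi x))%:E).
  exact: (measurableT_comp mXE mPhi).
have ic : unif01.-integrable setT (cst C%:E : measurableTypeR R -> \bar R).
  by apply/integrableP; split => //; rewrite integral_cst//= unif01_setT mule1 ger0_norm// ltry.
have mk k : measurable_fun setT (fun x : measurableTypeR R => (Xh (gk k (D x)))%:E).
  by apply/measurable_EFinP; exact: (level_transfer df (gk_dep k sk)).1.
have [] := @dominated_convergence _ _ _ unif01 setT measurableT
  (fun k x => (Xh (gk k (D x)))%:E) (fun x => (X (Phi x))%:E) (cst C%:E) mk mXP _ ic _.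
- exists (~` good_set f); split; first by apply: measurableC; exact: (measurable_good Hsl Hsu df).
    exact: (good_null Hsl Hsu df).
  move=> x /= nx gx; apply: nx => _.
  apply: cvg_EFin; first by apply: nearW.
  rewrite e; apply/cvgrPdist_le => eps eps0.
  pose h := eps / (C * (size us)%:R + 1).
  have h1 : 0 < C * (size us)%:R + 1 by rewrite ltr_wpDl// mulr_ge0.
  have h0 : 0 < h by rewrite divr_gt0.
  have [N HN] : exists N, forall k, (N <= k)%N -> forall t, t \in us -> `|Phi x t - gk k (D x) t| <= h.
    elim: (us) => [|t us' [N HN]]; first by exists 0%N.
    have /cvgrPdist_le/(_ h h0)[N' _ HN'] := PhiP x gx t.
    exists (maxn N N') => k; rewrite geq_max => /andP[k1 k2] s; rewrite inE => /predU1P[->|].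
      exact: HN'.
    exact: HN.
  exists N => // k /= Nk; apply: le_trans (sk.2 _ _) _.
  apply: (@le_trans _ _ (C * ((size us)%:R * h))).
    rewrite ler_wpM2l// (_ : _ * h = \sum_(t <- us) h); last first.
      by rewrite big_const_seq count_predT iter_addr addr0 mulr_natl.
    by rewrite !big_seq; apply: ler_sum => t; exact: HN.
  rewrite mulrA /h mulrCA ger_pMr// ler_pdivrMr// mul1r; lra.
- by apply: aeW => x n _ /=; rewrite lee_fin; exact: sk.1.
move=> iX _ cv.
rewrite (@integral_distribution _ _ _ _ _ unif01 Phi' (fun w => (X w)%:E) mXE iX).
have tr k : (\int[unif01]_x (Xh (gk k (D x)))%:E)%E = (f (fun w => Xh (gk k (path_event (R := R) ^~ w))))%:E.
  exact: (level_transfer df (gk_dep k sk)).2.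
have [M HM] := level_approximation sk e.
apply: (cvg_unique _ cv); first exact: ereal_hausdorff.
rewrite /= (_ : (fun k => _) = fun k => (f (fun w => Xh (gk k (path_event (R := R) ^~ w))))%:E); last first.
  by apply/funext => k; rewrite tr.
apply: cvg_EFin; first by apply: nearW.
apply/cvgrPdist_le => eps eps0.
have M1 : 0 < `|M| + 1 by rewrite ltr_wpDl.
have [N HN] := rate_small (divr_gt0 eps0 M1).
exists (maxn N 3) => // k /=; rewrite geq_max => /andP[k1 k2].
rewrite distrC; apply: le_trans (HM k k2) _.
have := HN k k1; have := rateX_gt0 (R := R) k.
rewrite ler_pdivlMr//.
by have := ler_norm M; nra.
Qed.

End Realized.

(** * Integration of real random variables *)

Section Expectation.
Import HBNNSimple.
Context d (T : measurableType d) {R : realType} (P : probability T R).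
Implicit Types (X Y U : T -> R) (f g : T -> \bar R).

(** A simple function below [f], set to 0 on [N], lies below [g] and keeps its integral. *)
Lemma ge0_integral_le_off_null f g (N : set T) : measurable N -> P N = 0%E ->
  (forall x, 0 <= f x)%E -> (forall x, 0 <= g x)%E ->
  (forall x, ~ N x -> f x <= g x)%E -> (\int[P]_x f x <= \int[P]_x g x)%E.
Proof.
move=> mN N0 f0 g0 H; rewrite [leLHS]ge0_integralTE//.
apply: ub_ereal_sup => _ [h /= hf <-]; rewrite -integralT_nnsfun.
have mCN : measurable (~` N) by exact: measurableC.
rewrite (@ae_eq_integral _ _ _ P _ (fun x => (proj_nnsfun h mCN x)%:E)) //.
- rewrite integralT_nnsfun [leRHS]ge0_integralTE//.
  apply: ereal_sup_ubound; exists (proj_nnsfun h mCN) => //= x.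
  rewrite /= /mindic indicE; have [xN|xN] := boolP (x \in ~` N); last by rewrite mulr0.
  by rewrite mulr1; apply: le_trans (hf x) (H x _); move: xN; rewrite inE.
- by apply/measurable_EFinP.
- by apply/measurable_EFinP.
- exists N; split => // x /= nx; apply: contrapT => xN; apply: nx => _.
  by rewrite /mindic indicE mem_set ?mulr1.
Qed.

(* No measurability is required of [f] and [g]: the integral of a nonnegative
   function is a supremum over the simple functions below it. *)
Lemma integral_le_off_null f g (N : set T) : measurable N -> P N = 0%E ->
  (forall x, ~ N x -> f x <= g x)%E -> (\int[P]_x f x <= \int[P]_x g x)%E.
Proof.
move=> mN N0 H; rewrite integralE [leRHS]integralE; apply: leeB.
- apply: (ge0_integral_le_off_null mN N0) => // x xN; rewrite !funeposE.
  by rewrite ge_max !le_max lexx orbT (H x xN).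
- apply: (ge0_integral_le_off_null mN N0) => // x xN; rewrite !funenegE.
  by rewrite ge_max !le_max lexx orbT leeN2 (H x xN).
Qed.

Definition itg X := P.-integrable setT (fun x => (X x)%:E).

Definition mean X : R := fine (\int[P]_x (X x)%:E).

Lemma meanE X : itg X -> (\int[P]_x (X x)%:E)%E = (mean X)%:E.
Proof. by move=> i; rewrite /mean fineK// integrable_fin_num. Qed.

Lemma itg_measurable X : itg X -> measurable_fun setT X.
Proof. by move=> /measurable_int/measurable_EFinP. Qed.

Lemma itg_cst (c : R) : itg (fun=> c).
Proof.
apply/integrableP; split; first by apply/measurable_EFinP; exact: measurable_cst.
by rewrite integral_cst//= probability_setT mule1 ltry.
Qed.

Lemma mean_cst (c : R) : mean (fun=> c) = c.
Proof. by rewrite /mean integral_cst//= probability_setT mule1. Qed.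

Lemma itgD X Y : itg X -> itg Y -> itg (fun x => X x + Y x).
Proof. by move=> iX iY; have := integrableD measurableT iX iY. Qed.

Lemma itgZ (c : R) X : itg X -> itg (fun x => c * X x).
Proof. by move=> iX; have := integrableZl measurableT c iX. Qed.

Lemma itgB X Y : itg X -> itg Y -> itg (fun x => X x - Y x).
Proof. by move=> iX iY; have := integrableB measurableT iX iY. Qed.

Lemma itg_norm X : itg X -> itg (fun x => `|X x|).
Proof. by move=> iX; have := integrable_abse iX. Qed.

Lemma itg_le X Y : measurable_fun setT X -> itg Y -> (forall x, `|X x| <= Y x) -> itg X.
Proof.
move=> mX iY H; apply: (le_integrable measurableT) iY; first exact/measurable_EFinP.
by move=> x _; rewrite lee_fin (le_trans (H x))// ler_norm.
Qed.

Lemma itg_bounded X (c : R) : measurable_fun setT X -> (forall x, `|X x| <= c) -> itg X.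
Proof. by move=> mX H; exact: itg_le mX (itg_cst c) H. Qed.

Lemma itgM X U (c : R) : measurable_fun setT X -> (forall x, `|X x| <= c) -> itg U ->
  itg (fun x => X x * U x).
Proof.
move=> mX H iU; apply: (itg_le _ (itgZ c (itg_norm iU))) => [|x].
  by apply: measurable_funM => //; exact: itg_measurable.
by rewrite normrM ler_wpM2r.
Qed.

Lemma meanD X Y : itg X -> itg Y -> mean (fun x => X x + Y x) = mean X + mean Y.
Proof.
move=> iX iY; apply: EFin_inj; rewrite -meanE ?EFinD -?meanE//; last exact: itgD.
by rewrite -integralD.
Qed.

Lemma meanZ (c : R) X : itg X -> mean (fun x => c * X x) = c * mean X.
Proof.
move=> iX; apply: EFin_inj; rewrite -meanE ?EFinM -?meanE//; last exact: itgZ.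
by rewrite -integralZl.
Qed.

Lemma meanB X Y : itg X -> itg Y -> mean (fun x => X x - Y x) = mean X - mean Y.
Proof.
move=> iX iY; have := meanD iX (itgZ (-1) iY); rewrite meanZ// mulN1r => <-.
by congr mean; apply/funext => x; rewrite mulN1r.
Qed.

Lemma itg_sum (I : Type) (s : seq I) (F : I -> T -> R) : (forall i, itg (F i)) ->
  itg (fun x => \sum_(i <- s) F i x) /\
  mean (fun x => \sum_(i <- s) F i x) = \sum_(i <- s) mean (F i).
Proof.
move=> iF; elim: s => [|i s [IH1 IH2]].
  rewrite big_nil -[in RHS](mean_cst 0).
  by rewrite (_ : (fun x => _) = fun=> 0); [split; [exact: itg_cst|]|apply/funext => x; rewrite big_nil].
rewrite big_cons -IH2 -meanD// (_ : (fun x => _) = fun x => F i x + \sum_(j <- s) F j x).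
  by split => //; exact: itgD.
by apply/funext => x; rewrite big_cons.
Qed.

Lemma mean_le_off_null X Y (N : set T) : itg X -> itg Y -> measurable N -> P N = 0%E ->
  (forall x, ~ N x -> X x <= Y x) -> mean X <= mean Y.
Proof.
move=> iX iY mN N0 H; rewrite -lee_fin -!meanE//.
by apply: (integral_le_off_null mN N0) => x xN; rewrite lee_fin; exact: H.
Qed.

Lemma mean_le X Y : itg X -> itg Y -> (forall x, X x <= Y x) -> mean X <= mean Y.
Proof. by move=> iX iY H; exact: mean_le_off_null iX iY measurable0 (measure0 P) (fun x _ => H x). Qed.

Lemma mean_norm X : itg X -> `|mean X| <= mean (fun x => `|X x|).
Proof.
move=> iX; have iN := itg_norm iX.
have h1 := mean_le iX iN (fun x => ler_norm (X x)).
have h2 : mean (fun x => -1 * X x) <= mean (fun x => `|X x|).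
  by apply: mean_le => // [|x]; [exact: itgZ|rewrite mulN1r -normrN ler_norm].
by rewrite meanZ// in h2; rewrite ler_norml; lra.
Qed.

Lemma mean_le_norm X e : measurable_fun setT X -> (\int[P]_x `|(X x)%:E| <= e%:E)%E ->
  itg X /\ mean (fun x => `|X x|) <= e.
Proof.
move=> mX H; have iX : itg X.
  by apply/integrableP; split; [exact/measurable_EFinP|exact: le_lt_trans H (ltry _)].
by split => //; rewrite -lee_fin -meanE//; exact: itg_norm.
Qed.

Lemma mean_markov X (c e : R) : itg X -> (forall x, 0 <= X x) -> 0 < c -> mean X <= c * e ->
  (P [set x | (c <= X x)%R] <= e%:E)%E.
Proof.
move=> iX X0 c0 H; set A := [set x | _].
have mA : measurable A.
  rewrite (_ : A = X @^-1` `[c, +oo[%classic); last by apply/seteqP; split => x; rewrite /A /= in_itv/= andbT.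
  by rewrite -[_ @^-1` _]setTI; apply: (itg_measurable iX).
have mI : measurable_fun setT (\1_A : T -> R) by exact: measurable_indic.
have iA : itg (\1_A) by apply: (itg_bounded mI (c := 1)) => x; rewrite indicE ger0_norm ?lern1 ?leq_b1.
have : mean (fun x => c * \1_A x) <= mean X.
  apply: mean_le => [||x]; [exact: itgZ|exact: iX|rewrite indicE].
  by have [|_] := boolP (x \in A); [rewrite inE mulr1|rewrite mulr0].
rewrite meanZ// => h; have : mean (\1_A) <= e by rewrite -(ler_pM2l c0); exact: le_trans h H.
by rewrite -lee_fin -meanE// integral_indic// setIT.
Qed.

Lemma mean_dominated_cvg (Xn : nat -> T -> R) X g (N : set T) :
  (forall n, measurable_fun setT (Xn n)) -> measurable_fun setT X ->
  measurable N -> P N = 0%E -> (forall x, ~ N x -> (fun n => Xn n x) @ \oo --> X x) ->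
  P.-integrable setT g -> (forall n x, ~ N x -> (`|Xn n x|%:E <= g x)%E) ->
  [/\ forall n, itg (Xn n), itg X & (fun n => mean (Xn n)) @ \oo --> mean X].
Proof.
move=> mXn mX mN N0 cv ig H.
have aN (Q : T -> Prop) : (forall x, ~ N x -> Q x) -> {ae P, forall x, Q x}.
  by move=> h; exists N; split => // x /= nQ; apply: contrapT => /h.
have mXnE n : measurable_fun setT (fun x => (Xn n x)%:E) by exact/measurable_EFinP.
have mXE : measurable_fun setT (fun x => (X x)%:E) by exact/measurable_EFinP.
have [||iX _ cm] := @dominated_convergence _ _ _ P setT measurableT (fun n x => (Xn n x)%:E)
  (fun x => (X x)%:E) g mXnE mXE _ ig _.
- apply: aN => x xN _; apply: cvg_EFin; first exact: nearW.
  exact: cv.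
- by apply: aN => x xN n _; exact: H.
have iXn n : itg (Xn n).
  have gX x : ~ N x -> (`|(Xn n x)%:E| <= g x)%E by exact: H.
  apply/integrableP; split => //; have /integrableP[_ gf] := ig.
  apply: le_lt_trans gf; apply: (integral_le_off_null mN N0) => x xN.
  by apply: le_trans (gX x xN) _; exact: lee_abs.
split => //.
rewrite (_ : (fun n => _) = fun n => fine ((fun n => (\int[P]_x (Xn n x)%:E)%E) n))//.
by apply: fine_cvg; rewrite -meanE//.
Qed.

Lemma itg_trunc X (e : R) : itg X -> 0 < e -> exists2 N : R, 0 < N &
  mean (fun x => `|X x| - Num.min `|X x| N) <= e.
Proof.
move=> iX e0; have iN := itg_norm iX; have mN := itg_measurable iN.
pose F n x := `|X x| - Num.min `|X x| n%:R.
have mF n : measurable_fun setT (F n).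
  apply: measurable_funB => //; apply: measurable_minr => //; exact: measurable_cst.
have FN n x : `|F n x| <= `|X x|.
  by rewrite /F; have := normr_ge0 (X x); have := ler0n R n; case: (leP `|X x| n%:R) => h a b; rewrite ger0_norm; lra.
have cF x : ~ set0 x -> (fun n => F n x) @ \oo --> (0 : R).
  move=> _; apply: cvg_near_cst; exists (Num.truncn `|X x|).+1 => // n /= h.
  have : `|X x| < n%:R by apply: lt_le_trans (truncnS_gt _) _; rewrite ler_nat.
  by rewrite /F => /ltW/min_l ->; rewrite subrr.
have [] := mean_dominated_cvg mF (measurable_cst (0 : R)) measurable0 (measure0 P) cF iN.
  by move=> n x _; rewrite lee_fin.
move=> _ _; rewrite mean_cst => cv'.
have /cvgrPdist_le/(_ e e0)[n _ /(_ n.+1 (leqnSn n))] := cv'.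
rewrite /= sub0r normrN => h; exists n.+1%:R => //.
exact: le_trans (ler_norm _) h.
Qed.

(** [U] is merely integrable, so it is cut at a level [N]: the cut part sees the convergence in
    mean, and the tail is weighted by at most [2 * c]. *)
Lemma mean_lim_bounded (Xn : nat -> T -> R) X U (c : R) : itg U ->
  (forall n, measurable_fun setT (Xn n)) -> measurable_fun setT X ->
  (forall n x, `|Xn n x| <= c) -> (forall x, `|X x| <= c) ->
  (forall e, 0 < e -> exists n, mean (fun x => `|Xn n x - X x|) <= e) ->
  (forall n, mean (fun x => Xn n x * U x) = 0) -> mean (fun x => X x * U x) = 0.
Proof.
move=> iU mXn mX Xnc Xc H Z.
have iXU : itg (fun x => X x * U x) by exact: itgM mX Xc iU.
have iXnU n : itg (fun x => Xn n x * U x) by exact: itgM (mXn n) (Xnc n) iU.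
have c0 : 0 <= c by exact: le_trans (normr_ge0 _) (Xc point).
apply/eqP; rewrite -normr_le0; apply/ler_addgt0Pr => e_; move: (e_ : R) => e e0; rewrite add0r.
have [|N N0 HN] := @itg_trunc U (e / (4 * c + 4)) iU; first by rewrite divr_gt0//; lra.
have [|n Hn] := H (e / (2 * N)); first by rewrite divr_gt0// mulr_gt0.
rewrite -[mean _]subr0 -(Z n) -meanB//.
have iB := itgB iXU (iXnU n).
apply: le_trans (mean_norm iB) _.
have mD : measurable_fun setT (fun x => Xn n x - X x) by exact: measurable_funB.
have bD x : `|Xn n x - X x| <= 2 * c.
  by apply: le_trans (ler_normB _ _) _; have := Xnc n x; have := Xc x; lra.
have iD : itg (fun x => `|Xn n x - X x|) by apply: itg_norm; exact: itg_bounded mD bD.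
have mT : measurable_fun setT (fun x => `|U x| - Num.min `|U x| N).
  have mU := itg_measurable (itg_norm iU).
  apply: measurable_funB => //; apply: measurable_minr => //; exact: measurable_cst.
have T0 x : 0 <= `|U x| - Num.min `|U x| N by rewrite subr_ge0 ge_min lexx.
have iT : itg (fun x => `|U x| - Num.min `|U x| N).
  apply: (itg_le mT (itg_norm iU)) => x; rewrite ger0_norm// gerBl le_min normr_ge0; exact: ltW.
apply: (@le_trans _ _ (mean (fun x => N * `|Xn n x - X x| + 2 * c * (`|U x| - Num.min `|U x| N)))).
  apply: mean_le => [||x]; [exact: itg_norm|exact: itgD (itgZ _ iD) (itgZ _ iT)|].
  rewrite -mulrBl normrM distrC.
  have a0 := normr_ge0 (Xn n x - X x); have b0 := bD x; have u0 := normr_ge0 (U x).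
  by case: (leP `|U x| N) => h; nra.
rewrite (meanD (itgZ _ iD) (itgZ _ iT)) !meanZ//.
have h1 : N * mean (fun x => `|Xn n x - X x|) <= e / 2.
  by rewrite -ler_pdivlMl// (_ : N^-1 * (e / 2) = e / (2 * N))//; field; lra.
have h2 : 2 * c * mean (fun x => `|U x| - Num.min `|U x| N) <= e / 2.
  apply: le_trans (ler_wpM2l _ HN) _; first lra.
  by rewrite mulrA ler_pdivrMr; [nra|lra].
lra.
Qed.

End Expectation.

(** * Martingales under the representing measures *)

Section LipVariables.
Context {R : realType}.
Local Notation Omega := (path_space R).
Implicit Types (X Y : Omega -> R) (t : R).

Lemma skelM us us' C C' (X X' : (R -> R) -> R) : skel us C X -> skel us' C' X' ->
  skel (us ++ us') (C * C') (fun g => X g * X' g).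
Proof.
move=> s s'; have C0 := skel_ge0 s; have C'0 := skel_ge0 s'.
have [h1 h2] := s; have [h1' h2'] := s'; split => [g|g g'].
  by rewrite normrM; exact: ler_pM.
have -> : X g * X' g - X g' * X' g' = (X g - X g') * X' g + X g' * (X' g - X' g') by ring.
apply: le_trans (ler_normD _ _) _; rewrite !normrM big_cat /= mulrDr; apply: lerD.
- rewrite (mulrC C C') -mulrA mulrC; exact: ler_pM.
- by rewrite -mulrA; exact: ler_pM.
Qed.

Lemma skel_comp us C (X : (R -> R) -> R) h c l : skel us C X -> (forall y, `|h y| <= c) ->
  (forall x y, `|h x - h y| <= l * `|x - y|) -> skel us (c + l * C) (fun g => h (X g)).
Proof.
move=> s hc hl; have C0 := skel_ge0 s.
have c0 : 0 <= c := le_trans (normr_ge0 _) (hc 0).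
have l0 : 0 <= l by have := le_trans (normr_ge0 _) (hl 1 0); rewrite subr0 normr1 mulr1.
have lC := mulr_ge0 l0 C0; split => [g|g g'].
  by apply: le_trans (hc _) _; rewrite lerDl.
apply: le_trans (hl _ _) _; apply: le_trans (ler_wpM2l l0 (s.2 g g')) _.
by rewrite mulrA ler_wpM2r ?sumr_ge0// lerDr.
Qed.

Lemma skel_Lip us C Xh X t : 0 <= t -> skel us C Xh -> {in us, forall s, 0 <= s <= t} ->
  (forall w : Omega, X w = Xh w) -> Lip t X.
Proof.
move=> t0 s ust e; have C0 := skel_ge0 s.
(* Position 0 is taken by the extra time 0, which makes the list nonempty as [Lip] demands; hence
   the shifted index. *)
pose g (x : seq R) s := x`_(index s us).+1.
exists (0 :: us), (fun x => Xh (g x)); split => //.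
- by move=> r; rewrite inE => /predU1P[->|/ust//]; rewrite lexx.
- exists (C + C * (size us)%:R); have M0 : 0 <= C * (size us)%:R by rewrite mulr_ge0.
  split => [x _|x y sx sy]; first by apply: le_trans (s.1 _) _; rewrite lerDl.
  set S := \sum_(i < _) _; have S0 : 0 <= S by exact: sumr_ge0.
  apply: le_trans (s.2 _ _) _; apply: (@le_trans _ _ (C * (size us)%:R * S)); last first.
    by rewrite ler_wpM2r// lerDr.
  rewrite -mulrA ler_wpM2l//.
  have -> : (size us)%:R * S = \sum_(r <- us) S.
    by rewrite big_const_seq count_predT iter_addr addr0 mulr_natl.
  rewrite !big_seq; apply: ler_sum => r rus; rewrite /g.
  have h : ((index r us).+1 < size (0%R :: us))%N by rewrite /= ltnS index_mem.
  by rewrite /S (bigD1 (Ordinal h))//= lerDl sumr_ge0.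
- move=> w; rewrite e; apply: (skel_eq s) => r rus.
  by rewrite /g /= (nth_map 0) ?index_mem// nth_index.
Qed.

Lemma Lip_time t X : Lip t X -> 0 <= t.
Proof.
move=> [[|r ts] [phi [//= _ /(_ r (mem_head _ _)) h _ _]]].
by case/andP: h => /le_trans; apply.
Qed.

Lemma Lip_mono s t X : s <= t -> Lip s X -> Lip t X.
Proof.
move=> st [ts [phi [h1 h2 h3 h4]]]; exists ts, phi; split => // r /h2/andP[-> rs].
exact: le_trans rs st.
Qed.

Lemma Lip_cst t c : 0 <= t -> Lip t (fun _ : Omega => c).
Proof. by move=> t0; exact: (skel_Lip t0 (skel_cst c)). Qed.

Lemma LipD t X Y : Lip t X -> Lip t Y -> Lip t (fun w => X w + Y w).
Proof.
move=> lX lY; have t0 := Lip_time lX.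
have [us [C [Xh [s h e]]]] := Lip_skel lX; have [us' [C' [Xh' [s' h' e']]]] := Lip_skel lY.
apply: (skel_Lip t0 (skelD s s')) => [r|w]; last by rewrite e e'.
by rewrite mem_cat => /orP[/h|/h'].
Qed.

Lemma LipM t X Y : Lip t X -> Lip t Y -> Lip t (fun w => X w * Y w).
Proof.
move=> lX lY; have t0 := Lip_time lX.
have [us [C [Xh [s h e]]]] := Lip_skel lX; have [us' [C' [Xh' [s' h' e']]]] := Lip_skel lY.
apply: (skel_Lip t0 (skelM s s')) => [r|w]; last by rewrite e e'.
by rewrite mem_cat => /orP[/h|/h'].
Qed.

Lemma Lip_comp t X h c l : Lip t X -> (forall y, `|h y| <= c) ->
  (forall x y, `|h x - h y| <= l * `|x - y|) -> Lip t (fun w => h (X w)).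
Proof.
move=> lX hc hl; have t0 := Lip_time lX.
have [us [C [Xh [s hu e]]]] := Lip_skel lX.
by apply: (skel_Lip t0 (skel_comp s hc hl)) => // w; rewrite e.
Qed.

Lemma LipZ t X c : Lip t X -> Lip t (fun w => c * X w).
Proof. by move=> lX; apply: LipM => //; exact: Lip_cst (Lip_time lX). Qed.

Lemma skel_incr h c l (u v : R) : (forall y, `|h y| <= c) ->
  (forall x y, `|h x - h y| <= l * `|x - y|) -> skel [:: u; v] (c + l) (fun g => h (g u - g v)).
Proof.
move=> hc hl; have c0 : 0 <= c := le_trans (normr_ge0 _) (hc 0).
have l0 : 0 <= l by have := le_trans (normr_ge0 _) (hl 1 0); rewrite subr0 normr1 mulr1.
split => [g|g g']; first by apply: le_trans (hc _) _; rewrite lerDl.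
apply: le_trans (hl _ _) _; rewrite !big_cons big_nil addr0.
have -> : g u - g v - (g' u - g' v) = (g u - g' u) - (g v - g' v) by ring.
by apply: ler_pM => //; [rewrite lerDr|exact: ler_normB].
Qed.

Lemma Lip_incr t h c l (u v : R) : 0 <= u <= t -> 0 <= v <= t -> (forall y, `|h y| <= c) ->
  (forall x y, `|h x - h y| <= l * `|x - y|) -> Lip t (fun w : Omega => h (w u - w v)).
Proof.
move=> ut vt hc hl; have t0 : 0 <= t by case/andP: ut => /le_trans; apply.
by apply: (skel_Lip t0 (skel_incr u v hc hl)) => // r; rewrite !inE => /orP[/eqP->|/eqP->].
Qed.

Lemma Lip_measurable t X : Lip t X -> measurable_fun setT X.
Proof. by move=> /Lip_skel[us [C [Xh [s _ e]]]]; exact: skel_measurable s e. Qed.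

Lemma Lip_bounded t X : Lip t X -> exists C, forall w, `|X w| <= C.
Proof. by move=> /Lip_skel[us [C [Xh [s _ e]]]]; exists C => w; rewrite e; exact: s.1. Qed.

Lemma Lip_stop t X w : Lip t X -> X (stop t w) = X w.
Proof.
move=> /Lip_skel[us [C [Xh [s h e]]]]; rewrite !e; apply: (skel_eq s) => r /h/andP[_ rt] /=.
by rewrite min_l.
Qed.

Lemma SG0_Lip T eta t : SG0 T eta -> 0 <= t -> Lip t (eta t).
Proof.
move=> [ts [h [tsT [C [h1 h2]] e]]] t0.
pose us := [seq Num.min s t | s <- ts].
have C0 : 0 <= C by apply: le_trans (normr_ge0 _) (h1 (t :: us) _); rewrite /= size_map.
apply: (@skel_Lip us C (fun g => h (t :: [seq g s | s <- us]))) => //.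
- split => [g|g g']; first by apply: h1; rewrite /= !size_map.
  apply: le_trans (h2 _ _ _ _) _; rewrite /= ?size_map//; apply: ler_wpM2l => //.
  rewrite big_ord_recl /= subrr normr0 add0r (big_nth 0) big_mkord size_map.
  apply: ler_sum => i _; rewrite /= !(nth_map 0) ?size_map ?ltn_ord//; exact: lexx.
- by move=> r /mapP[s /tsT/andP[s0 _] ->]; rewrite le_min s0 t0 ge_min lexx orbT.
- by move=> w; rewrite e /us -map_comp.
Qed.

Definition clip (N y : R) : R := Num.max (- N) (Num.min N y).

Lemma clip_bound N y : 0 <= N -> `|clip N y| <= N.
Proof.
move=> N0; rewrite /clip ler_norml le_max lexx /= ge_max ge_min lexx andbT; lra.
Qed.

Lemma clip_lip N x y : `|clip N x - clip N y| <= 1 * `|x - y|.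
Proof.
by rewrite mul1r; exact: le_trans (max_lip _ _ _) (min_lip _ _ _).
Qed.

Lemma clip_id N y : `|y| <= N -> clip N y = y.
Proof. by rewrite ler_norml /clip => /andP[a b]; rewrite min_r// max_r. Qed.

(** Used with the powers 2 and 4: the first fits a barrier, the second is controlled by the fourth
    moment. *)
Lemma clip_near N y (n : nat) : 1 <= N -> `|clip N y - y| <= `|y| ^+ n.+2 / N.
Proof.
move=> N1; have N0 : 0 < N by lra.
have y40 : 0 <= `|y| ^+ n.+2 by exact: exprn_ge0.
have [yN|Ny] := leP `|y| N; first by rewrite clip_id// subrr normr0 divr_ge0// ltW.
have h1 : `|clip N y - y| <= `|y|.
  rewrite /clip; have := ler_norm y; have := ler_norm (- y); rewrite normrN => a b.
  case: (leP N y) => h; first by rewrite max_r ?ler_norml; lra.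
  by case: (leP (- N) y) => h'; rewrite ler_norml; lra.
apply: le_trans h1 _; rewrite ler_pdivlMr//.
have y1 : 1 <= `|y| by lra.
rewrite exprS; apply: ler_wpM2l => //; apply: le_trans (ltW Ny) _.
by apply: ler_eXnr.
Qed.

End LipVariables.

(** * Moments and martingale increments under [calP] *)

Section CalP.
Context {R : realType} (sl su : R).
Hypotheses (Hsl : 0 <= sl) (Hsu : sl <= su).
Local Notation Omega := (path_space R).
Local Notation calP := (calP sl su).
Local Notation K4 := (3 * (su ^+ 2) ^+ 2).
Implicit Types (X Y : Omega -> R) (P : probability Omega R).

Lemma calP_attains X c : nested sl su X c -> exists2 P, calP P & mean P X = c.
Proof.
move=> n; have [f df fX] := dominated_exists Hsl Hsu n.
have [P HP] := dominated_realized Hsl Hsu df.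
have [us [C [Xh [_ [s _ _ e _]]]]] := n.
exists P; last by rewrite /mean (HP _ _ _ _ s e).
move=> Y d lY; have nY := lip_E_nested Hsl Hsu lY.
have [us' [C' [Yh [_ [s' _ _ e' _]]]]] := nY; rewrite (HP _ _ _ _ s' e') lee_fin.
by have [_ _ _ ] := df; apply.
Qed.

Lemma calP_nested P X c : calP P -> nested sl su X c -> itg P X /\ mean P X <= c.
Proof.
move=> hP n; have [us [C [Xh [_ [s _ _ e _]]]]] := n.
have iX : itg P X.
  by apply: (itg_bounded P (skel_measurable s e) (c := C)) => w; rewrite e; exact: s.1.
by split => //; rewrite -lee_fin -meanE//; apply: hP; exact: nested_lip_E.
Qed.

Lemma capacity_null P (A : set Omega) : calP P -> capacity sl su A = 0%E -> P A = 0%E.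
Proof.
move=> hP c0; apply/eqP; rewrite eq_le measure_ge0 andbT -c0.
by apply: ereal_sup_ubound; exists P.
Qed.

(** Given the path up to [v], the factor [xi] is a constant [a] bounded by [Cx]. The constant is
    chosen before [P], so the estimate is uniform over [calP]. *)
Lemma incr_mean v xi : Lip v xi -> exists2 Cx, 0 <= Cx & forall P C L phi u c, calP P ->
  blip C L phi -> v < u ->
  (forall a, `|a| <= Cx -> heat sl su (fun y => a * phi y) (u - v) 0 <= c) ->
  mean P (fun w => xi w * phi (w u - w v)) <= c.
Proof.
move=> lx; have v0 := Lip_time lx; have [us [Cx [Xh [s ust e]]]] := Lip_skel lx.
exists Cx; first exact: skel_ge0 s.
move=> P C L phi u c hP [b1 b2] vu H.
have sk := skelM s (skel_incr u v b1 b2).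
have n := skel_nested sl su sk (fun w : Omega => erefl _).
have -> : (fun w => xi w * phi (w u - w v)) = fun w : Omega => Xh w * phi (w u - w v).
  by apply/funext => w; rewrite e.
apply: le_trans (calP_nested hP n).2 _.
apply: (nested_last Hsl Hsu v0 vu sk _ _ n) => // [r|g [_ fg]].
  by rewrite mem_cat !inE => /orP[/ust/andP[_ ->]|/orP[/eqP->|/eqP->]]; [left|right|left].
rewrite (_ : (fun y => _) = fun y => Xh g * phi y); first by apply: H; exact: s.1.
apply/funext => y; congr (_ * phi _).
  apply: (skel_eq s) => r /ust/andP[_ rv]; rewrite /step ifF ?addr0//.
  by apply/negbTE; rewrite -ltNge (le_lt_trans rv).
by rewrite /step lexx leNgt vu /= addr0 (fg u (ltW vu)); ring.
Qed.

Lemma blipZ C L phi (a : R) : blip C L phi -> blip (`|a| * C) (`|a| * L) (fun y => a * phi y).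
Proof.
move=> [b1 b2]; split => [y|x y]; first by rewrite normrM ler_wpM2l.
by rewrite -mulrBr normrM -mulrA ler_wpM2l.
Qed.

Lemma blip_clip4 (N : R) : 0 < N -> blip (N ^+ 4) (4 * N ^+ 3) (fun y => N ^+ 4 * clip4 (y / N)).
Proof.
move=> N0; have N40 : 0 <= N ^+ 4 by rewrite exprn_ge0// ltW.
split => [y|x y].
  rewrite normrM !ger0_norm ?clip4_ge0// -[leRHS]mulr1 ler_wpM2l// clip4_le1//.
rewrite -mulrBr normrM ger0_norm//; apply: le_trans (ler_wpM2l N40 (clip4_lip _ _)) _.
rewrite -mulrBl normrM (@ger0_norm _ N^-1) ?invr_ge0 ?(ltW N0)//.
by rewrite le_eqVlt; apply/orP; left; apply/eqP; field; rewrite gt_eqF.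
Qed.

Lemma incr_clip4 P u v (N : R) : calP P -> 0 <= v -> v <= u -> 0 < N ->
  mean P (fun w => N ^+ 4 * clip4 ((w u - w v) / N)) <= K4 * (u - v) ^+ 2.
Proof.
move=> hP v0; rewrite le_eqVlt => /predU1P[<- N0|vu N0].
  rewrite subrr expr0n /= mulr0 (_ : (fun w => _) = fun=> 0) ?mean_cst//.
  by apply/funext => w; rewrite subrr mul0r /clip4 normr0 min_r// expr0n mulr0.
have b := blip_clip4 N0.
have sk := skel_incr u v b.1 b.2.
have n := skel_nested sl su sk (fun w : Omega => erefl _).
apply: le_trans (calP_nested hP n).2 _.
apply: (nested_last Hsl Hsu v0 vu sk _ _ n) => // [r|g [_ fg]].
  by rewrite !inE => /orP[/eqP->|/eqP->]; [right|left].
rewrite (_ : (fun y => _) = fun y => N ^+ 4 * clip4 (y / N)); last first.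
  apply/funext => y; rewrite /step lexx leNgt vu /= addr0 (fg u (ltW vu)).
  by congr (_ * clip4 (_ / _)); ring.
have d0 : 0 <= u - v by lra.
have := @heat_barrier _ _ _ Hsl Hsu _ _ _ 0 0 0 1 _ b ltr01 d0.
rewrite !mul0r !add0r mulr1 /Defs.G oppr0 maxxx !mulr0 subrr !mul0r add0r; apply => z.
rewrite !mul0r !add0r mul1r; apply: le_trans (ler_wpM2l _ (clip4_le _)) _.
  by rewrite exprn_ge0// ltW.
by rewrite exprMn exprVn mulrC divfK// expf_neq0// gt_eqF.
Qed.

(** Monotone convergence along the truncations $\min(n+1, |y|)^4$, which are cylinder variables. *)
Lemma incr_moment P u v : calP P -> 0 <= v -> v <= u ->
  itg P (fun w => (w u - w v) ^+ 4) /\ mean P (fun w => (w u - w v) ^+ 4) <= K4 * (u - v) ^+ 2.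
Proof.
move=> hP v0 vu; set X := fun w : Omega => _.
have mX : measurable_fun setT X.
  by apply: measurable_funX; apply: measurable_funB; exact: measurable_B.
pose F (n : nat) (w : Omega) : R := n.+1%:R ^+ 4 * clip4 ((w u - w v) / n.+1%:R).
have n0 n : 0 < n.+1%:R :> R by rewrite ltr0n.
have F0 n w : 0 <= F n w by rewrite /F mulr_ge0 ?exprn_ge0 ?clip4_ge0.
have FE n w : F n w = Num.min n.+1%:R `|w u - w v| ^+ 4.
  rewrite /F /clip4 -exprMn; congr (_ ^+ _).
  rewrite normrM (@ger0_norm _ _^-1) ?invr_ge0//; case: (leP 1 (`|w u - w v| / n.+1%:R)) => h.
    by rewrite mulr1 min_l//; move: h; rewrite ler_pdivlMr// mul1r.
  rewrite mulrC divfK ?gt_eqF// min_r// ltW//; move: h; rewrite ltr_pdivrMr// mul1r//.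
have mF n : measurable_fun setT (F n).
  have b := blip_clip4 (n0 n); exact: (skel_measurable (skel_incr u v b.1 b.2)).
have X0 w : 0 <= X w by rewrite /X (_ : 4 = 2 * 2)%N// exprM sqr_ge0.
have XF w : (fun n => F n w) @ \oo --> X w.
  apply: cvg_near_cst; exists (Num.truncn `|w u - w v|) => // n /= h.
  rewrite FE min_r; first by rewrite -normrX ger0_norm//; exact: X0.
  by apply/ltW/(lt_le_trans (truncnS_gt _)); rewrite ler_nat.
have iF n : itg P (F n).
  have b := blip_clip4 (n0 n).
  by apply: (itg_bounded P (mF n) (c := n.+1%:R ^+ 4)) => w; exact: b.1.
have H : (\int[P]_w `|(X w)%:E| <= (K4 * (u - v) ^+ 2)%:E)%E.
  have -> : (\int[P]_w `|(X w)%:E|)%E = (\int[P]_w limn (fun n => (F n w)%:E))%E.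
    apply: eq_integral => w _; rewrite abse_EFin ger0_norm//.
    by apply/esym/cvg_lim => //; apply: cvg_EFin; [exact: nearW|exact: XF].
  rewrite monotone_convergence//.
  - apply: lime_le.
      apply: ereal_nondecreasing_is_cvgn => m n mn; apply: ge0_le_integral => //.
      + by move=> w _; rewrite lee_fin.
      + exact/measurable_EFinP.
      + exact/measurable_EFinP.
      + move=> w _; rewrite lee_fin !FE; apply: lerXn2r; rewrite ?nnegrE ?le_min ?normr_ge0 ?ler0n//.
        by rewrite ge_min !ge_min lexx orbT ler_nat ltnS mn.
    apply: nearW => n; rewrite (meanE (iF n)) lee_fin; exact: incr_clip4.
  - by move=> n; exact/measurable_EFinP.
  - by move=> n w _; rewrite lee_fin.
  - move=> w _ m n mn; rewrite lee_fin !FE; apply: lerXn2r; rewrite ?nnegrE ?le_min ?normr_ge0 ?ler0n//.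
    by rewrite ge_min !ge_min lexx orbT ler_nat ltnS mn.
have [iX h] := mean_le_norm mX H; split => //.
move: h; congr (mean _ _ <= _); apply/funext => w; exact: ger0_norm.
Qed.

Lemma incr_itg P u v : calP P -> 0 <= v -> v <= u -> itg P (fun w => w u - w v).
Proof.
move=> hP v0 vu; have [i4 _] := incr_moment hP v0 vu.
apply: (itg_le _ (itgD (itg_cst P 1) i4)) => [|w].
  by apply: measurable_funB; exact: measurable_B.
have y40 : 0 <= (w u - w v) ^+ 4 by rewrite (_ : 4 = 2 * 2)%N// exprM sqr_ge0.
have [h|h] := leP `|w u - w v| 1; first lra.
rewrite -(ger0_norm y40) normrX.
have : `|w u - w v| <= `|w u - w v| ^+ 4 by apply: ler_eXnr => //; exact: ltW.
lra.
Qed.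

(** The increment is unbounded, hence clipped at [N]. A multiple [a] of the clipped increment [z] is
    at most $az + |a|z^2/N + z^4/N$, whose barrier value is $O(1/N)$; the clipping error is $O(1/N)$
    by the fourth moment. [K] collects both, and [N] tends to infinity. *)
Lemma martingale_incr_le P u v xi : calP P -> v <= u -> Lip v xi ->
  mean P (fun w => xi w * (w u - w v)) <= 0.
Proof.
move=> hP vu lx; have v0 := Lip_time lx.
move: vu; rewrite le_eqVlt => /predU1P[<-|vu].
  by rewrite (_ : (fun w => _) = fun=> 0) ?mean_cst//; apply/funext => w; rewrite subrr mulr0.
have [Cx Cx0 H] := incr_mean lx.
have [Cb bx] := Lip_bounded lx; have Cb0 : 0 <= Cb by exact: le_trans (normr_ge0 _) (bx point).
have [i4 m4] := incr_moment hP v0 (ltW vu).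
have iI := incr_itg hP v0 (ltW vu).
have mx := Lip_measurable lx.
have d0 : 0 < u - v by lra.
pose K := su ^+ 2 * Cx * (u - v) + K4 * (u - v) ^+ 2 + Cb * (K4 * (u - v) ^+ 2).
have K40 : 0 <= K4 * (u - v) ^+ 2 by rewrite mulr_ge0 ?sqr_ge0// mulr_ge0// sqr_ge0.
have su0 : 0 <= su ^+ 2 by exact: sqr_ge0.
have sC0 : 0 <= su ^+ 2 * Cx by exact: mulr_ge0.
have sCd0 : 0 <= su ^+ 2 * Cx * (u - v) by apply: mulr_ge0 => //; exact: ltW.
have K0 : 0 <= K.
  by apply: addr_ge0; [exact: addr_ge0|exact: mulr_ge0].
have mI : measurable_fun setT (fun w : Omega => w u - w v).
  by apply: measurable_funB; exact: measurable_B.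
have step1 (N : R) : 1 <= N -> mean P (fun w => xi w * (w u - w v)) <= K / N.
  move=> N1; have N0 : 0 < N by lra.
  have iN0 : 0 < N^-1 by rewrite invr_gt0.
  have bc : blip N 1 (clip N) by split; [move=> y; apply: clip_bound; exact: ltW|move=> x y; exact: clip_lip].
  have mc : measurable_fun setT (fun w : Omega => clip N (w u - w v)).
    exact: (skel_measurable (skel_incr u v bc.1 bc.2) (fun w : Omega => erefl _)).
  have ic : itg P (fun w => clip N (w u - w v)).
    apply: (itg_bounded P mc (c := N)) => w.
    exact: bc.1.
  have h1 : mean P (fun w => xi w * clip N (w u - w v)) <= (su ^+ 2 * Cx * (u - v) + K4 * (u - v) ^+ 2) / N.
    apply: (H P _ _ _ _ _ hP bc vu) => a aC.
    have := @heat_barrier _ _ _ Hsl Hsu _ _ _ 0 a (2 * `|a| / N) N^-1 _ (blipZ a bc) iN0 (ltW d0).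
    have b0 : 0 <= 2 * `|a| / N by rewrite divr_ge0 ?mulr_ge0// ltW.
    have -> : Defs.G sl su (2 * `|a| / N) = su ^+ 2 * `|a| / N.
      rewrite /Defs.G max_l// max_r ?oppr_le0//; field; lra.
    move=> h; apply: le_trans (h _) _.
      move=> z; rewrite add0r.
      have z40 : 0 <= N^-1 * z ^+ 4 by apply: mulr_ge0; [exact: ltW|rewrite (_ : 4 = 2 * 2)%N// exprM sqr_ge0].
      have c1 := @clip_near _ N z 0 N1.
      have c2 : a * (clip N z - z) <= `|a| * (`|z| ^+ 2 / N).
        by apply: le_trans (ler_norm _) _; rewrite normrM ler_wpM2l.
      have -> : 2 * `|a| / N / 2 * z ^+ 2 = `|a| * (`|z| ^+ 2 / N).
        by rewrite real_normK ?num_real//; field; lra.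
      by move: c2 z40; rewrite mulrBr; lra.
    rewrite add0r [leRHS]mulrDl; apply: lerD; last by rewrite le_eqVlt; apply/orP; left; apply/eqP; ring.
    rewrite mulrAC; apply: ler_wpM2r; first exact: ltW.
    by apply: ler_wpM2r; [exact: ltW|exact: ler_wpM2l].
  have i1 : itg P (fun w => xi w * clip N (w u - w v)) by apply: (itgM mx bx).
  have i2 : itg P (fun w => xi w * (w u - w v)) by apply: (itgM mx bx).
  have i3 : itg P (fun w => Cb / N * (w u - w v) ^+ 4) by exact: itgZ.
  have h2 : mean P (fun w => xi w * (w u - w v)) <=
      mean P (fun w => xi w * clip N (w u - w v) + Cb / N * (w u - w v) ^+ 4).
    apply: mean_le => // [|w]; first exact: itgD.
    set y := w u - w v; have c1 := @clip_near _ N y 2 N1.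
    have c2 : xi w * (y - clip N y) <= Cb * (`|y| ^+ 4 / N).
      apply: le_trans (ler_norm _) _; rewrite normrM distrC; exact: ler_pM.
    have -> : Cb / N * y ^+ 4 = Cb * (`|y| ^+ 4 / N).
      have -> : `|y| ^+ 4 = y ^+ 4 by rewrite -normrX ger0_norm// (_ : 4 = 2 * 2)%N// exprM sqr_ge0.
      ring.
    by move: c2; rewrite mulrBr; lra.
  apply: le_trans h2 _; rewrite meanD// meanZ//.
  have h3 : Cb / N * mean P (fun w => (w u - w v) ^+ 4) <= Cb / N * (K4 * (u - v) ^+ 2).
    by apply: ler_wpM2l => //; rewrite divr_ge0// ltW.
  apply: le_trans (lerD h1 h3) _; rewrite le_eqVlt; apply/orP; left; apply/eqP.
  rewrite /K; ring.
apply/ler_addgt0Pr => e e0; rewrite add0r.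
pose N := 1 + K / e; have N1 : 1 <= N by rewrite lerDl divr_ge0// ltW.
apply: le_trans (step1 N N1) _; rewrite ler_pdivrMr ?(lt_le_trans ltr01)// /N mulrDr mulr1.
by rewrite mulrCA divff ?gt_eqF// mulr1 lerDr ltW.
Qed.

Lemma martingale_incr P u v xi : calP P -> v <= u -> Lip v xi ->
  mean P (fun w => xi w * (w u - w v)) = 0.
Proof.
move=> hP vu lx; have v0 := Lip_time lx; have mx := Lip_measurable lx.
have [Cb bx] := Lip_bounded lx.
have i2 : itg P (fun w => xi w * (w u - w v)) by apply: (itgM mx bx); exact: incr_itg.
apply/eqP; rewrite eq_le martingale_incr_le//=.
have := martingale_incr_le hP vu (LipZ (-1) lx).
have -> : (fun w => -1 * xi w * (w u - w v)) = fun w => -1 * (xi w * (w u - w v)).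
  by apply/funext => w; rewrite mulrA.
by rewrite meanZ// mulN1r oppr_le0.
Qed.

End CalP.

(** * Norm convergence as uniform convergence over [calP] *)

Section UniformNorms.
Context {R : realType} (sl su : R).
Hypotheses (Hsl : 0 <= sl) (Hsu : sl <= su).
Local Notation Omega := (path_space R).
Local Notation calP := (calP sl su).
Local Notation Ehat := (Ehat sl su).
Local Notation Lnorm_G := (Lnorm_G sl su).
Implicit Types (X Y : Omega -> R) (P : probability Omega R).

(** A substitute for Jensen's inequality that is linear in $x^p$ and so passes through integrals at
    once; the scale [e] is free. *)
Lemma le_powR_split (e p x : R) : 0 < e -> 1 <= p -> 0 <= x ->
  x <= e + e `^ (1 - p) * x `^ p.
Proof.
move=> e0 p1 x0; have h0 : 0 <= e `^ (1 - p) * x `^ p by rewrite mulr_ge0 ?powR_ge0.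
have [xe|ex] := leP x e; first lra.
suff : x <= e `^ (1 - p) * x `^ p by lra.
have x0' : 0 < x by exact: lt_trans ex.
have -> : e `^ (1 - p) = (e `^ (p - 1))^-1 by rewrite -powRN opprB.
rewrite ler_pdivlMl ?powR_gt0// -[leRHS](mulr_powRB1 x0) ?(lt_le_trans ltr01)//.
rewrite mulrC; apply: ler_wpM2l => //; apply: ge0_ler_powR; rewrite ?nnegrE ?subr_ge0//; exact: ltW.
Qed.

(** One index [n0] serves every [P], which is how convergence in the norms is exploited from here
    on. *)
Lemma norm_small p (F : nat -> Omega -> \bar R) : 0 < p -> (forall n w, (0 <= F n w)%E) ->
  (fun n => (Ehat (F n) `^ p^-1)%E) @ \oo --> 0%E -> forall e, 0 < e ->
  exists n0, forall n, (n0 <= n)%N -> forall P, calP P -> (\int[P]_w F n w <= e%:E)%E.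
Proof.
move=> p0 F0 /fine_cvgP[[n1 _ H1] H2] e e0.
have d0 : 0 < e `^ p^-1 by exact: powR_gt0.
have /cvgrPdist_lt/(_ _ d0)[n2 _ {}H2] := H2.
exists (maxn n1 n2) => n; rewrite geq_max => /andP[/H1 f1 /H2]; rewrite /= sub0r normrN => f2 P hP.
rewrite leNgt; apply/negP => h; have hE : (e%:E <= Ehat (F n))%E.
  by apply: (le_trans (ltW h)); apply: ereal_sup_ubound; exists P.
have pi0 : 0 <= p^-1 by rewrite invr_ge0 ltW.
have := @gt0_ler_poweR _ _ pi0 e%:E (Ehat (F n)).
rewrite !in_itv /= !leey !andbT !lee_fin.
have E0 : (0 <= Ehat (F n))%E by apply: le_trans hE; rewrite lee_fin ltW.
move=> /(_ (ltW e0) E0 hE) /=; rewrite -(fineK f1) lee_fin => h2.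
by have := lt_le_trans f2 h2; rewrite ltNge ler_norm.
Qed.

Lemma Lnorm_small p (Xn : nat -> Omega -> R) X : 1 <= p ->
  (forall n, measurable_fun setT (Xn n)) -> measurable_fun setT X ->
  (fun n => Lnorm_G p (fun w => Xn n w - X w)) @ \oo --> 0%E -> forall e, 0 < e ->
  exists n0, forall n, (n0 <= n)%N -> forall P, calP P ->
    itg P (fun w => Xn n w - X w) /\ mean P (fun w => `|Xn n w - X w|) <= e.
Proof.
move=> p1 mXn mX cv e e0; have p0 : 0 < p by lra.
have e20 : 0 < e / 2 by lra.
pose a := (e / 2) `^ (1 - p); have a0 : 0 < a by exact: powR_gt0.
have c0 : 0 < e / 2 / a by rewrite divr_gt0.
have F0 n w : (0 <= (`|Xn n w - X w| `^ p)%:E)%E by rewrite lee_fin powR_ge0.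
have [n0 H] := norm_small p0 F0 cv c0.
exists n0 => n /H {}H P hP; set D := fun w => _.
have mD : measurable_fun setT D by exact: measurable_funB.
have mDp : measurable_fun setT (fun w => `|D w| `^ p).
  by apply: (@measurableT_comp _ _ _ _ _ _ (fun x : R => x `^ p)); [exact: measurable_powR|exact: measurableT_comp].
have [|iDp hDp] := @mean_le_norm _ _ _ P (fun w => `|D w| `^ p) (e / 2 / a) mDp.
  apply: le_trans (H P hP); rewrite le_eqVlt; apply/orP; left; apply/eqP.
  by apply: eq_integral => w _; rewrite gee0_abs// lee_fin powR_ge0.
have iB := itgD (itg_cst P (e / 2)) (itgZ a iDp).
have hB w : `|D w| <= e / 2 + a * `|D w| `^ p by exact: le_powR_split.
have iD : itg P D by exact: itg_le mD iB hB.
split => //; apply: le_trans (mean_le (itg_norm iD) iB hB) _.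
rewrite (meanD (itg_cst P _) (itgZ _ iDp)) mean_cst meanZ//.
have : a * mean P (fun w => `|D w| `^ p) <= e / 2.
  rewrite -ler_pdivlMl// mulrC; apply: le_trans (mean_le iDp (itg_norm iDp) _) hDp => w.
  exact: ler_norm.
lra.
Qed.

Lemma calP_neq0 : calP !=set0.
Proof.
have [us [C [Xh [s _ e]]]] := Lip_skel (@Lip_cst R 0 0 (lexx 0)).
by have [P hP _] := calP_attains Hsl Hsu (skel_nested sl su s e); exists P.
Qed.

Lemma Lnorm1_le X (e : R) : 0 <= e -> (forall P, calP P -> (\int[P]_w (`|X w|)%:E <= e%:E)%E) ->
  (Lnorm_G 1 X <= e%:E)%E.
Proof.
move=> e0 H; have -> : Lnorm_G 1 X = (Ehat (fun w => `|X w|%:E) `^ 1)%E.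
  rewrite /Defs.Lnorm_G invr1; congr (Ehat _ `^ _)%E.
  by apply/funext => w; rewrite powRr1.
have h : (Ehat (fun w => `|X w|%:E) <= e%:E)%E by apply/ereal_supP => _ [P hP <-]; exact: H.
have [P hP] := calP_neq0; have E0 : (0 <= Ehat (fun w => `|X w|%:E))%E.
  apply: (@le_trans _ _ (\int[P]_w (`|X w|)%:E)%E); first by apply: integral_ge0 => w _; rewrite lee_fin.
  by apply: ereal_sup_ubound; exists P.
by rewrite poweRe1.
Qed.

Lemma capacity0 (A : set Omega) : (forall P, calP P -> P A = 0%E) -> capacity sl su A = 0%E.
Proof.
move=> H; have [P hP] := calP_neq0; apply/eqP; rewrite eq_le; apply/andP; split.
  by apply/ereal_supP => _ [Q hQ <-]; rewrite H.
by apply: ereal_sup_ubound; exists P => //; exact: H.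
Qed.

End UniformNorms.

(** * Optional stopping *)

Section Stopping.
Context {R : realType} (sl su : R).
Hypotheses (Hsl : 0 <= sl) (Hsu : sl <= su).
Local Notation Omega := (path_space R).
Local Notation calP := (calP sl su).
Implicit Types (X Y : Omega -> R) (P : probability Omega R).

Lemma sp_integral_itg P T (en : simple_process T) t : calP P -> 0 <= t ->
  itg P (sp_integral B en t).
Proof.
move=> hP t0; rewrite /sp_integral.
set ts := sp_times en; have ts_inc : path.path <%R 0 ts by exact: sp_increasing.
pose F (j : 'I_(size ts)) w := sp_coef en j w *
  (B (Num.min (node ts j.+1) t) w - B (Num.min (node ts j) t) w).
have iF j : itg P (F j).
  have lj := sp_lip (ltn_ord j); have [c hc] := Lip_bounded lj.
  apply: (itgM (Lip_measurable lj) hc); apply: (incr_itg Hsl Hsu hP).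
    by rewrite le_min t0 (Lip_time lj).
  rewrite le_min ge_min ge_min lexx orbT andbT.
  by rewrite (ltW (node_lt ts_inc (ltnSn j) (ltn_ord j))).
by have [] := itg_sum (index_enum 'I_(size ts)) iF.
Qed.

Lemma sp_integral_martingale P T (en : simple_process T) s t zeta :
  calP P -> 0 <= s -> s <= t -> Lip s zeta ->
  mean P (fun w => zeta w * (sp_integral B en t w - sp_integral B en s w)) = 0.
Proof.
move=> hP s0 st lz; have t0 : 0 <= t by exact: le_trans st.
set ts := sp_times en; have ts_inc : path.path <%R 0 ts by exact: sp_increasing.
have [c hc] := Lip_bounded lz; have mz := Lip_measurable lz.
pose D u (j : 'I_(size ts)) w := B (Num.min (node ts j.+1) u) w - B (Num.min (node ts j) u) w.
pose F (j : 'I_(size ts)) w := zeta w * (sp_coef en j w * (D t j w - D s j w)).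
have -> : (fun w => zeta w * (sp_integral B en t w - sp_integral B en s w)) =
    fun w => \sum_(j < size ts) F j w.
  apply/funext => w; rewrite /sp_integral -sumrB mulr_sumr; apply: eq_bigr => j _.
  by rewrite /F -mulrBr.
have iD u j : 0 <= u -> itg P (D u j).
  have lj := sp_lip (ltn_ord j).
  move=> u0; apply: (incr_itg Hsl Hsu hP); first by rewrite le_min u0 (Lip_time lj).
  rewrite le_min ge_min ge_min lexx orbT andbT.
  by rewrite (ltW (node_lt ts_inc (ltnSn j) (ltn_ord j))).
have iF j : itg P (F j).
  have lj := sp_lip (ltn_ord j); have [c' hc'] := Lip_bounded lj.
  apply: (itgM mz hc); apply: (itgM (Lip_measurable lj) hc'); apply: itgB; exact: iD.
have [_ ->] := itg_sum (index_enum 'I_(size ts)) iF.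
apply: big1 => j _; have lj := sp_lip (ltn_ord j); rewrite -/ts in lj.
have ab : node ts j < node ts j.+1 := node_lt ts_inc (ltnSn j) (ltn_ord j).
have z0 (X : Omega -> R) : (forall w, X w = 0) -> mean P X = 0.
  by move=> h; rewrite (_ : X = fun=> 0) ?mean_cst//; exact/funext.
(* Either [s] precedes the [j]-th interval, and both factors are known at its left end; or [s]
   follows it, and the term vanishes; or [s] cuts it, and the increment starts at [s]. *)
have [sa|as_] := leP s (node ts j).
- have [at_|ta] := leP (node ts j) t; last first.
    apply: z0 => w; rewrite /F /D !min_r ?(ltW (lt_trans ta ab)) ?(ltW ta)//.
      by rewrite !subrr !mulr0.
    + exact: le_trans sa (ltW ab).
  have := martingale_incr Hsl Hsu hP (_ : node ts j <= Num.min (node ts j.+1) t) (LipM (Lip_mono sa lz) lj).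
  rewrite le_min (ltW ab) at_ => /(_ isT) <-; congr mean; apply/funext => w.
  rewrite /F /D (min_l at_) (min_r sa) (@min_r _ _ (node ts j.+1) s) ?(le_trans sa (ltW ab))//.
  by rewrite subrr subr0 mulrA.
have [a's|sa'] := leP (node ts j.+1) s.
  apply: z0 => w; rewrite /F /D !min_l ?(ltW as_)// ?(le_trans _ st) ?(ltW as_)//.
  by rewrite subrr !mulr0.
have := martingale_incr Hsl Hsu hP (_ : s <= Num.min (node ts j.+1) t) (LipM lz (Lip_mono (ltW as_) lj)).
rewrite le_min (ltW sa') st => /(_ isT) <-; congr mean; apply/funext => w.
rewrite /F /D (@min_l _ _ (node ts j) t) ?(le_trans (ltW as_) st)//.
rewrite (@min_l _ _ (node ts j) s) ?(ltW as_)// (@min_r _ _ (node ts j.+1) s) ?(ltW sa')//.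
by rewrite -mulrA /B; congr (_ * (_ * _)); ring.
Qed.

Lemma ito_itg P p T eta J t : calP P -> 1 <= p -> is_ito sl su p T eta J -> 0 <= t <= T ->
  itg P (J t).
Proof.
move=> hP p1 [mJ _ [en [_ cv]]] tT; have t0 : 0 <= t by case/andP: tT.
have mI n : measurable_fun setT (sp_integral B (en n) t).
  exact: itg_measurable (sp_integral_itg (en n) hP t0).
have [n0 /(_ n0 (leqnn _) P hP)[iD _]] := Lnorm_small p1 mI (mJ t tT) (cv t tT) ltr01.
have := itgB (sp_integral_itg (en n0) hP t0) iD; congr itg.
by apply/funext => w; rewrite opprB addrCA subrr addr0.
Qed.

Lemma ito_martingale P p T eta J s t zeta : calP P -> 1 <= p -> is_ito sl su p T eta J ->
  0 <= s -> s <= t -> t <= T -> Lip s zeta -> mean P (fun w => zeta w * (J t w - J s w)) = 0.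
Proof.
move=> hP p1 ito s0 st tT lz; have [mJ _ [en [_ cv]]] := ito.
have t0T : 0 <= t <= T by rewrite tT (le_trans s0 st).
have s0T : 0 <= s <= T by rewrite s0 (le_trans st tT).
have mI n u : 0 <= u -> measurable_fun setT (sp_integral B (en n) u).
  by move=> u0; exact: itg_measurable (sp_integral_itg (en n) hP u0).
have [c hc] := Lip_bounded lz; have mz := Lip_measurable lz.
have c0 : 0 <= c := le_trans (normr_ge0 _) (hc point).
have iJt := ito_itg hP p1 ito t0T; have iJs := ito_itg hP p1 ito s0T.
apply/eqP; rewrite -normr_le0; apply/ler_addgt0Pr => e_; move: (e_ : R) => e e0; rewrite add0r.
have d0 : 0 < e / (2 * c + 1) by rewrite divr_gt0//; lra.
have [n1 H1] := Lnorm_small p1 (fun n => mI n t (le_trans s0 st)) (mJ t t0T) (cv t t0T) d0.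
have [n2 H2] := Lnorm_small p1 (fun n => mI n s s0) (mJ s s0T) (cv s s0T) d0.
pose n := maxn n1 n2.
have [iD1 h1] := H1 n (leq_maxl _ _) P hP; have [iD2 h2] := H2 n (leq_maxr _ _) P hP.
have iI : itg P (fun w => zeta w * (sp_integral B (en n) t w - sp_integral B (en n) s w)).
  by apply: (itgM mz hc); apply: itgB; apply: sp_integral_itg => //; exact: le_trans st.
have iJ : itg P (fun w => zeta w * (J t w - J s w)) by apply: (itgM mz hc); exact: itgB.
rewrite -[mean _ _]subr0 -(sp_integral_martingale (en n) hP s0 st lz) -meanB//.
apply: le_trans (mean_norm (itgB iJ iI)) _.
pose U w := c * (`|sp_integral B (en n) t w - J t w| + `|sp_integral B (en n) s w - J s w|).
have iU : itg P U by apply: itgZ; apply: itgD; exact: itg_norm.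
apply: (@le_trans _ _ (mean P U)).
  apply: mean_le => // [|w]; first exact/itg_norm/itgB.
  rewrite -mulrBr normrM; apply: ler_pM => //.
  rewrite (_ : _ - _ - _ = (sp_integral B (en n) s w - J s w) - (sp_integral B (en n) t w - J t w)); last by ring.
  by rewrite [leRHS]addrC; exact: ler_normB.
rewrite /U meanZ ?meanD ?itg_norm//; last by apply: itgD; exact: itg_norm.
apply: (@le_trans _ _ (c * (2 * (e / (2 * c + 1))))).
  apply: ler_wpM2l => //; lra.
have -> : c * (2 * (e / (2 * c + 1))) = (2 * c * e) / (2 * c + 1) by field; lra.
rewrite ler_pdivrMr; nra.
Qed.

(** Two approximations in turn: [X] by its decreasing sequence in $L_G^1$, and the members of that
    sequence by cylinder variables. Clipping at 1 fixes [X] and bounds the approximations, as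
    [mean_lim_bounded] needs. *)
Lemma LG1star_martingale P s X U : calP P -> LG1star sl su s X -> (forall w, 0 <= X w <= 1) ->
  0 <= s -> itg P U -> (forall zeta, Lip s zeta -> mean P (fun w => zeta w * U w) = 0) ->
  mean P (fun w => X w * U w) = 0.
Proof.
move=> hP [mu _ [Xn [LX [N [mN cN HN]]]]] X01 s0 iU H.
have mX : measurable_fun setT X.
  move=> _ C mC; rewrite setTI; have [A [mA ->]] := mu C mC.
  have ms : measurable_fun setT (stop s : Omega -> Omega).
    apply: measurable_path => t t0; have := measurable_B (Num.min t s); congr measurable_fun.
  by rewrite -[_ @^-1` _]setTI; apply: ms.
have mXn n : measurable_fun setT (Xn n) by have [] := LX n.
have PN : P N = 0%E := capacity_null hP cN.
have mc (Y : Omega -> R) : measurable_fun setT Y -> measurable_fun setT (fun w => clip 1 (Y w)).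
  move=> mY; rewrite /clip; apply: measurable_maxr; first exact: measurable_cst.
  apply: measurable_minr => //; exact: measurable_cst.
have cX w : clip 1 (X w) = X w by apply: clip_id; have := X01 w; rewrite ler_norml; lra.
have cv w : ~ N w -> (fun n => `|clip 1 (Xn n w) - X w|) @ \oo --> (0 : R).
  move=> /HN[_ /cvgrPdist_le h]; apply/cvgrPdist_le => e e0; have := h e e0; apply: filterS => n.
  rewrite sub0r normrN normr_id -[X in clip _ _ - X]cX distrC => h'.
  by apply: le_trans (clip_lip _ _ _) _; rewrite mul1r.
have mD n : measurable_fun setT (fun w => `|clip 1 (Xn n w) - X w|).
  by apply: measurableT_comp => //; apply: measurable_funB => //; exact: mc.
have D2 n w : `|clip 1 (Xn n w) - X w| <= 2.
  apply: le_trans (ler_normB _ _) _; have := clip_bound (Xn n w) (@ler01 R).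
  by have := X01 w; move=> /andP[x0 x1]; rewrite (ger0_norm x0); lra.
have [|iD _ ] := mean_dominated_cvg mD (measurable_cst (0 : R)) mN PN cv (itg_cst P 2).
  by move=> n w _; rewrite lee_fin normr_id D2.
rewrite mean_cst => cm.
have [Z HZ] : {Z : nat -> Omega -> R & forall k, Lip s (Z k) /\
    mean P (fun w => `|clip 1 (Z k w) - X w|) <= k.+1%:R^-1}.
  apply: (@choice _ _ (fun k (Z : Omega -> R) => Lip s Z /\ mean P (fun w => `|clip 1 (Z w) - X w|) <= k.+1%:R^-1)) => k.
  have e0 : 0 < k.+1%:R^-1 / 2 :> R by rewrite divr_gt0 ?invr_gt0.
  have /cvgrPdist_le/(_ _ e0)[n _ /(_ n (leqnn n))] := cm.
  rewrite /= sub0r normrN => hn.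
  have [_ [Zn [lZ cZ]]] := LX n.
  have [m /(_ m (leqnn m) P hP)[iE hE]] := Lnorm_small (lexx 1) (fun m => Lip_measurable (lZ m)) (mXn n) cZ e0.
  exists (Zn m); split => //.
  have mZ := Lip_measurable (lZ m).
  apply: (@le_trans _ _ (mean P (fun w => `|Zn m w - Xn n w| + `|clip 1 (Xn n w) - X w|))).
    apply: mean_le => [||w]; last first.
    + apply: le_trans (ler_distD (clip 1 (Xn n w)) _ _) _; apply: lerD => //.
      by apply: le_trans (clip_lip _ _ _) _; rewrite mul1r.
    + by apply: itgD => //; exact: itg_norm.
    apply: itg_norm; apply: (itg_bounded P _ (c := 2)) => [|w].
      by apply: measurable_funB => //; exact: mc.
    apply: le_trans (ler_normB _ _) _; have := clip_bound (Zn m w) (@ler01 R).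
    by have := X01 w; move=> /andP[x0 x1]; rewrite (ger0_norm x0); lra.
  rewrite (meanD (itg_norm iE) (iD n)) [leRHS]splitr; apply: lerD => //.
  exact: le_trans (ler_norm _) hn.
apply: (@mean_lim_bounded _ _ _ P (fun k w => clip 1 (Z k w)) X U 1) => //.
- by move=> k; apply: mc; exact: Lip_measurable (HZ k).1.
- by move=> k w; exact: clip_bound.
- by move=> w; have := X01 w => /andP[x0 x1]; rewrite ger0_norm.
- move=> e e0; exists (Num.truncn e^-1); apply: le_trans (HZ _).2 _.
  by rewrite invf_ple ?posrE ?ltr0Sn//; exact/ltW/truncnS_gt.
- move=> k; apply: H; apply: (Lip_comp (HZ k).1 (c := 1) (l := 1)) => [y|x y].
  + exact: clip_bound.
  + exact: clip_lip.
Qed.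

(** For [z] in [[0, 1]] this is $\lceil zN\rceil/N$. Rounding up matters: whether the rounded time
    exceeds [r / N] is decided by the indicator of [tau <= r / N]. *)
Definition rnd N (z : R) : R := (\sum_(r < N) (r%:R < z * N%:R)%R)%N%:R / N%:R.

Lemma rnd_near N z : (0 < N)%N -> 0 <= z <= 1 -> z <= rnd N z <= z + N%:R^-1.
Proof.
move=> N0 /andP[z0 z1]; have N0' : 0 < N%:R :> R by rewrite ltr0n.
have zN : z * N%:R <= N%:R by apply: ler_piMl => //; exact: ltW.
have zN0 : 0 <= z * N%:R by apply: mulr_ge0 => //; exact: ltW.
have [/(_ zN zN0)/andP[h1 h2] _] := count_lt N (z * N%:R).
rewrite /rnd ler_pdivlMr// h1/= ler_pdivrMr// mulrDl mulVf ?gt_eqF//.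
Qed.

Lemma rnd_dyadic N z : exists2 k, (k <= N)%N & rnd N z = k%:R / N%:R.
Proof.
exists (\sum_(r < N) (r%:R < (z * N%:R)%R)%R)%N => //.
have : (\sum_(r < N) (r%:R < (z * N%:R)%R)%R <= \sum_(r < N) 1)%N by apply: leq_sum => i _; exact: leq_b1.
by rewrite sum1_card card_ord.
Qed.

Lemma telescope_lt N (z : R) (a : nat -> R) :
  \sum_(r < N) (r%:R < z)%R%:R * (a r.+1 - a r) = a (\sum_(r < N) (r%:R < z)%R)%N - a 0%N.
Proof.
elim: N => [|N IH]; first by rewrite !big_ord0 subrr.
rewrite !big_ord_recr /= IH; have [Nz|_] := ltP N%:R z; last by rewrite mul0r addr0 addn0.
by rewrite (count_lt N z).2 ?(ltW Nz)// mul1r addn1; ring.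
Qed.

(** A discrete stochastic integral: the weight of the [r]-th cell is known at its left end [r / N].
    The finite sum also shows that the stopped variable is measurable. *)
Lemma rnd_sum (J : R -> Omega -> R) (tau : Omega -> R) N w : (0 < N)%N ->
  J (rnd N (tau w)) w = J 0 w + \sum_(r < N) (1 - \1_[set w | tau w <= r%:R / N%:R] w) *
    (J (r.+1%:R / N%:R) w - J (r%:R / N%:R) w).
Proof.
move=> N0; have N0' : 0 < N%:R :> R by rewrite ltr0n.
have := @telescope_lt N (tau w * N%:R) (fun r => J (r%:R / N%:R) w).
rewrite mul0r -/(rnd N _) => /eqP; rewrite eq_sym subr_eq addrC => /eqP ->; congr (_ + _).
apply: eq_bigr => r _; congr (_ * _); rewrite indicE.
rewrite -ltr_pdivrMr// ltNge; have [h|h] := boolP (tau w <= r%:R / N%:R).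
  by rewrite mem_set//= subrr.
by rewrite memNset/= ?subr0//; exact/negP.
Qed.

Lemma stopping_time_measurable tau t : stopping_times01 sl su tau -> 0 <= t ->
  measurable_fun setT (\1_[set w | tau w <= t] : Omega -> R).
Proof.
move=> [[_ /(_ t) H] _] t0; have [mu _ _] := H t0 => _ C mC.
rewrite setTI; have [A [mA ->]] := mu C mC.
have ms : measurable_fun setT (stop t : Omega -> Omega).
  apply: measurable_path => s s0; have := measurable_B (Num.min s t); congr measurable_fun.
by rewrite -[_ @^-1` _]setTI; apply: ms.
Qed.

Lemma measurable_rnd tau N (J : R -> Omega -> R) : stopping_times01 sl su tau -> (0 < N)%N ->
  (forall t, 0 <= t <= 1 -> measurable_fun setT (J t)) ->
  measurable_fun setT (fun w => J (rnd N (tau w)) w).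
Proof.
move=> st N0 mJ; have N0' : 0 < N%:R :> R by rewrite ltr0n.
have m01 r : (r <= N)%N -> measurable_fun setT (J (r%:R / N%:R)).
  by move=> rN; apply: mJ; rewrite divr_ge0//= ler_pdivrMr// mul1r ler_nat.
rewrite (_ : (fun w => _) = fun w => J 0 w + \sum_(r < N) (1 - \1_[set w | tau w <= r%:R / N%:R] w) *
    (J (r.+1%:R / N%:R) w - J (r%:R / N%:R) w)); last by apply/funext => w; exact: rnd_sum.
apply: measurable_funD; first by apply: mJ; rewrite lexx ler01.
have mF (r : 'I_N) : measurable_fun setT (fun w => (1 - \1_[set w | tau w <= r%:R / N%:R] w) *
    (J (r.+1%:R / N%:R) w - J (r%:R / N%:R) w)).
  apply: measurable_funM; last by apply: measurable_funB; apply: m01 => //; exact: ltnW.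
  apply: measurable_funB; first exact: measurable_cst.
  by apply: stopping_time_measurable => //; rewrite divr_ge0.
exact: measurable_sum.
Qed.

Lemma optional_stopping P p eta J tau N : calP P -> 1 <= p -> is_ito sl su p 1 eta J ->
  stopping_times01 sl su tau -> (0 < N)%N ->
  itg P (fun w => J (rnd N (tau w)) w) /\ mean P (fun w => J (rnd N (tau w)) w) = mean P (J 0).
Proof.
move=> hP p1 ito st N0; have N0' : 0 < N%:R :> R by rewrite ltr0n.
have m01 r : (r <= N)%N -> 0 <= (r%:R / N%:R : R) <= 1.
  by move=> rN; rewrite divr_ge0//= ler_pdivrMr// mul1r ler_nat.
pose F (r : 'I_N) w := (1 - \1_[set w | tau w <= r%:R / N%:R] w) *
    (J (r.+1%:R / N%:R) w - J (r%:R / N%:R) w).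
have iD (r : 'I_N) : itg P (fun w => J (r.+1%:R / N%:R) w - J (r%:R / N%:R) w).
  by apply: itgB; apply: (ito_itg hP p1 ito); apply: m01 => //; exact: ltnW.
pose A r w : R := \1_[set w | tau w <= r%:R / N%:R] w.
have A01 r w : 0 <= A r w <= 1 by rewrite /A indicE ler0n lern1 leq_b1.
have mA r : measurable_fun setT (A r).
  by apply: stopping_time_measurable => //; rewrite divr_ge0.
have iA (r : 'I_N) : itg P (fun w => A r w * (J (r.+1%:R / N%:R) w - J (r%:R / N%:R) w)).
  by apply: (itgM (mA r) (c := 1)) => // w; have /andP[a0 a1] := A01 r w; rewrite ger0_norm.
have zA (r : 'I_N) : mean P (fun w => A r w * (J (r.+1%:R / N%:R) w - J (r%:R / N%:R) w)) = 0.
  have r0 : 0 <= r%:R / N%:R :> R by rewrite divr_ge0.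
  apply: (LG1star_martingale hP _ (A01 r) r0 (iD r)) => [|zeta lz].
    by have [[_ h] _] := st; exact: h.
  apply: (ito_martingale hP p1 ito r0 _ _ lz); last by have /andP[] := m01 _ (ltn_ord r).
  by rewrite ler_pM2r ?invr_gt0// ler_nat.
have z1 (r : 'I_N) : mean P (fun w => J (r.+1%:R / N%:R) w - J (r%:R / N%:R) w) = 0.
  have r0 : 0 <= r%:R / N%:R :> R by rewrite divr_ge0.
  have := @ito_martingale P p 1 eta J (r%:R / N%:R) (r.+1%:R / N%:R) (fun=> 1) hP p1 ito r0 _ _ (Lip_cst 1 r0).
  rewrite ler_pM2r ?invr_gt0// ler_nat leqnSn => /(_ isT); have /andP[_ ->] := m01 _ (ltn_ord r) => /(_ isT) <-.
  by congr mean; apply/funext => w; rewrite mul1r.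
have FE r : F r = fun w => (J (r.+1%:R / N%:R) w - J (r%:R / N%:R) w) -
    A r w * (J (r.+1%:R / N%:R) w - J (r%:R / N%:R) w).
  by apply/funext => w; rewrite /F mulrBl mul1r.
have iF r : itg P (F r) by rewrite FE; exact: itgB.
have [iS mS] := itg_sum (index_enum 'I_N) iF.
have iJ0 : itg P (J 0) by apply: (ito_itg hP p1 ito); rewrite lexx ler01.
have -> : (fun w => J (rnd N (tau w)) w) = fun w => J 0 w + \sum_(r < N) F r w.
  by apply/funext => w; exact: rnd_sum.
split; first exact: itgD.
rewrite meanD// mS big1 ?addr0// => r _; rewrite FE meanB//.
by rewrite zA z1 subrr.
Qed.

End Stopping.

(** * Approximation by cylinder variables in capacity *)

Section QuasiContinuous.
Context {R : realType} (sl su : R).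
Hypotheses (Hsl : 0 <= sl) (Hsu : sl <= su).
Local Notation Omega := (path_space R).
Local Notation calP := (calP sl su).
Implicit Types (X Y : Omega -> R) (P : probability Omega R).

(* A form of quasi-continuity; unlike membership in $L_G^p$ it requires neither
   measurability nor integrability, so it passes to versions and to limits. *)
Definition qc (t : R) X : Prop := forall e, 0 < e -> exists (Z : Omega -> R) (A : set Omega),
  [/\ Lip t Z, measurable A, forall P, calP P -> (P A <= e%:E)%E &
      forall w, ~ A w -> `|Z w - X w| <= e].

Lemma Lip_qc t X : Lip t X -> qc t X.
Proof.
move=> lX e e0; exists X, set0; split => // [P _|w _]; first by rewrite measure0 lee_fin ltW.
by rewrite subrr normr0 ltW.
Qed.

Lemma qc_mono s t X : s <= t -> qc s X -> qc t X.
Proof.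
move=> st qX e e0; have [Z [A [lZ mA PA H]]] := qX e e0; exists Z, A; split => //.
exact: Lip_mono lZ.
Qed.

Lemma PU_le P (A A' : set Omega) (a b : R) : measurable A -> measurable A' ->
  (P A <= a%:E -> P A' <= b%:E -> P (A `|` A') <= (a + b)%:E)%E.
Proof.
move=> mA mA' PA PA'; rewrite EFinD; apply: le_trans (leeD PA PA').
exact: measureU2.
Qed.

Lemma qc_approx t X : (forall e, 0 < e -> exists Y A, [/\ qc t Y, measurable A,
    forall P, calP P -> (P A <= e%:E)%E & forall w, ~ A w -> `|Y w - X w| <= e]) -> qc t X.
Proof.
move=> H e e0; have e20 : 0 < e / 2 by rewrite divr_gt0.
have [Y [A [qY mA PA HA]]] := H _ e20; have [Z [A' [lZ mA' PA' HA']]] := qY _ e20.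
exists Z, (A `|` A'); split => // [|P hP|w nA]; first exact: measurableU.
  by rewrite (splitr e); apply: PU_le => //; [exact: PA|exact: PA'].
rewrite (splitr e); apply: le_trans (ler_distD (Y w) _ _) _; apply: lerD.
  by apply: HA' => ?; apply: nA; right.
by apply: HA => ?; apply: nA; left.
Qed.

Lemma qc_qs t X Y : qc t Y -> qs sl su (fun w => Y w = X w) -> qc t X.
Proof.
move=> qY [N [mN cN H]]; apply: qc_approx => e e0; exists Y, N; split => // [P hP|w nN].
  by rewrite (capacity_null hP cN) lee_fin ltW.
by rewrite H// subrr normr0 ltW.
Qed.

Lemma Lip_map2 (h : R -> R -> R) t X Y :
  (forall x y x' y', `|h x y - h x' y'| <= `|x - x'| + `|y - y'|) ->
  Lip t X -> Lip t Y -> Lip t (fun w => h (X w) (Y w)).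
Proof.
move=> Hh lX lY; have t0 := Lip_time lX.
have [us [C [Xh [s hu e]]]] := Lip_skel lX; have [us' [C' [Xh' [s' hu' e']]]] := Lip_skel lY.
have C0 := skel_ge0 s; have C'0 := skel_ge0 s'.
have sk : skel (us ++ us') (`|h 0 0| + C + C') (fun g => h (Xh g) (Xh' g)).
  have [h1 h2] := s; have [h1' h2'] := s'; split => [g|g g'].
    have := Hh (Xh g) (Xh' g) 0 0; rewrite !subr0; have := h1 g; have := h1' g.
    have := ler_normD (h (Xh g) (Xh' g) - h 0 0) (h 0 0); rewrite subrK; lra.
  apply: le_trans (Hh _ _ _ _) _; rewrite big_cat /= mulrDr; have h0 := normr_ge0 (h 0 0).
  apply: lerD; [apply: le_trans (h2 _ _) _|apply: le_trans (h2' _ _) _].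
    by rewrite ler_wpM2r ?sumr_ge0//; lra.
  by rewrite ler_wpM2r ?sumr_ge0//; lra.
apply: (skel_Lip t0 sk) => [r|w]; last by rewrite e e'.
by rewrite mem_cat => /orP[/hu|/hu'].
Qed.

Lemma qc_map2 (h : R -> R -> R) t X Y :
  (forall x y x' y', `|h x y - h x' y'| <= `|x - x'| + `|y - y'|) ->
  qc t X -> qc t Y -> qc t (fun w => h (X w) (Y w)).
Proof.
move=> Hh qX qY e e0; have e20 : 0 < e / 2 by rewrite divr_gt0.
have [Z [A [lZ mA PA HA]]] := qX _ e20; have [Z' [A' [lZ' mA' PA' HA']]] := qY _ e20.
exists (fun w => h (Z w) (Z' w)), (A `|` A'); split => [||P hP|w nA].
- exact: Lip_map2.
- exact: measurableU.
- by rewrite (splitr e); apply: PU_le => //; [exact: PA|exact: PA'].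
apply: le_trans (Hh _ _ _ _) _; rewrite (splitr e); apply: lerD.
  by apply: HA => ?; apply: nA; left.
by apply: HA' => ?; apply: nA; right.
Qed.

Lemma qcD t X Y : qc t X -> qc t Y -> qc t (fun w => X w + Y w).
Proof.
apply: (@qc_map2 (fun x y => x + y)) => x y x' y'.
by rewrite (_ : _ - _ = (x - x') + (y - y')) ?ler_normD//; ring.
Qed.

Lemma qcB t X Y : qc t X -> qc t Y -> qc t (fun w => X w - Y w).
Proof.
apply: (@qc_map2 (fun x y => x - y)) => x y x' y'.
by rewrite (_ : _ - _ = (x - x') - (y - y')) ?ler_normB//; ring.
Qed.

Lemma qc_min t X Y : qc t X -> qc t Y -> qc t (fun w => Num.min (X w) (Y w)).
Proof.
apply: (@qc_map2 (fun x y => Num.min x y)) => x y x' y'.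
have := ler_norm (x - x'); have := ler_norm (x' - x); rewrite (distrC x' x).
have := ler_norm (y - y'); have := ler_norm (y' - y); rewrite (distrC y' y).
by case: (leP x y) => ?; case: (leP x' y') => ?; rewrite ler_norml; lra.
Qed.

Lemma qc_LipM t xi X : Lip t xi -> qc t X -> qc t (fun w => xi w * X w).
Proof.
move=> lx qX; have [c hc] := Lip_bounded lx; have c0 : 0 <= c := le_trans (normr_ge0 _) (hc point).
move=> e_; move: (e_ : R) => e e0; have d0 : 0 < e / (c + 1) by rewrite divr_gt0//; lra.
have de : e / (c + 1) <= e by rewrite ler_pdivrMr; nra.
have [Z [A [lZ mA PA HA]]] := qX _ d0.
exists (fun w => xi w * Z w), A; split => // [|P hP|w nA]; first exact: LipM.
  by apply: le_trans (PA P hP) _; rewrite lee_fin.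
rewrite -mulrBr normrM; apply: le_trans (ler_pM _ _ (hc w) (HA w nA)) _ => //.
by rewrite mulrA ler_pdivrMr; nra.
Qed.

Lemma qc_sum t (I : Type) (r : seq I) (F : I -> Omega -> R) : 0 <= t -> (forall i, qc t (F i)) ->
  qc t (fun w => \sum_(i <- r) F i w).
Proof.
move=> t0 qF; elim: r => [|i r IH].
  by rewrite (_ : (fun w => _) = fun=> 0); [exact/Lip_qc/Lip_cst|apply/funext => w; rewrite big_nil].
rewrite (_ : (fun w => _) = fun w => F i w + \sum_(j <- r) F j w); first exact: qcD.
by apply/funext => w; rewrite big_cons.
Qed.

Lemma small_of_mean (e : R) X : measurable_fun setT X -> 0 < e ->
  (forall P, calP P -> itg P X /\ mean P (fun w => `|X w|) <= e * e) ->
  exists A, [/\ measurable A, forall P, calP P -> (P A <= e%:E)%E & forall w, ~ A w -> `|X w| <= e].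
Proof.
move=> mX e0 H; exists [set w | e <= `|X w|]; split.
- rewrite (_ : [set w | _] = (fun w => `|X w|) @^-1` `[e, +oo[%classic); last first.
    by apply/seteqP; split => w; rewrite /= in_itv/= andbT.
  have mN : measurable_fun setT (fun w => `|X w|) by exact: measurableT_comp.
  by rewrite -[_ @^-1` _]setTI; apply: mN.
- move=> P hP; have [iX mX'] := H P hP.
  exact: mean_markov (itg_norm iX) (fun w => normr_ge0 _) e0 mX'.
- by move=> w /= /negP; rewrite -ltNge => /ltW.
Qed.

Lemma qc_Lnorm p t (Xn : nat -> Omega -> R) X : 1 <= p -> (forall n, measurable_fun setT (Xn n)) ->
  measurable_fun setT X -> (fun n => Lnorm_G sl su p (fun w => Xn n w - X w)) @ \oo --> 0%E ->
  (forall n, qc t (Xn n)) -> qc t X.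
Proof.
move=> p1 mXn mX cv qXn; apply: qc_approx => e e0.
have [n /(_ n (leqnn _)) H] := Lnorm_small p1 mXn mX cv (mulr_gt0 e0 e0).
have mD : measurable_fun setT (fun w => Xn n w - X w) by exact: measurable_funB.
by have [A [mA PA HA]] := small_of_mean mD e0 H; exists (Xn n), A; split.
Qed.

(** Unbounded functions of an increment are reached by clipping at [N = 1 + K / e]: Markov's
    inequality and the fourth-moment bound [K] leave capacity at most [e] to the set where clipping
    acts. *)
Lemma qc_incr (h : R -> R) t u v : 0 <= v -> v <= u -> u <= t ->
  (forall N, 0 < N -> exists c l, (forall y, `|h (clip N y)| <= c) /\
     forall x y, `|h (clip N x) - h (clip N y)| <= l * `|x - y|) ->
  qc t (fun w => h (w u - w v)).
Proof.
move=> v0 vu ut Hh e_; move: (e_ : R) => e e0.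
pose K := 3 * (su ^+ 2) ^+ 2 * (u - v) ^+ 2.
have K0 : 0 <= K by apply: mulr_ge0; [apply: mulr_ge0 => //; exact: sqr_ge0|exact: sqr_ge0].
pose N := 1 + K / e; have N1 : 1 <= N by rewrite lerDl divr_ge0// ltW.
have [c [l [hc hl]]] := Hh N (lt_le_trans ltr01 N1).
have N40 : 0 < N ^+ 4 by rewrite exprn_gt0//; lra.
pose A := [set w : Omega | N ^+ 4 <= (w u - w v) ^+ 4].
exists (fun w => h (clip N (w u - w v))), A; split.
- apply: (@Lip_incr _ t (fun y => h (clip N y)) c l) => //; first by rewrite ut (le_trans v0 vu).
  by rewrite v0 (le_trans vu ut).
- have mI : measurable_fun setT (fun w : Omega => (w u - w v) ^+ 4).
    by apply: measurable_funX; apply: measurable_funB; exact: measurable_B.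
  rewrite (_ : A = (fun w : Omega => (w u - w v) ^+ 4) @^-1` `[N ^+ 4, +oo[%classic); last first.
    by apply/seteqP; split => w; rewrite /= in_itv/= andbT.
  by rewrite -[_ @^-1` _]setTI; apply: mI.
- move=> P hP; have [i4 m4] := incr_moment Hsl Hsu hP v0 vu.
  apply: (mean_markov i4) => // [w|]; first by rewrite (_ : 4 = 2 * 2)%N// exprM sqr_ge0.
  apply: (le_trans m4); rewrite -/K; apply: (@le_trans _ _ (N * e)).
    by rewrite /N mulrDl mul1r divfK ?gt_eqF// lerDr ltW.
  by apply: ler_wpM2r; [exact: ltW|apply: ler_eXnr].
- move=> w /negP; rewrite -ltNge => h4; rewrite clip_id ?subrr ?normr0 ?ltW//.
  have : `|w u - w v| ^+ 4 < N ^+ 4 by rewrite -normrX ger0_norm// (_ : 4 = 2 * 2)%N// exprM sqr_ge0.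
  by rewrite ltr_pXn2r// ?nnegrE//; lra.
Qed.

Lemma qc_B t : 0 <= t -> qc t (B t).
Proof.
move=> t0; have := @qc_incr id t t 0 (lexx 0) t0 (lexx t); rewrite /B => h.
rewrite (_ : (fun w : Omega => w t) = fun w : Omega => w t - w 0); last first.
  by apply/funext => w; rewrite (path_le0 w (lexx 0)) subr0.
apply: h => N N0; exists N, 1; split => [y|x y]; first by apply: clip_bound; exact: ltW.
exact: clip_lip.
Qed.

Lemma qc_incr2 t u v : 0 <= v -> v <= u -> u <= t -> qc t (fun w => (w u - w v) ^+ 2).
Proof.
move=> v0 vu ut; apply: (@qc_incr (fun y => y ^+ 2)) => // N N0.
have cb y := clip_bound y (ltW N0).
exists (N ^+ 2), (2 * N); split => [y|x y].
  by rewrite normrX; apply: lerXn2r; rewrite ?nnegrE// ltW.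
rewrite subr_sqr normrM mulrC; apply: ler_pM => //.
  by apply: le_trans (ler_normD _ _) _; have := cb x; have := cb y; lra.
by have := clip_lip N x y; rewrite mul1r.
Qed.

Lemma qc_simple_integral (W : R -> Omega -> R) T (en : simple_process T) t : 0 <= t ->
  (forall u, 0 <= u <= t -> qc u (W u)) -> qc t (sp_integral W en t).
Proof.
move=> t0 qW; rewrite /sp_integral.
set ts := sp_times en; have ts_inc : path.path <%R 0 ts by exact: sp_increasing.
have qWm j : qc t (W (Num.min (node ts j) t)) \/ node ts j < 0.
  have [j0|] := leP 0 (node ts j); [left|by right].
  have ut : Num.min (node ts j) t <= t by rewrite ge_min lexx orbT.
  by apply: (qc_mono ut); apply: qW; rewrite ut le_min j0 t0.
apply: qc_sum => // j; have lj := sp_lip (ltn_ord j); rewrite -/ts in lj.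
have ab := node_lt ts_inc (ltnSn j) (ltn_ord j).
have [jt|tj] := leP (node ts j) t; last first.
  rewrite (_ : (fun w => _) = fun=> 0); first exact/Lip_qc/Lip_cst.
  by apply/funext => w; rewrite !min_r ?(ltW (lt_trans tj ab)) ?ltW// subrr mulr0.
apply: qc_LipM; first exact: Lip_mono lj.
have j0 := Lip_time lj.
have [|] := qWm j; last by rewrite ltNge j0.
have [|] := qWm j.+1; last by rewrite ltNge (le_trans j0 (ltW ab)).
by rewrite (min_l jt) => q1 q2; exact: qcB.
Qed.

Lemma measurable_simple_integral (W : R -> Omega -> R) T (en : simple_process T) t : 0 <= t ->
  (forall u, 0 <= u <= t -> measurable_fun setT (W u)) -> measurable_fun setT (sp_integral W en t).
Proof.
move=> t0 mW; rewrite /sp_integral.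
set ts := sp_times en; have ts_inc : path.path <%R 0 ts by exact: sp_increasing.
have mF (j : 'I_(size ts)) : measurable_fun setT (fun w => sp_coef en j w *
    (W (Num.min (node ts j.+1) t) w - W (Num.min (node ts j) t) w)).
  have lj := sp_lip (ltn_ord j); rewrite -/ts in lj; have j0 := Lip_time lj.
  have ab := node_lt ts_inc (ltnSn j) (ltn_ord j).
  apply: measurable_funM; first exact: Lip_measurable lj.
  by apply: measurable_funB; apply: mW; rewrite le_min t0 ge_min lexx orbT ?j0 ?(le_trans j0 (ltW ab)).
exact: measurable_sum.
Qed.

Lemma qc_integral nrm p (W : R -> Omega -> R) T eta I t : 1 <= p -> 0 <= t <= T ->
  (forall u, 0 <= u <= T -> measurable_fun setT (W u) /\ qc u (W u)) ->
  is_integral sl su nrm p W T eta I -> qc t (I t).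
Proof.
move=> p1 tT HW [mI _ [en [_ /(_ t tT) cv]]]; have /andP[t0 t1] := tT.
have uT u : 0 <= u <= t -> 0 <= u <= T by move=> /andP[-> /le_trans]; apply.
apply: (qc_Lnorm p1 _ (mI t tT) cv) => n.
  by apply: measurable_simple_integral => // u /uT/HW[].
by apply: qc_simple_integral => // u /uT/HW[].
Qed.

Lemma Ehat_ge0 (F : Omega -> \bar R) : (forall w, (0 <= F w)%E) -> (0 <= Ehat sl su F)%E.
Proof.
move=> F0; have [P hP] := calP_neq0 Hsl Hsu.
apply: (@le_trans _ _ (\int[P]_w F w)%E); first exact: integral_ge0.
by apply: ereal_sup_ubound; exists P.
Qed.

Lemma SG_Lnorm p T (Xn : nat -> R -> Omega -> R) t : 1 <= p -> 0 <= t <= T ->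
  (fun n => Snorm sl su p T (Xn n)) @ \oo --> 0%E -> (fun n => Lnorm_G sl su p (Xn n t)) @ \oo --> 0%E.
Proof.
move=> p1 tT cv; apply: (squeeze_cvge _ (cvg_cst 0%E) cv); apply: nearW => n.
rewrite poweR_ge0 /=; apply: gt0_ler_poweR; rewrite ?in_itv /= ?leey ?andbT ?invr_ge0; first lra.
- by apply: Ehat_ge0 => w; rewrite lee_fin powR_ge0.
- apply: Ehat_ge0 => w; apply: (@le_trans _ _ (`|Xn n t w| `^ p)%:E); first by rewrite lee_fin powR_ge0.
  by apply: ereal_sup_ubound; exists t.
apply/ereal_supP => _ [P hP <-].
apply: (@le_trans _ _ (\int[P]_w ereal_sup [set (`|Xn n t w| `^ p)%:E | t in `[0%R, T]%classic])%E).
  apply: (ge0_integral_le_off_null measurable0 (measure0 P)) => [w|w|w _].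
  - by rewrite lee_fin powR_ge0.
  - apply: (@le_trans _ _ (`|Xn n t w| `^ p)%:E); first by rewrite lee_fin powR_ge0.
    by apply: ereal_sup_ubound; exists t.
  - by apply: ereal_sup_ubound; exists t.
by apply: ereal_sup_ubound; exists P.
Qed.

Lemma qc_SG p T eta t : 1 <= p -> SG sl su p T eta -> 0 <= t <= T -> qc t (eta t).
Proof.
move=> p1 [me _ [en [sen cv]]] tT; have /andP[t0 _] := tT.
have mn n : measurable_fun setT (en n t) := Lip_measurable (SG0_Lip (sen n) t0).
apply: (qc_Lnorm p1 mn (me t tT) (SG_Lnorm p1 tT cv)) => n; exact/Lip_qc/SG0_Lip.
Qed.

End QuasiContinuous.

(** * Quadratic variation *)

Section QuadraticVariation.
Context {R : realType} (sl su : R).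
Hypotheses (Hsl : 0 <= sl) (Hsu : sl <= su).
Local Notation Omega := (path_space R).

Let unif (t : R) n := mkseq (fun k => k.+1%:R * (t / n.+1%:R)) n.+1.

Lemma node_unif t n j : (j <= n.+1)%N -> node (unif t n) j = j%:R * (t / n.+1%:R).
Proof. by case: j => [|j] jn; rewrite /node /= ?mul0r// nth_mkseq. Qed.

Lemma unif_partition t n : 0 < t -> is_partition t (unif t n).
Proof.
move=> t0; have d0 : 0 < t / n.+1%:R by rewrite divr_gt0.
split; last first.
  rewrite (last_nth 0) size_mkseq -/(node _ _) node_unif// mulrC divfK// pnatr_eq0//.
apply/(pathP 0) => i; rewrite size_mkseq => i_n.
by rewrite -/(node _ _) node_unif 1?ltnW// nth_mkseq// ltr_pM2r// ltr_nat.
Qed.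

Lemma unif_mesh t : 0 <= t -> (fun n => mesh (unif t n)) @ \oo --> (0 : R).
Proof.
move=> t0; have H n : 0 <= mesh (unif t n) <= t / n.+1%:R.
  have d0 : 0 <= t / n.+1%:R by rewrite divr_ge0.
  rewrite /mesh big_seq; apply: (big_ind (fun x : R => 0 <= x <= t / n.+1%:R)) => [|x y /andP[x0 xd] /andP[y0 yd]|d].
  - by rewrite lexx.
  - by rewrite le_max x0 ge_max xd yd.
  move=> /(nthP 0)[j]; rewrite size_pairmap => js <-; rewrite increments_nth//.
  rewrite size_mkseq in js; rewrite !node_unif// 1?ltnW// -mulrBl -natr1 addrAC subrr add0r mul1r.
  by rewrite d0 lexx.
apply/cvgrPdist_le => e e0; exists (Num.truncn (t / e)) => // n /= hn.
rewrite sub0r normrN ger0_norm; last by have /andP[] := H n.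
have /andP[_ h] := H n; apply: le_trans h _.
rewrite ler_pdivrMr// -ler_pdivrMl// mulrC.
by apply/ltW/(lt_le_trans (truncnS_gt _)); rewrite ler_nat.
Qed.

Lemma qc_quadratic_variation T QV t : is_quadratic_variation sl su T QV -> 0 <= t <= T ->
  qc sl su t (QV t).
Proof.
move=> [mQ _ H] tT; have /andP[t0 _] := tT.
have [ts pt mt] : exists2 ts : nat -> seq R, (forall n, is_partition t (ts n)) &
    (fun n => mesh (ts n)) @ \oo --> (0 : R).
  (* Partitions increase strictly from 0, so for [t = 0] only the empty one exists. *)
  move: t0; rewrite le_eqVlt => /predU1P[<-|t0].
    exists (fun=> [::]) => [n|]; first by split.
    rewrite /mesh /increments /= big_nil; exact: cvg_cst.
  by exists (unif t) => [n|]; [exact: unif_partition|exact/unif_mesh/ltW].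
have nt n j : (j <= size (ts n))%N -> 0 <= node (ts n) j <= t.
  move=> jn; have [p l] := pt n; rewrite (_ : 0 = node (ts n) 0)// node_le//=.
  by rewrite -l (last_nth 0) -/(node _ _) node_le.
have E n : (fun w : Omega => \sum_(d <- increments w (ts n)) d ^+ 2) =
    fun w => \sum_(j < size (ts n)) (w (node (ts n) j.+1) - w (node (ts n) j)) ^+ 2.
  apply/funext => w; rewrite (big_nth 0) big_mkord size_pairmap; apply: eq_bigr => j _.
  by rewrite increments_nth.
have mI n (j : 'I_(size (ts n))) : measurable_fun setT
    (fun w : Omega => (w (node (ts n) j.+1) - w (node (ts n) j)) ^+ 2).
  by apply: measurable_funX; apply: measurable_funB; exact: measurable_B.
have p2 : 1 <= (2 : R) by rewrite ler1n.
have {}H := H t tT ts pt mt.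
apply: (qc_Lnorm p2 _ (mQ t tT) H) => n; rewrite E.
  exact: measurable_sum.
apply: (@qc_sum _ _ _ _ 'I_(size (ts n)) _ (fun j w => (w (node (ts n) j.+1) - w (node (ts n) j)) ^+ 2) t0) => j.
apply: (qc_incr2 Hsl Hsu).
- by have /andP[] := nt n j (ltnW (ltn_ord j)).
- by have [p _] := pt n; rewrite node_le.
- by have /andP[] := nt n j.+1 (ltn_ord j).
Qed.

End QuadraticVariation.

(** * Integrals in time *)

Section TimeIntegral.
Context {R : realType} (sl su : R).
Hypotheses (Hsl : 0 <= sl) (Hsu : sl <= su).
Local Notation Omega := (path_space R).
Local Notation calP := (calP sl su).
Local Notation mu := (@lebesgue_measure R).

Lemma integrable_cst_itv (a b c : R) : mu.-integrable `[a, b] (EFin \o cst c).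
Proof.
apply/integrableP; split; first exact/measurable_EFinP.
rewrite (_ : (\int[mu]_(x in _) _)%E = (\int[mu]_(x in `[a, b]) (cst `|c|%:E) x)%E)//.
rewrite integral_cst//= lebesgue_measure_itv/=.
by case: ifP => _; rewrite ?mule0 ?ltry// -EFinB -EFinM ltry.
Qed.

(** The scale [d] is free: the part of the distance below [d] costs at most [d] on the unit
    interval, the rest is paid by the [p]-th power. The bound holds for all [t] at once. *)
Lemma integrable_powR_close (f g : R -> R) (p c d : R) : 1 <= p -> 0 < d -> 0 <= c ->
  mu.-integrable `[0%R, 1%R] (EFin \o f) -> measurable_fun (`[0%R, 1%R]%classic : set R) g ->
  (\int[mu]_(s in `[0%R, 1%R]) (`|f s - g s| `^ p)%:E <= c%:E)%E ->
  mu.-integrable `[0%R, 1%R] (EFin \o g) /\ forall t, 0 <= t <= 1 ->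
  `|\int[mu]_(s in `[0, t]) f s - \int[mu]_(s in `[0, t]) g s| <= d + d `^ (1 - p) * c.
Proof.
move=> p1 d0 c0 iF mg H; have mD : measurable (`[0%R, 1%R]%classic : set (measurableTypeR R)) by exact: measurable_itv.
have mf : measurable_fun (`[0%R, 1%R]%classic : set R) f by have /integrableP[/measurable_EFinP] := iF.
have mfg : measurable_fun (`[0%R, 1%R]%classic : set R) (fun s => f s - g s) by exact: measurable_funB.
have mq : measurable_fun (`[0%R, 1%R]%classic : set R) (fun s => `|f s - g s| `^ p).
  by apply: (measurableT_comp (measurable_powR p)); exact: measurableT_comp.
pose k := d `^ (1 - p); have k0 : 0 <= k by exact: powR_ge0.
have iq : mu.-integrable `[0%R, 1%R] (EFin \o (fun s => `|f s - g s| `^ p)).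
  apply/integrableP; split; first exact/measurable_EFinP.
  apply: le_lt_trans (ltry c); apply: le_trans H; rewrite le_eqVlt; apply/orP; left; apply/eqP.
  by apply: eq_integral => s _; rewrite /= ger0_norm// powR_ge0.
have ib : mu.-integrable `[0%R, 1%R] (EFin \o (fun s => d + k * `|f s - g s| `^ p)).
  have := integrableD mD (integrable_cst_itv 0 1 d) (integrableZl mD k iq).
  by apply: eq_integrable.
have bd s : `|f s - g s| <= d + k * `|f s - g s| `^ p by exact: le_powR_split.
have ifg : mu.-integrable `[0%R, 1%R] (EFin \o (fun s => f s - g s)).
  apply: (le_integrable mD _ _ ib); first exact/measurable_EFinP.
  move=> s _ /=; rewrite lee_fin; apply: le_trans (bd s) _; exact: ler_norm.
have ig : mu.-integrable `[0%R, 1%R] (EFin \o g).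
  have := integrableB mD iF ifg; apply: eq_integrable => // s _ /=.
  by rewrite -EFinB opprB addrCA subrr addr0.
split => // t /andP[t0 t1].
have sub : `[0%R, t]%classic `<=` `[0%R, 1%R]%classic by apply: subset_itvl; rewrite bnd_simp.
have mt : measurable (`[0%R, t]%classic : set (measurableTypeR R)) by exact: measurable_itv.
have S (h : R -> R) : mu.-integrable `[0%R, 1%R] (EFin \o h) -> mu.-integrable `[0%R, t] (EFin \o h).
  exact: integrableS.
rewrite -RintegralB//; [|exact: S|exact: S].
apply: le_trans (le_normr_Rintegral mt (S _ ifg)) _.
apply: (@le_trans _ _ (\int[mu]_(s in `[0, t]) (d + k * `|f s - g s| `^ p))).
  apply: le_Rintegral => //; [|exact: S].
  by have := integrable_norm (S _ ifg).
have iqt := S _ iq.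
rewrite RintegralD//; [|exact: integrable_cst_itv|]; last first.
  by have := integrableZl mt k iqt; apply: eq_integrable.
rewrite RintegralZl// Rintegral_cst//=; apply: lerD.
  rewrite lebesgue_measure_itv/= lte_fin; case: ltP => t0' /=; last by rewrite mulr0 ltW.
  by rewrite subr0 -[leRHS]mulr1 ler_wpM2l// ltW.
apply: ler_wpM2l => //; rewrite -lee_fin.
have fin : (\int[mu]_(s in `[0%R, t]) (`|f s - g s| `^ p)%:E \is a fin_num)%E.
  exact: integrable_fin_num iqt.
rewrite /Rintegral fineK//; apply: le_trans H; apply: ge0_subset_integral => //.
  exact/measurable_EFinP.
Qed.

Variable (b : R -> Omega -> R).

Lemma sp_val_measurable (en : simple_process (1 : R)) :
  measurable_fun setT (fun z : R * Omega => sp_val en z.1 z.2).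
Proof.
rewrite /sp_val.
set ts := sp_times en.
have mF (j : 'I_(size ts)) : measurable_fun setT (fun z : R * Omega => sp_coef en j z.2 *
    \1_(`[node ts j, node ts j.+1[%classic) z.1).
  have lj := sp_lip (ltn_ord j); rewrite -/ts in lj.
  apply: measurable_funM.
    by apply: (measurableT_comp (Lip_measurable lj)); exact: measurable_snd.
  apply: (@measurableT_comp _ _ _ _ _ _ (\1_(`[node ts j, node ts j.+1[%classic) : R -> R)).
    exact: measurable_indic.
  exact: measurable_fst.
exact: measurable_sum.
Qed.

Lemma section_measurable : jointly_measurable 1 b -> forall w,
  measurable_fun (`[0%R, 1%R]%classic : set R) (b^~ w).
Proof.
move=> jm w; apply: (measurable_comp _ _ jm (g := pair^~ w)) => //.
- by apply: measurableX.
- by move=> _ [s sT <-]; split.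
- by apply: measurable_funTS; exact: pair2_measurable.
Qed.

(** Joint measurability enters through Tonelli's theorem: the time integral of the error is a
    measurable function of the path, so Markov's inequality applies under every [P]. *)
Lemma MG_close p : 1 <= p -> MG sl su p 1 b -> forall e, 0 < e ->
  exists (en : simple_process (1 : R)) A, [/\ measurable A,
    forall P, calP P -> (P A <= e%:E)%E &
    forall w, ~ A w -> (\int[mu]_(s in `[0%R, 1%R]) (`|sp_val en s w - b s w| `^ p)%:E <= e%:E)%E].
Proof.
move=> p1 [jm [en cv]] e_; move: (e_ : R) => e e0; have p0 : 0 < p by lra.
have F0 n w : (0 <= \int[mu]_(s in `[0%R, 1%R]) (`|sp_val (en n) s w - b s w| `^ p)%:E)%E.
  by apply: integral_ge0 => s _; rewrite lee_fin powR_ge0.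
have [n /(_ n (leqnn _)) H] := norm_small p0 F0 cv (mulr_gt0 e0 e0).
pose D := (`[0%R, 1%R]%classic : set R) `*` (setT : set Omega).
have mD : measurable D by apply: measurableX.
pose f (z : R * Omega) := (`|sp_val (en n) z.1 z.2 - b z.1 z.2| `^ p)%:E.
have mf : measurable_fun D f.
  apply/measurable_EFinP; apply: (measurableT_comp (measurable_powR p)).
  apply: measurableT_comp => //; apply: measurable_funB => //.
  by apply: measurable_funTS; exact: sp_val_measurable.
have mfD : measurable_fun setT (f \_ D).
  by apply/(measurable_restrict f mD measurableT); rewrite setTI.
have f0 z : (0 <= (f \_ D) z)%E by rewrite patchE; case: ifP => // _; rewrite lee_fin powR_ge0.
have mI : measurable_fun setT (fun w => \int[mu]_(s in `[0%R, 1%R]) (`|sp_val (en n) s w - b s w| `^ p)%:E)%E.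
  have := @measurable_fun_fubini_tonelli_G _ _ _ _ _ mu _ mfD f0.
  congr measurable_fun; apply/funext => w; rewrite /fubini_G [in RHS]integral_mkcond.
  apply: eq_integral => s _; rewrite !patchE /D; congr (if _ then _ else _).
  by apply/idP/idP => /set_mem h; apply/mem_set; [case: h|split].
pose I w := (\int[mu]_(s in `[0%R, 1%R]) (`|sp_val (en n) s w - b s w| `^ p)%:E)%E.
exists (en n), [set w | (e%:E <= I w)%E]; split.
- rewrite -[X in measurable X]setTI; exact: emeasurable_fun_c_infty.
- move=> P hP; have := le_integral_abse P measurableT mI e0.
  rewrite setTI => h; rewrite -(@lee_pmul2l _ e%:E)//.
  apply: (@le_trans _ _ (e%:E * P [set w | (e%:E <= `|I w|)%E])%E).
    by apply: lee_wpmul2l; [rewrite lee_fin ltW|rewrite le_eqVlt; apply/orP; left; apply/eqP; congr (P _);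
      apply/seteqP; split => w /=; rewrite gee0_abs//; exact: F0].
  apply: le_trans h _; apply: le_trans (H P hP); rewrite le_eqVlt; apply/orP; left; apply/eqP.
  by apply: eq_integral => w _; rewrite gee0_abs//; exact: F0.
- by move=> w /= /negP; rewrite -ltNge => /ltW.
Qed.

Lemma simple_time_integral (en : simple_process (1 : R)) t w : 0 <= t <= 1 ->
  mu.-integrable `[0%R, t] (EFin \o (fun s => sp_val en s w)) /\
  \int[mu]_(s in `[0, t]) sp_val en s w =
  \sum_(j < size (sp_times en)) sp_coef en j w *
    \int[mu]_(s in `[0, t]) (\1_(`[node (sp_times en) j, node (sp_times en) j.+1[%classic) s).
Proof.
move=> t01; rewrite /sp_val; set ts := sp_times en.
have mt : measurable (`[0%R, t]%classic : set (measurableTypeR R)) by exact: measurable_itv.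
pose E j : R -> R := \1_(`[node ts j, node ts j.+1[%classic).
have iE j : mu.-integrable `[0%R, t] (EFin \o E j).
  apply: (le_integrable mt _ _ (integrable_cst_itv 0 t 1)).
    exact/measurable_EFinP/measurable_indic.
  by move=> s _; rewrite /= lee_fin normr1 /E indicE ger0_norm ?lern1 ?leq_b1.
have [iS ->] : mu.-integrable `[0%R, t] (EFin \o (fun s => \sum_(j < size ts) sp_coef en j w * E j s)) /\
   \int[mu]_(s in `[0, t]) (\sum_(j < size ts) sp_coef en j w * E j s) =
   \sum_(j < size ts) sp_coef en j w * \int[mu]_(s in `[0, t]) E j s.
  elim: (index_enum _) => [|j r [IH1 IH2]].
    split.
      by rewrite (_ : EFin \o _ = EFin \o cst 0); [exact: integrable_cst_itv|apply/funext => s /=; rewrite big_nil].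
    rewrite big_nil (_ : (fun s => _) = cst 0); last by apply/funext => s; rewrite big_nil.
    by rewrite Rintegral_cst// mul0r.
  have iZ : mu.-integrable `[0%R, t] (EFin \o (fun s => sp_coef en j w * E j s)).
    by have := integrableZl mt (sp_coef en j w) (iE j); apply: eq_integrable.
  rewrite (_ : (fun s => \sum_(j <- j :: r) _) =
    fun s => sp_coef en j w * E j s + \sum_(j <- r) sp_coef en j w * E j s); last first.
    by apply/funext => s; rewrite big_cons.
  split; first by have := integrableD mt iZ IH1; apply: eq_integrable.
  by rewrite RintegralD// IH2 big_cons RintegralZl.
by [].
Qed.

Lemma simple_time_Lip (en : simple_process (1 : R)) t : 0 <= t <= 1 ->
  Lip t (fun w => \int[mu]_(s in `[0, t]) sp_val en s w).
Proof.
move=> t01; have /andP[t0 t1] := t01.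
rewrite (_ : (fun w => _) = fun w => \sum_(j < size (sp_times en)) sp_coef en j w *
    \int[mu]_(s in `[0, t]) (\1_(`[node (sp_times en) j, node (sp_times en) j.+1[%classic) s)); last first.
  by apply/funext => w; have [_] := simple_time_integral en w t01.
set ts := sp_times en.
suff H (j : 'I_(size ts)) : Lip t (fun w => sp_coef en j w *
    \int[mu]_(s in `[0, t]) (\1_(`[node ts j, node ts j.+1[%classic) s)).
  elim: (index_enum _) => [|j r IH].
    by rewrite (_ : (fun w => _) = fun=> 0); [exact: Lip_cst|apply/funext => w; rewrite big_nil].
  rewrite (_ : (fun w => \sum_(j <- j :: r) _) = fun w => sp_coef en j w *
    \int[mu]_(s in `[0, t]) (\1_(`[node ts j, node ts j.+1[%classic) s) +
    \sum_(j <- r) sp_coef en j w * \int[mu]_(s in `[0, t]) (\1_(`[node ts j, node ts j.+1[%classic) s)).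
    exact: LipD.
  by apply/funext => w; rewrite big_cons.
have lj := sp_lip (ltn_ord j); rewrite -/ts in lj.
have [jt|tj] := leP (node ts j) t.
  by apply: LipM; [exact: Lip_mono lj|exact: Lip_cst].
rewrite (_ : (fun w => _) = fun=> 0); first exact: Lip_cst.
apply/funext => w; rewrite (@eq_Rintegral _ _ _ _ _ (cst 0)).
  by rewrite Rintegral_cst// mul0r mulr0.
move=> s; rewrite inE /= in_itv/= => /andP[_ st]; rewrite indicE memNset//= in_itv/=.
by rewrite leNgt (le_lt_trans st tj).
Qed.

Lemma MG_time_integral p : 1 <= p -> MG sl su p 1 b -> forall e, 0 < e ->
  exists (en : simple_process (1 : R)) A, [/\ measurable A,
    forall P, calP P -> (P A <= e%:E)%E &
    forall w, ~ A w -> mu.-integrable `[0%R, 1%R] (EFin \o (b^~ w)) /\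
      forall t, 0 <= t <= 1 ->
      `|\int[mu]_(s in `[0, t]) sp_val en s w - \int[mu]_(s in `[0, t]) b s w| <= e].
Proof.
move=> p1 mb e_; move: (e_ : R) => e e0; have [jm _] := mb.
have d0 : 0 < e / 2 by rewrite divr_gt0.
pose k := (e / 2) `^ (1 - p); have k0 : 0 < k by exact: powR_gt0.
pose c := Num.min e (e / 2 / k).
have c0 : 0 < c by rewrite lt_min e0 divr_gt0.
have [en [A [mA PA HA]]] := MG_close p1 mb c0.
exists en, A; split => // [P hP|w nA].
  by apply: le_trans (PA P hP) _; rewrite lee_fin ge_min lexx.
have t11 : 0 <= (1 : R) <= 1 by rewrite ler01 lexx.
have [ie _] := simple_time_integral en w t11.
have [ib hb] := integrable_powR_close p1 d0 (ltW c0) ie (section_measurable jm w) (HA w nA).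
split => // t /hb h; apply: le_trans h _; rewrite [leRHS]splitr lerD2l -/k mulrC.
by rewrite -ler_pdivlMr// ge_min lexx orbT.
Qed.

Lemma qc_time_integral p t : 1 <= p -> MG sl su p 1 b -> 0 <= t <= 1 ->
  qc sl su t (fun w => \int[mu]_(s in `[0, t]) b s w).
Proof.
move=> p1 mb t01; apply: qc_approx => e e0.
have [en [A [mA PA HA]]] := MG_time_integral p1 mb e0.
exists (fun w => \int[mu]_(s in `[0, t]) sp_val en s w), A; split => //.
  exact/Lip_qc/simple_time_Lip.
by move=> w /HA[_]; apply.
Qed.

(** For each [n] the paths of [b] are integrable off a set of probability at most $1/(n+1)$, hence
    off the intersection of these sets, which is null. *)
Lemma time_integral_continuous p (P : probability Omega R) : calP P -> 1 <= p -> MG sl su p 1 b ->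
  exists N, [/\ measurable N, P N = 0%E & forall w, ~ N w ->
    {within `[0, 1], continuous (fun t => \int[mu]_(s in `[0, t]) b s w)}].
Proof.
move=> hP p1 mb.
have /choice[A HA] : forall n : nat, exists A : set Omega, [/\ measurable A, (P A <= (n.+1%:R^-1)%:E)%E &
    forall w, ~ A w -> mu.-integrable `[0%R, 1%R] (EFin \o (b^~ w))].
  move=> n; have e0 : 0 < n.+1%:R^-1 :> R by rewrite invr_gt0.
  have [en [A [mA PA HA]]] := MG_time_integral p1 mb e0.
  by exists A; split => // [|w /HA[]]; first exact: PA.
have mN : measurable (\bigcap_n A n) by apply: bigcap_measurable => // n _; have [] := HA n.
exists (\bigcap_n A n); split => // [|w].
  apply/eqP; rewrite eq_le measure_ge0 andbT; apply/lee_addgt0Pr => e e0; rewrite add0e.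
  have [mA PA _] := HA (Num.truncn e^-1).
  apply: (@le_trans _ _ (P (A (Num.truncn e^-1)))).
    by apply: le_measure; rewrite ?inE// => w; apply.
  apply: le_trans PA _; rewrite lee_fin invf_ple ?posrE ?ltr0Sn//; exact/ltW/truncnS_gt.
move=> nN; have [n nA] : exists n, ~ A n w by apply: contrapT => h; apply: nN => n _; apply: contrapT => h'; apply: h; exists n.
have [_ _ /(_ w nA) ib] := HA n.
exact: parameterized_integral_continuous ler01 ib.
Qed.

End TimeIntegral.

(** * Versions, and indicators of sublevel sets *)

Section StoppingIndicators.
Context {R : realType} (sl su : R).
Hypotheses (Hsl : 0 <= sl) (Hsu : sl <= su).
Local Notation Omega := (path_space R).
Local Notation calP := (calP sl su).
Local Notation qc := (qc sl su).
Implicit Types (X Y : Omega -> R) (P : probability Omega R).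

(* Paths stopped at time t determine the limit of the cylinder approximations,
   which is therefore a version measurable up to time t. *)
Lemma qc_version t X : qc t X -> exists X' : Omega -> R,
  [/\ measurable_fun setT X', forall r w, t <= r -> X' (stop r w) = X' w & qs sl su (fun w => X' w = X w)].
Proof.
(* The errors $2^{-(k+1)}$ are summable, so by Borel-Cantelli quasi every path lies in finitely many
   exceptional sets. *)
move=> qX; pose e k : R := 1 / (2 ^ k.+1)%:R.
have e0 k : 0 < e k by rewrite divr_gt0// ltr0n expn_gt0.
have /choice[Z HZ] : forall k, exists ZA : (Omega -> R) * set Omega, [/\ Lip t ZA.1, measurable ZA.2,
    forall P, calP P -> (P ZA.2 <= (e k)%:E)%E & forall w, ~ ZA.2 w -> `|ZA.1 w - X w| <= e k].
  by move=> k; have [Y [A H]] := qX _ (e0 k); exists (Y, A).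
pose A k := (Z k).2; pose Y k := (Z k).1.
have mA k : measurable (A k) by have [] := HZ k.
(* The upper limit makes sense at every path, which gives exact, not just q.s., invariance under
   stopping. *)
exists (fun w => fine (limn_esup (fun k => (Y k w)%:E))); split.
- apply: (measurableT_comp (fine_measurable _)) => //.
  apply: measurable_fun_limn_esup => k; apply/measurable_EFinP; have [lY _ _ _] := HZ k.
  exact: Lip_measurable lY.
- move=> r w tr; congr (fine (limn_esup _)); apply/funext => k; congr _%:E.
  by have [lY _ _ _] := HZ k; exact: Lip_stop (Lip_mono tr lY).
exists (lim_sup_set A); split.
- by apply: bigcap_measurable => // n _; apply: bigcup_measurable => j _.
- apply: (capacity0 Hsl Hsu) => P hP; apply: lim_sup_set_cvg0 => //.
  apply: (@le_lt_trans _ _ 1%:E); last exact: ltry.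
  apply: le_trans (epsilon_trick0 predT (@ler01 R)); apply: lee_nneseries => k _ //.
  by have [_ _ h _] := HZ k; exact: h.
move=> w nw; have [n Hn] : exists n, forall k, (n <= k)%N -> ~ A k w.
  apply: contrapT => h; apply: nw => n _; apply: contrapT => h'; apply: h; exists n => k nk Ak.
  by apply: h'; exists k.
suff cv : (fun k => (Y k w)%:E) @ \oo --> (X w)%:E by rewrite (cvg_limn_einf_sup cv).2.
apply: cvg_EFin; first exact: nearW.
apply/cvgrPdist_le => d d0; exists (maxn n (Num.truncn d^-1)) => // k /=.
rewrite geq_max => /andP[nk dk]; rewrite distrC.
have [_ _ _ /(_ w (Hn k nk)) h] := HZ k; apply: le_trans h _.
rewrite /e div1r invf_ple ?posrE ?ltr0n ?expn_gt0//.
apply/ltW/(lt_le_trans (truncnS_gt _)); rewrite ler_nat.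
by apply: leq_ltn_trans dk _; apply: ltn_trans (ltn_expl _ _); rewrite ?ltnS.
Qed.

(** Boundedness of [h] pays for an exceptional set of capacity $1/(k+1)$, where the error is at most
    [2 * c]; off it the Lipschitz bound applies. *)
Lemma LG_comp t X (h : R -> R) (c l : R) : qc t X -> measurable_fun setT X ->
  measurable_fun setT h -> (forall y, `|h y| <= c) -> (forall x y, `|h x - h y| <= l * `|x - y|) ->
  LG sl su 1 t (fun w => h (X w)).
Proof.
move=> qX mX mh hc hl.
have c0 : 0 <= c := le_trans (normr_ge0 _) (hc 0).
have l0 : 0 <= l by have := le_trans (normr_ge0 _) (hl 1 0); rewrite subr0 normr1 mulr1.
have mhX : measurable_fun setT (fun w => h (X w)) by exact: measurableT_comp.
split => //.
have e0 k : 0 < k.+1%:R^-1 :> R by rewrite invr_gt0.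
have /choice[Z HZ] : forall k, exists ZA : (Omega -> R) * set Omega, [/\ Lip t ZA.1, measurable ZA.2,
    forall P, calP P -> (P ZA.2 <= (k.+1%:R^-1)%:E)%E & forall w, ~ ZA.2 w -> `|ZA.1 w - X w| <= k.+1%:R^-1].
  by move=> k; have [Y [A H]] := qX _ (e0 k); exists (Y, A).
exists (fun k w => h ((Z k).1 w)); split => [k|].
  by have [lZ _ _ _] := HZ k; exact: Lip_comp lZ hc hl.
have K0 : 0 <= l + 2 * c by rewrite addr_ge0// mulr_ge0.
have B k : (Lnorm_G sl su 1 (fun w => (h ((Z k).1 w) - h (X w))%R) <= ((l + 2 * c) / k.+1%:R)%:E)%E.
  have [lZ mA PA HA] := HZ k; apply: (Lnorm1_le Hsl Hsu) => [|P hP]; first by rewrite divr_ge0.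
  set D := fun w => h ((Z k).1 w) - h (X w).
  have mD : measurable_fun setT D.
    by apply: measurable_funB => //; exact: Lip_measurable (Lip_comp lZ hc hl).
  have bD w : `|D w| <= 2 * c.
    by apply: le_trans (ler_normB _ _) _; have := hc (X w); have := hc ((Z k).1 w); lra.
  have iD : itg P (fun w => `|D w|) by apply: itg_norm; exact: itg_bounded mD bD.
  have mI : measurable_fun setT (\1_(Z k).2 : Omega -> R) by exact: measurable_indic.
  have iA : itg P (\1_(Z k).2) by apply: (itg_bounded P mI (c := 1)) => w; rewrite indicE ger0_norm ?lern1 ?leq_b1.
  have mA1 : mean P (\1_(Z k).2) <= k.+1%:R^-1.
    by rewrite -lee_fin -meanE// integral_indic// setIT; exact: PA.
  have iU : itg P (fun w => l * k.+1%:R^-1 + 2 * c * \1_(Z k).2 w).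
    by apply: itgD; [exact: itg_cst|exact: itgZ].
  rewrite (meanE iD) lee_fin; apply: le_trans (mean_le iD iU _) _ => [w|].
    rewrite indicE; have [/set_mem wA|/negP wA] := boolP (w \in (Z k).2).
      by rewrite mulr1; apply: le_trans (bD w) _; rewrite lerDr mulr_ge0// ltW.
    rewrite mulr0 addr0; apply: le_trans (hl _ _) _; apply: ler_wpM2l => //; apply: HA => h'.
    by apply: wA; apply: mem_set.
  rewrite (meanD (itg_cst P _) (itgZ _ iA)) mean_cst meanZ// [leRHS]mulrDl; apply: lerD => //.
  by apply: ler_wpM2l => //; rewrite mulr_ge0.
have cv : (fun k => ((l + 2 * c) / k.+1%:R)%:E) @ \oo --> 0%E.
  apply: cvg_EFin; first exact: nearW.
  rewrite -(mulr0 (l + 2 * c)); apply: cvgM; [exact: cvg_cst|exact: cvg_harmonic].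
apply: (squeeze_cvge _ (cvg_cst 0%E) cv); apply: nearW => k; rewrite B andbT.
exact: poweR_ge0.
Qed.

Lemma upto_of_stop t X : measurable_fun setT X -> (forall w, X (stop t w) = X w) ->
  measurable_upto t X.
Proof.
move=> mX sX C mC; exists (X @^-1` C); split; first by rewrite -[_ @^-1` _]setTI; exact: mX.
by apply/seteqP; split => w /=; rewrite sX.
Qed.

Lemma Ehat_indic (A : set Omega) : (Ehat sl su (fun w => `|\1_A w|%:E) < +oo)%E.
Proof.
apply: (@le_lt_trans _ _ 1%:E); last exact: ltry.
apply/ereal_supP => _ [P hP <-].
apply: (@le_trans _ _ (\int[P]_w (cst 1%:E) w)%E); last by rewrite integral_cst//= probability_setT mule1.
apply: (ge0_integral_le_off_null measurable0 (measure0 P)) => w.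
- by rewrite lee_fin.
- by rewrite lee_fin.
- by rewrite lee_fin indicE ger0_norm ?lern1 ?leq_b1.
Qed.

(** Continuous functions decreasing to the indicator of [y <= e] as [m] grows. Approximation from
    above, as [LG1star] demands, fits closed sublevel sets; hitting times are accordingly defined by
    [<=]. *)
Let ramp (e : R) m (y : R) : R := Num.max 0 (1 - m%:R * Num.max 0 (y - e)).

Let ramp01 e m y : 0 <= ramp e m y <= 1.
Proof.
rewrite /ramp le_max lexx ge_max ler01 /= gerBl mulr_ge0// le_max lexx//.
Qed.

Let ramp_lip e m x y : `|ramp e m x - ramp e m y| <= m%:R * `|x - y|.
Proof.
have m0 : 0 <= m%:R :> R by [].
apply: le_trans (max_lip _ _ _) _.
rewrite (_ : _ - _ - _ = m%:R * (Num.max 0 (y - e) - Num.max 0 (x - e))); last by ring.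
rewrite normrM ger0_norm// ler_wpM2l// distrC; apply: le_trans (max_lip _ _ _) _.
by rewrite (_ : _ - _ - _ = x - y)//; ring.
Qed.

Lemma LG1star_le t X (e : R) : qc t X -> measurable_fun setT X -> (forall w, X (stop t w) = X w) ->
  LG1star sl su t (\1_[set w | X w <= e]).
Proof.
move=> qX mX sX; have mS : measurable [set w | X w <= e].
  rewrite (_ : [set w | _] = X @^-1` `]-oo, e]%classic); last by apply/seteqP; split => w; rewrite /= in_itv.
  by rewrite -[_ @^-1` _]setTI; exact: mX.
split; [|exact: Ehat_indic|].
  apply: upto_of_stop => [|w]; first exact: measurable_indic.
  by rewrite !indicE; congr (nat_of_bool _)%:R; apply/idP/idP => /set_mem /= h; apply/mem_set; move: h; rewrite /= sX.
exists (fun m w => ramp e m (X w)); split => [m|].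
  apply: (LG_comp qX mX (c := 1) (l := m%:R)) => [|y|x y]; last exact: ramp_lip.
    apply: measurable_maxr; first exact: measurable_cst.
    apply: measurable_funB; first exact: measurable_cst.
    apply: measurable_funM; first exact: measurable_cst.
    apply: measurable_maxr; first exact: measurable_cst.
    by apply: measurable_funB; [exact: measurable_id|exact: measurable_cst].
  by have /andP[a b] := ramp01 e m y; rewrite ger0_norm.
exists set0; split; first exact: measurable0.
  by apply: (capacity0 Hsl Hsu) => P _; rewrite measure0.
move=> w _; split => [m|].
  rewrite /ramp; set z := Num.max 0 (X w - e); have z0 : 0 <= z by rewrite le_max lexx.
  have h : 1 - m.+1%:R * z <= 1 - m%:R * z by rewrite lerB// ler_wpM2r// ler_nat.
  by rewrite ge_max !le_max lexx /= h orbT.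
rewrite indicE; have [/set_mem /= h|/negP h] := boolP (w \in _).
  apply: cvg_near_cst; apply: nearW => m; rewrite /ramp.
  have -> : Num.max 0 (X w - e) = 0 by apply: max_l; rewrite subr_le0.
  by rewrite mulr0 subr0 max_r.
have {}h : e < X w by rewrite ltNge; apply/negP => h'; apply: h; exact: mem_set.
have d0 : 0 < X w - e by rewrite subr_gt0.
apply: cvg_near_cst; exists (Num.truncn (X w - e)^-1).+1 => // m /= hm; rewrite /ramp.
rewrite (max_r (ltW d0)) max_l// subr_le0 -ler_pdivrMr// div1r.
by apply/ltW/(lt_le_trans (truncnS_gt _)); rewrite ler_nat.
Qed.

End StoppingIndicators.

(** * Hitting times and optimal stopping *)

Section Paths.
Context {R : realType}.
Implicit Types (f g : R -> R).

Definition unit_continuous f := forall x e, 0 <= x <= 1 -> 0 < e ->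
  exists2 d, 0 < d & forall y, 0 <= y <= 1 -> `|y - x| < d -> `|f y - f x| <= e.

Lemma unit_continuous_within f : {within `[0, 1], continuous f} -> unit_continuous f.
Proof.
move=> /subspace_continuousP cf x e x01 e0.
have := cf x; rewrite /= in_itv /= => /(_ x01)/cvgrPdist_le/(_ e e0)/nbhs_ballP[d d0 H].
exists d => // y y01 yx; rewrite distrC; apply: H; first by rewrite /ball /= distrC.
by rewrite /= in_itv.
Qed.

Lemma unit_continuousD f g : unit_continuous f -> unit_continuous g ->
  unit_continuous (fun t => f t + g t).
Proof.
move=> cf cg x e x01 e0; have e20 : 0 < e / 2 by rewrite divr_gt0.
have [d d0 H] := cf x _ x01 e20; have [d' d'0 H'] := cg x _ x01 e20.
exists (Num.min d d') => [|y y01]; first by rewrite lt_min d0.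
rewrite lt_min => /andP[yd yd'].
rewrite (_ : _ - _ = (f y - f x) + (g y - g x)); last by ring.
by rewrite (splitr e); apply: le_trans (ler_normD _ _) _; apply: lerD; [exact: H|exact: H'].
Qed.

Lemma unit_continuousN f : unit_continuous f -> unit_continuous (fun t => - f t).
Proof.
move=> cf x e x01 e0; have [d d0 H] := cf x e x01 e0; exists d => // y y01 yd.
by rewrite -opprD normrN; exact: H.
Qed.

Lemma eq_unit_continuous f g : (forall t, 0 <= t <= 1 -> f t = g t) -> unit_continuous g ->
  unit_continuous f.
Proof.
move=> fg cg x e x01 e0; have [d d0 H] := cg x e x01 e0; exists d => // y y01 yd.
by rewrite !fg//; exact: H.
Qed.

Lemma unit_continuous_cvg f (u : nat -> R) (x : R) : unit_continuous f -> (forall n, 0 <= u n <= 1) ->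
  0 <= x <= 1 -> u @ \oo --> x -> (fun n => f (u n)) @ \oo --> f x.
Proof.
move=> cf u01 x01 /cvgrPdist_lt cu; apply/cvgrPdist_le => e e0; have [d d0 H] := cf x e x01 e0.
have := cu d d0; apply: filterS => n h; rewrite distrC; apply: H => //; by rewrite distrC.
Qed.

(** If the level is not reached before the last grid point the value is [N], that is time 1; there
    [Y] and [X] will agree. *)
Definition hit (D : R -> R) (e : R) (N : nat) : nat :=
  find (fun j => D (j%:R / N%:R) <= e) (iota 0 N).

Lemma hit_le D e N : (hit D e N <= N)%N.
Proof. by rewrite -[leqRHS](size_iota 0); exact: find_size. Qed.

Lemma hit_lt D e N : (hit D e N < N)%N -> D ((hit D e N)%:R / N%:R) <= e.
Proof.
move=> h; have := h; rewrite -[X in (_ < X)%N](size_iota 0) -has_find => /(nth_find 0%N).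
by rewrite nth_iota.
Qed.

Lemma hit_min D e N j : (j < N)%N -> D (j%:R / N%:R) <= e -> (hit D e N <= j)%N.
Proof.
move=> jN Dj; rewrite leqNgt; apply/negP => /(before_find 0%N).
by rewrite nth_iota// add0n Dj.
Qed.

Lemma eq_hit D D' e N : (forall j, (j < N)%N -> D (j%:R / N%:R) = D' (j%:R / N%:R)) ->
  hit D e N = hit D' e N.
Proof.
move=> DD'; apply: eq_in_find => j; rewrite mem_iota add0n => /andP[_ jN] /=.
by rewrite DD'.
Qed.

Lemma frac01 (k N : nat) : (k <= N)%N -> 0 <= (k%:R / N%:R : R) <= 1.
Proof.
case: N => [|N] kN; first by rewrite invr0 mulr0 lexx ler01.
by rewrite divr_ge0//= ler_pdivrMr// mul1r ler_nat.
Qed.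

Lemma hit01 D e N : 0 <= ((hit D e N)%:R / N%:R : R) <= 1.
Proof. exact/frac01/hit_le. Qed.

(** The fine grid contains the coarse one; along powers of 2 the hitting times therefore
    decrease. *)
Lemma hit_double D e N : (0 < N)%N ->
  (hit D e (2 * N))%:R / (2 * N)%:R <= (hit D e N)%:R / N%:R :> R.
Proof.
move=> N0; have N0' : 0 < N%:R :> R by rewrite ltr0n.
have [h|h] := ltnP (hit D e N) N; last first.
  have -> : hit D e N = N by apply/eqP; rewrite eqn_leq hit_le h.
  by rewrite divff ?gt_eqF//; have /andP[] := hit01 D e (2 * N).
have E (j : nat) : (2 * j)%:R / (2 * N)%:R = j%:R / N%:R :> R.
  by rewrite !natrM -mulf_div divff ?mul1r ?pnatr_eq0.
rewrite -[leRHS]E ler_pM2r ?invr_gt0 ?ltr0n ?muln_gt0// ler_nat.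
by apply: hit_min; rewrite ?ltn_pmul2l// E; exact: hit_lt.
Qed.

Lemma stieltjes_itv (F : cumulative R R) (a b : R) : a <= b ->
  lebesgue_stieltjes_measure F `]a, b]%classic = (F b - F a)%:E.
Proof.
move=> ab; rewrite /lebesgue_stieltjes_measure /measure_extension measurable_mu_extE/=; last exact: is_ocitv.
exact: wlength_itv_bnd.
Qed.

(* The obstacle gap exceeds e before the hitting time, hence so does its
   Stieltjes integral divided by the increment of the integrator. *)
Lemma hit_limit D L (e v : R) : unit_continuous D -> (forall t, 0 <= t <= 1 -> 0 <= D t) ->
  0 < e -> L 0 = 0 -> is_stieltjes D L 1 v -> exists t : R, [/\ 0 <= t <= 1,
    (fun n => (hit D e (2 ^ n))%:R / (2 ^ n)%:R) @ \oo --> t & e * L t <= v].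
Proof.
move=> cD D0 e0 L0 [F [FL Fv]].
pose u n : R := (hit D e (2 ^ n))%:R / (2 ^ n)%:R.
have u01 n : 0 <= u n <= 1 by exact: hit01.
have uS n : u n.+1 <= u n by rewrite /u expnS; apply: hit_double; rewrite expn_gt0.
have ni : {homo u : n m / (n <= m)%N >-> m <= n} by exact/nonincreasing_seqP.
have lb : has_lbound (range u) by exists 0 => _ [n _ <-]; have /andP[] := u01 n.
have cu := nonincreasing_cvgn ni lb; set t := inf _ in cu.
have tu n : t <= u n by apply: ge_inf => //; exists n.
have t01 : 0 <= t <= 1.
  apply/andP; split; last by apply: le_trans (tu 0%N) _; have /andP[] := u01 0%N.
  by apply: lb_le_inf; [exists (u 0%N); exists 0%N|move=> _ [n _ <-]; have /andP[] := u01 n].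
exists t; split => //.
(* Otherwise [D] would be at most [e] at a grid point just to the right of [s] and before [t],
   against the minimality of the hitting time. *)
have below s : 0 <= s -> s < t -> e <= D s.
  move=> s0 st; rewrite leNgt; apply/negP => Ds.
  have s01 : 0 <= s <= 1 by rewrite s0 (le_trans (ltW st))//; case/andP: t01.
  have d0 : 0 < e - D s by rewrite subr_gt0.
  have [d d'0 H] := cD s _ s01 d0.
  have m0 : 0 < Num.min d (t - s) by rewrite lt_min d'0 subr_gt0.
  pose n := (Num.truncn (Num.min d (t - s))^-1).+1.
  have N0 : (0 < 2 ^ n)%N by rewrite expn_gt0.
  have hN : ((2 ^ n)%N%:R)^-1 < Num.min d (t - s).
    rewrite invf_plt ?posrE ?ltr0n//; apply: lt_le_trans (truncnS_gt _) _.
    by rewrite ler_nat; apply/ltnW/ltn_expl.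
  have /andP[r1 r2] := rnd_near N0 s01.
  have [k kN kE] := rnd_dyadic (2 ^ n) s; rewrite kE in r1 r2.
  move: hN; rewrite lt_min => /andP[hd ht].
  have rt : k%:R / (2 ^ n)%N%:R < t by apply: le_lt_trans r2 _; rewrite addrC -ltrBrDr.
  have r01 : 0 <= (k%:R / (2 ^ n)%N%:R : R) <= 1 by exact: frac01.
  have Dr : D (k%:R / (2 ^ n)%N%:R) <= e.
    have := H _ r01; rewrite ger0_norm ?subr_ge0// => H'.
    have /H' /ler_normlP[_] : k%:R / (2 ^ n)%:R - s < d by rewrite ltrBlDl; apply: le_lt_trans r2 _; rewrite ltrD2l.
    by rewrite lerD2r.
  have kN' : (k < 2 ^ n)%N.
    rewrite ltn_neqAle kN andbT; apply/eqP => kE'; move: rt; rewrite kE' divff ?pnatr_eq0 -?lt0n//.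
    by case/andP: t01 => _; rewrite leNgt => /negP.
  have := hit_min kN' Dr; rewrite -(@ler_nat R) -(ler_pM2r (x := ((2 ^ n)%N%:R)^-1)) ?invr_gt0 ?ltr0n//.
  by move=> h; have := le_lt_trans (le_trans (tu n) h) rt; rewrite ltxx.
(* The interval []0, t]] contains [t]; continuity from the left extends the bound to it. *)
have at_t : 0 < t -> e <= D t.
  move=> t0; rewrite leNgt; apply/negP => Dt; have d0 : 0 < e - D t by rewrite subr_gt0.
  have d20 : 0 < (e - D t) / 2 by rewrite divr_gt0.
  have [d d'0 H] := cD t _ t01 d20.
  pose s := Num.max (t - d / 2) (t / 2).
  have st : s < t by rewrite gt_max; apply/andP; split; lra.
  have s0 : 0 <= s by rewrite le_max; apply/orP; right; lra.
  have sd : t - d / 2 <= s by rewrite le_max lexx.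
  have s01 : 0 <= s <= 1 by rewrite s0 (le_trans (ltW st))//; case/andP: t01.
  have sd' : `|s - t| < d by rewrite ler0_norm ?subr_le0 1?ltW//; move: sd d'0; clear; lra.
  have /ler_normlP[_ h] := H s s01 sd'; have := below s s0 st.
  by move: h d0; clear; lra.
move: t01 => /andP[]; rewrite le_eqVlt => /predU1P[<- _|t0 t1].
  rewrite L0 mulr0 -lee_fin Fv; apply: integral_ge0 => s /=; rewrite in_itv /= => /andP[s0 s1].
  by rewrite lee_fin D0// ltW.
have FE s : 0 <= s <= 1 -> F s = L s by move=> s01; apply: FL; rewrite in_itv.
(* Clamping to [[0, 1]] makes [D] continuous on the whole line, hence measurable. *)
pose c (x : R) := Num.max 0 (Num.min 1 x).
have c01 x : 0 <= c x <= 1 by rewrite le_max lexx ge_max ler01 ge_min lexx.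
have c_id x : 0 <= x <= 1 -> c x = x by move=> /andP[x0 x1]; rewrite /c min_r// max_r.
have c_lip x y : `|c x - c y| <= `|x - y|.
  by rewrite /c; apply: le_trans (max_lip _ _ _) (min_lip _ _ _).
have cDc : continuous (fun x => D (c x)).
  move=> x; apply/cvgrPdist_le => z z0; have [d d0 H] := cD (c x) z (c01 x) z0.
  exists d => //= y xy; rewrite distrC; apply: H => //; apply: le_lt_trans (c_lip _ _) _.
  by rewrite distrC.
have mDc := continuous_measurable_fun cDc.
have mt : measurable (`]0%R, t]%classic : set (measurableTypeR R)) by exact: measurable_itv.
have m1 : measurable (`]0%R, 1%R]%classic : set (measurableTypeR R)) by exact: measurable_itv.
rewrite -lee_fin Fv.
have -> : (\int[lebesgue_stieltjes_measure F]_(s in `]0%R, 1%R]) (D s)%:E =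
    \int[lebesgue_stieltjes_measure F]_(s in `]0%R, 1%R]) (D (c s))%:E)%E.
  apply: eq_integral => s; rewrite inE /= in_itv /= => /andP[s0 s1].
  by rewrite c_id// s1 ltW.
have cge0 x : (0 <= (D (c x))%:E)%E by rewrite lee_fin D0.
apply: (@le_trans _ _ (\int[lebesgue_stieltjes_measure F]_(s in `]0%R, t]) (D (c s))%:E)%E); last first.
  apply: ge0_subset_integral => //.
    by apply/measurable_EFinP; exact: measurable_funTS.
  by apply: subset_itvl; rewrite bnd_simp.
apply: (@le_trans _ _ (\int[lebesgue_stieltjes_measure F]_(s in `]0%R, t]) (cst e%:E) s)%E).
  rewrite integral_cst//= stieltjes_itv ?(ltW t0)// !FE ?lexx ?ler01 ?(ltW t0)// L0 subr0.
  by rewrite EFinM.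
apply: ge0_le_integral => //.
- by move=> s _; rewrite lee_fin ltW.
- by apply/measurable_EFinP; exact: measurable_funTS.
move=> s /=; rewrite in_itv /= => /andP[s0 st]; rewrite lee_fin c_id; last by rewrite (ltW s0) (le_trans st).
move: st; rewrite le_eqVlt => /predU1P[->|st]; first exact: at_t.
by apply: below => //; exact: ltW.
Qed.

End Paths.

(** * Processes in [SG], and the obstacle *)

Section SGProcesses.
Context {R : realType} (sl su : R).
Hypotheses (Hsl : 0 <= sl) (Hsu : sl <= su).
Local Notation Omega := (path_space R).
Local Notation calP := (calP sl su).
Implicit Types (P : probability Omega R).

Lemma qs_ae P (Q : Omega -> Prop) : calP P -> qs sl su Q -> {ae P, forall w, Q w}.
Proof.
move=> hP [N [mN cN H]]; exists N; split => //; first exact: capacity_null hP cN.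
by move=> w /= nQ; apply: contrapT => /H.
Qed.

Lemma ae_null P (Q : Omega -> Prop) : {ae P, forall w, Q w} ->
  exists N, [/\ measurable N, P N = 0%E & forall w, ~ N w -> Q w].
Proof.
move=> [N [mN PN H]]; exists N; split => // w nN; apply: contrapT => nQ; exact/nN/H.
Qed.

Lemma SG0_bounded (T : R) (eta : R -> Omega -> R) : SG0 T eta -> exists C, forall t w, `|eta t w| <= C.
Proof.
move=> [ts [h [_ [C [h1 _]] e]]]; exists C => t w; rewrite e; apply: h1.
by rewrite /= size_map.
Qed.

Let ratio (i : nat) : R :=
  if unpickle i is Some (k, n) then (if (k <= n)%N then k%:R / n%:R else 0) else 0.

Let ratio01 i : 0 <= ratio i <= 1.
Proof.
rewrite /ratio; case: (unpickle i) => [[k n]|]; last by rewrite lexx ler01.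
by case: ifP => [kn|_]; [exact: frac01|rewrite lexx ler01].
Qed.

Let ratio_pickle k n : (k <= n)%N -> ratio (pickle (k, n)) = k%:R / n%:R.
Proof. by move=> kn; rewrite /ratio pickleK kn. Qed.

(** Only grid times are dominated: a supremum over all times need not be measurable, whereas a
    countable one is. Cylinder processes are bounded, and $x \le 1 + x^p$ handles the distance to
    one of them. *)
Lemma SG_dominated P p eta : calP P -> 1 <= p -> SG sl su p 1 eta ->
  exists g : Omega -> \bar R, P.-integrable setT g /\
    forall k N w, (k <= N)%N -> (`|eta (k%:R / N%:R) w|%:E <= g w)%E.
Proof.
move=> hP p1 [me _ [en [sen cv]]]; have p0 : 0 < p by lra.
pose F n w := ereal_sup [set (`|en n t w - eta t w| `^ p)%:E | t in `[0%R, 1%R]%classic].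
have F0 n w : (0 <= F n w)%E.
  apply: (@le_trans _ _ (`|en n 0 w - eta 0 w| `^ p)%:E); first by rewrite lee_fin powR_ge0.
  by apply: ereal_sup_ubound; exists 0 => //; rewrite /= in_itv /= lexx ler01.
have [n /(_ n (leqnn _) P hP) H] := norm_small p0 F0 cv ltr01.
have [C hC] := SG0_bounded (sen n).
pose f i w := (`|en n (ratio i) w - eta (ratio i) w| `^ p)%:E.
pose S w := esups (f^~ w) 0%N.
have mf i : measurable_fun setT (f i).
  apply/measurable_EFinP; apply: (measurableT_comp (measurable_powR p)); apply: measurableT_comp => //.
  apply: measurable_funB; last exact: me.
  by apply: Lip_measurable (SG0_Lip (sen n) _); have /andP[] := ratio01 i.
have mS : measurable_fun setT S by exact: measurable_fun_esups.
have fS i w : (f i w <= S w)%E by apply: ereal_sup_ubound; exists i.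
have S0 w : (0 <= S w)%E by apply: le_trans (fS 0%N w); rewrite lee_fin powR_ge0.
have iS : P.-integrable setT S.
  apply/integrableP; split => //; apply: le_lt_trans (ltry 1); apply: le_trans H.
  apply: (ge0_integral_le_off_null measurable0 (measure0 P)) => // w; rewrite ?abse_ge0// gee0_abs//.
  move=> _; apply/ereal_supP => _ [i _ <-]; apply: ereal_sup_ubound; exists (ratio i) => //.
  by rewrite /= in_itv /=; exact: ratio01.
exists (fun w => ((C + 1)%:E + S w)%E); split.
  apply: integrableD => //; exact: itg_cst.
move=> k N w kN; apply: (@le_trans _ _ ((C + 1)%:E + f (pickle (k, N)) w)%E); last exact: leeD2l.
rewrite /f ratio_pickle// -EFinD lee_fin; set t := k%:R / N%:R.
have := le_powR_split ltr01 p1 (normr_ge0 (en n t w - eta t w)).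
rewrite powR1 mul1r => h; have := hC t w.
have := ler_normB (en n t w) (en n t w - eta t w); rewrite opprB addrCA subrr addr0; lra.
Qed.

(** At time 0 a cylinder variable depends on $B_0 = 0$ only, so it is constant. Such constants
    converge to [eta 0] in mean, uniformly over [calP], hence the mean under a single [P0] is the
    value under all. *)
Lemma SG_initial p T eta : 1 <= p -> 0 <= T -> SG sl su p T eta ->
  exists y, qs sl su (fun w => eta 0 w = y).
Proof.
move=> p1 T0 [me _ [en [sen cv]]]; have p0 : 0 < p by lra.
have t0 : 0 <= (0 : R) <= T by rewrite lexx.
have m0 := me 0 t0.
have Ec n w : en n 0 w = en n 0 point.
  have [us [C [Xh [s h e]]]] := Lip_skel (SG0_Lip (sen n) (lexx 0)).
  rewrite !e; apply: (skel_eq s) => r /h; rewrite -eq_le => /eqP <-.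
  by rewrite !path_le0.
have me0 n : measurable_fun setT (en n 0) := Lip_measurable (SG0_Lip (sen n) (lexx 0)).
have H := Lnorm_small p1 me0 m0 (SG_Lnorm Hsl Hsu p1 t0 cv).
have iE P : calP P -> itg P (eta 0).
  move=> hP; have [n /(_ n (leqnn _) P hP)[i _]] := H 1 ltr01.
  have := itgB (itg_cst P (en n 0 point)) i; congr itg; apply/funext => w.
  by rewrite (Ec n w) opprB addrCA subrr addr0.
have [P0 hP0] := calP_neq0 Hsl Hsu.
pose y := mean P0 (eta 0).
exists y, [set w | eta 0 w != y]; split.
- rewrite (_ : [set w | _] = eta 0 @^-1` (~` [set y])); last first.
    by apply/seteqP; split => w /= /eqP.
  by rewrite -[_ @^-1` _]setTI; apply: m0 => //; apply: measurableC.
- apply: (capacity0 Hsl Hsu) => P hP.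
  have iP := iE P hP; have iD : itg P (fun w => eta 0 w - y) by exact: itgB (itg_cst P y).
  have Z : mean P (fun w => `|eta 0 w - y|) = 0.
    apply/eqP; rewrite eq_le; apply/andP; split; last first.
      by have := mean_le (itg_cst P 0) (itg_norm iD) (fun w => normr_ge0 _); rewrite mean_cst.
    apply/ler_addgt0Pr => e_; move: (e_ : R) => e e0; rewrite add0r.
    have e20 : 0 < e / 2 by rewrite divr_gt0.
    have [n Hn] := H _ e20; have [i1 h1] := Hn n (leqnn _) P hP; have [i2 h2] := Hn n (leqnn _) P0 hP0.
    set c := en n 0 point; have E : (fun w => en n 0 w - eta 0 w) = fun w => c - eta 0 w.
      by apply/funext => w; rewrite Ec.
    rewrite E in i1 i2.
    have cy : `|c - y| <= e / 2.
      rewrite /y -(mean_cst P0 c) -meanB; [|exact: itg_cst|exact: iE].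
      by apply: le_trans (mean_norm i2) _; move: h2; rewrite (_ : (fun w => `|_|) = fun w => `|c - eta 0 w|)//; apply/funext => w; rewrite Ec.
    apply: (@le_trans _ _ (mean P (fun w => `|c - y| + `|c - eta 0 w|))).
      apply: mean_le => [||w]; [exact: itg_norm|by apply: itgD; [exact: itg_cst|exact: itg_norm]|].
      rewrite (_ : eta 0 w - y = (c - y) - (c - eta 0 w)); last by ring.
      exact: ler_normB.
    rewrite (meanD (itg_cst P _) (itg_norm i1)) mean_cst (splitr e); apply: lerD => //.
    by move: h1; rewrite (_ : (fun w => `|_|) = fun w => `|c - eta 0 w|)//; apply/funext => w; rewrite Ec.
  have mD : measurable_fun setT (fun w => (eta 0 w - y)%:E).
    by apply/measurable_EFinP; exact: itg_measurable iD.
  have /(ae_eq_integral_abs P measurableT mD) [N [mN PN HN]] : (\int[P]_(w in setT) `|(eta 0 w - y)%:E| = 0)%E.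
    by rewrite (meanE (itg_norm iD)) Z.
  apply: (subset_measure0 _ mN _ PN).
    rewrite (_ : [set w | _] = eta 0 @^-1` (~` [set y])); last by apply/seteqP; split => w /= /eqP.
    by rewrite -[_ @^-1` _]setTI; apply: m0 => //; apply: measurableC.
  move=> w /= /eqP h; apply: HN => /= /(_ I) [] /eqP; rewrite subr_eq0 => /eqP.
  exact: h.
- by move=> w /= /negP; rewrite negbK => /eqP.
Qed.

Lemma SG_unit_continuous P p eta : calP P -> SG sl su p 1 eta ->
  {ae P, forall w, unit_continuous (eta^~ w)}.
Proof.
move=> hP [_ qc _]; apply: filterS (qs_ae hP qc) => w; exact: unit_continuous_within.
Qed.

Lemma obstacle_qc beta X t : 2 < beta ->
  bounded_above_obstacle sl su beta X \/ ito_obstacle sl su beta X -> 0 <= t <= 1 -> qc sl su t (X t).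
Proof.
move=> b2 HX t01; have b1 : 1 <= beta by lra.
case: HX => [[SX _]|[x0 [b [l [sigma [QV [IQ [IB [[Mb _ _] qv iq ib E]]]]]]]]].
  exact: (qc_SG Hsl Hsu b1 SX t01).
have q1 := qc_time_integral b1 Mb t01.
have q2 : qc sl su t (IQ t).
  apply: (qc_integral (lexx 1) t01 _ iq) => u u01; have [mQ _ _] := qv; split; first exact: mQ.
  exact: (qc_quadratic_variation Hsl Hsu qv u01).
have q3 : qc sl su t (IB t).
  apply: (qc_integral b1 t01 _ ib) => u /andP[u0 _]; split; first exact: measurable_B.
  exact: qc_B.
have t0 : 0 <= t by case/andP: t01.
have q0 : qc sl su t (fun=> x0) := Lip_qc sl su (Lip_cst x0 t0).
apply: (qc_qs (qcD (qcD (qcD q0 q1) q2) q3)).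
by have [N [mN cN H]] := E; exists N; split => // w /H /(_ t t01).
Qed.

Lemma obstacle_unit_continuous P beta X : calP P -> 2 < beta ->
  bounded_above_obstacle sl su beta X \/ ito_obstacle sl su beta X ->
  {ae P, forall w, unit_continuous (X^~ w)}.
Proof.
move=> hP b2; have b1 : 1 <= beta by lra.
case=> [[SX _]|[x0 [b [l [sigma [QV [IQ [IB [[Mb _ _] _ [_ cq _] [_ cb _] E]]]]]]]]].
  exact: SG_unit_continuous SX.
have [N [mN PN HN]] := time_integral_continuous hP b1 Mb.
have aN : {ae P, forall w, {within `[0, 1], continuous (fun t => \int[lebesgue_measure]_(s in `[0, t]) b s w)}}.
  by exists N; split => // w /= nQ; apply: contrapT => /HN.
apply: filterS3 (filterI aN (qs_ae hP cq)) (qs_ae hP cb) (qs_ae hP E) => w [c1 c2] c3 Ew.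
apply: (eq_unit_continuous Ew).
apply: unit_continuousD; last exact: unit_continuous_within.
apply: unit_continuousD; last exact: unit_continuous_within.
apply: unit_continuousD; last exact: unit_continuous_within.
by move=> x e _ e0; exists 1 => // y _ _; rewrite subrr normr0 ltW.
Qed.

End SGProcesses.

(** * Grid hitting times as G-stopping times *)

Section HittingTime.
Context {R : realType} (sl su : R).
Hypotheses (Hsl : 0 <= sl) (Hsu : sl <= su).
Local Notation Omega := (path_space R).
Variables (V : R -> Omega -> R) (e : R).
Hypothesis HV : forall t, 0 <= t <= 1 -> [/\ qc sl su t (V t), measurable_fun setT (V t) &
  forall r w, t <= r -> V t (stop r w) = V t w].

(** The minimum over no times is [e + 1], above the level, so that an empty list means not yet
    hit. *)
Let M (r : seq R) w := foldr (fun u m => Num.min (V u w) m) (e + 1) r.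

Let M_le r w : (M r w <= e) = has (fun u => V u w <= e) r.
Proof.
elim: r => [|u r IH] /=; first by rewrite gerDl ler10.
by rewrite ge_min IH.
Qed.

Let M_upto r t : 0 <= t <= 1 -> {in r, forall u, 0 <= u <= t} ->
  [/\ qc sl su t (M r), measurable_fun setT (M r) & forall w, M r (stop t w) = M r w].
Proof.
move=> /andP[t0 t1]; elim: r => [_|u r IH h].
  split => //; [exact/Lip_qc/Lip_cst|exact: measurable_cst].
have /andP[u0 ut] := h u (mem_head _ _).
have [|q1 m1 s1] := IH; first by move=> v vr; apply: h; rewrite inE vr orbT.
have [|q2 m2 s2] := HV (t := u); first by rewrite u0 (le_trans ut).
split => [||w /=]; [exact: qc_min (qc_mono ut q2) q1|exact: measurable_minr|].
by rewrite s2// s1.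
Qed.

Lemma hit_stopping_time N : (0 < N)%N ->
  stopping_times01 sl su (fun w => (hit (V^~ w) e N)%:R / N%:R).
Proof.
move=> N0; have N0' : 0 < N%:R :> R by rewrite ltr0n.
split => [|w]; last exact: hit01.
split => [w|t t0]; first by have /andP[] := hit01 (V^~ w) e N.
(* From time 1 on the event is the whole space, paths that never reach the level included; it is
   rewritten as a trivial sublevel set so that [LG1star_le] applies. *)
have [t1|t1] := leP 1 t.
  rewrite (_ : [set w | _] = [set w : Omega | (0 : R) <= 0]).
    apply: (LG1star_le Hsl Hsu (X := fun=> 0)) => //; exact/Lip_qc/Lip_cst.
  apply/seteqP; split => w /= _; first exact: lexx.
  by apply: le_trans t1; have /andP[] := hit01 (V^~ w) e N.
pose r : seq R := [seq j%:R / N%:R | j <- iota 0 N & j%:R / N%:R <= t].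
have [||qM mM sM] := @M_upto r t.
- by rewrite t0 ltW.
- by move=> u /mapP[j]; rewrite mem_filter => /andP[jt _] ->; rewrite divr_ge0.
rewrite (_ : [set w | _] = [set w | M r w <= e]); first exact: LG1star_le.
apply/seteqP; split => w /=; rewrite M_le.
  move=> h; have hN : (hit (V^~ w) e N < N)%N.
    by have := le_lt_trans h t1; rewrite ltr_pdivrMr// mul1r ltr_nat.
  apply/hasP; exists ((hit (V^~ w) e N)%:R / N%:R); last exact: hit_lt hN.
  by apply/mapP; exists (hit (V^~ w) e N) => //; rewrite mem_filter mem_iota h.
move=> /hasP[x /mapP[j]]; rewrite mem_filter mem_iota add0n => /andP[jt /andP[_ jN]] -> Vj.
by apply: le_trans jt; rewrite ler_pM2r ?invr_gt0// ler_nat; exact: hit_min.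
Qed.

End HittingTime.

(** * The two inequalities *)

Section OptimalStopping.
Context {R : realType} (sl su : R).
Hypotheses (Hsl : 0 <= sl) (Hsu : sl <= su).
Local Notation Omega := (path_space R).
Local Notation calP := (calP sl su).
Local Notation qs := (qs sl su).
Implicit Types (P : probability Omega R).

(** Hitting times already lie on the grid, so [optional_stopping] applies to them unrounded. *)
Lemma rnd_id (k N : nat) : (k <= N)%N -> rnd N (k%:R / N%:R : R) = k%:R / N%:R.
Proof.
case: N => [|N] kN; first by rewrite /rnd big_ord0 invr0 !mulr0.
rewrite /rnd divfK ?pnatr_eq0//; congr (_%:R / _).
under eq_bigr do rewrite ltr_nat.
elim: N.+1 kN => [|m IH]; first by rewrite leqn0 => /eqP ->; rewrite big_ord0.
rewrite leq_eqVlt big_ord_recr /= => /predU1P[->|].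
  rewrite ltnSn addn1; congr _.+1.
  rewrite (eq_bigr (fun=> 1%N)) ?sum1_card ?card_ord// => i _.
  by rewrite ltnS ltnW.
by rewrite ltnS => km; rewrite IH// ltnNge km addn0.
Qed.

Lemma lip_condE0 (X Y : Omega -> R) : lip_condE sl su 0 X Y -> exists c, lip_E sl su X c /\ forall w, Y w = c.
Proof.
move=> [ts [phi [j [[h1 h2] [h3 h4] h5 h6 h7]]]].
have j0 : j = 0%N.
  case: j h3 h4 {h7} => // j js /eqP; rewrite -(_ : node ts 0 = 0)// => /eqP e.
  by have := node_lt h2 (ltn0Sn j) js; rewrite e ltxx.
have c0 w : take j (increments w ts) = [::] by rewrite j0 take0.
exists (phi j [::]); split => [|w]; last by have [_ ->] := h7 w; rewrite c0.
exists ts, phi, j; split => // w; have [-> _] := h7 w; split => //.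
by rewrite c0.
Qed.

(** Cylinder variables close to [K1] have expectations [c n] close to 0, the value of [K0], and each
    [c n] is attained by some measure. Closeness is uniform over [calP], so it holds under that
    measure. *)
Lemma condE0_attained K1 K0 d : condE sl su 0 K1 K0 -> qs (fun w => K0 w = 0) -> 0 < d ->
  exists P, [/\ calP P, itg P K1 & - d <= mean P K1].
Proof.
move=> [mK1 mK0 [Xn [Yn [cXY cX cY]]]] K00 d0.
have d20 : 0 < d / 2 by rewrite divr_gt0.
have /choice[c Hc] : forall n, exists c, lip_E sl su (Xn n) c /\ forall w, Yn n w = c.
  by move=> n; exact: lip_condE0.
have nX n := lip_E_nested Hsl Hsu (Hc n).1.
have mX n : measurable_fun setT (Xn n).
  by have [us [C [Xh [_ [s _ _ e _]]]]] := nX n; exact: skel_measurable s e.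
have mY n : measurable_fun setT (Yn n).
  by rewrite (_ : Yn n = fun=> c n); [exact: measurable_cst|apply/funext => w; exact: (Hc n).2].
have [n1 H1] := Lnorm_small (lexx 1) mX mK1 cX d20.
have [n2 H2] := Lnorm_small (lexx 1) mY mK0 cY d20.
pose n := maxn n1 n2.
have [P hP mP] := calP_attains Hsl Hsu (nX n); exists P.
have [iX _] := calP_nested Hsl Hsu hP (nX n).
have [i1 h1] := H1 n (leq_maxl _ _) P hP; have [i2 h2] := H2 n (leq_maxr _ _) P hP.
have iK : itg P K1.
  by have := itgB iX i1; congr itg; apply/funext => w; rewrite opprB addrCA subrr addr0.
split => //.
have [N [mN PN HN]] := ae_null (qs_ae hP K00).
have c2 : `|c n| <= d / 2.
  apply: le_trans h2; rewrite -(mean_cst P `|c n|).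
  apply: (mean_le_off_null (itg_cst P _) (itg_norm i2) mN PN) => w /HN K0w.
  by rewrite (Hc n).2 K0w subr0.
have := mean_norm i1; rewrite meanB// mP => h3.
have := le_trans h3 h1; move: c2; rewrite !ler_norml; move=> /andP[a b] /andP[a' b']; lra.
Qed.

Variables (alpha : R) (X Y Z L J : R -> Omega -> R) (y0 : R).
Hypotheses (a1 : 1 <= alpha) (SY : SG sl su alpha 1 Y) (SL : SG sl su alpha 1 L).
Hypothesis LH : qs (fun w => L 0 w = 0 /\
  forall s t, 0 <= s -> s <= t -> t <= 1 -> L s w <= L t w).
Hypothesis XY : qs (fun w => forall t, 0 <= t <= 1 -> X t w <= Y t w).
Hypothesis ito : is_ito sl su alpha 1 Z J.
Hypothesis YE : qs (fun w => forall t, 0 <= t <= 1 ->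
  Y t w = X 1 w - (J 1 w - J t w) + (L 1 w - L t w)).
Hypothesis Y0 : qs (fun w => Y 0 w = y0).

Let unit0 : 0 <= (0 : R) <= 1. Proof. by rewrite lexx ler01. Qed.
Let unit1 : 0 <= (1 : R) <= 1. Proof. by rewrite lexx ler01. Qed.

Let YJ P : calP P -> {ae P, forall w, forall t, 0 <= t <= 1 -> Y t w = y0 + (J t w - J 0 w) - L t w}.
Proof.
move=> hP; apply: filterS3 (qs_ae hP LH) (qs_ae hP YE) (qs_ae hP Y0) => w [L0 _] Yw Y0w t t01.
by have := Yw 0 unit0; rewrite Y0w L0 (Yw t t01) => ->; ring.
Qed.

Lemma stopping_le P tau : calP P -> stopping_times01 sl su tau ->
  (\int[P]_w (X (tau w) w)%:E <= y0%:E)%E.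
Proof.
move=> hP st.
have aL : {ae P, forall w, forall t, 0 <= t <= 1 -> 0 <= L t w}.
  by apply: filterS (qs_ae hP LH) => w [L0 Lm] t /andP[t0 t1]; rewrite -L0; exact: Lm.
have [N [mN PN HN]] := ae_null (filterI (YJ hP)
  (filterI (SG_unit_continuous hP SY) (filterI (qs_ae hP XY) aL))).
have [g [ig gY]] := SG_dominated hP a1 SY.
have [mY _ _] := SY; have [_ t01] := st.
pose Yn n w := Y (rnd n.+1 (tau w)) w.
have mYn n : measurable_fun setT (Yn n) by exact: (measurable_rnd (J := Y) st).
(* [Y] at an arbitrary stopping time is not known to be measurable; [W] is a version of it, a limit
   of values at rounded times off [N] and 0 on [N]. *)
pose W w := \1_(~` N) w * Y (tau w) w.
have rcv w : (fun n => rnd n.+1 (tau w)) @ \oo --> tau w.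
  have inv0 : (fun n => tau w + n.+1%:R^-1) @ \oo --> tau w.
    rewrite -[X in _ --> X]addr0; apply: cvgD; [exact: cvg_cst|exact: cvg_harmonic].
  apply: (squeeze_cvgr _ (cvg_cst (tau w)) inv0); apply: nearW => n.
  exact: rnd_near.
have r01 n w : 0 <= rnd n.+1 (tau w) <= 1.
  by have [k kn ->] := rnd_dyadic n.+1 (tau w); exact: frac01.
have cY w : ~ N w -> (fun n => Yn n w) @ \oo --> Y (tau w) w.
  by move=> /HN[_ [cYw _]]; exact: unit_continuous_cvg cYw (r01^~ w) (t01 w) (rcv w).
have WE w : ~ N w -> W w = Y (tau w) w by move=> nN; rewrite /W indicE mem_set//= mul1r.
have mW : measurable_fun setT W.
  have mF n : measurable_fun setT (fun w => \1_(~` N) w * Yn n w).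
    apply: measurable_funM => //; apply: measurable_indic; exact: measurableC.
  apply: (measurable_fun_cvg mF) => w _; rewrite /W indicE.
  have [/set_mem wN|/negP wN] := boolP (w \in ~` N).
    by under eq_fun do rewrite mul1r; rewrite mul1r; exact: cY.
  by under eq_fun do rewrite mul0r; rewrite mul0r; exact: cvg_cst.
have gYn n w : ~ N w -> (`|Yn n w|%:E <= g w)%E.
  by move=> _; have [k kn E] := rnd_dyadic n.+1 (tau w); rewrite /Yn E; exact: gY.
have cW w : ~ N w -> (fun n => Yn n w) @ \oo --> W w by move=> nN; rewrite WE//; exact: cY.
have [iYn iW cm] := mean_dominated_cvg mYn mW mN PN cW ig gYn.
have J0i := ito_itg Hsl Hsu hP a1 ito unit0.
have up n : mean P (Yn n) <= y0.
  have [iJ mJ] := optional_stopping Hsl Hsu hP a1 ito st (ltn0Sn n).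
  have iU : itg P (fun w => y0 + (J (rnd n.+1 (tau w)) w - J 0 w)).
    by apply: itgD; [exact: itg_cst|exact: itgB].
  apply: (@le_trans _ _ (mean P (fun w => y0 + (J (rnd n.+1 (tau w)) w - J 0 w)))).
    apply: (mean_le_off_null (iYn n) iU mN PN) => w /HN[Yw [_ [_ Lw]]].
    by rewrite /Yn Yw// lerBlDr lerDl Lw.
  by rewrite (meanD (itg_cst P _) (itgB iJ J0i)) mean_cst meanB// mJ subrr addr0.
apply: (@le_trans _ _ (\int[P]_w (W w)%:E)%E).
  apply: (integral_le_off_null mN PN) => w nN; rewrite lee_fin WE//.
  by have [_ [_ [XYw _]]] := HN w nN; exact: XYw.
rewrite (meanE iW) lee_fin.
have <- : limn (fun n => mean P (Yn n)) = mean P W by apply/cvg_lim.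
by apply: limr_le; [apply/cvg_ex; exists (mean P W)|exact: nearW].
Qed.

Variable K : R -> Omega -> R.
Hypothesis KS : qs (fun w => forall t, 0 <= t <= 1 ->
  is_stieltjes (fun s => Y s w - X s w) (L^~ w) t (- K t w)).
Hypothesis KG : G_martingale sl su 1 K.
Hypothesis qX : forall t, 0 <= t <= 1 -> qc sl su t (X t).
Hypothesis cX : forall P, calP P -> {ae P, forall w, unit_continuous (X^~ w)}.

Let K0 : qs (fun w => K 0 w = 0).
Proof.
have [N [mN cN H]] := KS; exists N; split => // w /H /(_ 0 unit0) [F [_]].
rewrite set_itvoc0 integral_set0 => -[] /eqP; rewrite oppr_eq0 => /eqP; exact.
Qed.

Lemma stopping_ge e : 0 < e -> exists P tau, [/\ calP P, stopping_times01 sl su tau &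
  ((y0 - 3 * e)%:E <= \int[P]_w (X (tau w) w)%:E)%E].
Proof.
move=> e0; have [_ KE] := KG.
have [P [hP iK mK]] := condE0_attained (KE 0 1 (lexx 0) ler01 (lexx 1)) K0 (mulr_gt0 e0 e0).
have qY t : 0 <= t <= 1 -> qc sl su t (Y t) by move=> t01; exact: (qc_SG Hsl Hsu a1 SY t01).
(* Hitting times are built from versions [V t] of [Y t - X t], because a G-stopping time must be
   adapted at every path, while the gap is controlled q.s. only. *)
have /choice[V HV] : forall t, exists V : Omega -> R, 0 <= t <= 1 -> [/\ measurable_fun setT V,
    forall r w, t <= r -> V (stop r w) = V w & qs (fun w => V w = Y t w - X t w)].
  move=> t; have [t01|] := boolP (0 <= t <= 1); last by exists (fun=> 0).
  by have [V HV] := qc_version Hsl Hsu (qcB (qY t t01) (qX t01)); exists V.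
have HV' t : 0 <= t <= 1 -> [/\ qc sl su t (V t), measurable_fun setT (V t) &
    forall r w, t <= r -> V t (stop r w) = V t w].
  move=> t01; have [mV sV [N [mN cN HN]]] := HV t t01; split => //.
  apply: (qc_qs (qcB (qY t t01) (qX t01))); exists N; split => // w /HN ->//.
pose k n w := hit (V^~ w) e (2 ^ n); pose tau n w : R := (k n w)%:R / (2 ^ n)%:R.
have N0 n : (0 < 2 ^ n)%N by rewrite expn_gt0.
have st n : stopping_times01 sl su (tau n) by rewrite /tau /k; exact: (hit_stopping_time Hsl Hsu e HV' (N0 n)).
have rtau n w : rnd (2 ^ n) (tau n w) = tau n w by apply: rnd_id; exact: hit_le.
have aV : {ae P, forall w, forall n j : nat, (j < 2 ^ n)%N ->
    V (j%:R / (2 ^ n)%:R) w = Y (j%:R / (2 ^ n)%:R) w - X (j%:R / (2 ^ n)%:R) w}.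
  apply/ae_foralln => n; apply/ae_foralln => j.
  have [jn|jn] := ltnP j (2 ^ n); last by apply: nearW => w.
  have [_ _ h] := HV _ (frac01 (ltnW jn)).
  by apply: filterS (qs_ae hP h) => w + _.
have [N [mN PN HN]] := ae_null (filterI (filterI (YJ hP) (filterI (qs_ae hP YE) aV))
  (filterI (filterI (SG_unit_continuous hP SY) (filterI (SG_unit_continuous hP SL) (cX hP)))
  (filterI (qs_ae hP XY) (filterI (qs_ae hP LH) (qs_ae hP KS))))).
have kD n w : ~ N w -> k n w = hit (fun t => Y t w - X t w) e (2 ^ n).
  by move=> /HN[[_ [_ Vw]] _]; apply: eq_hit => j jn; exact: Vw.
have D1 w : ~ N w -> Y 1 w - X 1 w = 0.
  by move=> /HN[[_ [Yw _]] _]; rewrite (Yw 1 unit1); ring.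
have lim w : exists l, ~ N w -> (fun n => L (tau n w) w) @ \oo --> l /\ e * l <= - K 1 w.
  have [wN|wN] := pselect (N w); first by exists 0.
  have [_ [[cYw [cLw cXw]] [XYw [[L0 _] Kw]]]] := HN w wN.
  have D0 t : 0 <= t <= 1 -> 0 <= Y t w - X t w by move=> t01; rewrite subr_ge0; exact: XYw.
  have cD : unit_continuous (fun t => Y t w - X t w).
    exact: unit_continuousD cYw (unit_continuousN cXw).
  have [t [t01 ct h]] := hit_limit cD D0 e0 L0 (Kw 1 unit1).
  exists (L t w) => _; split => //; apply: (unit_continuous_cvg cLw _ t01).
    by move=> n; exact: hit01.
  rewrite (_ : (fun n => tau n w) = fun n => (hit (fun t => Y t w - X t w) e (2 ^ n))%:R / (2 ^ n)%:R)//.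
  by apply/funext => n; rewrite /tau kD.
have {lim}/choice[l Hl] := lim.
have [mL _ _] := SL.
pose Ln n w := L (tau n w) w.
have mLn n : measurable_fun setT (Ln n).
  have := measurable_rnd (st n) (N0 n) mL; congr measurable_fun.
  by apply/funext => w; rewrite rtau.
pose l' w := \1_(~` N) w * l w.
have lE w : ~ N w -> l' w = l w by move=> nN; rewrite /l' indicE mem_set//= mul1r.
have cL w : ~ N w -> (fun n => Ln n w) @ \oo --> l' w by move=> nN; rewrite lE//; have [] := Hl w nN.
have ml : measurable_fun setT l'.
  have mF n : measurable_fun setT (fun w => \1_(~` N) w * Ln n w).
    apply: measurable_funM => //; apply: measurable_indic; exact: measurableC.
  apply: (measurable_fun_cvg mF) => w _; rewrite /l' indicE.
  have [/set_mem wN|/negP wN] := boolP (w \in ~` N).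
    by under eq_fun do rewrite mul1r; rewrite mul1r; have [] := Hl w wN.
  by under eq_fun do rewrite mul0r; rewrite mul0r; exact: cvg_cst.
have [g [ig gL]] := SG_dominated hP a1 SL.
have gLn n w : ~ N w -> (`|Ln n w|%:E <= g w)%E by move=> _; apply: gL; exact: hit_le.
have [iLn il cm] := mean_dominated_cvg mLn ml mN PN cL ig gLn.
have ml_le : mean P l' <= e.
  rewrite -(ler_pM2l e0) -meanZ//; apply: (@le_trans _ _ (mean P (fun w => -1 * K 1 w))).
    apply: (mean_le_off_null (itgZ _ il) (itgZ _ iK) mN PN) => w nN.
    by rewrite lE// mulN1r; have [] := Hl w nN.
  by rewrite meanZ// mulN1r lerNl.
(* The limit of the variables [Ln n] has mean at most [e], so some [n] gives [2 * e]; the gap [e] at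
   the hitting time completes the loss [3 * e]. *)
have [n hn] : exists n, mean P (Ln n) <= 2 * e.
  have /cvgrPdist_le/(_ e e0)[n _ /(_ n (leqnn n))] := cm.
  by rewrite /= ler_norml => /andP[h _]; exists n; move: h ml_le; lra.
exists P, (tau n); split => //.
have [iJ mJ] := optional_stopping Hsl Hsu hP a1 ito (st n) (N0 n).
have J0i := ito_itg Hsl Hsu hP a1 ito unit0.
have JE : (fun w => J (rnd (2 ^ n) (tau n w)) w) = fun w => J (tau n w) w.
  by apply/funext => w; rewrite rtau.
rewrite JE in iJ mJ.
pose U w := (y0 - e) + (J (tau n w) w - J 0 w) - Ln n w.
have iU : itg P U by apply: itgB => //; apply: itgD; [exact: itg_cst|exact: itgB].
have mU : mean P U = y0 - e - mean P (Ln n).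
  rewrite /U (meanB (itgD (itg_cst P _) (itgB iJ J0i)) (iLn n)).
  by rewrite (meanD (itg_cst P _) (itgB iJ J0i)) mean_cst meanB// mJ subrr addr0.
apply: (@le_trans _ _ (\int[P]_w (U w)%:E)%E).
  by rewrite (meanE iU) lee_fin mU; move: hn; lra.
apply: (integral_le_off_null mN PN) => w nN; rewrite lee_fin.
have [[Yw _] _] := HN w nN.
have tau01 : 0 <= tau n w <= 1 by exact: hit01.
suff : Y (tau n w) w - X (tau n w) w <= e.
  by rewrite /U (Yw _ tau01) /Ln; lra.
have kn : (k n w <= 2 ^ n)%N by exact: hit_le.
(* The value [2 ^ n] of [k n w] says nothing about the level, but the gap vanishes at time 1. *)
move: kn; rewrite leq_eqVlt => /predU1P[E|kn].
  by rewrite /tau E divff ?pnatr_eq0 -?lt0n// D1// ltW.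
rewrite /tau; move: kn; rewrite kD// => kn; exact: (hit_lt kn).
Qed.

Lemma stopping_valueE : stopping_value sl su X = y0%:E.
Proof.
apply/eqP; rewrite eq_le; apply/andP; split.
  by apply/ereal_supP => _ [tau st <-]; apply/ereal_supP => _ [P hP <-]; exact: stopping_le.
apply/lee_subgt0Pr => e e0; have e30 : 0 < e / 3 by rewrite divr_gt0.
have [P [tau [hP st h]]] := stopping_ge e30.
apply: (@le_trans _ _ (\int[P]_w (X (tau w) w)%:E)%E).
  by move: h; rewrite mulrC divfK ?pnatr_eq0.
apply: (@le_trans _ _ (Ehat sl su (fun w => (X (tau w) w)%:E))).
  by apply: ereal_sup_ubound; exists P.
by apply: ereal_sup_ubound; exists tau.
Qed.

End OptimalStopping.

Theorem theorem4p4 (R : realType) (sl su : R) (Hsl : 0 <= sl) (Hsu : sl <= su)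
    (beta : R) (Hbeta : 2 < beta) (X : R -> path_space R -> R)
    (HX : bounded_above_obstacle sl su beta X \/ ito_obstacle sl su beta X)
    (Y Z L : R -> path_space R -> R)
    (Hsol : reflected_GBSDE_solution sl su beta X Y Z L) :
  qs sl su (fun w => (Y 0 w)%:E = stopping_value sl su X).
Proof.
have [alpha [/andP[a1 _] [SY _ [SL LH] XY [[J [ito YE]] [K [KS _ KG]]]]]] := Hsol.
have a1' : 1 <= alpha := ltW a1.
have [y0 Y0] := SG_initial Hsl Hsu a1' ler01 SY.
have qX t (t01 : 0 <= t <= 1) := obstacle_qc Hsl Hsu Hbeta HX t01.
have cX P (hP : calP sl su P) := obstacle_unit_continuous hP Hbeta HX.
have V := stopping_valueE Hsl Hsu a1' SY SL LH XY ito YE Y0 KS KG qX cX.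
by have [N [mN cN H]] := Y0; exists N; split => // w /H ->.
Qed.
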